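(* Let $\varphi:[0,1]\to[0,\infty)$ be a Lipschitz and concave function, and for $N\in[0,\infty)$ set $$\mathcal R_N:=\{(x,y)\in\mathbb{R}^2: 0<y<1,\ -\varphi(y)<x<N\}.$$ Let $m\ge1$ be an integer and let $u_{m,N}$ be the $m$-th Dirichlet eigenfunction of the Laplacian in $\mathcal R_N$. Then, for $N$ large enough, $u_{m,N}$ has exactly $m$ critical points in $\mathcal R_N$, and they are nondegenerate. Moreover all of them are (local) maxima and minima.
   Context: Here $u_{m,N}\in C^\infty(\mathcal R_N)$ is a nonzero solution of $-\Delta u_{m,N}=\lambda_{m,N}u_{m,N}$ in $\mathcal R_N$, $u_{m,N}=0$ on $\partial\mathcal R_N$, where $\lambda_{m,N}$ is the $m$-th Dirichlet eigenvalue of $-\Delta$ in $\mathcal R_N$ (counted with multiplicity, in nondecreasing order). It is known (Grieser–Jerison) that $\lambda_{1,N},\dots,\lambda_{m,N}$ are simple for $N$ sufficiently large, so $u_{m,N}$ is determined up to a multiplicative constant. A critical point is nondegenerate if the Hessian matrix there is invertible. *)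

(* Defs.v *)
From HB Require Import structures.
From mathcomp Require Import all_boot all_order all_algebra.
From mathcomp Require Import all_classical all_reals all_analysis.

Set Implicit Arguments.
Unset Strict Implicit.
Unset Printing Implicit Defensive.

Import Order.TTheory GRing.Theory Num.Theory.
Import numFieldNormedType.Exports.

Local Open Scope classical_set_scope.
Local Open Scope ring_scope.

Definition concave_function (R : realType) (D : set R) (f : R -> R) : Prop :=
  convex_function (D : set R^o) (fun x => - f x).

Section Calculus.
Context {R : realType} {n : nat}.
Implicit Types (u : 'rV[R]_n.+1 -> R) (p : 'rV[R]_n.+1).
Implicit Types (Omega : set 'rV[R]_n.+1).

Definition partial (i : 'I_n.+1) u : 'rV[R]_n.+1 -> R :=
  fun p => 'D_('e_i) u p.

(* C^oo on an open set: all iterated partial derivatives, of every order,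
   exist and are continuous at every point of Omega. *)
Definition smooth_on Omega u : Prop :=
  forall (s : seq 'I_n.+1) p, Omega p ->
    {for p, continuous (foldr partial u s)} /\
    (forall i, derivable (foldr partial u s) p 'e_i).

Definition laplacian u p : R := \sum_i partial i (partial i u) p.

Definition hessian u p : 'M[R]_n.+1 :=
  \matrix_(i, j) partial i (partial j u) p.

Definition critical_point u p : Prop := forall i, partial i u p = 0.

Definition nondegenerate_at u p : Prop := hessian u p \in unitmx.

Definition local_max u p : Prop := \forall q \near p, u q <= u p.

Definition local_min u p : Prop := \forall q \near p, u p <= u q.

Definition boundary Omega : set 'rV[R]_n.+1 := closure Omega `\` interior Omega.

(* Classical solutions of -Delta u = mu u in Omega, u = 0 on the boundary.
   The values of u outside the closure of Omega are irrelevant, so functions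
   are compared on Omega only. *)
Definition dirichlet_solution Omega (mu : R) u : Prop :=
  [/\ smooth_on Omega u,
      {within closure Omega, continuous u},
      (forall p, Omega p -> - laplacian u p = mu * u p) &
      (forall p, boundary Omega p -> u p = 0)].

Definition dirichlet_eigenfunction Omega (mu : R) u : Prop :=
  dirichlet_solution Omega mu u /\ exists2 p, Omega p & u p != 0.

(* (e k), for k in K, is an (algebraic) basis of the space of Dirichlet
   solutions for mu, seen as functions on Omega. *)
Definition dirichlet_eigenbasis Omega (mu : R) (K : pred nat)
    (e : nat -> 'rV[R]_n.+1 -> R) : Prop :=
  [/\ (forall k, K k -> dirichlet_solution Omega mu (e k)),
      (forall (l : nat) (c : nat -> R),
         (forall p, Omega p -> \sum_(k < l | K k) c k * e k p = 0) ->
         forall k, (k < l)%N -> K k -> c k = 0) &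
      (forall u, dirichlet_solution Omega mu u ->
         exists (l : nat) (c : nat -> R),
           forall p, Omega p -> u p = \sum_(k < l | K k) c k * e k p)].

(* lam 0 <= lam 1 <= ... lists all Dirichlet eigenvalues of -Delta in Omega,
   each one repeated as many times as the dimension of its eigenspace.  A real
   mu which is not an eigenvalue does not occur, its eigenbasis being empty. *)
Definition dirichlet_spectrum Omega (lam : nat -> R) : Prop :=
  {homo lam : i j / (i <= j)%N >-> i <= j} /\
  exists e : nat -> 'rV[R]_n.+1 -> R,
    forall mu, dirichlet_eigenbasis Omega mu (fun k => lam k == mu) e.

(* Eigenvalues are numbered from 1: the m-th one is lam (m - 1), for m >= 1. *)
Definition mth_dirichlet_eigenfunction Omega (m : nat) u : Prop :=
  exists2 lam, dirichlet_spectrum Omega lam &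
    dirichlet_eigenfunction Omega (lam m.-1) u.

End Calculus.

(* A point (x, y) is the row vector p with x = p 0 0 and y = p 0 1. *)
Definition strip (R : realType) (phi : R -> R) (N : R) : set 'rV[R]_2 :=
  [set p : 'rV[R]_2 | 0 < p 0 1 < 1 /\ - phi (p 0 1) < p 0 0 < N].

(* Main.v *)
Require Import Defs.
From mathcomp Require Import all_boot all_order all_algebra.
From mathcomp Require Import all_classical all_reals all_analysis.
From mathcomp Require Import zify lra ring.

Set Implicit Arguments.
Unset Strict Implicit.
Unset Printing Implicit Defensive.
Import Order.TTheory GRing.Theory Num.Theory.
Import numFieldNormedType.Exports.
Local Open Scope classical_set_scope.
Local Open Scope ring_scope.

(* An eigenfunction u with eigenvalue pi^2 + k^2 <= pi^2 + (m pi / N)^2 is small in the left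
   cap and, beyond a distance e N from it, exponentially close to A sin (k (N - x)) sin (pi y);
   both facts come from the maximum principle with explicit supersolutions.  Hence k N is close
   to j pi for some 1 <= j <= m, the class of u, and comparing two eigenfunctions of the same
   class shows that they are proportional.  Discretising the domain, minimising Rayleigh
   quotients and passing to the limit along an ultrafilter gives m eigenfunctions below the
   threshold; therefore the m-th eigenfunction is the one of class m.  For this one, u_x does not
   vanish near either end (difference quotients in x are positive supersolutions), and in between
   its critical points are those of the sine profile: one in each of the m boxes around
   k (N - x) = (i + 1/2) pi, y = 1/2, where the Hessian is definite. *)

(* [lra] reifies the whole context, which is slow: try first with few hypotheses (except for the goal [False], whose field is found from the context). *)
Ltac revert_last := match goal with H : _ |- _ => revert H end.
Tactic Notation "qlra" :=
  lazymatch goal with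
  | |- context [False] => lra
  | |- context [is_true false] => lra
  | _ => first
      [ solve [clear; lra]
      | solve [do 6 (try revert_last); clear; intros; lra]
      | lra ]
  end.

(** * Maximum principles *)

(** Closeness to the sine in y comes from one transformation: u_y - pi cot(pi y) u kills sin(pi y)
    and satisfies an equation with potential 2 pi^2 / sin(pi y)^2 - lam. Since lam is at most pi^2 +
    1, this potential is bounded below by a positive constant, so the transformed function decays
    exponentially away from the ends. Every other estimate loses only powers of N, because k N >= pi
    / 4. With a cut-off length e N, where e depends on m alone, all errors are thus powers of N
    times exp(- e N).

    The eigenfunction is never computed in the cap. At distance about e N from it the supersolution
    sin(k (x + S + 1)) sin(pi y) is O(e), so the profile must nearly vanish there, which quantises k
    N. The same smallness yields uniqueness inside a class: where sin(k (N - x)) nearly vanishes,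
    the normalised profile is most sensitive to k.

    Counting then closes without an explicit multiplicity formula: the classes allow at most m
    eigenvalues below the threshold, and the discrete limits supply m eigenfunctions, no two of them
    proportional. *)

Section OneVariable.
Context {R : realType}.
Implicit Types (f g : R -> R) (x y a b : R).

Lemma mvt f f' a b : a < b ->
    (forall x, a <= x <= b -> is_derive x 1 f (f' x)) ->
  exists2 c, a < c < b & f b - f a = f' c * (b - a).
Proof.
move=> ab df; have [||c] := @MVT R f f' a b ab.
- by move=> x; rewrite in_itv/= => /andP[ax xb]; apply: df; rewrite !ltW.
- apply: derivable_within_continuous => x; rewrite in_itv/= => xab.
  exact: (@ex_derive _ _ _ _ _ _ _ (df x xab)).
- by rewrite in_itv/= => cab e; exists c.
Qed.

Lemma mvt_le f f' K a b : 
    (forall x, Num.min a b <= x <= Num.max a b -> is_derive x 1 f (f' x) /\ `|f' x| <= K) ->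
  `|f b - f a| <= K * `|b - a|.
Proof.
wlog ab : a b / a <= b.
  move=> H; have /orP[/H//|ba df] := le_total a b.
  rewrite distrC (distrC b); apply: (H b a ba) => x.
  by rewrite minC maxC; exact: df.
rewrite (min_l ab) (max_r ab) => df.
have [->|nab] := eqVneq a b; first by rewrite !subrr normr0 mulr0.
have ltab : a < b by rewrite lt_neqAle nab.
have [x /df[]//|c /andP[ac cb] ->] := @mvt f f' a b ltab.
rewrite normrM ler_wpM2r//; apply: (df c _).2.
by rewrite !ltW.
Qed.

Lemma is_derive_unique f x a b :
  is_derive x 1 f a -> is_derive x 1 f b -> a = b.
Proof. by move=> [_ <-] [_ <-]. Qed.

Lemma near_is_derive f g x a : (\forall t \near x, f t = g t) ->
  is_derive x 1 f a -> is_derive x 1 g a.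
Proof. by move=> fg fa; apply: (@near_eq_is_derive _ _ _ f). Qed.

Lemma is_deriveP f x a : is_derive x 1 f a <->
  forall e, 0 < e -> exists2 d, 0 < d & forall h, `|h| < d ->
    `|f (x + h) - f x - a * h| <= e * `|h|.
Proof.
split=> [[dfx <-] e e0|H].
  have /cvgrPdist_le/(_ e e0) := dfx.
  rewrite near_withinE /= => /nbhs_ballP[d /= d0 Hd].
  exists d => // h hd; have [->|h0] := eqVneq h 0.
    by rewrite addr0 subrr mulr0 subr0 normr0 mulr0.
  have := Hd h; rewrite /ball/= sub0r normrN => /(_ hd h0).
  have -> : f (x + h) - f x - 'D_1 f x * h = - (h * ('D_1 f x - h^-1 * (f (h + x) - f x))).
    rewrite mulrBr mulrA divff// mul1r (addrC h) opprB; congr (_ - _).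
    by rewrite mulrC.
  rewrite normrN normrM mulrC (_ : h *: 1 = h) ?scaler1 ?[h%:A]mulr1//.
  by move=> le; rewrite ler_wpM2r.
have cv : h^-1 *: (f (h *: (1:R) + x) - f x) @[h --> 0^'] --> a.
  apply/cvgrPdist_le => e e0; have [d d0 Hd] := H e e0.
  rewrite near_withinE; apply/nbhs_ballP; exists d => //= h.
  rewrite /ball/= sub0r normrN => hd h0.
  have := Hd h hd; rewrite [h *: 1]mulr1 (addrC h).
  have -> : a - h^-1 *: (f (x + h) - f x) = - (h^-1 * (f (x + h) - f x - a * h)).
    by rewrite [_ *: _]/(_ * _) (mulrBr h^-1) mulrCA mulVf// mulr1 opprB.
  rewrite normrN normrM normfV => le.
  by rewrite ler_pdivrMl ?normr_gt0// (mulrC _ e).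
split; first by apply/cvg_ex; exists a.
exact: cvg_lim cv.
Qed.

(** A relation instead of an operator: the value comes together with its existence, so sums,
    multiples and affine substitutions transport both at once. *)
Definition d2 f x a := exists f1, (\forall t \near x, is_derive (t : R) 1 f (f1 t)) /\
  is_derive x 1 f1 a.

Lemma is_derive_min0 f l x : (\forall t \near x, f x <= f t) ->
  is_derive x 1 f l -> l = 0.
Proof.
move=> /nbhs_ballP[r /= r0 fmin] /is_deriveP df.
apply/eqP; rewrite -normr_eq0; apply/negPn/negP => ln0.
have lpos : 0 < `|l| by rewrite lt_def ln0/=.
have [d d0 Hd] := df (`|l| / 2) ltac:(by rewrite divr_gt0).
(* The step goes against the sign of [l]: the linear part lowers [f] by |l| s, twice what the error
   term can give back. *)
pose s := Num.min (r / 2) (d / 2); pose h := - (Num.sg l * s).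
have s0 : 0 < s by rewrite lt_min !divr_gt0.
have nh : `|h| = s by rewrite normrN normrM normr_sg -normr_eq0 ln0 mul1r gtr0_norm.
have hd : `|h| < d by rewrite nh gt_min orbC (_ : d / 2 < d)//; qlra.
have := Hd h hd; have := fmin (x + h).
rewrite /ball/= opprD addrA subrr sub0r normrN nh gt_min (_ : r / 2 < r)//=; last qlra.
move=> /(_ isT) fxh.
have -> : l * h = - (`|l| * s) by rewrite mulrN mulrA (mulrC l) -normrEsg.
rewrite ler_norml => /andP[_]; have : 0 < `|l| * s by rewrite mulr_gt0.
by qlra.
Qed.

(* If f'' < 0 at a critical point, then f' < 0 just to the right of it. *)
Lemma d2_min f x a : (\forall t \near x, f x <= f t) -> d2 f x a -> 0 <= a.
Proof.
move=> fmin [f1 [df df1]]; rewrite leNgt; apply/negP => a0.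
have f10 := is_derive_min0 fmin (nbhs_singleton df).
have [/= d d0 Hd] := (is_deriveP f1 x a).1 df1 (- a / 2) ltac:(qlra).
move: fmin df => /nbhs_ballP[r /= r0 fmin] /nbhs_ballP[r' /= r'0 df].
pose h := Num.min (Num.min (r / 2) (r' / 2)) (d / 2).
have h0 : 0 < h by rewrite !lt_min !divr_gt0.
have hr : h < r by rewrite !gt_min; apply/orP; left; apply/orP; left; qlra.
have hr' : h < r' by rewrite !gt_min; apply/orP; left; apply/orP; right; qlra.
have hd : h < d by rewrite !gt_min; apply/orP; right; qlra.
have xh : x < x + h by qlra.
have [t xth|c /andP[xc cxh] E] := @mvt f f1 x (x + h) xh.
  by apply: df; rewrite /ball/= distrC ger0_norm; qlra.
have := fmin (x + h); rewrite /ball/= distrC ger0_norm; last qlra.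
move=> /(_ ltac:(qlra)); rewrite -subr_ge0 E.
rewrite (_ : x + h - x = h); last qlra.
rewrite pmulr_lge0// => f1c.
have := Hd (c - x); rewrite ger0_norm; last qlra.
move=> /(_ ltac:(qlra)); rewrite f10 (addrC x) subrK subr0 ler_norml => /andP[_].
nra.
Qed.

Lemma d2D f g x a b : d2 f x a -> d2 g x b -> d2 (fun t => f t + g t) x (a + b).
Proof.
move=> [f1 [df df1]] [g1 [dg dg1]]; exists (fun t => f1 t + g1 t); split.
  by apply: filterS2 df dg => t dft dgt; exact: is_deriveD.
exact: is_deriveD.
Qed.

Lemma d2Z c f x a : d2 f x a -> d2 (fun t => c * f t) x (c * a).
Proof.
move=> [f1 [df df1]]; exists (fun t => c * f1 t); split.
  by apply: filterS df => t dft; exact: is_deriveZ.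
exact: is_deriveZ.
Qed.

Lemma d2_near f g x a : (\forall t \near x, f t = g t) -> d2 f x a -> d2 g x a.
Proof.
move=> fg [f1 [df df1]]; exists f1; split => //.
by apply: filterS2 (near_join fg) df => t; exact: near_is_derive.
Qed.

Lemma is_derive_affine f c b x a : is_derive (c * x + b) 1 f a ->
  is_derive x 1 (fun t => f (c * t + b)) (c * a).
Proof.
move=> df; have dg : is_derive x 1 (fun t : R => c * t + b) c.
  by apply: is_derive_eq; rewrite addr0 /GRing.scale/= mulr1.
by have := @is_derive1_comp R f (fun t => c * t + b) x a c df dg; rewrite mulrC.
Qed.

Lemma d2_affine f c b x a : d2 f (c * x + b) a ->
  d2 (fun t => f (c * t + b)) x (c * (c * a)).
Proof.
move=> [f1 [df df1]]; exists (fun t => c * f1 (c * t + b)); split; last first.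
  have := @is_derive_affine f1 c b x a df1 => H; exact: is_deriveZ.
have ct : (c * t + b) @[t --> x] --> c * x + b.
  by apply: cvgD; [apply: cvgM; [exact: cvg_cst|exact: cvg_id]|exact: cvg_cst].
by apply: (@filterS _ (nbhs x) _ _ _ _ (ct _ df)) => t /=; exact: is_derive_affine.
Qed.

Lemma d2C c x : d2 (fun=> c : R) x 0.
Proof. by exists (fun=> 0); split; [apply: (@filterE _ (nbhs x)) => t|]; exact: is_derive_cst. Qed.

Lemma d2_ext f f1 l x : (forall t : R, is_derive t 1 f (f1 t)) ->
  is_derive x 1 f1 l -> d2 f x l.
Proof. by move=> H1 H2; exists f1; split => //; apply: (@filterE _ (nbhs x)). Qed.

End OneVariable.

Definition ctn {R : realType} (f : R -> R -> R) x y :=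
  {for (x, y), continuous (fun p : R * R => f p.1 p.2)}.

(** Only the pure second derivatives along the two axes are asked for: at a minimum each of them is
    nonnegative, and this is all that the maximum principle exploits. *)
Definition lap {R : realType} (f : R -> R -> R) x y v :=
  exists a b, [/\ d2 (f^~ y) x a, d2 (f x) y b & v = a + b].

Section MaximumPrinciple.
Context {R : realType}.
Implicit Types (f g w psi : R -> R -> R) (x y : R) (O K : set (R * R)).

Lemma lapD f g x y a b : lap f x y a -> lap g x y b ->
  lap (fun s t => f s t + g s t) x y (a + b).
Proof.
move=> [a1 [a2 [fa1 fa2 ->]]] [b1 [b2 [gb1 gb2 ->]]].
exists (a1 + b1), (a2 + b2); split; [exact: d2D|exact: d2D|by rewrite addrACA].
Qed.

Lemma lapZ c f x y a : lap f x y a -> lap (fun s t => c * f s t) x y (c * a).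
Proof.
move=> [a1 [a2 [fa1 fa2 ->]]]; exists (c * a1), (c * a2).
by split; [exact: d2Z|exact: d2Z|rewrite mulrDr].
Qed.

Lemma lapB f g x y a b : lap f x y a -> lap g x y b ->
  lap (fun s t => f s t - g s t) x y (a - b).
Proof.
move=> fa gb; have := lapD fa (lapZ (-1) gb); rewrite mulN1r.
by under [X in lap X]eq_fun do under eq_fun do rewrite mulN1r.
Qed.

Lemma lap_affine f c b c' b' x y a1 a2 :
    d2 (f^~ (c' * y + b')) (c * x + b) a1 -> d2 (f (c * x + b)) (c' * y + b') a2 ->
  lap (fun s t => f (c * s + b) (c' * t + b')) x y (c * (c * a1) + c' * (c' * a2)).
Proof.
move=> fa1 fa2; exists (c * (c * a1)), (c' * (c' * a2)).
split => //; [exact: (@d2_affine _ (f^~ (c' * y + b')))|exact: (@d2_affine _ (f (c * x + b)))].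
Qed.

Lemma open_lines O x y : open O -> O (x, y) ->
  (\forall s \near x, O (s, y)) /\ (\forall t \near y, O (x, t)).
Proof.
move=> oO Oxy; have nO : nbhs (x, y) O by exact: open_nbhs_nbhs.
have [[A B] [/= nA nB] sub] := nO.
split; [apply: filterS nA => s As|apply: filterS nB => t Bt]; apply: sub; split => //=;
  exact: nbhs_singleton.
Qed.

Lemma compact_argmin K (h : R * R -> R) : compact K -> K !=set0 ->
  (forall p, K p -> {for p, continuous h}) ->
  exists2 p, K p & forall q, K q -> h p <= h q.
Proof.
move=> cK K0 hc; have hw : {within K, continuous h}.
  by apply: continuous_in_subspaceT => p; rewrite inE => /hc.
have [p Kp pmin] := compact_EVT_min K0 cK hw.
by exists p; [exact: set_mem|move=> q Kq; apply: pmin; exact: mem_set].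
Qed.

(* At a negative minimum of w / psi, say t, the function w - t psi is minimal, so that
   its Laplacian is nonnegative; but lap w <= - c w = - t c psi < t lap psi there. *)
Lemma maximum_principle O w psi c :
    open O -> (forall x y, O (x, y) -> ctn w x y /\ ctn psi x y) ->
    (forall x y, O (x, y) -> 0 < psi x y /\
       exists2 v, lap psi x y v & v + c x y * psi x y < 0) ->
    (forall x y, O (x, y) ->
       exists2 v, lap w x y v & w x y < 0 -> v + c x y * w x y <= 0) ->
    (forall e : R, 0 < e -> exists K, [/\ compact K, K `<=` O &
       forall x y, O (x, y) -> ~ K (x, y) -> - e * psi x y <= w x y]) ->
  forall x y, O (x, y) -> 0 <= w x y.
Proof.
move=> oO ct psi0 lw HK x0 y0 O0; rewrite leNgt; apply/negP => w0.
have p0 := (psi0 _ _ O0).1.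
(* With half of the negative ratio, the point (x0, y0) must lie in [K], and outside [K] the ratio
   [w / psi] stays above its value at (x0, y0). So a minimum over [K] is a minimum over [O]. *)
pose e := - (w x0 y0 / psi x0 y0) / 2.
have t0 : w x0 y0 / psi x0 y0 < 0 by rewrite pmulr_llt0// invr_gt0.
have e0 : 0 < e by rewrite /e; qlra.
have [K [cK KO Kw]] := HK e e0.
have K0 : K (x0, y0).
  apply: contrapT => /(Kw _ _ O0); rewrite -ler_pdivlMr//.
  by rewrite /e; qlra.
pose q (p : R * R) := w p.1 p.2 / psi p.1 p.2.
have [|[x y] Kxy qmin] := @compact_argmin K q cK ltac:(by exists (x0, y0)).
  move=> [x y] /KO Oxy; have [cw cp] := ct _ _ Oxy; apply: cvgM; first exact: cw.
  by apply: cvgV; [rewrite gt_eqF//; exact: (psi0 _ _ Oxy).1|exact: cp].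
pose t := q (x, y).
have tlt : t <= w x0 y0 / psi x0 y0 by exact: (qmin (x0, y0)).
have pos s r : O (s, r) -> 0 <= w s r - t * psi s r.
  move=> Osr; have p' := (psi0 _ _ Osr).1; rewrite subr_ge0 -ler_pdivlMr//.
  have [Ksr|nK] := pselect (K (s, r)); first exact: (qmin (s, r)).
  rewrite ler_pdivlMr// (le_trans _ (Kw _ _ Osr nK))// ler_pM2r// /e; qlra.
have Oxy := KO _ Kxy; have [py [v lv vneg]] := psi0 _ _ Oxy.
have wxy : w x y = t * psi x y by rewrite /t /q/= divfK// gt_eqF.
have [v' lv'] := lw _ _ Oxy.
have [a [b [da db vE]]] := lapB lv' (lapZ t lv).
have [Ox Oy] := open_lines oO Oxy.
have a0 : 0 <= a.
  apply: d2_min da; apply: filterS Ox => s /= /pos; rewrite wxy; qlra.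
have b0 : 0 <= b.
  apply: d2_min db; apply: filterS Oy => s /= /pos; rewrite wxy; qlra.
rewrite wxy => H; have := H ltac:(by rewrite pmulr_llt0//; qlra).
nra.
Qed.


Lemma d2Zr c (f : R -> R) x a : d2 f x a -> d2 (fun s => f s * c) x (a * c).
Proof.
move=> fa; rewrite mulrC; apply: d2_near (d2Z c fa).
by apply: (@filterE _ (nbhs x)) => t; rewrite mulrC.
Qed.

Lemma d2_cvg (f : R -> R) x a : d2 f x a -> {for x, continuous f}.
Proof.
move=> [f1 [/nbhs_singleton df _]].
by apply: differentiable_continuous; apply/derivable1_diffP; exact: (@ex_derive _ _ _ _ _ _ _ df).
Qed.

Lemma lapM1 (f g : R -> R) x y a b : d2 f x a -> d2 g y b ->
  lap (fun s t => f s * g t) x y (a * g y + f x * b).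
Proof.
move=> fa gb; exists (a * g y), (f x * b).
by split => //; [exact: d2Zr|exact: d2Z].
Qed.

Lemma ctnx (f : R -> R) x y : {for x, continuous f} -> ctn (fun s _ => f s) x y.
Proof.
move=> cf; apply: (@cvg_comp _ _ _ (@fst R R) f (nbhs (x, y)) (nbhs x)) => //.
exact: cvg_fst.
Qed.

Lemma ctny (f : R -> R) x y : {for y, continuous f} -> ctn (fun _ t => f t) x y.
Proof.
move=> cf; apply: (@cvg_comp _ _ _ (@snd R R) f (nbhs (x, y)) (nbhs y)) => //.
exact: cvg_snd.
Qed.

Lemma ctnM1 (f g : R -> R) x y a b : d2 f x a -> d2 g y b ->
  ctn (fun s t => f s * g t) x y.
Proof.
move=> /d2_cvg fa /d2_cvg gb; apply: cvgM; [exact: ctnx|exact: ctny].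
Qed.

Lemma ctn_eq f g x y : (forall s t, f s t = g s t) -> ctn f x y -> ctn g x y.
Proof. by move=> fg; have -> : g = f by apply: funext => s; apply: funext => t. Qed.

Lemma ctnD f g x y : ctn f x y -> ctn g x y -> ctn (fun s t => f s t + g s t) x y.
Proof. by move=> cf cg; exact: cvgD. Qed.

Lemma ctnB f g x y : ctn f x y -> ctn g x y -> ctn (fun s t => f s t - g s t) x y.
Proof. by move=> cf cg; exact: cvgB. Qed.

Lemma ctnM f g x y : ctn f x y -> ctn g x y -> ctn (fun s t => f s t * g s t) x y.
Proof. by move=> cf cg; exact: cvgM. Qed.

Lemma ctnC c x y : ctn (fun _ _ => c : R) x y.
Proof. exact: cvg_cst. Qed.

Lemma compact_box a b c d : compact [set p : R * R | a <= p.1 <= b /\ c <= p.2 <= d].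
Proof.
have := compact_setX (@segment_compact R a b) (@segment_compact R c d).
by congr (compact _); apply/seteqP; split => -[s t] /=; rewrite !in_itv.
Qed.

Lemma compact_ge K (h : R * R -> R) e : compact K ->
  (forall p, K p -> {for p, continuous h}) -> compact [set p | K p /\ e <= h p].
Proof.
rewrite !compact_ultra => cK hc F FU FK.
have [p [Kp Fp]] := cK F FU ltac:(by apply: filterS FK => q []).
exists p; split => //; split => //.
have Fh : h @ F --> h p by exact: cvg_trans (cvg_app h Fp) (hc _ Kp).
by apply: cvgr_to_ge Fh _; apply: filterS FK => q [].
Qed.

Lemma open_ltf (f g : R * R -> R) : continuous f -> continuous g -> open [set p | f p < g p].
Proof.
move=> cf cg; rewrite (_ : mkset _ = (g \- f) @^-1` [set z | 0 < z]).
  have cgf : continuous (g \- f) by move=> p; exact: cvgB (cg p) (cf p).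
  by move/continuousP : cgf; apply; exact: open_gt.
by apply/seteqP; split => p /=; rewrite subr_gt0.
Qed.

Lemma open_rect a b c d : open [set p : R * R | a < p.1 < b /\ c < p.2 < d].
Proof.
have c1 : continuous (fst : R * R -> R) by move=> p; exact: cvg_fst.
have c2 : continuous (snd : R * R -> R) by move=> p; exact: cvg_snd.
have cc (z : R) : continuous (fun _ : R * R => z) by move=> p; exact: cvg_cst.
rewrite (_ : mkset _ = ([set p | a < p.1] `&` [set p | p.1 < b]) `&`
                       ([set p | c < p.2] `&` [set p | p.2 < d])).
  by do 2?apply: openI; apply: open_ltf.
apply/seteqP; split => -[s t] /=; first by move=> [/andP[-> ->] /andP[-> ->]].
by move=> [[-> ->] [-> ->]].
Qed.

(** The supersolution 1 + B^2 - x^2 has Laplacian - 2 and is at least 1 on [O]; hence the unweighted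
    lower bound - e outside [K] suffices. *)
Lemma max_princ0 O w B :
    open O -> (forall x y, O (x, y) -> ctn w x y /\ `|x| <= B) ->
    (forall x y, O (x, y) -> exists2 v, lap w x y v & w x y < 0 -> v <= 0) ->
    (forall e : R, 0 < e -> exists K, [/\ compact K, K `<=` O &
       forall x y, O (x, y) -> ~ K (x, y) -> - e <= w x y]) ->
  forall x y, O (x, y) -> 0 <= w x y.
Proof.
move=> oO H lw HK.
have dpsi x : d2 (fun t => 1 + B ^+ 2 - t ^+ 2) x (- 2).
  apply: (@d2_ext _ _ (fun t => - (2 * t))).
    move=> t; apply: is_derive_eq; rewrite ?scaler0 ?addr0 ?add0r /GRing.scale/=; ring.
  by apply: is_derive_eq; rewrite ?scaler0 ?addr0 ?add0r /GRing.scale/=; ring.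
have d1 (y : R) : d2 (fun=> 1 : R) y 0 by exact: d2C.
have psi1 x y : O (x, y) -> 1 <= 1 + B ^+ 2 - x ^+ 2.
  move=> /H[_]; rewrite -(real_normK (num_real x)); have := normr_ge0 x; nra.
apply: (@maximum_principle O w (fun x _ => (1 + B ^+ 2 - x ^+ 2) * 1) (fun _ _ => 0)) => //.
- by move=> x y /H[cw _]; split => //; exact: ctnM1.
- move=> x y /psi1 ?; split; first by qlra.
  by exists (- 2 * 1 + (1 + B ^+ 2 - x ^+ 2) * 0); [exact: lapM1|qlra].
- move=> x y /lw[v lv v0]; exists v => //; rewrite mul0r addr0; exact: v0.
- move=> e e0; have [K [cK KO Kw]] := HK e e0; exists K; split => // x y Oxy nK.
  by have := Kw _ _ Oxy nK; have := psi1 _ _ Oxy; nra.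
Qed.

Lemma d2_sin x : d2 (@sin R) x (- sin x).
Proof. by apply: (@d2_ext _ _ cos) => [t|]; exact: is_derive_eq. Qed.

Lemma d2_cos x : d2 (@cos R) x (- cos x).
Proof. by apply: (@d2_ext _ _ (fun t => - sin t)) => [t|]; exact: is_derive_eq. Qed.

Lemma sin_ge_mid (e a : R) : 0 <= e -> e <= a <= pi - e -> sin e <= sin a.
Proof.
move=> e0; wlog api : a / a <= pi / 2.
  move=> H /andP[ea ae]; have [api|/ltW api] := leP a (pi / 2); first by apply: H; qlra.
  have := H (pi - a) ltac:(qlra) ltac:(qlra).
  by rewrite sinB sinpi cospi mul0r mulN1r sub0r opprK.
move=> /andP[ea _].
have inI (t : R) : 0 <= t -> t <= pi / 2 -> t \in `[- (pi / 2), pi / 2].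
  by move=> ? ?; rewrite in_itv/=; have := @pi_gt0 R; qlra.
by rewrite leNgt ltr_sin ?inI// -?leNgt//; qlra.
Qed.

Lemma cos_ge_mid (c a : R) : 0 <= c <= pi -> `|a| <= c -> cos c <= cos a.
Proof.
move=> /andP[c0 cpi] ac; rewrite -(cos_norm a).
have := normr_ge0 a => a0.
by rewrite leNgt ltr_cos -?leNgt// in_itv/=; qlra.
Qed.

(* Comparison with the positive supersolution sin (al (s x + t)) cos (be (y - 1/2)). *)
Lemma max_princ_sin O w al be s t lam eta :
    open O -> (forall x y, O (x, y) -> ctn w x y) ->
    0 < eta -> eta <= pi / 2 -> 0 < be < pi -> s ^+ 2 = 1 -> lam < al ^+ 2 + be ^+ 2 ->
    (forall x y, O (x, y) -> 0 < y < 1 /\ eta <= al * (s * x + t) <= pi - eta) ->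
    (forall x y, O (x, y) ->
       exists2 v, lap w x y v & w x y < 0 -> v + lam * w x y <= 0) ->
    (forall e : R, 0 < e -> exists K, [/\ compact K, K `<=` O &
       forall x y, O (x, y) -> ~ K (x, y) -> - e <= w x y]) ->
  forall x y, O (x, y) -> 0 <= w x y.
Proof.
move=> oO cw eta0 etapi be0 s1 lam0 OI lw HK.
pose f x := sin (al * s * x + al * t); pose g y := cos (be * y + - (be / 2)).
have df x : d2 f x (al * s * (al * s * - sin (al * s * x + al * t))).
  exact: (@d2_affine _ sin) (d2_sin _).
have dg y : d2 g y (be * (be * - cos (be * y + - (be / 2)))).
  exact: (@d2_affine _ cos) (d2_cos _).
have seta : 0 < sin eta by apply: sin_gt0_pi; have := @pi_gt0 R; qlra.
have cbe : 0 < cos (be / 2) by apply: cos_gt0_pihalf; have := @pi_gt0 R; qlra.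
have flb x y : O (x, y) -> sin eta <= f x.
  by move=> /OI[_ ?]; apply: sin_ge_mid; [exact: ltW|rewrite -mulrA -mulrDr].
have glb x y : O (x, y) -> cos (be / 2) <= g y.
  move=> /OI[/andP[y0 y1] _]; apply: cos_ge_mid; first by qlra.
  by rewrite ler_norml; nra.
have plb x y : O (x, y) -> sin eta * cos (be / 2) <= f x * g y.
  by move=> Oxy; apply: ler_pM; [exact: ltW|exact: ltW|exact: flb Oxy|exact: glb Oxy].
have c0 : 0 < sin eta * cos (be / 2) by exact: mulr_gt0.
apply: (@maximum_principle O w (fun x y => f x * g y) (fun _ _ => lam)) => //.
- by move=> x y Oxy; split; [exact: cw|exact: ctnM1].
- move=> x y Oxy; have p0 := plb _ _ Oxy; split; first exact: lt_le_trans p0.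
  eexists; first exact: (lapM1 (df x) (dg y)).
  rewrite -/(f x) -/(g y).
  rewrite [ltLHS](_ : _ = (lam - (al ^+ 2 * s ^+ 2 + be ^+ 2)) * (f x * g y)); last by ring.
  by rewrite s1 mulr1 nmulr_rlt0 ?(lt_le_trans c0)//; qlra.
- move=> e e0; have [K [cK KO Kw]] := HK (e * (sin eta * cos (be / 2))) ltac:(exact: mulr_gt0).
  exists K; split => // x y Oxy nK; apply: le_trans (Kw _ _ Oxy nK).
  by rewrite !mulNr lerN2 ler_pM2l//; exact: plb.
Qed.

End MaximumPrinciple.

(** * Gradient bounds from quadratic barriers and odd reflection *)

Section GradientBounds.
Context {R : realType}.
Implicit Types (u w : R -> R -> R) (x y r M F e l d sg : R) (K : set (R * R)).

Lemma d2_quad (a b c x : R) : d2 (fun t => a * t ^+ 2 + b * t + c) x (2 * a).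
Proof.
apply: (@d2_ext _ _ (fun t => 2 * a * t + b)).
  by move=> t; apply: is_derive_eq; rewrite ?scaler0 ?addr0 ?add0r /GRing.scale/=; ring.
by apply: is_derive_eq; rewrite ?scaler0 ?addr0 ?add0r /GRing.scale/=; ring.
Qed.

Lemma lap_sum (f g : R -> R) x y a b : d2 f x a -> d2 g y b ->
  lap (fun s t => f s + g t) x y (a + b).
Proof.
move=> fa gb; have := lapD (lapM1 fa (d2C 1 y)) (lapM1 (d2C 1 x) gb).
rewrite mulr1 mulr0 addr0 mul0r add0r mul1r.
by under eq_fun do under eq_fun do rewrite mulr1 mul1r.
Qed.

Lemma lap_swap u x y v : lap u x y v -> lap (fun s t => u t s) y x v.
Proof. by move=> [a [b [? ? ->]]]; exists b, a; split; rewrite // addrC. Qed.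

Lemma ctn_swap u x y : ctn u x y -> ctn (fun s t => u t s) y x.
Proof.
move=> cu; apply: (@cvg_comp _ _ _ (fun p : R * R => (p.2, p.1)) (fun p => u p.1 p.2)
  (nbhs (y, x)) (nbhs (x, y))) => //.
by apply: (@cvg_pair _ _ _ (nbhs (y, x)) (nbhs x) (nbhs y)); [exact: cvg_snd|exact: cvg_fst].
Qed.

Lemma cvg_affine (c b x : R) : (c * t + b) @[t --> x] --> c * x + b.
Proof. by apply: cvgD; [apply: cvgM; [exact: cvg_cst|exact: cvg_id]|exact: cvg_cst]. Qed.

Lemma ctn_affine u c b c' b' x y : ctn u (c * x + b) (c' * y + b') ->
  ctn (fun s t => u (c * s + b) (c' * t + b')) x y.
Proof.
move=> cu; apply: (@cvg_comp _ _ _ (fun p : R * R => (c * p.1 + b, c' * p.2 + b'))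
  (fun p => u p.1 p.2) (nbhs (x, y)) (nbhs (c * x + b, c' * y + b'))) => //.
apply: (@cvg_pair _ _ _ (nbhs (x, y)) (nbhs (c * x + b)) (nbhs (c' * y + b'))).
  by apply: (@ctnx _ (fun s => c * s + b)); exact: cvg_affine.
by apply: (@ctny _ (fun s => c' * s + b')); exact: cvg_affine.
Qed.

(** Barrier c (y^2 + x (3 r - 2 x)) with c r^2 = 2 M + F r^2. Its Laplacian is - 2 c <= - F, it
    exceeds M where x or |y| is above 9 r / 10, it is nonnegative in the box, and on the axis y = 0
    it is at most 3 r c x, the claimed linear bound. *)
Lemma half_box_upper w r M F : 0 < r ->
    (forall x y, 0 < x < r -> - r < y < r -> [/\ ctn w x y,
       exists2 v, lap w x y v & - F <= v & w x y <= M]) -> 0 <= M -> 0 <= F ->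
    (forall e : R, 0 < e -> exists K, [/\ compact K,
       forall x y, K (x, y) -> 0 < x < r /\ - r < y < r &
       forall x y, 0 < x <= r * (9 / 10) -> `|y| <= r * (9 / 10) -> ~ K (x, y) -> w x y <= e]) ->
  forall x, 0 < x < r -> w x 0 <= 3 * (2 * M / r + F * r) * x.
Proof.
move=> r0 H M0 F0 HK x xr.
pose c := (2 * M + F * r ^+ 2) / r ^+ 2.
have c0 : 0 <= c by rewrite divr_ge0 ?addr_ge0 ?mulr_ge0 ?exprn_ge0// ltW.
have cr : c * r ^+ 2 = 2 * M + F * r ^+ 2 by rewrite /c divfK// gt_eqF// exprn_gt0.
have FM : F <= c * 2.
  by rewrite -(ler_pM2r (exprn_gt0 2 r0)) [leRHS]mulrAC cr; have := exprn_gt0 2 r0; nra.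
pose O := [set p : R * R | 0 < p.1 < r /\ - r < p.2 < r].
pose f x := (- 2 * c) * x ^+ 2 + (3 * r * c) * x + 0; pose g y := c * y ^+ 2 + 0 * y + 0.
suff /(_ x 0) : forall x y, O (x, y) -> 0 <= f x + g y - w x y.
  rewrite /O/= => /(_ ltac:(qlra)); rewrite /f /g !addr0 mul0r expr0n/= mulr0 !addr0.
  have -> : 3 * (2 * M / r + F * r) * x = 3 * r * c * x.
    by rewrite /c; field; rewrite gt_eqF.
  by have := sqr_ge0 x; nra.
apply: (@max_princ0 _ O _ r) => //.
- exact: open_rect.
- move=> a b [/= a0 b0]; have [ca _ _] := H _ _ a0 b0; split; last by rewrite ler_norml; qlra.
  apply: ctnB => //; apply: ctnD; [apply: ctnx|apply: ctny]; apply: d2_cvg; exact: d2_quad.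
- move=> a b [/= a0 b0]; have [_ [v lv vF] _] := H _ _ a0 b0.
  exists (2 * (- 2 * c) + 2 * c - v); last by qlra.
  apply: lapB => //; apply: lap_sum; exact: d2_quad.
- move=> e e0; have [K [cK KO Kw]] := HK e e0; exists K; split => //.
    by move=> [a b] /KO.
  move=> a b [/= a0 b0] nK; have [_ _ wM] := H _ _ a0 b0.
  have fg : f a + g b = c * (b ^+ 2 + a * (3 * r - 2 * a)) by rewrite /f /g; ring.
  rewrite fg.
  have pos : 0 <= c * (b ^+ 2 + a * (3 * r - 2 * a)).
    by rewrite mulr_ge0// addr_ge0 ?sqr_ge0// mulr_ge0//; qlra.
  have [ar|ar] := leP a (r * (9 / 10)); last first.
    have : c * (r ^+ 2 / 2) <= c * (b ^+ 2 + a * (3 * r - 2 * a)).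
      by rewrite ler_wpM2l//; have := sqr_ge0 b; nra.
    rewrite mulrA cr; have : 0 <= F * r ^+ 2 by rewrite mulr_ge0// sqr_ge0.
    qlra.
  have [br|br] := leP `|b| (r * (9 / 10)).
    by have := Kw a b ltac:(qlra) br nK; qlra.
  have : c * (r ^+ 2 / 2) <= c * (b ^+ 2 + a * (3 * r - 2 * a)).
    rewrite ler_wpM2l// -(real_normK (num_real b)).
    have : 0 <= a * (3 * r - 2 * a) by rewrite mulr_ge0//; qlra.
    have : (r * (9 / 10)) ^+ 2 <= `|b| ^+ 2 by rewrite lerXn2r ?nnegrE//; qlra.
    have := sqr_ge0 r; nra.
  rewrite mulrA cr; have : 0 <= F * r ^+ 2 by rewrite mulr_ge0// sqr_ge0.
  qlra.
Qed.

Lemma half_box w r M F : 0 < r ->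
    (forall x y, 0 < x < r -> - r < y < r -> [/\ ctn w x y,
       exists2 v, lap w x y v & `|v| <= F & `|w x y| <= M]) ->
    (forall e : R, 0 < e -> exists K, [/\ compact K,
       forall x y, K (x, y) -> 0 < x < r /\ - r < y < r &
       forall x y, 0 < x <= r * (9 / 10) -> `|y| <= r * (9 / 10) -> ~ K (x, y) -> `|w x y| <= e]) ->
  forall x, 0 < x < r -> `|w x 0| <= 3 * (2 * M / r + F * r) * x.
Proof.
move=> r0 H HK x xr.
have [M0 F0] : 0 <= M /\ 0 <= F.
  have [_ [v _ /(le_trans (normr_ge0 _)) F0] /(le_trans (normr_ge0 _)) M0] :=
    H (r / 2) 0 ltac:(qlra) ltac:(qlra).
  by [].
rewrite ler_norml; apply/andP; split; last first.
  apply: (@half_box_upper _ _ _ _ r0) => //.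
    move=> a b a0 b0; have [ca [v lv]] := H _ _ a0 b0.
    by rewrite !ler_norml => /andP[? ?] /andP[? ?]; split => //; exists v.
  move=> e e0; have [K [cK KO Kw]] := HK e e0; exists K; split => // a b a0 b0 nK.
  exact: le_trans (ler_norm _) (Kw _ _ a0 b0 nK).
rewrite lerNl -mulN1r; apply: (@half_box_upper (fun x y => (-1) * w x y) _ _ _ r0) => //.
  move=> a b a0 b0; have [ca [v lv]] := H _ _ a0 b0.
  rewrite !ler_norml => /andP[? ?] /andP[? ?]; split; last by qlra.
    by apply: ctnM => //; exact: ctnC.
  by exists (-1 * v); [exact: lapZ|qlra].
move=> e e0; have [K [cK KO Kw]] := HK e e0; exists K; split => // a b a0 b0 nK.
by rewrite mulN1r (le_trans (ler_norm _))// normrN; exact: Kw.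
Qed.

(** Odd reflection in the line x = x0: the difference of the values at x0 + x and x0 - x vanishes on
    that line, so the half-box bound makes it O(x), and it equals 2 l x to first order. *)
Lemma grad_bound u x0 y0 r M F l : 0 < r ->
    (forall x y, `|x - x0| < r -> `|y - y0| < r -> [/\ ctn u x y,
       exists2 v, lap u x y v & `|v| <= F & `|u x y| <= M]) ->
    is_derive x0 1 (u^~ y0) l ->
  `|l| <= 3 * (2 * M / r + F * r).
Proof.
move=> r0 H dl.
pose w x y := u (1 * x + x0) (1 * y + y0) - u ((-1) * x + x0) (1 * y + y0).
have bx x z : - r < x < r -> `|1 * x + z - z| < r /\ `|(-1) * x + z - z| < r.
  by move=> xr; rewrite !addrK !mul1r mulN1r normrN ltr_norml.
have cw x y : - r < x < r -> - r < y < r -> ctn w x y.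
  move=> /(bx _ x0)[x1 x2] /(bx _ y0)[y1 _].
  have [c1 _ _] := H _ _ x1 y1; have [c2 _ _] := H _ _ x2 y1.
  apply: ctnB; first exact: (@ctn_affine u).
  exact: (@ctn_affine u).
have Hw x y : 0 < x < r -> - r < y < r -> [/\ ctn w x y,
       exists2 v, lap w x y v & `|v| <= 2 * F & `|w x y| <= 2 * M].
  move=> x0r yr; have xr : - r < x < r by qlra.
  have [x1 x2] := bx _ x0 xr; have [y1 _] := bx _ y0 yr.
  have [c1 [v1 [a1 [b1 [da1 db1 E1]]] V1] M1] := H _ _ x1 y1.
  have [c2 [v2 [a2 [b2 [da2 db2 E2]]] V2] M2] := H _ _ x2 y1.
  split; first exact: cw.
    eexists.
      apply: lapB; first exact: (@lap_affine _ u 1 x0 1 y0 x y a1 b1 da1 db1).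
      exact: (@lap_affine _ u (-1) x0 1 y0 x y a2 b2 da2 db2).
    rewrite !mul1r !mulN1r opprK -E1 -E2.
    by apply: le_trans (ler_normB _ _) _; qlra.
  by apply: le_trans (ler_normB _ _) _; qlra.
have := half_box r0 Hw; have HK (e : R) : 0 < e -> exists K, [/\ compact K,
       forall x y, K (x, y) -> 0 < x < r /\ - r < y < r &
       forall x y, 0 < x <= r * (9 / 10) -> `|y| <= r * (9 / 10) -> ~ K (x, y) -> `|w x y| <= e].
  move=> e0.
  pose Bx := [set p : R * R | 0 <= p.1 <= r * (9 / 10) /\
                              - (r * (9 / 10)) <= p.2 <= r * (9 / 10)].
  have Kc : compact Bx by exact: compact_box.
  have cwK p : Bx p -> {for p, continuous (fun p : R * R => `|w p.1 p.2|)}.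
    case: p => x y [/= xr yr]; have cxy : ctn w x y by apply: cw; qlra.
    exact: cvg_norm cxy.
  (* The superlevel set inside a closed box is compact, and it avoids x = 0, where the reflected
     difference vanishes. *)
  exists [set p : R * R | Bx p /\ e <= `|w p.1 p.2|]; split; first exact: (compact_ge Kc cwK).
    move=> x y [[/= xr yr] /= ew]; split; last by qlra.
    suff : x != 0 by move=> xn0; rewrite lt_def xn0/=; qlra.
    apply/eqP => x00; move: ew; rewrite x00 /w !mulr0 subrr normr0; qlra.
  move=> x y xr yr /=; have [//|we] := leP `|w x y| e => nK; exfalso; apply: nK.
  by move: yr; rewrite ler_norml => yr; split; [split => /=; qlra|exact: ltW].
move=> /(_ HK) wb; apply/ler_addgt0Pr => e e0.
have [d /= d0 Hd] := (is_deriveP _ _ _).1 dl e e0.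
pose h := Num.min (d / 2) (r / 2).
have h0 : 0 < h by rewrite lt_min !divr_gt0.
have hd : h < d by rewrite gt_min; apply/orP; left; qlra.
have hr : h < r by rewrite gt_min; apply/orP; right; qlra.
have Hp := Hd h; have Hm := Hd (- h).
move: Hp Hm (wb h); rewrite normrN gtr0_norm// /w mul1r mulN1r mul1r add0r.
move=> /(_ hd) Hp /(_ hd) Hm /(_ ltac:(qlra)).
rewrite (addrC h) (addrC (- h)) ler_norml => /andP[w1 w2].
move: Hp Hm; rewrite !ler_norml => /andP[? ?] /andP[? ?].
have E : 3 * (2 * (2 * M) / r + 2 * F * r) = 2 * (3 * (2 * M / r + F * r)).
  by field; rewrite gt_eqF.
move: w1 w2; rewrite E; set C := 3 * _ => w1 w2.
by apply/andP; split; rewrite -(ler_pM2r h0); nra.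
Qed.

Lemma grad_bound_y u x0 y0 r M F l : 0 < r ->
    (forall x y, `|x - x0| < r -> `|y - y0| < r -> [/\ ctn u x y,
       exists2 v, lap u x y v & `|v| <= F & `|u x y| <= M]) ->
    is_derive y0 1 (u x0) l ->
  `|l| <= 3 * (2 * M / r + F * r).
Proof.
move=> r0 H dl; apply: (@grad_bound (fun s t => u t s) y0 x0) dl => // x y xr yr.
have [cu [v lv vF] uM] := H _ _ yr xr; split => //; first exact: ctn_swap.
by exists v => //; exact: lap_swap.
Qed.

(** Linear growth off a flat side on which [u] vanishes: [sg = 1] serves a side below the domain,
    [sg = -1] a side above it. The coordinates are exchanged so that the distance to the side
    becomes the first variable of [half_box]. *)
Lemma flat_bound u x0 y0 sg r M F : 0 < r -> sg * sg = 1 ->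
    (forall x y, `|x - x0| < r -> 0 < sg * (y - y0) < r -> [/\ ctn u x y,
       exists2 v, lap u x y v & `|v| <= F & `|u x y| <= M]) ->
    (forall e, 0 < e -> exists2 d, 0 < d & forall x y, `|x - x0| < r ->
       0 < sg * (y - y0) < d -> 0 < sg * (y - y0) < r -> `|u x y| <= e) ->
  forall y, 0 < sg * (y - y0) < r -> `|u x0 y| <= 3 * (2 * M / r + F * r) * (sg * (y - y0)).
Proof.
move=> r0 sg1 H Hd y yr.
pose w x y := u (1 * y + x0) (sg * x + y0).
have sgE t : sg * (sg * t + y0 - y0) = t by rewrite addrK mulrA sg1 mul1r.
have xE t : 1 * t + x0 - x0 = t by rewrite addrK mul1r.
have := @half_box w r M F r0 _ _ (sg * (y - y0)) yr.
rewrite /w mul1r [0 + x0]add0r mulrA sg1 mul1r subrK; apply.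
  move=> a b a0 b0.
  have [c1 [v [a1 [b1 [da1 db1 E1]]] V1] M1] := H (1 * b + x0) (sg * a + y0)
     ltac:(by rewrite xE ltr_norml) ltac:(by rewrite sgE).
  split => //; first by have := ctn_swap (@ctn_affine u 1 x0 sg y0 b a c1).
  have := lap_swap (@lap_affine _ u 1 x0 sg y0 b a a1 b1 da1 db1).
  by rewrite !mul1r mulrA sg1 mul1r -E1 => ?; exists v.
move=> e e0; have [d d0 ud] := Hd e e0.
exists [set p : R * R | d <= p.1 <= r * (9 / 10) /\ - (r * (9 / 10)) <= p.2 <= r * (9 / 10)]; split.
- exact: compact_box.
- by move=> a b [/= ? ?]; qlra.
- move=> a b a0; rewrite ler_norml => b0 nK; apply: ud; rewrite ?sgE; last by qlra.
    by rewrite xE ltr_norml; qlra.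
  by apply/andP; split; [qlra|rewrite ltNge; apply/negP => da; apply: nK; split => /=; qlra].
Qed.

End GradientBounds.

(** * Jets and strips *)

Section TrigBounds.
Context {R : realType}.
Implicit Types (x y a b c t : R).

Lemma norm_sin_le x : `|sin x| <= `|x|.
Proof.
have := @mvt_le R (@sin R) (@cos R) 1 0 x; rewrite sin0 !subr0 mul1r; apply.
by move=> t _; split; [exact: is_derive_sin|rewrite ler_norml cos_geN1 cos_le1].
Qed.

Lemma sin_le_dist c t d : 0 <= c <= 4 -> 0 < t < d -> `|sin (c * t)| <= 4 * d.
Proof.
move=> /andP[c0 c4] /andP[t0 td]; apply: le_trans (norm_sin_le _) _.
by rewrite ger0_norm ?ler_pM// ?mulr_ge0// ltW.
Qed.

Lemma cos_ge_quad x : 1 - x ^+ 2 / 2 <= cos x.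
Proof.
have := cos_mulr2n (x / 2); rewrite (_ : (x / 2) *+ 2 = x); last by rewrite mulr2n; lra.
move=> ->; have := cos2Dsin2 (x / 2); have := norm_sin_le (x / 2).
move=> sx; have : `|sin (x / 2)| ^+ 2 <= `|x / 2| ^+ 2 by rewrite lerXn2r ?nnegrE.
by rewrite !real_normK ?num_real// (mulr2n (cos _ ^+ 2)); lra.
Qed.

Lemma sin_ge_lin x : 0 <= x <= pi / 2 -> x / 4 <= sin x.
Proof.
move=> /andP[x0 xpi]; have pi4 : pi < 4 :> R by have := @pihalf_lt2 R; lra.
have [x1|x1] := leP x 1.
  have [->|xn0] := eqVneq x 0; first by rewrite sin0 mul0r.
  have [c /andP[c0 cx]] := @mvt R (@sin R) (@cos R) 0 x ltac:(by rewrite lt_def xn0).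
  rewrite sin0 !subr0 => ->; have := cos_ge_quad c; nra.
have s1 : sin 1 <= sin x by apply: sin_ge_mid => //; lra.
suff : 1 / 2 <= sin (1 : R) by lra.
have [c /andP[c0 cx]] := @mvt R (@sin R) (@cos R) 0 1 ltr01.
rewrite sin0 !subr0 mulr1 => ->; have := cos_ge_quad c; nra.
Qed.

Lemma pi_bounds : 2 <= (pi : R) < 4.
Proof. by have := @pihalf_lt2 R; have := @pi_ge2 R; lra. Qed.

Lemma sinpi_gt0 y : 0 < y < 1 -> 0 < sin (pi * y).
Proof. by move=> y01; apply: sin_gt0_pi; have := pi_bounds; nra. Qed.

Lemma sinpiB y : sin (pi * (1 - y)) = sin (pi * y).
Proof. by rewrite mulrBr mulr1 sinB sinpi cospi mul0r mulN1r sub0r opprK. Qed.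

Lemma sinpi_lb y : 0 < y < 1 -> y <= 1 / 2 -> y / 2 <= sin (pi * y).
Proof.
move=> y01 y2; have pib := pi_bounds.
by have := @sin_ge_lin (pi * y) ltac:(nra); nra.
Qed.

Lemma le_sinpi y B c : 0 < y < 1 -> 0 <= B -> c <= B * y -> c <= B * (1 - y) ->
  c <= 2 * B * sin (pi * y).
Proof.
move=> y01 B0 cy cy'; have [y2|y2] := leP y (1 / 2).
  by have := sinpi_lb y01 y2; nra.
by have := @sinpi_lb (1 - y) ltac:(lra) ltac:(lra); rewrite sinpiB; nra.
Qed.

(* The n-th derivative of sin (c t + b). *)
Definition sinj c b n (t : R) := c ^+ n * sin (c * t + b + n%:R * (pi / 2)).

Lemma is_derive_sinj c b n t : is_derive t 1 (sinj c b n) (sinj c b n.+1 t).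
Proof.
have ds : is_derive (c * t + (b + n%:R * (pi / 2))) 1 (@sin R)
    (cos (c * t + (b + n%:R * (pi / 2)))) by exact: is_derive_sin.
have := is_derive_affine ds => da.
have := @is_deriveZ _ _ _ _ (c ^+ n) t 1 _ da.
have E : sinj c b n.+1 t = c ^+ n *: (c * cos (c * t + (b + n%:R * (pi / 2)))).
  by rewrite /sinj -natr1 (mulrDl _ _ (pi / 2)) mul1r !addrA sinDpihalf exprSr -mulrA.
by move=> H; rewrite E /sinj; under eq_fun do rewrite -addrA.
Qed.

End TrigBounds.

(* F i j stands for the derivative d_x^i d_y^j of F 0 0. *)
Definition jets {R : realType} (O : set (R * R)) (F : nat -> nat -> R -> R -> R) :=
  forall i j x y, O (x, y) -> [/\ ctn (F i j) x y,
    is_derive x 1 ((F i j)^~ y) (F i.+1 j x y) & is_derive y 1 (F i j x) (F i j.+1 x y)].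

Section Jets.
Context {R : realType}.
Implicit Types (O : set (R * R)) (F G : nat -> nat -> R -> R -> R) (x y c d lam : R).

Lemma jets_shift O F a b : jets O F -> jets O (fun i j => F (a + i)%N (b + j)%N).
Proof. by move=> JF i j x y Oxy; have := JF (a + i)%N (b + j)%N x y Oxy; rewrite !addnS. Qed.

Lemma jets_sub O O' F : O' `<=` O -> jets O F -> jets O' F.
Proof. by move=> sub JF i j x y /sub; exact: JF. Qed.

Lemma jets_lin O F G c d : jets O F -> jets O G ->
  jets O (fun i j s t => c * F i j s t + d * G i j s t).
Proof.
move=> JF JG i j x y Oxy.
have [cF xF yF] := JF i j x y Oxy; have [cG xG yG] := JG i j x y Oxy; split.
- by apply: ctnD; apply: ctnM => //; exact: ctnC.
- exact: (is_deriveD (is_deriveZ c xF) (is_deriveZ d xG)).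
- exact: (is_deriveD (is_deriveZ c yF) (is_deriveZ d yG)).
Qed.

Lemma jets_prod O (f g : nat -> R -> R) :
    (forall n t, is_derive (t : R) 1 (f n) (f n.+1 t)) ->
    (forall n t, is_derive (t : R) 1 (g n) (g n.+1 t)) ->
  jets O (fun i j s t => f i s * g j t).
Proof.
move=> df dg i j x y _.
have df2 n t : d2 (f n) t (f n.+2 t) by apply: (@d2_ext _ _ (f n.+1)).
have dg2 n t : d2 (g n) t (g n.+2 t) by apply: (@d2_ext _ _ (g n.+1)).
split; first exact: ctnM1 (df2 i x) (dg2 j y).
  rewrite mulrC; have := is_deriveZ (g j y) (df i x).
  by rewrite /GRing.scale/=; under eq_fun do rewrite mulrC.
exact: (is_deriveZ (f i x) (dg j y)).
Qed.

Lemma jets_lap O F i j x y : open O -> jets O F -> O (x, y) ->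
  lap (F i j) x y (F i.+2 j x y + F i j.+2 x y).
Proof.
move=> oO JF Oxy; have [Ox Oy] := open_lines oO Oxy.
exists (F i.+2 j x y), (F i j.+2 x y); split => //.
- exists ((F i.+1 j)^~ y); split; last by have [] := JF i.+1 j x y Oxy.
  by apply: filterS Ox => s Os; have [] := JF i j s y Os.
- exists (F i j.+1 x); split; last by have [] := JF i j.+1 x y Oxy.
  by apply: filterS Oy => s Os; have [] := JF i j x s Os.
Qed.

Lemma jets0 O F : open O -> jets O F -> (forall x y, O (x, y) -> F 0%N 0%N x y = 0) ->
  forall i j x y, O (x, y) -> F i j x y = 0.
Proof.
move=> oO JF F0; have dz (x : R) : is_derive x 1 (fun=> 0 : R) 0 by exact: is_derive_cst.
have step i : forall j x y, O (x, y) -> F 0%N j x y = 0.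
  elim=> [//|j IH] x y Oxy; have [_ Oy] := open_lines oO Oxy; have [_ _ d] := JF 0%N j x y Oxy.
  apply: is_derive_unique d _; apply: near_is_derive (dz y).
  by apply: filterS Oy => t /IH.
elim=> [//|i IH] j x y Oxy; first exact: step.
have [Ox _] := open_lines oO Oxy; have [_ d _] := JF i j x y Oxy.
apply: is_derive_unique d _; apply: near_is_derive (dz x).
by apply: filterS Ox => t /IH.
Qed.

(** The difference of the two sides is again a jet, since the coefficients are constant. Its values
    vanish, hence so do all its derivatives by [jets0]: the equation has been differentiated. *)
Lemma jets_eq O F G lam d : open O -> jets O F -> jets O G ->
    (forall x y, O (x, y) ->
       F 2%N 0%N x y + F 0%N 2%N x y + lam * F 0%N 0%N x y = d * G 0%N 0%N x y) ->
  forall i j x y, O (x, y) ->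
    F i.+2 j x y + F i j.+2 x y + lam * F i j x y = d * G i j x y.
Proof.
move=> oO JF JG H i j x y Oxy.
have J1 := jets_lin 1 1 (jets_shift 2 0 JF) (jets_shift 0 2 JF).
have J2 := jets_lin lam (- d) JF JG.
have := jets0 oO (jets_lin 1 1 J1 J2) _ i j Oxy.
rewrite /= !mul1r mulNr addrA => E; apply/eqP; rewrite -subr_eq0; apply/eqP; apply: E => s t Ost.
by rewrite !mul1r mulNr addrA; apply/eqP; rewrite subr_eq0; apply/eqP; exact: H.
Qed.

End Jets.

Definition rect {R : realType} (a b : R) := [set p : R * R | a < p.1 < b /\ 0 < p.2 < 1].

(** Uniform vanishing at y = 0 and y = 1, expressed with interior points only, so that [u] may be
    arbitrary on the boundary. *)
Definition side0 {R : realType} (a b : R) (u : R -> R -> R) := forall e : R, 0 < e ->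
  exists2 d, 0 < d & forall x y, rect a b (x, y) -> y < d \/ 1 - d < y -> `|u x y| <= e.

(** * Estimates up to the flat sides of a strip *)

Section Strip.
Context {R : realType}.
Variables (a b : R) (u : R -> R -> R) (M K : R).
Hypothesis (uP : forall x y, rect a b (x, y) -> [/\ ctn u x y,
       exists2 v, lap u x y v & `|v| <= K & `|u x y| <= M]).
Hypothesis (u0 : side0 a b u).

Lemma strip_ge0 x y : rect a b (x, y) -> 0 <= M /\ 0 <= K.
Proof.
by move=> /uP[_ [v _ /(le_trans (normr_ge0 _)) K0] /(le_trans (normr_ge0 _)) M0].
Qed.

Lemma strip_flat x y : a + 1 / 2 <= x <= b - 1 / 2 -> 0 < y < 1 ->
  `|u x y| <= 12 * (M + K) * y /\ `|u x y| <= 12 * (M + K) * (1 - y).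
Proof.
move=> xab y01; have xyr : rect a b (x, y) by split => /=; lra.
have [M0 K0] := strip_ge0 xyr; have [_ _ uM] := uP xyr.
have nx z : `|z - x| < 1 / 2 -> a < z < b by rewrite ltr_norml; lra.
have H sg y0 : sg * sg = 1 -> (forall z, 0 < sg * (z - y0) < 1 / 2 -> 0 < z < 1) ->
   (forall z d, 0 < sg * (z - y0) < d -> z < d \/ 1 - d < z) ->
   0 < sg * (y - y0) -> `|u x y| <= 12 * (M + K) * (sg * (y - y0)).
  move=> sg1 sgz sgd sy; have [y2|y2] := ltP (sg * (y - y0)) (1 / 2); last by nra.
  have := @flat_bound _ u x y0 sg (1 / 2) M K ltac:(lra) sg1 _ _ y ltac:(lra).
  have -> : 3 * (2 * M / (1 / 2) + K * (1 / 2)) = 12 * M + 3 / 2 * K by lra.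
  move=> fb; apply: (le_trans (fb _ _)); last by nra.
    by move=> s t /nx s0 /sgz t0; apply: uP; split.
  move=> e /u0[d d0 ud]; exists d => // s t /nx s0 td /sgz t0.
  by apply: ud; [split|exact: sgd td].
split.
  by have := H 1 0 ltac:(lra) ltac:(move=> ?; lra) ltac:(move=> ? ? ?; left; lra) ltac:(lra); rewrite subr0 mul1r.
have := H (-1) 1 ltac:(lra) ltac:(move=> ?; lra) ltac:(move=> ? ? ?; right; lra) ltac:(lra).
by rewrite mulN1r opprB.
Qed.

Lemma strip_sin x y : a + 1 / 2 <= x <= b - 1 / 2 -> 0 < y < 1 ->
  `|u x y| <= 24 * (M + K) * sin (pi * y).
Proof.
move=> xab y01; have [M0 K0] : 0 <= M /\ 0 <= K by apply: (@strip_ge0 x y); split => /=; lra.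
have [h1 h2] := strip_flat xab y01.
by have := le_sinpi y01 _ h1 h2; rewrite (_ : 2 * (12 * _) = 24 * (M + K)); [apply|]; nra.
Qed.

(** With r half the distance to the nearer side, [strip_flat] makes [u] itself of size r on the box
    of radius r. The term M / r of [grad_bound] then stays bounded up to the sides, which is what
    [strip_grad] needs. *)
Lemma strip_box x y : a + 1 <= x <= b - 1 -> 0 < y < 1 ->
  exists2 r : R, 0 < r <= 1 / 4 & 
   (forall s t, `|s - x| < r -> `|t - y| < r -> rect a b (s, t) /\ `|u s t| <= 36 * (M + K) * r).
Proof.
move=> xab y01; have [M0 K0] : 0 <= M /\ 0 <= K by apply: (@strip_ge0 x y); split => /=; lra.
exists (Num.min y (1 - y) / 2); first by have [] := leP y (1 - y); lra.
move=> s t; rewrite !ltr_norml => sx ty.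
have t01 : 0 < t < 1 by move: ty; have [] := leP y (1 - y); lra.
have sab : a + 1 / 2 <= s <= b - 1 / 2 by move: sx; have [] := leP y (1 - y); lra.
have [h1 h2] := strip_flat sab t01; split; first by split => /=; lra.
move: ty; have [yy|yy] := leP y (1 - y) => ty.
  by apply: le_trans h1 _; have ? : t <= 3 * (y / 2) := ltac:(lra); nra.
by apply: le_trans h2 _; have ? : 1 - t <= 3 * ((1 - y) / 2) := ltac:(lra); nra.
Qed.

Lemma strip_grad x y l : a + 1 <= x <= b - 1 -> 0 < y < 1 ->
  is_derive x 1 (u^~ y) l \/ is_derive y 1 (u x) l -> `|l| <= 220 * (M + K).
Proof.
move=> xab y01 dl; have [M0 K0] : 0 <= M /\ 0 <= K by apply: (@strip_ge0 x y); split => /=; lra.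
have [r r0 H] := strip_box xab y01.
have HH s t : `|s - x| < r -> `|t - y| < r -> [/\ ctn u s t,
       exists2 v, lap u s t v & `|v| <= K & `|u s t| <= 36 * (M + K) * r].
  by move=> sx ty; have [/uP[cu lu _] ub] := H s t sx ty.
have : `|l| <= 3 * (2 * (36 * (M + K) * r) / r + K * r).
  case: dl => dl.
    by apply: (@grad_bound _ u x y r _ K _ _ HH dl); lra.
  by apply: (@grad_bound_y _ u x y r _ K _ _ HH dl); lra.
move/le_trans; apply; rewrite mulrA mulfK ?gt_eqF//; [nra|lra].
Qed.

End Strip.

Section Flip.
Context {R : realType}.
Implicit Types (x y N : R) (V : nat -> nat -> R -> R -> R) (O : set (R * R)).

Definition flip N V i j x y : R := (-1) ^+ i * V i j (N - x) y.

Lemma jets_flip N O O' V : (forall x y, O' (x, y) -> O (N - x, y)) -> jets O V ->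
  jets O' (flip N V).
Proof.
move=> sub JV i j x y /sub Oxy; have [c d1 d2] := JV i j _ _ Oxy.
have e1 : -1 * x + N = N - x by ring.
split.
- have := @ctn_affine R (V i j) (-1) N 1 0 x y; rewrite mul1r addr0 e1 => /(_ c) c'.
  apply: (@ctn_eq R (fun s t => (-1) ^+ i * V i j (-1 * s + N) (1 * t + 0))) => [s t|]; last first.
    by apply: ctnM c'; exact: ctnC.
  by rewrite /flip mul1r addr0; congr (_ * V i j _ _); ring.
- have := @is_derive_affine R (V i j ^~ y) (-1) N x (V i.+1 j (N - x) y); rewrite e1 => /(_ d1) d.
  have := @is_deriveZ _ _ _ _ ((-1) ^+ i) _ _ _ d.
  rewrite /flip exprS; under eq_fun do rewrite mulN1r addrC.
  by move=> h; apply: is_derive_eq h _; rewrite /GRing.scale/=; ring.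
- have := @is_deriveZ _ _ _ _ ((-1) ^+ i) _ _ _ d2.
  by rewrite /flip; apply.
Qed.

End Flip.

(** * Decay to the sine profile *)

Section Cotangent.
Context {R : realType}.
Implicit Types (x y t : R).

(** The logarithmic derivative of sin(pi y): the factor pi is included. *)
Definition ctg y := pi * cos (pi * y) / sin (pi * y).

Lemma is_derive_sinpi y : is_derive y 1 (fun t => sin (pi * t)) (pi * cos (pi * y)).
Proof.
have H : is_derive (pi * y + 0) 1 (@sin R) (cos (pi * y + 0)) by exact: is_derive_sin.
have := is_derive_affine H; rewrite addr0; under eq_fun do rewrite addr0.
by [].
Qed.

Lemma is_derive_cospi y : is_derive y 1 (fun t => cos (pi * t)) (- (pi * sin (pi * y))).
Proof.
have H : is_derive (pi * y + 0) 1 (@cos R) (- sin (pi * y + 0)) by exact: is_derive_cos.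
have := is_derive_affine H; rewrite addr0 mulrN; under eq_fun do rewrite addr0.
by [].
Qed.

Lemma is_derive_ctg y : 0 < y < 1 -> is_derive y 1 ctg (- (pi / sin (pi * y)) ^+ 2).
Proof.
move=> y01; have s0 : sin (pi * y) != 0 by rewrite gt_eqF// sinpi_gt0.
have dc := is_deriveZ pi (is_derive_cospi y).
have ds := is_deriveV s0 (is_derive_sinpi y).
apply: is_derive_eq (is_deriveM dc ds) _.
rewrite /GRing.scale/= /GRing.scale/=; have := cos2Dsin2 (pi * y) => /(canRL (addrK _)) c2.
rewrite (_ : _ + _ = - (pi ^+ 2 * (cos (pi * y) ^+ 2 + sin (pi * y) ^+ 2)) / sin (pi * y) ^+ 2).
  by rewrite c2 subrK mulr1; field.
by field.
Qed.

Lemma is_derive_ctg2 y : 0 < y < 1 ->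
  is_derive y 1 (fun t => - (pi / sin (pi * t)) ^+ 2) (2 * (pi / sin (pi * y)) ^+ 2 * ctg y).
Proof.
move=> y01; have s0 : sin (pi * y) != 0 by rewrite gt_eqF// sinpi_gt0.
have dq := is_deriveZ pi (is_deriveV s0 (is_derive_sinpi y)).
have := is_deriveN (is_deriveM dq dq); rewrite /GRing.scale/= => dd.
apply: is_derive_eq dd _; rewrite /GRing.scale/= /ctg; by field.
Qed.

Lemma near01 y : 0 < y < 1 -> \forall t \near y, 0 < t < 1.
Proof. by move=> y01; have := near_in_itvoo y01; apply: filterS => t; rewrite in_itv. Qed.

(** This is sin(pi y) times the y-derivative of F / sin(pi y). On a cross-section it vanishes
    exactly when F is a multiple of sin(pi y) there, so it measures the defect from the first
    transversal mode. *)
Definition zf (F : nat -> nat -> R -> R -> R) x y := F 0%N 1%N x y - ctg y * F 0%N 0%N x y.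

Lemma d2_zf_y O F x y : open O -> jets O F -> O (x, y) -> 0 < y < 1 ->
  is_derive y 1 (zf F x) (F 0%N 2%N x y + (pi / sin (pi * y)) ^+ 2 * F 0%N 0%N x y
      - ctg y * F 0%N 1%N x y) /\
  d2 (zf F x) y (F 0%N 3%N x y - ctg y * F 0%N 2%N x y
      + 2 * (pi / sin (pi * y)) ^+ 2 * zf F x y).
Proof.
move=> oO JF Oxy y01; have [_ Oy] := open_lines oO Oxy.
have st t : O (x, t) -> 0 < t < 1 -> is_derive t 1 (zf F x) (F 0%N 2%N x t
   - (ctg t * F 0%N 1%N x t + F 0%N 0%N x t * (- (pi / sin (pi * t)) ^+ 2))).
  move=> Oxt t01; have [_ _ d0] := JF 0%N 0%N x t Oxt; have [_ _ d1] := JF 0%N 1%N x t Oxt.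
  exact: (is_deriveB d1 (is_deriveM (is_derive_ctg t01) d0)).
split; first by apply: is_derive_eq (st y Oxy y01) _; ring.
exists (fun t => F 0%N 2%N x t
   - (ctg t * F 0%N 1%N x t + F 0%N 0%N x t * (- (pi / sin (pi * t)) ^+ 2))); split.
  by apply: filterS2 Oy (near01 y01) => t; exact: st.
have [_ _ d0] := JF 0%N 0%N x y Oxy; have [_ _ d1] := JF 0%N 1%N x y Oxy.
have [_ _ d2'] := JF 0%N 2%N x y Oxy.
have := is_deriveB d2' (is_deriveD (is_deriveM (is_derive_ctg y01) d1)
  (is_deriveM d0 (is_derive_ctg2 y01))).
move=> dd; apply: is_derive_eq dd _; rewrite /GRing.scale/= /zf; ring.
Qed.

(** A Darboux transformation. With q = (pi / sin(pi y))^2 one has ctg' = - q and ctg'' = 2 q ctg, so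
    commuting d/dy - [ctg] with the Laplacian leaves exactly the multiplication of [zf F] by 2 q. *)
Lemma lap_zf O F x y : open O -> jets O F -> O (x, y) -> 0 < y < 1 ->
  lap (zf F) x y (F 2%N 1%N x y + F 0%N 3%N x y - ctg y * (F 2%N 0%N x y + F 0%N 2%N x y)
      + 2 * (pi / sin (pi * y)) ^+ 2 * zf F x y).
Proof.
move=> oO JF Oxy y01; have [Ox _] := open_lines oO Oxy.
exists (F 2%N 1%N x y - ctg y * F 2%N 0%N x y); eexists; split.
- exists (fun s => F 1%N 1%N s y - ctg y * F 1%N 0%N s y); split.
    apply: filterS Ox => s Os; have [_ d0 _] := JF 0%N 0%N s y Os.
    have [_ d1 _] := JF 0%N 1%N s y Os; exact: (is_deriveB d1 (is_deriveZ (ctg y) d0)).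
  have [_ d0 _] := JF 1%N 0%N x y Oxy; have [_ d1 _] := JF 1%N 1%N x y Oxy.
  exact: (is_deriveB d1 (is_deriveZ (ctg y) d0)).
- exact: (d2_zf_y oO JF Oxy y01).2.
- by ring.
Qed.

Lemma ctn_zf O F x y : jets O F -> O (x, y) -> 0 < y < 1 -> ctn (zf F) x y.
Proof.
move=> JF Oxy y01; have [c0 _ _] := JF 0%N 0%N x y Oxy; have [c1 _ _] := JF 0%N 1%N x y Oxy.
apply: ctnB => //; apply: ctnM => //; apply: ctny; apply: differentiable_continuous.
by apply/derivable1_diffP; exact: (@ex_derive _ _ _ _ _ _ _ (is_derive_ctg y01)).
Qed.

Lemma norm_ctg y B c : 0 < y < 1 -> `|c| <= B * sin (pi * y) -> `|ctg y * c| <= pi * B.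
Proof.
move=> y01 cB; have s0 := sinpi_gt0 y01; have p0 := @pi_gt0 R.
rewrite /ctg !normrM normfV (gtr0_norm s0) (gtr0_norm p0).
have := cos_max (pi * y) => c1; rewrite -!mulrA ler_pM2l//.
rewrite mulrCA mulrC ler_pdivrMr// mulrC; apply: le_trans cB.
by rewrite ler_piMr.
Qed.

End Cotangent.

(* lam = pi^2 + k^2; W solves (lap + lam) W = de V, and V solves (lap + lam') V = 0. *)
Record strip_sol {R : realType} (a b k lam' de M T : R) (W V : nat -> nat -> R -> R -> R) : Prop :=
  StripSol {
  sol_k : 0 <= k <= 1;
  sol_lam' : 0 <= lam' <= 17;
  sol_W : jets (rect a b) W;
  sol_V : jets (rect a b) V;
  sol_eqW : forall x y, rect a b (x, y) ->
    W 2%N 0%N x y + W 0%N 2%N x y + (pi ^+ 2 + k ^+ 2) * W 0%N 0%N x y = de * V 0%N 0%N x y;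
  sol_eqV : forall x y, rect a b (x, y) ->
    V 2%N 0%N x y + V 0%N 2%N x y + lam' * V 0%N 0%N x y = 0;
  sol_M : forall x y, rect a b (x, y) -> `|W 0%N 0%N x y| <= M;
  sol_T : forall x y, rect a b (x, y) -> `|V 0%N 0%N x y| <= T;
  sol_W0 : side0 a b (W 0%N 0%N);
  sol_V0 : side0 a b (V 0%N 0%N) }.

(** * Exponential decay of the transversal defect *)

Section StripEstimates.
Context {R : realType}.
Variables (a b k lam' de M T : R) (W V : nat -> nat -> R -> R -> R).
Hypothesis sol : strip_sol a b k lam' de M T W V.
Hypothesis ab : a < b.
Let lam : R := pi ^+ 2 + k ^+ 2.
Let G := `|de| * T.
Let rO : open (rect a b) := @open_rect R a b 0 1.

Lemma sol_lam : 0 <= lam <= 17.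
Proof. have := sol_k sol; have := @pi_bounds R; rewrite /lam; nra. Qed.

Lemma sol_MT : 0 <= M /\ 0 <= T.
Proof.
have r : rect a b ((a + b) / 2, 1 / 2) by split => /=; move: ab; lra.
by split; [apply: le_trans (sol_M sol r)|apply: le_trans (sol_T sol r)].
Qed.

Lemma sol_G : 0 <= G.
Proof. by rewrite mulr_ge0//; exact: sol_MT.2. Qed.

Lemma stripW x y : rect a b (x, y) -> [/\ ctn (W 0%N 0%N) x y,
  exists2 v, lap (W 0%N 0%N) x y v & `|v| <= 17 * M + G & `|W 0%N 0%N x y| <= M].
Proof.
move=> rxy; split; [by have [] := sol_W sol 0 0 rxy| |exact: (sol_M sol)].
eexists; first exact: jets_lap rO (sol_W sol) rxy.
have := sol_eqW sol rxy => /(canRL (addrK _)) ->; apply: le_trans (ler_normB _ _) _.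
have [M0 _] := sol_MT; have := sol_lam => lam17.
rewrite addrC !normrM lerD ?ler_wpM2l ?(sol_T sol)// -/lam.
rewrite ger0_norm; last by case/andP : lam17.
by apply: ler_pM => //; [case/andP : lam17|case/andP : lam17|exact: (sol_M sol)].
Qed.

Lemma stripV x y : rect a b (x, y) -> [/\ ctn (V 0%N 0%N) x y,
  exists2 v, lap (V 0%N 0%N) x y v & `|v| <= 17 * T & `|V 0%N 0%N x y| <= T].
Proof.
move=> rxy; split; [by have [] := sol_V sol 0 0 rxy| |exact: (sol_T sol)].
eexists; first exact: jets_lap rO (sol_V sol) rxy.
have := sol_eqV sol rxy => /eqP; rewrite addr_eq0 => /eqP ->.
have [l0 l1] := andP (sol_lam' sol); rewrite normrN normrM ger0_norm//.
by apply: ler_pM => //; exact: (sol_T sol).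
Qed.

(** The singular factor [ctg] is harmless: by [strip_sin] the function is O(sin(pi y)) near the
    sides, so the product stays bounded. *)
Lemma zf_bound_of F B K : jets (rect a b) F ->
    (forall x y, rect a b (x, y) -> [/\ ctn (F 0%N 0%N) x y,
      exists2 v, lap (F 0%N 0%N) x y v & `|v| <= K & `|F 0%N 0%N x y| <= B]) ->
    side0 a b (F 0%N 0%N) ->
  forall x y, a + 1 <= x <= b - 1 -> 0 < y < 1 -> `|zf F x y| <= 320 * (B + K).
Proof.
move=> JF FP F0 x y xab y01.
have rxy : rect a b (x, y) by split => /=; lra.
have [_ _ d] := JF 0%N 0%N x y rxy.
have g := strip_grad FP F0 xab y01 (or_intror d).
have s := strip_sin FP F0 (x := x) ltac:(lra) y01.
apply: le_trans (ler_normB _ _) _; have := norm_ctg y01 s.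
have [B0 K0] := strip_ge0 FP rxy; have := @pi_bounds R; nra.
Qed.

Lemma zfW_bound x y : a + 1 <= x <= b - 1 -> 0 < y < 1 -> `|zf W x y| <= (320 * 18) * (M + G).
Proof.
move=> xab y01; have := zf_bound_of (sol_W sol) stripW (sol_W0 sol) xab y01.
have [M0 _] := sol_MT; have := sol_G; lra.
Qed.

Lemma zfV_bound x y : a + 1 <= x <= b - 1 -> 0 < y < 1 -> `|de * zf V x y| <= (320 * 18) * G.
Proof.
move=> xab y01; have := zf_bound_of (sol_V sol) stripV (sol_V0 sol) xab y01.
by rewrite normrM /G; have := normr_ge0 de; nra.
Qed.

(** The potential is at least 2 pi^2 - lam = pi^2 - k^2, a positive constant; the decay of [zf W]
    rests on this positivity. *)
Lemma lap_zfW x y : rect a b (x, y) ->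
  lap (zf W) x y ((2 * (pi / sin (pi * y)) ^+ 2 - lam) * zf W x y + de * zf V x y).
Proof.
move=> rxy; have y01 : 0 < y < 1 by case: rxy.
have := lap_zf rO (sol_W sol) rxy y01; congr (lap _ _ _ _).
have E := jets_eq rO (sol_W sol) (sol_V sol) (sol_eqW sol).
have := E 0%N 0%N x y rxy; have := E 0%N 1%N x y rxy.
rewrite -/lam => /(canRL (addrK _)) -> /(canRL (addrK _)) ->.
by rewrite /zf; ring.
Qed.


Let Kz := (320 * 18) * (M + G).
Let E := (320 * 18) * G.
(** Rate 1 is admissible because the potential is at least 3. The factor 2 makes [barr] at least
    [Kz], the a priori bound on |zf W|, in a layer of width 1/2 at each end, since 2 exp(- 1/2) >=
    1; the constant [E] pays for the source term. *)
Let barr x := 2 * Kz * expR (- (x - (a + 1))) + 2 * Kz * expR (- (b - 1 - x)) + E.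

Lemma d2_expR c d x : d2 (fun t : R => expR (c * t + d)) x (c * (c * expR (c * x + d))).
Proof.
apply: (@d2_affine R expR).
by apply: (@d2_ext _ _ expR) => [t|]; exact: is_derive_expR.
Qed.

Lemma lap_barr x y : lap (fun s _ => barr s) x y (barr x - E).
Proof.
have d1 := d2Z (2 * Kz) (d2_expR (-1) (a + 1) x).
have d3 := d2Z (2 * Kz) (d2_expR 1 (- (b - 1)) x).
have := lap_sum (d2D (d2D d1 d3) (d2C E x)) (d2C 0 y).
rewrite (_ : _ + 0 + 0 = barr x - E); last first.
  rewrite (_ : -1 * x + (a + 1) = - (x - (a + 1))); last by ring.
  by rewrite (_ : 1 * x - (b - 1) = - (b - 1 - x)); rewrite /barr; ring.
congr (lap _ _ _ _); apply: funext => s; apply: funext => t.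
by rewrite /barr addr0 mul1r mulN1r !opprB (addrC (- s)).
Qed.

(** Near y = 0 and y = 1 the function [zf W] is known to be bounded, but no boundary value is
    available. A supersolution tending to infinity there replaces it: a bounded function is at least
    - e [lnpsi] close to the sides. *)
Definition lnpsi y : R := 2 - ln (sin (pi * y)).

Lemma d2_lnpsi y : 0 < y < 1 -> d2 lnpsi y ((pi / sin (pi * y)) ^+ 2).
Proof.
move=> y01; exists (fun t => - ctg t); split.
  apply: filterS (near01 y01) => t t01; have s0 := sinpi_gt0 t01.
  have dl : is_derive t 1 (fun t => ln (sin (pi * t))) ((sin (pi * t))^-1 * (pi * cos (pi * t))).
    exact: (@is_derive1_comp R (@ln R) (fun t => sin (pi * t)) t _ _ (is_derive1_ln s0) (is_derive_sinpi t)).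
  apply: is_derive_eq (is_deriveB (is_derive_cst (2 : R) t 1) dl) _.
  by rewrite /ctg sub0r mulrC.
by apply: is_derive_eq (is_deriveN (is_derive_ctg y01)) _; rewrite opprK.
Qed.

Lemma lnpsi_ge2 y : 0 < y < 1 -> 2 <= lnpsi y.
Proof. by move=> y01; rewrite /lnpsi lerDl oppr_ge0 ln_le0// sin_le1. Qed.

Lemma lnpsi_big c : exists2 d, 0 < d & forall y, 0 < y < 1 -> y < d \/ 1 - d < y -> c <= lnpsi y.
Proof.
have side y : 0 < y < 1 -> y < expR (- c) / 4 -> c <= lnpsi y.
  move=> y01 yc; have s0 := sinpi_gt0 y01.
  have : ln (sin (pi * y)) <= - c.
    rewrite -[leRHS]expRK ler_ln ?posrE ?expR_gt0//.
    have := norm_sin_le (pi * y); have pib := @pi_bounds R; have := expR_gt0 (- c) => ec.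
    by rewrite (gtr0_norm s0) gtr0_norm; nra.
  by rewrite /lnpsi; lra.
exists (expR (- c) / 4); first by rewrite divr_gt0// expR_gt0.
move=> y y01 [yc|yc]; first exact: side.
have := side (1 - y); rewrite /lnpsi sinpiB; apply; lra.
Qed.

Lemma zfW_decay1 sg x y : sg = 1 \/ sg = -1 -> a + 1 < x < b - 1 -> 0 < y < 1 -> 
  0 <= barr x - sg * zf W x y.
Proof.
move=> sgE xab y01; have [M0 T0] := sol_MT; have G0 := sol_G; have pib := @pi_bounds R.
have Kz0 : 0 <= Kz by rewrite /Kz; nra.
have E0 : 0 <= E by rewrite /E; nra.
have sub : rect (a + 1) (b - 1) `<=` rect a b by move=> -[s t] [/= ? ?]; split => /=; lra.
have sgn c : `|sg * c| = `|c| by case: sgE => ->; rewrite ?mul1r// mulN1r normrN.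
have zb s t : rect (a + 1) (b - 1) (s, t) -> `|sg * zf W s t| <= Kz.
  by move=> [/= s0 t0]; rewrite sgn; apply: zfW_bound => //; lra.
have b0 s : E <= barr s.
  by rewrite /barr lerDr addr_ge0// mulr_ge0 ?expR_ge0//; lra.
apply: (@maximum_principle R (rect (a + 1) (b - 1)) (fun s t => barr s - sg * zf W s t)
  (fun _ t => lnpsi t) (fun _ t => lam - 2 * (pi / sin (pi * t)) ^+ 2)) => //.
- exact: open_rect.
- move=> s t rst; have /= t01 := rst.2; split.
    apply: ctnB.
      have [a1 [b1 [/d2_cvg dd _ _]]] := lap_barr s t; exact: ctnx.
    apply: ctnM; [exact: ctnC|exact: ctn_zf (sol_W sol) (sub _ rst) t01].
  by apply: ctny; exact: d2_cvg (d2_lnpsi t01).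
- move=> s t [/= s0 t0]; have l2 := lnpsi_ge2 t0; split; first by lra.
  exists (0 + (pi / sin (pi * t)) ^+ 2).
    have := lap_sum (d2C 0 s) (d2_lnpsi t0).
    by congr (lap _ _ _ _); apply: funext => ?; apply: funext => ?; rewrite add0r.
  have s1 := sinpi_gt0 t0; have s2 := sin_le1 (pi * t).
  have q1 : pi ^+ 2 <= (pi / sin (pi * t)) ^+ 2.
    by rewrite expr_div_n ler_pdivlMr ?exprn_gt0// ler_piMr ?sqr_ge0// expr_le1// ltW.
  have := sol_k sol; move: q1; set q := (_ / _) ^+ 2; rewrite /lam => q1 k1.
  have : lam - 2 * q <= - 3 / 4 * q by rewrite /lam; nra.
  by rewrite /lam; nra.
- move=> s t rst; exists (barr s - E - sg * ((2 * (pi / sin (pi * t)) ^+ 2 - lam) * zf W s t + de * zf V s t)).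
    by apply: lapB (lap_barr s t) _; apply: lapZ; exact: lap_zfW (sub _ rst).
  move=> _; have [/= s0 t0] := rst; have s1 := sinpi_gt0 t0; have s2 := sin_le1 (pi * t).
  have q1 : pi ^+ 2 <= (pi / sin (pi * t)) ^+ 2.
    by rewrite expr_div_n ler_pdivlMr ?exprn_gt0// ler_piMr ?sqr_ge0// expr_le1// ltW.
  have : `|sg * (de * zf V s t)| <= E by rewrite sgn; apply: zfV_bound => //; lra.
  rewrite ler_norml => /andP[v1 v2]; have := b0 s; have := sol_k sol.
  move: q1; set q := (_ / _) ^+ 2 => q1 k1 bE.
  rewrite [leLHS](_ : _ = (1 + lam - 2 * q) * (barr s - E) + (lam - 2 * q) * E - sg * (de * zf V s t)); last by ring.
  have : lam - 2 * q <= - 3 by rewrite /lam; nra.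
  nra.
- move=> e e0; have [d d0 dl] := lnpsi_big (Kz / e).
  exists [set p | a + 1 + 1 / 2 <= p.1 <= b - 1 - 1 / 2 /\ d / 2 <= p.2 <= 1 - d / 2]; split.
  + exact: compact_box.
  + by move=> -[s t] [/= ? ?]; split => /=; lra.
  + move=> s t rst nK; have [/= s0 t0] := rst; have l2 := lnpsi_ge2 t0.
    have := zb _ _ rst; rewrite ler_norml => /andP[z1 z2].
    have [td|td] := pselect (t < d \/ 1 - d < t).
      have := dl t t0 td; rewrite ler_pdivrMr// => ?; have := b0 s; nra.
    have ex c : c <= 1 / 2 -> Kz <= 2 * Kz * expR (- c).
      by move=> c2; have := expR_ge1Dx (- c); nra.
    have ge0 c : 0 <= 2 * Kz * expR (- c) by rewrite mulr_ge0 ?expR_ge0//; lra.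
    suff : Kz <= barr s by nra.
    have [sa|sa] := leP s (a + 1 + 1 / 2).
      by have := ex (s - (a + 1)) ltac:(lra); have := ge0 (b - 1 - s); rewrite /barr; lra.
    have [sb|sb] := leP (b - 1 - 1 / 2) s.
      by have := ex (b - 1 - s) ltac:(lra); have := ge0 (s - (a + 1)); rewrite /barr; lra.
    exfalso; apply: nK; split => /=; first by lra.
    apply/andP; split; rewrite leNgt; apply/negP => ?; apply: td; [left|right]; lra.
Qed.

Lemma zfW_decay x y : a + 1 < x < b - 1 -> 0 < y < 1 -> `|zf W x y| <= barr x.
Proof.
move=> xab y01; have := zfW_decay1 (or_introl erefl) xab y01.
have := zfW_decay1 (or_intror erefl) xab y01; rewrite ler_norml; lra.
Qed.

End StripEstimates.

(** * Comparison with a source term, and a perturbed oscillator equation *)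

Section Ode.
Context {R : realType}.
Implicit Types (x y t k N X L M G Q c d e lam al be s eta : R) (O : set (R * R)) (w : R -> R -> R).

Lemma d2_sin_affine c d x : d2 (fun t => sin (c * t + d)) x (- (c ^+ 2 * sin (c * x + d))).
Proof.
have := @d2_affine _ (@sin R) c d x _ (d2_sin _).
by rewrite (_ : c * (c * - _) = - (c ^+ 2 * sin (c * x + d))); last by ring.
Qed.

Lemma is_derive_sinB k N x : is_derive x 1 (fun t => sin (k * (N - t))) (- k * cos (k * (N - x))).
Proof.
have H : is_derive (- k * x + k * N) 1 (@sin R) (cos (- k * x + k * N)) by exact: is_derive_sin.
have := is_derive_affine H.
have E t : - k * t + k * N = k * (N - t) by ring.
by rewrite E; under eq_fun do rewrite E.
Qed.

Lemma is_derive_cosB k N x : is_derive x 1 (fun t => cos (k * (N - t))) (k * sin (k * (N - x))).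
Proof.
have H : is_derive (- k * x + k * N) 1 (@cos R) (- sin (- k * x + k * N)) by exact: is_derive_cos.
have := is_derive_affine H.
have E t : - k * t + k * N = k * (N - t) by ring.
by rewrite E; under eq_fun do rewrite E; rewrite mulrNN.
Qed.

(** Compare with a multiple T of the product f g of a sine and a cosine. Since f g is at least
    sin(eta) cos(be / 2), the chosen T makes T f g dominate the boundary size [tau] plus the source
    [G] divided by the gap al^2 + be^2 - lam. *)
Lemma max_princ_src O w al be s t lam eta tau G :
    open O -> (forall x y, O (x, y) -> ctn w x y) ->
    0 < eta -> eta <= pi / 2 -> 0 < be < pi -> s ^+ 2 = 1 -> lam < al ^+ 2 + be ^+ 2 ->
    (forall x y, O (x, y) -> 0 < y < 1 /\ eta <= al * (s * x + t) <= pi - eta) ->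
    (forall x y, O (x, y) -> exists2 v, lap w x y v & `|v + lam * w x y| <= G) ->
    0 <= tau -> 0 <= G ->
    (forall e : R, 0 < e -> exists K, [/\ compact K, K `<=` O &
       forall x y, O (x, y) -> ~ K (x, y) -> `|w x y| <= tau + e]) ->
  forall x y, O (x, y) ->
    `|w x y| <= (tau + G / (al ^+ 2 + be ^+ 2 - lam)) / (sin eta * cos (be / 2)).
Proof.
move=> oO cw eta0 etapi be0 s1 lam0 OI lw tau0 G0 HK x0 y0 O0.
pose f x := sin (al * s * x + al * t); pose g y := cos (be * y + - (be / 2)).
have df x : d2 f x (al * s * (al * s * - sin (al * s * x + al * t))).
  exact: (@d2_affine _ sin) (d2_sin _).
have dg y : d2 g y (be * (be * - cos (be * y + - (be / 2)))).
  exact: (@d2_affine _ cos) (d2_cos _).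
have seta : 0 < sin eta by apply: sin_gt0_pi; have := @pi_gt0 R; lra.
have cbe : 0 < cos (be / 2) by apply: cos_gt0_pihalf; have := @pi_gt0 R; lra.
have flb x y : O (x, y) -> sin eta <= f x.
  by move=> /OI[_ ?]; apply: sin_ge_mid; [exact: ltW|rewrite -mulrA -mulrDr].
have glb x y : O (x, y) -> cos (be / 2) <= g y.
  move=> /OI[/andP[? ?] _]; apply: cos_ge_mid; first by lra.
  by rewrite ler_norml; nra.
have plb x y : O (x, y) -> sin eta * cos (be / 2) <= f x * g y.
  by move=> Oxy; apply: ler_pM; [exact: ltW|exact: ltW|exact: flb Oxy|exact: glb Oxy].
set c0 := sin eta * cos (be / 2); have c00 : 0 < c0 by exact: mulr_gt0.
set D := al ^+ 2 + be ^+ 2 - lam; have D0 : 0 < D by rewrite /D; lra.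
set T := (tau + G / D) / c0.
have T0 : 0 <= T.
  by apply: divr_ge0; [apply: addr_ge0 => //; apply: divr_ge0; last exact: ltW|exact: ltW].
have Tc x y : O (x, y) -> tau + G / D <= T * (f x * g y).
  by move=> Oxy; rewrite /T mulrAC ler_pdivlMr// ler_wpM2l ?addr_ge0 ?divr_ge0 ?(ltW D0)//; exact: plb.
have side sg : sg = 1 \/ sg = -1 -> forall x y, O (x, y) -> 0 <= T * (f x * g y) - sg * w x y.
  move=> sgE; apply: (@max_princ_sin _ O _ al be s t lam eta) => //.
  - move=> x y Oxy; apply: ctnB; apply: ctnM; try exact: ctnC; last exact: cw.
    exact: ctnM1.
  - move=> x y Oxy; have [v lv vG] := lw _ _ Oxy.
    exists (T * (al * s * (al * s * - sin (al * s * x + al * t)) * g y +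
       f x * (be * (be * - cos (be * y + - (be / 2))))) - sg * v).
      by apply: lapB; apply: lapZ => //; exact: lapM1.
    move=> _; rewrite -/(f x) -/(g y).
    rewrite [leLHS](_ : _ = - (al ^+ 2 * s ^+ 2 + be ^+ 2 - lam) * (T * (f x * g y))
      - sg * (v + lam * w x y)); last by ring.
    rewrite s1 mulr1 -/D; have := Tc _ _ Oxy; rewrite -(ler_pM2l D0).
    rewrite mulrDr mulrCA divff ?mulr1 ?gt_eqF//.
    have : - (sg * (v + lam * w x y)) <= G.
      move: vG; rewrite ler_norml; case: sgE => ->; lra.
    have : 0 <= D * tau by rewrite mulr_ge0// ltW.
    lra.
  - move=> e e0; have [K [cK KO Kw]] := HK e e0; exists K; split => // x y Oxy nK.
    have := Kw _ _ Oxy nK; have := Tc _ _ Oxy.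
    have : 0 <= G / D by rewrite divr_ge0// ltW.
    by rewrite ler_norml; case: sgE => ->; lra.
have p1 := side 1 (or_introl erefl) x0 y0 O0; have p2 := side (-1) (or_intror erefl) x0 y0 O0.
have fg1 : T * (f x0 * g y0) <= T.
  rewrite ler_piMr//; apply: le_trans (ler_norm _) _; rewrite normrM.
  by rewrite -[leRHS]mulr1; apply: ler_pM => //; [exact: sin_max|exact: cos_max].
by rewrite ler_norml; lra.
Qed.

(** Variation of constants: p and q below are constant along exact solutions, hence change by at
    most N e. The solution is matched exactly at N - X and within T at N - X / 2; these two
    conditions determine (p, q) with determinant sin(k X / 2). *)
Lemma ode_close (a a1 a2 : R -> R) k N X e T lo hi : 0 < k -> 0 < X -> k * X <= pi / 4 ->
    (forall x, lo <= x <= hi -> [/\ is_derive x 1 a (a1 x), is_derive x 1 a1 (a2 x) &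
       `|a2 x + k ^+ 2 * a x| <= e]) ->
    lo <= N - X -> N - X / 2 <= hi -> hi - lo <= N ->
    let A := a (N - X) / sin (k * X) in
    `|a (N - X / 2) - A * sin (k * (X / 2))| <= T ->
  forall x, lo <= x <= hi ->
    k * `|a x - A * sin (k * (N - x))| <= 2 * ((k * T + 2 * (N * e)) / sin (k * (X / 2)) + N * e).
Proof.
move=> k0 X0 kX H lo1 hi2 hilo A HT x xI; have pib := @pi_bounds R.
have kX2 : 0 < k * (X / 2) by rewrite mulr_gt0// divr_gt0.
have kXE : k * X = k * (X / 2) + k * (X / 2) by lra.
have sX : 0 < sin (k * X) by apply: sin_gt0_pi; rewrite kXE; lra.
have sX2 : 0 < sin (k * (X / 2)) by apply: sin_gt0_pi; lra.
pose S x := sin (k * (N - x)); pose C x := cos (k * (N - x)).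
(* The term k A in [q] centres the pair: both p and q vanish when a(x) = A sin(k (N - x)). *)
pose p x := a1 x * S x + k * (a x * C x); pose q x := a1 x * C x - k * (a x * S x) + k * A.
have e0 : 0 <= e by have [] := H x xI => _ _; apply: le_trans.
have dp z : lo <= z <= hi -> is_derive z 1 p ((a2 z + k ^+ 2 * a z) * S z).
  move=> /H[d1 d2 _]; apply: is_derive_eq (is_deriveD (is_deriveM d2 (is_derive_sinB k N z))
     (is_deriveZ k (is_deriveM d1 (is_derive_cosB k N z)))) _.
  by rewrite /GRing.scale/= /S; ring.
have dq z : lo <= z <= hi -> is_derive z 1 q ((a2 z + k ^+ 2 * a z) * C z).
  move=> /H[d1 d2 _]; apply: is_derive_eq (is_deriveD (is_deriveB (is_deriveM d2 (is_derive_cosB k N z))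
     (is_deriveZ k (is_deriveM d1 (is_derive_sinB k N z)))) (is_derive_cst (k * A) z 1)) _.
  by rewrite /GRing.scale/= /C; ring.
have vary (f f1 : R -> R) z z' : (forall z, lo <= z <= hi -> is_derive z 1 f (f1 z)) ->
    (forall z, lo <= z <= hi -> `|f1 z| <= e) -> lo <= z <= hi -> lo <= z' <= hi ->
    `|f z' - f z| <= N * e.
  move=> df f1e zI z'I; apply: (@le_trans _ _ (e * `|z' - z|)).
    apply: (@mvt_le _ _ f1) => u uI.
    have uI' : lo <= u <= hi by move: uI; have [] := leP z z'; lra.
    by split; [exact: df|exact: f1e].
  by rewrite mulrC ler_wpM2r// ler_norml; lra.
have pe z : lo <= z <= hi -> `|(a2 z + k ^+ 2 * a z) * S z| <= e.
  by move=> /H[_ _ ze]; rewrite normrM -[e]mulr1 ler_pM//; exact: sin_max.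
have qe z : lo <= z <= hi -> `|(a2 z + k ^+ 2 * a z) * C z| <= e.
  by move=> /H[_ _ ze]; rewrite normrM -[e]mulr1 ler_pM//; exact: cos_max.
have cs z : p z * C z - q z * S z = k * (a z - A * S z).
  rewrite [LHS](_ : _ = k * a z * (C z ^+ 2 + S z ^+ 2) - k * A * S z); last by rewrite /p /q; ring.
  by rewrite cos2Dsin2; ring.
pose x1 := N - X; pose x2 := N - X / 2.
have x1I : lo <= x1 <= hi by rewrite /x1; move: lo1 hi2; lra.
have x2I : lo <= x2 <= hi by rewrite /x2; move: lo1 hi2; lra.
have E1 : p x1 * C x1 - q x1 * S x1 = 0.
  by rewrite cs /A /x1 /S (_ : N - (N - X) = X) ?divfK ?gt_eqF ?subrr ?mulr0//; lra.
have E2 : `|p x2 * C x2 - q x2 * S x2| <= k * T.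
  rewrite cs normrM gtr0_norm//; apply: ler_wpM2l; first exact: ltW.
  by rewrite /S /x2 (_ : N - (N - X / 2) = X / 2); last lra.
have S1E : S x1 = sin (k * (X / 2) + k * (X / 2)) by rewrite /S /x1 -kXE; congr (sin (k * _)); lra.
have C1E : C x1 = cos (k * (X / 2) + k * (X / 2)) by rewrite /C /x1 -kXE; congr (cos (k * _)); lra.
have S2E : S x2 = sin (k * (X / 2)) by rewrite /S /x2; congr (sin (k * _)); lra.
have C2E : C x2 = cos (k * (X / 2)) by rewrite /C /x2; congr (cos (k * _)); lra.
have E3 : `|p x1 * C x2 - q x1 * S x2| <= k * T + 2 * (N * e).
  rewrite (_ : p x1 * C x2 - q x1 * S x2 = (p x2 * C x2 - q x2 * S x2) -
     ((p x2 - p x1) * C x2 - (q x2 - q x1) * S x2)); last by ring.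
  apply: le_trans (ler_normB _ _) _; rewrite lerD//.
  apply: le_trans (ler_normB _ _) _; rewrite !normrM mulr_natl mulr2n lerD//.
    by rewrite -[leRHS]mulr1 ler_pM ?cos_max//; exact: vary dp pe x1I x2I.
  by rewrite -[leRHS]mulr1 ler_pM ?sin_max//; exact: vary dq qe x1I x2I.
set B := k * T + 2 * (N * e) in E3 *.
have c2s2 := cos2Dsin2 (k * (X / 2)).
have tr : C x2 * S x1 - C x1 * S x2 = sin (k * (X / 2)).
  rewrite S1E C1E S2E C2E sinD cosD.
  rewrite [LHS](_ : _ = sin (k * (X / 2)) * (cos (k * (X / 2)) ^+ 2 + sin (k * (X / 2)) ^+ 2)).
    by rewrite c2s2 mulr1.
  by ring.
have q1 : `|q x1| <= B / sin (k * (X / 2)).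
  rewrite ler_pdivlMr// -[X in _ * X <= _](gtr0_norm sX2) -normrM -tr.
  rewrite [X in `|X|](_ : _ = C x1 * (p x1 * C x2 - q x1 * S x2)
     - C x2 * (p x1 * C x1 - q x1 * S x1)); last by ring.
  by rewrite E1 mulr0 subr0 normrM -[leRHS]mul1r ler_pM ?cos_max.
have p1 : `|p x1| <= B / sin (k * (X / 2)).
  rewrite ler_pdivlMr// -[X in _ * X <= _](gtr0_norm sX2) -normrM -tr.
  rewrite [X in `|X|](_ : _ = S x1 * (p x1 * C x2 - q x1 * S x2)
     - S x2 * (p x1 * C x1 - q x1 * S x1)); last by ring.
  by rewrite E1 mulr0 subr0 normrM -[leRHS]mul1r ler_pM ?sin_max.
have bd (f f1 : R -> R) : (forall z, lo <= z <= hi -> is_derive z 1 f (f1 z)) ->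
    (forall z, lo <= z <= hi -> `|f1 z| <= e) -> `|f x1| <= B / sin (k * (X / 2)) ->
    `|f x| <= B / sin (k * (X / 2)) + N * e.
  move=> df f1e fx1; rewrite -(subrK (f x1) (f x)) addrC.
  by apply: le_trans (ler_normD _ _) _; rewrite lerD//; exact: vary df f1e x1I xI.
rewrite -[X in X * _](gtr0_norm k0) -normrM -cs; apply: le_trans (ler_normB _ _) _.
rewrite !normrM mulr_natl mulr2n; apply: lerD; rewrite -[leRHS]mulr1; apply: ler_pM => //.
- exact: bd dp pe p1.
- exact: cos_max.
- exact: bd dq qe q1.
- exact: sin_max.
Qed.

End Ode.

(** * Asymptotics in the middle of the strip and at its right end *)

Section StripMiddle.
Context {R : realType}.
Implicit Types (x y t : R).
Variables (a b k lam' de M T L : R) (W V : nat -> nat -> R -> R -> R).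
Hypothesis sol : strip_sol a b k lam' de M T W V.
Hypothesis ab : a < b.
Hypothesis L1 : 1 <= L.
Let G := `|de| * T.
Let Q := M * expR (- L) + G.
Let tau := (5 * (320 * 18)) * Q.
Let rO : open (rect a b) := @open_rect R a b 0 1.

Let Qpos : [/\ 0 <= M, 0 <= G, 0 <= M * expR (- L) & 0 <= Q].
Proof.
have [M0 _] := sol_MT sol ab; have G0 := sol_G sol ab.
have e0 : 0 <= M * expR (- L) by rewrite mulr_ge0 ?expR_ge0.
by split => //; rewrite addr_ge0.
Qed.

Lemma zf_mid x y : a + 1 + L <= x <= b - 1 - L -> 0 < y < 1 -> `|zf W x y| <= tau.
Proof.
move=> xab y01; have [M0 G0 e0 Q0] := Qpos; have L1' := L1.
have xab' : a + 1 < x < b - 1 by move: L1; lra.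
have := zfW_decay sol ab xab' y01; rewrite -/G => zb; apply: le_trans zb _.
have ex c : L <= c -> 2 * ((320 * 18) * (M + G)) * expR (- c) <= (2 * (320 * 18)) * (M * expR (- L) + G).
  move=> Lc; have : expR (- c) <= expR (- L) by rewrite ler_expR lerN2.
  have : expR (- L) <= 1 by rewrite expR_le1 oppr_le0; lra.
  have := expR_ge0 (- c); nra.
have := ex (x - (a + 1)) ltac:(lra); have := ex (b - 1 - x) ltac:(lra).
have GQ : G <= Q by rewrite /Q; lra.
by rewrite -/Q /tau; lra.
Qed.

(** The y-derivative of W / sin(pi y) is zf W / sin(pi y); apply the mean value bound from y = 1/2.
    Between 1/2 and y the sine is at least sin(pi y), so the final multiplication by sin(pi y)
    cancels the denominator. *)
Lemma profile_mid x y : a + 1 + L <= x <= b - 1 - L -> 0 < y < 1 ->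
  `|W 0%N 0%N x y - W 0%N 0%N x (1 / 2) * sin (pi * y)| <= tau.
Proof.
move=> xab y01; have s0 := sinpi_gt0 y01; have pib := @pi_bounds R; have L1' := L1.
have tau0 : 0 <= tau by rewrite /tau; have [] := Qpos; lra.
have s12 : sin (pi * (1 / 2)) = 1 :> R by rewrite mul1r sin_pihalf.
pose f t := W 0%N 0%N x t / sin (pi * t).
have df t : 0 < t < 1 -> is_derive t 1 f (zf W x t / sin (pi * t)).
  move=> t01; have st := sinpi_gt0 t01; have sn : sin (pi * t) != 0 by rewrite gt_eqF.
  have [_ _ d] := sol_W sol 0 0 (x := x) (y := t) ltac:(split => /=; lra).
  apply: is_derive_eq (is_deriveM d (is_deriveV sn (is_derive_sinpi t))) _.
  by rewrite /GRing.scale/= /zf /ctg; field.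
have := @mvt_le R f (fun t => zf W x t / sin (pi * t)) (tau / sin (pi * y)) (1 / 2) y.
have H t : Num.min (1 / 2) y <= t <= Num.max (1 / 2) y ->
   0 < t < 1 /\ sin (pi * y) <= sin (pi * t).
  move=> tI; have t01 : 0 < t < 1 by move: tI; have [] := leP (1 / 2) y; lra.
  split => //; move: tI; have [y2|y2] := leP (1 / 2) y => tI.
    rewrite -(sinpiB y); apply: sin_ge_mid; nra.
  by apply: sin_ge_mid; nra.
move=> bd; have {bd}: `|f y - f (1 / 2)| <= tau / sin (pi * y) * `|y - 1 / 2|.
  apply: bd => t /H[t01 st]; split; first exact: df.
  rewrite normrM normfV (gtr0_norm (sinpi_gt0 t01)); apply: ler_pM => //.
  - by rewrite invr_ge0 ltW// sinpi_gt0.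
  - exact: zf_mid.
  - by rewrite lef_pV2 ?posrE ?sinpi_gt0.
have -> : W 0%N 0%N x y - W 0%N 0%N x (1 / 2) * sin (pi * y) = sin (pi * y) * (f y - f (1 / 2)).
  by rewrite /f s12; field; rewrite gt_eqF.
move=> bd; rewrite normrM (gtr0_norm s0) mulrC -ler_pdivlMr//; apply: le_trans bd _.
apply: ler_piMr; first by apply: divr_ge0 => //; exact: ltW.
by rewrite ler_norml; lra.
Qed.

Tactic Notation "keep2" hyp(h1) hyp(h2) := clear -sol ab L1 G Q tau rO Qpos h1 h2.

(** At y = 1/2 [ctg] vanishes and the sine is 1, so the y-derivative of [zf W] is W_yy + pi^2 W. The
    equation turns this into de V - (W_xx + k^2 W), and the gradient bound applied to the small
    function [zf W] shows that the oscillator equation holds up to O(tau). *)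
Lemma ode_mid x : a + L + 5 / 4 <= x <= b - L - 5 / 4 ->
  [/\ is_derive x 1 (fun s => W 0%N 0%N s (1 / 2)) (W 1%N 0%N x (1 / 2)),
      is_derive x 1 (fun s => W 1%N 0%N s (1 / 2)) (W 2%N 0%N x (1 / 2)) &
      `|W 2%N 0%N x (1 / 2) + k ^+ 2 * W 0%N 0%N x (1 / 2)| <= (30 * 64) * tau].
Proof.
move=> xab; have pib := @pi_bounds R; have [M0 G0 e0 Q0] := Qpos; have L1' := L1.
have y01 : 0 < (1 / 2 : R) < 1 by lra.
have rx : rect a b (x, 1 / 2) by split => /=; lra.
have [_ d0 _] := sol_W sol 0 0 rx; have [_ d1 _] := sol_W sol 1 0 rx.
split => //; have [dz _] := d2_zf_y rO (sol_W sol) rx y01.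
have s12 : sin (pi * (1 / 2)) = 1 :> R by rewrite mul1r sin_pihalf.
have c12 : ctg (1 / 2) = 0 :> R by rewrite /ctg mul1r cos_pihalf mulr0 mul0r.
rewrite s12 c12 mul0r subr0 divr1 in dz.
have tau0 : 0 <= tau by rewrite /tau; lra.
have Gt : 320 * 18 * G <= tau by rewrite /tau /Q; lra.
have H s t : `|s - x| < 1 / 4 -> `|t - 1 / 2| < 1 / 4 -> [/\ ctn (zf W) s t,
    exists2 v, lap (zf W) s t v & `|v| <= (34 * 64) * tau & `|zf W s t| <= tau].
  rewrite !ltr_norml => sx tx; have t01 : 0 < t < 1 by lra.
  have rst : rect a b (s, t) by split => /=; lra.
  have zt : `|zf W s t| <= tau by apply: zf_mid => //; lra.
  split => //; first exact: ctn_zf (sol_W sol) rst t01.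
  eexists; first exact: (lap_zfW sol rst).
  have := zfV_bound sol (x := s) ltac:(lra) t01; rewrite -/G => zv.
  apply: le_trans (ler_normD _ _) _; rewrite normrM.
  have s8 : 1 / 8 <= sin (pi * t).
    have [t2|t2] := leP t (1 / 2); first by have := sinpi_lb t01 t2; keep2 tx t2; lra.
    by have := @sinpi_lb R (1 - t) ltac:(keep2 tx t2; lra) ltac:(keep2 t01 t2; lra); rewrite sinpiB; keep2 tx t2; lra.
  have q1 : 0 <= (pi / sin (pi * t)) ^+ 2 <= 32 ^+ 2.
    have s80 : 0 < sin (pi * t) by keep2 s8 s8; lra.
    have h32 : pi <= 32 * sin (pi * t) by have := @pi_bounds R; keep2 s8 s8; lra.
    rewrite sqr_ge0/= lerXn2r ?nnegrE ?ler_pdivrMr ?divr_ge0 ?(ltW s80) ?pi_ge0//.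
  have vb : `|2 * (pi / sin (pi * t)) ^+ 2 - (pi ^+ 2 + k ^+ 2)| <= (33 * 64).
    have := sol_lam sol; rewrite ler_norml; lra.
  have : `|2 * (pi / sin (pi * t)) ^+ 2 - (pi ^+ 2 + k ^+ 2)| * `|zf W s t| <= (33 * 64) * tau.
    exact: ler_pM.
  lra.
have := grad_bound_y (r := 1 / 4) ltac:(lra) H dz.
have -> : 3 * (2 * tau / (1 / 4) + (34 * 64) * tau * (1 / 4)) = 24 * tau + 3 / 4 * ((34 * 64) * tau) by lra.
move=> zb; have := sol_eqW sol rx => /(canRL (addrK _)) E.
rewrite (_ : _ + _ = de * V 0%N 0%N x (1 / 2)
  - (W 0%N 2%N x (1 / 2) + pi ^+ 2 * W 0%N 0%N x (1 / 2))); last by lra.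
apply: le_trans (ler_normB _ _) _.
have : `|de * V 0%N 0%N x (1 / 2)| <= G.
  by rewrite normrM ler_wpM2l//; exact: (sol_T sol).
lra.
Qed.

End StripMiddle.

Section StripRight.
Context {R : realType}.
Implicit Types (x y s t e : R).
Variables (a b k lam' de M T L X : R) (W V : nat -> nat -> R -> R -> R).
Hypothesis sol : strip_sol a b k lam' de M T W V.
Hypothesis ab : a < b.
Hypothesis L1 : 1 <= L.
Hypothesis k0 : 0 < k <= 1 / 8.
Hypothesis kX : k * X <= pi / 4.
Hypothesis X1 : L + 3 / 2 <= X / 2.
Hypothesis aX : a + L + 3 / 2 <= b - X.
Hypothesis W0b : forall e : R, 0 < e -> exists2 d, 0 < d &
  forall x y, rect a b (x, y) -> b - d < x -> `|W 0%N 0%N x y| <= e.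
Let G := `|de| * T.
Let Q := M * expR (- L) + G.
Let tau := 5 * (320 * 18) * Q.
Let rO : open (rect a b) := @open_rect R a b 0 1.
Let A := W 0%N 0%N (b - X) (1 / 2) / sin (k * X).

Ltac keep := clear -sol ab L1 k0 kX X1 aX W0b G Q tau rO A.

(** Within L of the right end [zf W] is not known to be small, so the maximum principle carries the
    estimate from the edge x = b - X, where [profile_mid] applies and A fits W at y = 1/2, to the
    side x = b, where both functions vanish. The condition k X <= pi / 4 keeps the comparison sine
    of frequency 2 k positive. *)
Lemma strip_right x y : b - X < x < b -> 0 < y < 1 ->
  `|W 0%N 0%N x y - A * (sin (k * (b - x)) * sin (pi * y))|
    <= (tau + G / (k ^+ 2)) / (k ^+ 3 / 128).
Proof.
have [L1' k0' kX' X1'] : [/\ 1 <= L, 0 < k <= 1 / 8, k * X <= pi / 4 & L + 3 / 2 <= X / 2] by [].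
have [aX' ab'] : a + L + 3 / 2 <= b - X /\ a < b by [].
move=> xb y01; have pib := @pi_bounds R; have [M0 _] := sol_MT sol ab; have G0 := sol_G sol ab.
rewrite -/G in G0; have Q0 : 0 <= Q by apply: addr_ge0 => //; apply: mulr_ge0 => //; exact: expR_ge0.
have tau0 : 0 <= tau by rewrite /tau; lra.
(* Together with al = 2 k this leaves the gap al^2 + be^2 - lam = 2 k^2. *)
pose be := Num.sqrt (pi ^+ 2 - k ^+ 2).
have be2 : be ^+ 2 = pi ^+ 2 - k ^+ 2 by rewrite sqr_sqrtr//; nra.
have beb : 0 < be < pi.
  have be0 : 0 < be by rewrite sqrtr_gt0; nra.
  by rewrite be0 -(ltr_pXn2r (n := 2)) ?nnegrE ?be2//; nra.
pose w s t := W 0%N 0%N s t - A * (sin (- k * s + k * b) * sin (pi * t + 0)).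
have sE s : sin (- k * s + k * b) = sin (k * (b - s)) by congr sin; ring.
have dS s := d2_sin_affine (- k) (k * b) s; have dP (t : R) := d2_sin_affine pi 0 t.
pose O := [set p : R * R | b - X < p.1 < b /\ 0 < p.2 < 1].
have Or s t : O (s, t) -> rect a b (s, t) by move=> [/= ? ?]; split => /=; lra.
have kb s : b - X < s -> s < b -> 0 < k * (b - s) <= k * X by move=> ? ?; apply/andP; split; nra.
have := @max_princ_src R O w (2 * k) be (-1) (b + 1) (pi ^+ 2 + k ^+ 2) (2 * k) tau G.
have -> : (2 * k) ^+ 2 + be ^+ 2 - (pi ^+ 2 + k ^+ 2) = 2 * k ^+ 2 by rewrite be2; ring.
have goalE : w x y = W 0%N 0%N x y - A * (sin (k * (b - x)) * sin (pi * y)).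
  by rewrite /w sE addr0.
move=> mp; rewrite -goalE; apply: le_trans (mp _ _ _ _ _ _ _ _ _ _ _ _ _ _ _) _ => {mp}.
- exact: open_rect.
- move=> s t /Or rst; apply: ctnB; first by have [] := sol_W sol 0 0 rst.
  by apply: ctnM; [exact: ctnC|exact: ctnM1].
- lra.
- lra.
- exact: beb.
- by rewrite sqrrN expr1n.
- by rewrite be2; nra.
- move=> s t [/= s0 t0]; split => //.
  have : 2 * k * (-1 * s + (b + 1)) = 2 * (k * (b - s)) + 2 * k by ring.
  have := kb s; lra.
- move=> s t Ost; have rst := Or _ _ Ost.
  eexists; first exact: lapB (jets_lap 0 0 rO (sol_W sol) rst) (lapZ A (lapM1 (dS s) (dP t))).
  have := sol_eqW sol rst => /(canRL (addrK _)) ->; rewrite /w.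
  rewrite [X in `|X|](_ : _ = de * V 0%N 0%N s t); last by ring.
  by rewrite normrM /G ler_wpM2l//; exact: (sol_T sol).
- exact: tau0.
- exact: G0.
- move=> e e0.
  have [d1 d10 H1] := sol_W0 sol (e := e / 2) ltac:(lra).
  have [d2 d20 H2] := W0b (e := e / 2) ltac:(lra).
  have sX : 0 < sin (k * X) by apply: sin_gt0_pi; nra.
  (* The error on the centre line. It is zero at b - X by the choice of A, hence small in a thin
     layer next to that edge. *)
  pose g s := W 0%N 0%N s (1 / 2) - A * sin (k * (b - s)).
  have g0 : g (b - X) = 0.
    by rewrite /g (_ : b - (b - X) = X) ?/A ?divfK ?gt_eqF ?subrr//; lra.
  have [d3 d30 H3] : exists2 d3 : R, 0 < d3 & forall s, `|s - (b - X)| < d3 -> `|g s| <= e.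
    have rX : rect a b (b - X, 1 / 2) by split => /=; lra.
    have [_ dW _] := sol_W sol 0 0 rX.
    have dg := is_deriveB dW (is_deriveZ A (is_derive_sinB k b (b - X))).
    have [d d0 Hd] := (is_deriveP _ _ _).1 dg 1 ltr01.
    set l := (X in is_derive _ _ _ X) in dg Hd.
    exists (Num.min d (e / (1 + `|l|))); first by rewrite lt_min d0 divr_gt0// ltr_wpDr.
    move=> s; rewrite lt_min ltr_pdivlMr ?ltr_wpDr// => /andP[sd se].
    have := Hd _ sd; rewrite (addrC (b - X)) subrK.
    rewrite -[X in _ - X - _]/(g (b - X)) g0 subr0 -[X in `|X - _|]/(g s) => gs.
    rewrite -(subrK (l * (s - (b - X))) (g s)); apply: le_trans (ler_normD _ _) _.
    by rewrite normrM; nra.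
  pose d : R := Num.min (Num.min d1 (Num.min d2 d3)) (Num.min (e / (8 * (1 + `|A|))) (1 / 2)).
  have A0 : 0 < 1 + `|A| by rewrite ltr_wpDr.
  have d12 : d <= 1 / 2 by rewrite !ge_min lexx !orbT.
  have [[dd1 dd2] [dd3 dd4] d0] : [/\ d <= d1 /\ d <= d2, d <= d3 /\ `|A| * (4 * d) <= e / 2 & 0 < d].
    have dA : d <= e / (8 * (1 + `|A|)) by rewrite !ge_min lexx !orbT.
    split; [by rewrite !ge_min !lexx !orbT|split; first by rewrite !ge_min !lexx !orbT|].
      by move: dA; rewrite ler_pdivlMr ?mulr_gt0//; have := normr_ge0 A; nra.
    by rewrite !lt_min d10 d20 d30 divr_gt0 ?mulr_gt0//=; lra.
  exists [set p | b - X + d / 2 <= p.1 <= b - d / 2 /\ d / 2 <= p.2 <= 1 - d / 2]; split.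
  + exact: compact_box.
  + by move=> -[s t] [/= s1 t1]; split; move: s1 t1 d0 => /=; move: (d) => z; keep; lra.
  + move=> s t Ost nK; have rst := Or _ _ Ost; have [/= s0 t0] := Ost.
    rewrite /w sE addr0.
    have small c : `|c| <= 4 * d -> `|A * c| <= e / 2.
      by rewrite normrM => cd; apply: le_trans (ler_wpM2l (normr_ge0 A) cd) _.
    have fin c : `|c| <= 4 * d -> `|W 0%N 0%N s t| <= e / 2 -> `|W 0%N 0%N s t - A * c| <= tau + e.
      move=> /small cA We; apply: le_trans (ler_normB _ _) _; apply: le_trans (lerD We cA) _.
      by rewrite -splitr lerDr.
    have [td|td] := pselect (t < d \/ 1 - d < t).
      apply: fin; last by apply: H1 rst _; move: td dd1; move: (d) => z; keep; lra.
      rewrite normrM -[leRHS]mul1r ler_pM ?sin_max//.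
      have pi4 : 0 <= (pi : R) <= 4 by have := @pi_bounds R; keep; lra.
      case: td => td; last rewrite -sinpiB.
        by apply: sin_le_dist pi4 _; move: td t0; move: (d) => z; keep; lra.
      by apply: sin_le_dist pi4 _; move: td t0; move: (d) => z; keep; lra.
    have [sd|sd] := ltP (b - d) s.
      apply: fin; last by apply: H2 rst _; move: sd dd2; move: (d) => z; keep; lra.
      rewrite normrM -[leRHS]mulr1 ler_pM ?sin_max//.
      have k4 : 0 <= k <= 4 by move: (k0); keep; lra.
      by apply: sin_le_dist k4 _; move: sd s0; move: (d) => z; keep; lra.
    have sX' : s < b - X + d.
      rewrite ltNge; apply/negP => sX'; apply: nK; split => /=; first by move: sX' sd d0; move: (d) => z; keep; lra.
      apply/andP; split; rewrite leNgt; apply/negP => h; apply: td; [left|right]; move: h d0; move: (d) => z; keep; lra.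
    have s3 : `|s - (b - X)| < d3.
      rewrite gtr0_norm ?subr_gt0; last by case/andP: s0.
      by rewrite ltrBlDl; apply: lt_le_trans sX' _; rewrite lerD2l.
    have ge := H3 s s3.
    have pr := profile_mid sol ab L1 (x := s) ltac:(move: (X1) aX' sX' s0 d12; move: (d) => z; keep; move=> *; lra) t0; rewrite -/G -/Q -/tau in pr.
    rewrite (_ : _ - _ = W 0%N 0%N s t - W 0%N 0%N s (1 / 2) * sin (pi * t) + g s * sin (pi * t)); last by rewrite /g; ring.
    apply: le_trans (ler_normD _ _) _; apply: lerD => //.
    by rewrite normrM -[e]mulr1 ler_pM ?sin_max.
- by split.
- move: tau0 G0 beb be2 pib (k0); keep => tau0 G0 beb be2 pib k00.
  have k3 : 0 < k ^+ 3 by rewrite exprn_gt0//; lra.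
  have k2 : 0 < k ^+ 2 by rewrite exprn_gt0//; lra.
  have s2k : k / 2 <= sin (2 * k) by have := @sin_ge_lin R (2 * k) ltac:(lra); lra.
  have cbe : k ^+ 2 / 64 <= cos (be / 2).
    rewrite -sinDpihalf (_ : be / 2 + pi / 2 = pi - (pi - be) / 2); last by lra.
    rewrite sinB sinpi cospi mul0r mulN1r sub0r opprK.
    by have := @sin_ge_lin R ((pi - be) / 2) ltac:(lra); nra.
  apply: ler_pM.
  + by rewrite addr_ge0// divr_ge0//; lra.
  + by rewrite invr_ge0 mulr_ge0; lra.
  + by rewrite lerD2l ler_wpM2l// lef_pV2 ?posrE; lra.
  + rewrite lef_pV2 ?posrE ?divr_gt0//; last by rewrite mulr_gt0//; lra.
    rewrite (_ : k ^+ 3 / 128 = k / 2 * (k ^+ 2 / 64)); last by field.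
    by apply: ler_pM; lra.
Qed.

End StripRight.

Section StripAsymptotics.
Context {R : realType}.
Implicit Types (x y k L M T N a lam de e d C : R).

Definition side_right a b (u : R -> R -> R) := forall e : R, 0 < e -> exists2 d, 0 < d &
  forall x y, rect a b (x, y) -> b - d < x -> `|u x y| <= e.

(** Bookkeeping of powers through k N >= pi / 4: [strip_right] costs k^(-5), that is N^5, and
    dividing the oscillator estimate by k costs one more N. With X = N / (4 m) the angle k X is at
    most pi / 4 and also at least 1 / (8 m), so sin(k X / 2) has a lower bound depending on m
    only. *)
Lemma strip_asymp (m : nat) : (0 < m)%N -> exists2 C, 0 < C &
  forall a N k lam' de M T L W V, strip_sol a N k lam' de M T W V -> side_right a N (W 0%N 0%N) ->
    let X := N / (4 * m%:R) in
    0 <= a -> 1 <= L -> k <= 1 / 8 -> pi / 4 <= k * N <= m%:R * pi ->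
    L + 3 / 2 <= X / 2 -> a + L + 3 / 2 <= N - X ->
  forall x y, a + L + 3 / 2 <= x < N -> 0 < y < 1 ->
    `|W 0%N 0%N x y - W 0%N 0%N (N - X) (1 / 2) / sin (k * X) * (sin (k * (N - x)) * sin (pi * y))|
      <= C * N ^+ 6 * (M * expR (- L) + `|de| * T).
Proof.
move=> m0; pose mu : R := m%:R; have mu1 : 1 <= mu by rewrite /mu ler1n.
have [c0 c00 c0E] : exists2 c : R, 0 < c & 5 * (320 * 18) = c by eexists; last reflexivity; qlra.
have [c1 c10 c1E] : exists2 c : R, 0 < c & 32 * 32 * (c0 + 4) = c by eexists; last reflexivity; qlra.
have [c2 c20 c2E] : exists2 c : R, 0 < c & 30 * 64 * c0 = c by eexists; last reflexivity; qlra.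
exists (c0 + c1 + 256 * mu * c1 + 516 * mu * c2); first by nra.
move=> a N k lam' de M T L W V sol Wr X a0 L1 k8 kN LX aX x y xI y01.
have pib := @pi_bounds R; rewrite -/mu in kN.
have mu40 : 0 < 4 * mu by qlra.
have XE : X * (4 * mu) = N by rewrite /X -/mu divfK ?gt_eqF.
have X0 : 5 <= X by qlra.
have NX : 4 * X <= N by rewrite -XE; nra.
have N1 : 1 <= N by qlra.
have aN : a < N by qlra.
have kN0 : 0 < k * N by qlra.
have k0 : 0 < k by move: kN0; rewrite pmulr_lgt0//; qlra.
have kNX : k * N = k * X * (4 * mu) by rewrite -XE; ring.
have kX : k * X <= pi / 4.
  by rewrite -(ler_pM2r mu40) -kNX; qlra.
have kX8 : 1 <= 8 * mu * (k * X) by qlra.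
have kN2 : 1 <= k * (2 * N) by qlra.
have sc1 : a + L + 5 / 4 <= N - X by clear - aX; qlra.
have sc2 : N - X / 2 <= N - L - 5 / 4 by clear - LX; qlra.
have sc3 : N - L - 5 / 4 - (a + L + 5 / 4) <= N by clear - a0 L1; qlra.
have sc4 : x <= N - X -> a + L + 5 / 4 <= x <= N - L - 5 / 4 by clear - xI LX X0; qlra.
have sc5 : x <= N - X -> a + 1 + L <= x <= N - 1 - L by clear - xI LX X0; qlra.
have sc6 : N - X < N - X / 2 < N by clear - X0; qlra.
have X00 : 0 < X by clear - X0; qlra.
have [M0 T0] := sol_MT sol aN; set G := `|de| * T; set Q := M * expR (- L) + G.
have G0 : 0 <= G by rewrite mulr_ge0.
have GQ : G <= Q by rewrite lerDr mulr_ge0// expR_ge0.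
have Q0 : 0 <= Q by qlra.
have Npow n : 1 <= N ^+ n by exact: exprn_ege1.
have T4 s t : N - X < s < N -> 0 < t < 1 ->
   `|W 0%N 0%N s t - W 0%N 0%N (N - X) (1 / 2) / sin (k * X) * (sin (k * (N - s)) * sin (pi * t))|
     <= c1 * N ^+ 5 * Q.
  move=> sI t01; apply: le_trans (strip_right sol aN L1 _ kX LX aX Wr sI t01) _; first by rewrite k0 k8.
  rewrite -/G -/Q c0E; have k3 : 0 < k ^+ 3 by rewrite exprn_gt0.
  have k2 : 0 < k ^+ 2 by rewrite exprn_gt0.
  have h1 : G / k ^+ 2 <= 4 * N ^+ 2 * Q.
    rewrite ler_pdivrMr//; have : 1 <= (k * (2 * N)) ^+ 2 by exact: exprn_ege1.
    by rewrite exprMn; clear - k2 GQ G0; nra.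
  have h2 : c0 * Q + G / k ^+ 2 <= (c0 + 4) * N ^+ 2 * Q.
    have := Npow 2%N; have : 0 <= c0 * Q by rewrite mulr_ge0// ltW.
    by clear - h1; nra.
  rewrite ler_pdivrMr; last by qlra.
  have : 1 <= (k * (2 * N)) ^+ 3 by exact: exprn_ege1.
  rewrite exprMn => h; apply: le_trans h2 _.
  rewrite (_ : c1 * N ^+ 5 * Q * (k ^+ 3 / 128) = (c0 + 4) * N ^+ 2 * Q * (k ^+ 3 * (2 * N) ^+ 3)); last by rewrite -c1E; field.
  have c4 : 0 <= c0 + 4 by clear - c00; qlra.
  have N0 : 0 <= N by clear - N1; qlra.
  by rewrite ler_peMr// !mulr_ge0 ?exprn_ge0.
set A := _ / sin (k * X).
have Cle c : 0 <= c -> c <= c0 + c1 + 256 * mu * c1 + 516 * mu * c2 -> forall n, (n <= 6)%N ->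
   c * N ^+ n * Q <= (c0 + c1 + 256 * mu * c1 + 516 * mu * c2) * N ^+ 6 * Q.
  move=> c' cC n n6; rewrite ler_wpM2r// ler_pM ?exprn_ge0//; first by clear - N1; qlra.
  by rewrite ler_weXn2l.
have [xX|xX] := ltP (N - X) x.
  apply: le_trans (T4 x y _ y01) _; first by case/andP: xI => _ ->; rewrite xX.
  by apply: Cle => //; [exact: ltW|clear - c00 c10 c20 mu1; nra].
have pr := profile_mid sol aN L1 (sc5 xX) y01.
rewrite -/G -/Q c0E in pr.
have := @ode_close R (fun s => W 0%N 0%N s (1 / 2)) (fun s => W 1%N 0%N s (1 / 2))
  (fun s => W 2%N 0%N s (1 / 2)) k N X (c2 * Q) (c1 * N ^+ 5 * Q) (a + L + 5 / 4) (N - L - 5 / 4)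
  k0 X00 kX _ sc1 sc2 sc3 _ x (sc4 xX).
rewrite -/A => oc; have {oc} : k * `|W 0%N 0%N x (1 / 2) - A * sin (k * (N - x))| <=
     2 * ((k * (c1 * N ^+ 5 * Q) + 2 * (N * (c2 * Q))) / sin (k * (X / 2)) + N * (c2 * Q)).
  apply: oc.
    move=> s sI; have [d0 d1 d2] := ode_mid sol aN L1 sI.
    by split => //; apply: le_trans d2 _; rewrite -/G -/Q c0E -c2E mulrA.
  have h12 : 0 < (1 / 2 : R) < 1 by clear; qlra.
  have := T4 (N - X / 2) (1 / 2) sc6 h12.
  have s12 : sin (pi * (1 / 2)) = 1 :> R by rewrite mul1r sin_pihalf.
  have NN : N - (N - X / 2) = X / 2 by clear; ring.
  by rewrite s12 mulr1 NN.
have sl : 1 / (64 * mu) <= sin (k * (X / 2)).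
  have kXh : 0 <= k * (X / 2) <= pi / 2.
    by clear - kX pib k0 X00; nra.
  have := sin_ge_lin kXh; apply: le_trans; rewrite ler_pdivrMr; last by clear - mu1; qlra.
  by clear - kX8; qlra.
have s0 : 0 < sin (k * (X / 2)) by apply: lt_le_trans sl; rewrite divr_gt0//; clear - mu1; qlra.
have si : (sin (k * (X / 2)))^-1 <= 64 * mu.
  have m64 : 0 < 64 * mu by clear - mu1; qlra.
  by rewrite -[leRHS]invrK lef_pV2 ?posrE ?invr_gt0// -[X in X <= _]mul1r.
set r := `|_ - _|; set P := k * _ + _ => kr.
have N0 : 0 <= N by clear - N1; qlra.
have cQ : 0 <= c1 * N ^+ 5 * Q by rewrite !mulr_ge0// ?exprn_ge0// ltW.
have cQ2 : 0 <= N * (c2 * Q) by rewrite !mulr_ge0// ltW.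
have P0 : 0 <= P <= c1 * N ^+ 5 * Q + 2 * (N * (c2 * Q)).
  rewrite /P; move: cQ cQ2; set u := c1 * _ * Q; set v := N * _ => u0 v0.
  have k1 : k <= 1 by clear - k8; qlra.
  by clear - u0 v0 k1 k0; nra.
have mP : P / sin (k * (X / 2)) <= (c1 * N ^+ 5 * Q + 2 * (N * (c2 * Q))) * (64 * mu).
  by case/andP: P0 => P1 P2; apply: ler_pM; rewrite ?invr_ge0// ltW.
have r0 : 0 <= r by exact: normr_ge0.
have rb : r <= (256 * mu * c1 + 516 * mu * c2) * N ^+ 6 * Q.
  have rk : r <= k * r * (2 * N).
    by rewrite mulrAC ler_peMl.
  apply: le_trans rk _; apply: (@le_trans _ _ (2 * ((c1 * N ^+ 5 * Q + 2 * (N * (c2 * Q))) * (64 * mu)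
      + N * (c2 * Q)) * (2 * N))).
    rewrite ler_wpM2r ?mulr_ge0//; apply: le_trans kr _.
    by rewrite ler_wpM2l// lerD2r.
  have n6 : N ^+ 6 = N ^+ 4 * N ^+ 2 by rewrite -exprD.
  have N4 : 0 <= N ^+ 4 - 1 by rewrite subr_ge0.
  have n5 : N ^+ 5 = N ^+ 4 * N by rewrite exprSr.
  have : 0 <= c2 * Q * N ^+ 2 * (N ^+ 4 - 1).
    by rewrite !mulr_ge0// ?exprn_ge0// ltW.
  have m1 : 0 <= mu - 1 by rewrite subr_ge0.
  have : 0 <= (mu - 1) * (c2 * Q * N ^+ 2) by rewrite !mulr_ge0// ?exprn_ge0// ltW.
  have : 0 <= (mu - 1) * (c2 * Q * N ^+ 2 * (N ^+ 4 - 1)).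
    by rewrite !mulr_ge0// ?exprn_ge0// ltW.
  rewrite n6 n5; set n4 := N ^+ 4.
  by clear; qlra.
rewrite (_ : _ - _ = W 0%N 0%N x y - W 0%N 0%N x (1 / 2) * sin (pi * y) +
  (W 0%N 0%N x (1 / 2) - A * sin (k * (N - x))) * sin (pi * y)); last by ring.
apply: le_trans (ler_normD _ _) _.
have : `|(W 0%N 0%N x (1 / 2) - A * sin (k * (N - x))) * sin (pi * y)| <= r.
  by rewrite normrM -[leRHS]mulr1 ler_pM ?sin_max.
have : c0 * Q <= c0 * N ^+ 6 * Q by rewrite ler_wpM2r// ler_peMr// ltW.
have : 0 <= c1 * N ^+ 6 * Q by rewrite !mulr_ge0// ?exprn_ge0// ltW.
move: rb pr; rewrite (mulrDl _ (516 * mu * c2)) => rb pr.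
by clear - rb pr; qlra.
Qed.

End StripAsymptotics.

(** * Eigenfunctions and their classes *)

Definition dom {R : realType} (phi : R -> R) (N : R) : set (R * R) :=
  [set p | 0 < p.2 < 1 /\ - phi p.2 < p.1 < N].

(* The Dirichlet boundary condition, stated without the closure of O. *)
Definition vanishing {R : realType} (O : set (R * R)) (u : R -> R -> R) := forall e : R, 0 < e ->
  compact [set p | O p /\ e <= `|u p.1 p.2|].

Record efun {R : realType} (phi : R -> R) (N lam : R) (u : nat -> nat -> R -> R -> R) : Prop :=
  Efun {
  ef_jets : jets (dom phi N) u;
  ef_eq : forall x y, dom phi N (x, y) ->
    u 2%N 0%N x y + u 0%N 2%N x y + lam * u 0%N 0%N x y = 0;
  ef_van : vanishing (dom phi N) (u 0%N 0%N) }.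

Section Vanishing.
Context {R : realType}.
Implicit Types (x y e d a b N : R) (u : R -> R -> R) (O : set (R * R)).

Lemma compact_cut (K : set (R * R)) (h : R * R -> R) : compact K -> continuous h ->
  compact [set p | K p /\ 0 <= h p].
Proof. by move=> cK hc; apply: compact_ge cK _ => p _; exact: hc. Qed.

Lemma cont_fst_aff (c d : R) : continuous (fun p : R * R => c * p.1 + d).
Proof.
by move=> p; apply: cvgD; [apply: cvgM; [exact: cvg_cst|exact: cvg_fst]|exact: cvg_cst].
Qed.

Lemma cont_snd_aff (c d : R) : continuous (fun p : R * R => c * p.2 + d).
Proof.
by move=> p; apply: cvgD; [apply: cvgM; [exact: cvg_cst|exact: cvg_snd]|exact: cvg_cst].
Qed.

Lemma compact_pos (K : set (R * R)) (h : R * R -> R) : compact K -> continuous h ->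
  (forall p, K p -> 0 < h p) -> exists2 d, 0 < d & forall p, K p -> d <= h p.
Proof.
move=> cK hc h0; have [K0|nK] := pselect (K !=set0); last first.
  by exists 1 => // p Kp; exfalso; apply: nK; exists p.
have [p Kp pmin] := compact_argmin cK K0 (fun p _ => hc p).
by exists (h p); [exact: h0|exact: pmin].
Qed.

Lemma vanishing_far O u (h : R * R -> R) e : vanishing O u -> continuous h ->
  (forall p, O p -> 0 < h p) -> 0 < e ->
  exists2 d, 0 < d & forall x y, O (x, y) -> h (x, y) < d -> `|u x y| <= e.
Proof.
move=> van hc h0 e0; have [|d d0 Hd] := compact_pos (van e e0) hc.
  by move=> p [Op _]; exact: h0.
exists d => // x y Oxy hd; rewrite leNgt; apply/negP => eu.
by have := Hd (x, y) (conj Oxy (ltW eu)); rewrite leNgt hd.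
Qed.

Lemma vanishing_side0 O u a b : vanishing O u -> (forall p, O p -> 0 < p.2 < 1) ->
  rect a b `<=` O -> side0 a b u.
Proof.
move=> van O01 sub e e0.
have [|d1 d10 H1] := vanishing_far van (@cont_snd_aff 1 0) _ e0.
  by move=> p /O01; qlra.
have [|d2 d20 H2] := vanishing_far van (@cont_snd_aff (-1) 1) _ e0.
  by move=> p /O01; qlra.
exists (Num.min d1 d2); first by rewrite lt_min d10.
by move=> x y /sub Oxy [yd|yd]; [apply: H1|apply: H2] => //=; move: yd; have [] := leP d1 d2; qlra.
Qed.

Lemma vanishing_right O u a b : vanishing O u -> (forall p, O p -> p.1 < b) ->
  rect a b `<=` O -> side_right a b u.
Proof.
move=> van O01 sub e e0.
have [|d d0 H] := vanishing_far (h := fun p => (-1) * p.1 + b) van (@cont_fst_aff (-1) b) _ e0.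
  by move=> p /O01; qlra.
by exists d => // x y /sub Oxy xd; apply: H => //=; qlra.
Qed.

Lemma vanishing_max O u x0 y0 : vanishing O u -> (forall x y, O (x, y) -> ctn u x y) ->
  O (x0, y0) -> u x0 y0 != 0 ->
  exists M x y, [/\ 0 < M, O (x, y), `|u x y| = M & forall s t, O (s, t) -> `|u s t| <= M].
Proof.
move=> van cu O0 u0; have e0 : 0 < `|u x0 y0| by rewrite normr_gt0.
have cK := van _ e0; pose h (p : R * R) := - `|u p.1 p.2|.
have [|[x y] [Oxy _] pmin] := @compact_argmin _ _ h cK ltac:(by exists (x0, y0)).
  by move=> [x y] [Oxy _]; apply: cvgN; apply: cvg_norm; exact: cu.
have lb := pmin (x0, y0) (conj O0 (lexx _)); rewrite /h/= lerN2 in lb.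
exists `|u x y|, x, y; split => //; first exact: lt_le_trans lb.
move=> s t Ost; have [le|/ltW le] := leP `|u s t| `|u x0 y0|; first exact: le_trans lb.
by have := pmin (s, t) (conj Ost le); rewrite /h/= lerN2.
Qed.

Lemma sinB_natpi (j : nat) x : `|sin (x - j%:R * pi)| = `|sin x|.
Proof.
elim: j => [|j IH]; first by rewrite mul0r subr0.
rewrite -natr1 mulrDl mul1r opprD addrA sinB sinpi cospi mulr0 subr0 mulrN1 normrN.
exact: IH.
Qed.

Lemma sin_small x d : 0 < x -> `|sin x| <= d -> exists j : nat, `|x - j%:R * pi| <= 4 * d.
Proof.
move=> x0 sd; have pi0 := @pi_gt0 R.
(* The integer nearest to x / pi, so that x - j pi lies in the quarter periods around 0. *)
pose j := Num.trunc (x / pi + 1 / 2); exists j.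
have /andP[j1 j2] : j%:R <= x / pi + 1 / 2 < j.+1%:R.
  by apply: trunc_itv; rewrite addr_ge0// divr_ge0 ?ltW.
have xE : x = x / pi * pi by rewrite divfK ?gt_eqF.
rewrite -(@natr1 R j) in j2; move: sd; rewrite -(sinB_natpi j); set t := x - _ => sd.
have th : - (pi / 2) <= t <= pi / 2 by rewrite /t {1 2}xE; nra.
have [t0|t0] := leP 0 t.
  have := @sin_ge_lin R t ltac:(qlra); move: sd; rewrite ler_norml (ger0_norm t0); qlra.
have := @sin_ge_lin R (- t) ltac:(qlra); rewrite sinN; move: sd; rewrite ler_norml (ltr0_norm t0); qlra.
Qed.

End Vanishing.

(** * Bounds in the left cap *)

Section LeftBound.
Context {R : realType}.
Implicit Types (phi : R -> R) (N S lam k x y a al : R) (w : R -> R -> R)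
  (u : nat -> nat -> R -> R -> R).

Definition between0 phi S := forall y, 0 < y < 1 -> 0 <= phi y <= S.

Lemma rect_dom phi N S a : between0 phi S -> 0 <= a -> rect a N `<=` dom phi N.
Proof. by move=> phiS a0 [x y] [/= x1 y01]; have := phiS _ y01; split => //=; qlra. Qed.

Lemma lap_efun phi N lam u x y : open (dom phi N) -> efun phi N lam u -> dom phi N (x, y) ->
  lap (u 0%N 0%N) x y (- (lam * u 0%N 0%N x y)).
Proof.
move=> dO ef Oxy; have := jets_lap 0 0 dO (ef_jets ef) Oxy.
by have := ef_eq ef Oxy => /eqP; rewrite addr_eq0 => /eqP ->.
Qed.

Lemma open_dom_lt phi N c : open (dom phi N) ->
  open [set p : R * R | dom phi N p /\ p.1 < c].
Proof.
move=> dO; apply: openI => //; apply: open_ltf; first by move=> p; exact: cvg_fst.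
by move=> p; exact: cvg_cst.
Qed.

(* Supersolution of a left cap {x < x1}: compare with a multiple of
   sin (pi y) sin (al (x + S + 1)), which is positive up to the curved side. *)
Lemma cap_bound phi N S lam w al x1 T : between0 phi S -> open (dom phi N) ->
    pi ^+ 2 < lam -> lam <= pi ^+ 2 + al ^+ 2 -> 0 < al -> al * (x1 + S + 1) <= pi / 2 -> 
    al <= 1 / 4 -> 0 < x1 < N ->
    (forall x y, dom phi N (x, y) -> x < x1 -> ctn w x y /\
       exists2 v, lap w x y v & `|v + lam * w x y| <=
         (pi ^+ 2 + al ^+ 2 - lam) * (T * (sin (al * (x + S + 1)) * sin (pi * y)))) ->
    vanishing (dom phi N) w -> 0 <= T ->
    (exists2 d, 0 < d & forall x y, 0 < y < 1 -> x1 - d < x < x1 -> 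
       `|w x y| <= T * (sin (al * (x + S + 1)) * sin (pi * y))) ->
  forall x y, dom phi N (x, y) -> x < x1 ->
    `|w x y| <= T * (sin (al * (x + S + 1)) * sin (pi * y)).
Proof.
move=> phiS dO lampi lamal al0 alx al4 x1N wP van T0 [d d0 Hd] x0 y0 O0 x01.
have pib := @pi_bounds R.
pose O := [set p : R * R | dom phi N p /\ p.1 < x1].
have angle x y : O (x, y) -> al <= al * (x + S + 1) <= pi / 2.
  move=> [[/= y01 xN] xx1]; have := phiS _ y01 => pS.
  have : al * (x + S + 1) <= al * (x1 + S + 1) by rewrite ler_pM2l//; qlra.
  have : al * 1 <= al * (x + S + 1) by rewrite ler_pM2l//; qlra.
  by move: alx; clear; qlra.
have B0 x y : O (x, y) -> 0 <= T * (sin (al * (x + S + 1)) * sin (pi * y)).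
  move=> Oxy; have := angle _ _ Oxy; have y01 : 0 < y < 1 by case: Oxy => -[].
  have := sinpi_gt0 y01 => s1 ang; rewrite !mulr_ge0 ?(ltW s1)//.
  by rewrite ltW// sin_gt0_pi//; move: ang al0 pib; clear; qlra.
(* With the frequency 5/4 al in x one gets (5/4 al)^2 + be^2 = pi^2 + 21/16 al^2 > lam: a strict
   supersolution, still positive because al (x + S + 1) <= pi / 2. *)
pose be := Num.sqrt (pi ^+ 2 - al ^+ 2 / 4).
have be2 : be ^+ 2 = pi ^+ 2 - al ^+ 2 / 4 by rewrite sqr_sqrtr//; move: al0 al4 pib; clear; nra.
have beb : 0 < be < pi.
  have be0 : 0 < be by rewrite sqrtr_gt0; move: al0 al4 pib; clear; nra.
  rewrite be0 -(ltr_pXn2r (n := 2)) ?nnegrE ?be2//; move: be0 al0 al4 pib; clear; nra.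
pose f x := sin (al * x + al * (S + 1)); pose g y := sin (pi * y + 0).
have fE x : f x = sin (al * (x + S + 1)) by rewrite /f; congr sin; ring.
have gE y : g y = sin (pi * y) by rewrite /g addr0.
have df x : d2 f x (- (al ^+ 2 * f x)) by exact: d2_sin_affine.
have dg y : d2 g y (- (pi ^+ 2 * g y)) by exact: d2_sin_affine.
have side sg : sg = 1 \/ sg = -1 -> forall x y, O (x, y) -> 0 <= T * (f x * g y) - sg * w x y.
  move=> sgE; have sgn c : sg * c <= `|c|.
    by case: sgE => ->; rewrite ?mul1r ?mulN1r ?ler_norm// -normrN ler_norm.
  apply: (@max_princ_sin _ O _ (5 / 4 * al) be 1 (S + 1) lam al) => //.
  - exact: open_dom_lt.
  - move=> x y [Oxy xx1]; have [cw _] := wP _ _ Oxy xx1.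
    by apply: ctnB; (apply: ctnM; first exact: ctnC) => //; exact: ctnM1.
  - by move: al4 pib; clear; qlra.
  - by rewrite expr1n.
  - by rewrite be2; move: al0 lamal; clear; nra.
  - move=> x y Oxy; split; first by case: Oxy => -[].
    have := angle _ _ Oxy; rewrite (_ : 1 * x + (S + 1) = x + S + 1); last by ring.
    rewrite -mulrA; move: al4 pib al0; clear; qlra.
  - move=> x y [Oxy xx1]; have [_ [v lv vb]] := wP _ _ Oxy xx1.
    eexists; first exact: lapB (lapZ T (lapM1 (df x) (dg y))) (lapZ sg lv).
    move=> _; rewrite [leLHS](_ : _ = - ((pi ^+ 2 + al ^+ 2 - lam) * (T * (f x * g y)))
      + sg * - (v + lam * w x y)); last by ring.
    by rewrite addrC subr_le0 fE gE; apply: le_trans (sgn _) _; rewrite normrN.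
  - move=> e e0; exists [set p | ([set p | dom phi N p /\ e <= `|w p.1 p.2|] p) /\
       0 <= (-1) * p.1 + (x1 - d / 2)]; split.
    + apply: compact_cut (van e e0) _; exact: cont_fst_aff.
    + by move=> -[x y] [[Oxy _] /= xx]; split => //=; qlra.
    + move=> x y [Oxy /= xx1] nK; have y01 : 0 < y < 1 by case: Oxy.
      rewrite fE gE; have := B0 _ _ (conj Oxy xx1) => B0'.
      have [xd|xd] := leP x (x1 - d / 2).
        have we : `|w x y| < e.
          by rewrite ltNge; apply/negP => ?; apply: nK; split => //=; qlra.
        by have := sgn (w x y); qlra.
      by have := Hd x y y01 ltac:(qlra); have := sgn (w x y); qlra.
have p1 := side 1 (or_introl erefl) x0 y0 (conj O0 x01).
have p2 := side (-1) (or_intror erefl) x0 y0 (conj O0 x01).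
by rewrite -fE -gE ler_norml; move: p1 p2; clear; qlra.
Qed.

(** With al = pi / (2 N) the sine of al (x + S + 1) is positive on the whole domain, cap included,
    so the maximum principle applies to u and to - u. This is the origin of the lower bound k N >=
    pi / 4. *)
Lemma efun_small_lam phi N S lam u : between0 phi S -> open (dom phi N) -> S + 2 <= N -> 0 <= S -> lam <= pi ^+ 2 + (pi / (4 * N)) ^+ 2 -> efun phi N lam u ->
  forall x y, dom phi N (x, y) -> u 0%N 0%N x y = 0.
Proof.
move=> phiS dO SN S0 lamN ef; have pib := @pi_bounds R.
have N0 : 0 < N by qlra.
pose al := pi / (2 * N); have al0 : 0 < al by rewrite divr_gt0 ?mulr_gt0//; qlra.
have alN : al * N = pi / 2 by rewrite /al; field; rewrite gt_eqF.
have lamal : lam <= pi ^+ 2 + al ^+ 2 / 4.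
  by rewrite (_ : al ^+ 2 / 4 = (pi / (4 * N)) ^+ 2)//; rewrite /al; field; rewrite gt_eqF.
have N2 : 2 <= N by qlra.
have alpi : al <= pi / 4 by move: alN N2 al0; clear; nra.
pose be := Num.sqrt (pi ^+ 2 - al ^+ 2 / 2).
have be2 : be ^+ 2 = pi ^+ 2 - al ^+ 2 / 2 by rewrite sqr_sqrtr//; move: al0 alpi pib; clear; nra.
have beb : 0 < be < pi.
  have be0 : 0 < be by rewrite sqrtr_gt0; move: al0 alpi pib; clear; nra.
  by rewrite be0 -(ltr_pXn2r (n := 2)) ?nnegrE ?be2//; move: be0 al0 pib; clear; nra.
have side sg : sg = 1 \/ sg = -1 -> forall x y, dom phi N (x, y) -> 0 <= sg * u 0%N 0%N x y.
  move=> sgE; apply: (@max_princ_sin _ _ _ al be 1 (S + 1) lam al) => //.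
  - by move=> x y Oxy; apply: ctnM; [exact: ctnC|have [] := ef_jets ef 0 0 Oxy].
  - by move: alpi pib; clear; qlra.
  - by rewrite expr1n.
  - by rewrite be2; move: lamal al0; clear; nra.
  - move=> x y [/= y01 xN]; split => //; have := phiS _ y01 => pS.
    have h1 : 1 <= 1 * x + (S + 1) by qlra.
    have h2 : 1 * x + (S + 1) <= 2 * N - 1 by qlra.
    apply/andP; split; first by rewrite ler_peMr// ltW.
    apply: (@le_trans _ _ (al * (2 * N - 1))); first by rewrite ler_pM2l.
    by move: alN; clear; qlra.
  - move=> x y Oxy; eexists; first exact: lapZ (lap_efun dO ef Oxy).
    by move=> _; rewrite [leLHS](_ : _ = 0)//; ring.
  - move=> e e0; exists [set p | dom phi N p /\ e <= `|u 0%N 0%N p.1 p.2|]; split.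
    + exact: (ef_van ef).
    + by move=> p [].
    + move=> x y Oxy nK; have : `|sg * u 0%N 0%N x y| <= e.
        have -> : `|sg * u 0%N 0%N x y| = `|u 0%N 0%N x y|.
          by case: sgE => ->; rewrite ?mul1r// mulN1r normrN.
        by rewrite leNgt; apply/negP => /ltW ?; apply: nK.
      by rewrite ler_norml => /andP[].
move=> x y Oxy; have := side 1 (or_introl erefl) x y Oxy.
have := side (-1) (or_intror erefl) x y Oxy; rewrite mul1r mulN1r; clear; qlra.
Qed.

End LeftBound.

Section Remainder.
Context {R : realType}.
Implicit Types (phi : R -> R) (N S lam k x y a b A B C e eta : R) (w : R -> R -> R)
  (u : nat -> nat -> R -> R -> R) (m : nat).

Lemma exp_dominates (p : nat) C e eta : 0 < e -> 0 < eta -> 0 <= C ->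
  exists2 N0 : R, 0 < N0 & forall N, N0 <= N -> C * N ^+ p * expR (- (e * N)) <= eta.
Proof.
(* exp(e N) = exp(N / q)^(p + 1) >= (N / q)^(p + 1), one power of N more than has to be beaten. *)
move=> e0 eta0 C0; pose q : R := p.+1%:R / e.
have q0 : 0 < q by rewrite divr_gt0// ltr0n.
have qp : 0 < q ^+ p.+1 by rewrite exprn_gt0.
exists ((C + 1) * q ^+ p.+1 / eta).
  by rewrite divr_gt0// mulr_gt0//; qlra.
move=> N NN; have N0 : 0 < N.
  by apply: lt_le_trans NN; rewrite divr_gt0// mulr_gt0//; qlra.
have le : (N / q) ^+ p.+1 <= expR (e * N).
  have -> : e * N = N / q * p.+1%:R.
    by rewrite /q invf_div mulrA divfK ?pnatr_eq0// mulrC.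
  rewrite expRM_natr; apply: lerXn2r; rewrite ?nnegrE ?expR_ge0 ?divr_ge0 ?ltW//.
  by apply: lt_le_trans (expR_ge1Dx _); qlra.
rewrite expRN ler_pdivrMr ?expR_gt0//.
apply: (@le_trans _ _ (eta * (N / q) ^+ p.+1)); last by rewrite ler_pM2l.
rewrite expr_div_n mulrA ler_pdivlMr// (exprS N) mulrA.
move: NN; rewrite ler_pdivrMr// => NN.
have Np : 0 < N ^+ p by rewrite exprn_gt0.
rewrite mulrAC ler_pM2r//; move: NN qp; set Z := q ^+ _; move=> NN qp.
by rewrite (mulrC eta); apply: le_trans NN; rewrite mulrDl; qlra.
Qed.

Lemma sinj2 c b n (t : R) : sinj c b n.+2 t = - (c ^+ 2 * sinj c b n t).
Proof.
rewrite /sinj -addn2 natrD mulrDl addrA (_ : 2 * (pi / 2) = pi); last by field.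
by rewrite sinD sinpi cospi mulr0 addr0 exprD; ring.
Qed.

(* The derivatives of u - A sin (k (N - x)) sin (pi y). *)
Definition remd N k A u i j x y : R :=
  1 * u i j x y + (- A) * (sinj (- k) (k * N) i x * sinj pi 0 j y).

Lemma rem00 N k A u x y :
  remd N k A u 0 0 x y = u 0%N 0%N x y - A * (sin (k * (N - x)) * sin (pi * y)).
Proof.
rewrite /remd /sinj !mul0r !addr0 !expr0 !mul1r mulNr; congr (_ - _ * (sin _ * _)); ring.
Qed.

Lemma jets_rem O N k A u : jets O u -> jets O (remd N k A u).
Proof.
move=> Ju; apply: jets_lin => //.
by apply: jets_prod => n t; exact: is_derive_sinj.
Qed.

Lemma rem_eq O N k A u lam : lam = pi ^+ 2 + k ^+ 2 ->
  (forall x y, O (x, y) -> u 2%N 0%N x y + u 0%N 2%N x y + lam * u 0%N 0%N x y = 0) ->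
  forall x y, O (x, y) ->
    remd N k A u 2 0 x y + remd N k A u 0 2 x y + lam * remd N k A u 0 0 x y = 0.
Proof.
move=> -> H x y /H E; rewrite -E /remd !sinj2; ring.
Qed.

Lemma side0_rem a N k A u : side0 a N (u 0%N 0%N) -> side0 a N (remd N k A u 0%N 0%N).
Proof.
move=> H e e0; have [d d0 Hd] := H (e / 2) ltac:(qlra).
have A1 : 0 < 1 + `|A| by rewrite ltr_wpDr.
exists (Num.min d (e / (8 * (1 + `|A|)))); first by rewrite lt_min d0 divr_gt0// mulr_gt0.
move=> x y rxy yd; have /= y01 := rxy.2.
have dE : Num.min d (e / (8 * (1 + `|A|))) <= d by rewrite ge_min lexx.
have dE' : Num.min d (e / (8 * (1 + `|A|))) <= e / (8 * (1 + `|A|)) by rewrite ge_min lexx orbT.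
rewrite rem00; apply: le_trans (ler_normB _ _) _.
have ub : `|u 0%N 0%N x y| <= e / 2 by apply: Hd rxy _; case: yd => ?; [left|right]; qlra.
suff : `|A * (sin (k * (N - x)) * sin (pi * y))| <= e / 2 by move: ub; clear; qlra.
have sy : `|sin (pi * y)| <= 4 * (e / (8 * (1 + `|A|))).
  have pib := @pi_bounds R; case: yd => yd; last rewrite -sinpiB.
    by apply: le_trans (norm_sin_le _) _; rewrite gtr0_norm; move: pib y01 yd dE'; clear; nra.
  by apply: le_trans (norm_sin_le _) _; rewrite gtr0_norm; move: pib y01 yd dE'; clear; nra.
have ss : `|sin (k * (N - x)) * sin (pi * y)| <= 4 * (e / (8 * (1 + `|A|))).
  by rewrite normrM; apply: le_trans sy; rewrite ler_piMl// sin_max.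
rewrite normrM; apply: le_trans (ler_wpM2l (normr_ge0 A) ss) _.
rewrite (_ : `|A| * (4 * (e / (8 * (1 + `|A|)))) = e / 2 * (`|A| / (1 + `|A|))); last by field; rewrite gt_eqF.
by rewrite ler_piMr ?ler_pdivrMr//; qlra.
Qed.

Lemma side0_sub a b N w : a <= b -> side0 a N w -> side0 b N w.
Proof.
move=> ab H e e0; have [d d0 Hd] := H e e0; exists d => // x y [/= x1 y1].
by apply: Hd; split => /=; qlra.
Qed.

Lemma rem_strip a N k A B lam u : lam = pi ^+ 2 + k ^+ 2 -> 0 <= k <= 1 ->
    jets (rect a N) u ->
    (forall x y, rect a N (x, y) ->
       u 2%N 0%N x y + u 0%N 2%N x y + lam * u 0%N 0%N x y = 0) ->
    (forall x y, rect a N (x, y) -> `|remd N k A u 0 0 x y| <= B) ->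
  forall x y, rect a N (x, y) -> [/\ ctn (remd N k A u 0 0) x y,
     exists2 v, lap (remd N k A u 0 0) x y v & `|v| <= 17 * B & `|remd N k A u 0 0 x y| <= B].
Proof.
move=> lamE k01 Ju Eu HB x y rxy.
have Jr := jets_rem N k A Ju; have Er := rem_eq N A lamE Eu rxy.
split; [by have [] := Jr 0%N 0%N x y rxy| |exact: HB].
eexists; first exact: jets_lap (@open_rect R a N 0 1) Jr rxy.
move: Er => /eqP; rewrite addr_eq0 => /eqP ->.
have lam17 : 0 <= lam <= 17 by have := @pi_bounds R; rewrite lamE; nra.
rewrite normrN normrM ger0_norm; last by case/andP: lam17.
by apply: ler_pM => //; [case/andP: lam17|case/andP: lam17|exact: HB].
Qed.

End Remainder.

(** * The a priori estimate for one eigenfunction *)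

Section Apriori.
Context {R : realType}.
Implicit Types (phi : R -> R) (N S lam k x y a b A B C e eta M X : R)
  (u : nat -> nat -> R -> R -> R) (m : nat).

(** [e N] plays the part of the cut-off length [L] of [strip_asymp]: longer than the cap, yet short
    compared with N / m. *)
Record large m S e N : Prop := Large {
  lg_S : 4 * m%:R * (S + 2) <= N;
  lg_m : 32 * m%:R <= N;
  lg_1 : 1 <= e * N;
  lg_e : e * N + 3 <= N / (8 * m%:R);
  lg_Se : S + 3 <= e * N }.

Lemma efun_strip_sol phi N S lam k a M u : between0 phi S -> 0 <= a ->
    efun phi N lam u -> lam = pi ^+ 2 + k ^+ 2 -> 0 <= k <= 1 ->
    (forall x y, rect a N (x, y) -> `|u 0%N 0%N x y| <= M) ->
  strip_sol a N k lam 0 M M u u /\ side_right a N (u 0%N 0%N).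
Proof.
move=> phiS a0 ef lamE k01 uM; have sub := rect_dom (N := N) phiS a0.
have lam17 : 0 <= lam <= 17 by have := @pi_bounds R; rewrite lamE; nra.
have s0 : side0 a N (u 0%N 0%N).
  by apply: vanishing_side0 (ef_van ef) _ sub => p [].
split; last by apply: vanishing_right (ef_van ef) _ sub => p [_ /andP[]].
split => //.
- exact: jets_sub sub (ef_jets ef).
- exact: jets_sub sub (ef_jets ef).
- by move=> x y /sub/(ef_eq ef); rewrite -lamE mul0r.
- by move=> x y /sub/(ef_eq ef).
Qed.

(** The amplitude for which A sin(k (N - x)) sin(pi y) agrees with [u] at (N - X, 1/2), where X = N
    / (4 m). *)
Definition amp m N k u : R := u 0%N 0%N (N - N / (4 * m%:R)) (1 / 2) / sin (k * (N / (4 * m%:R))).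

(** A bootstrap in M = max |u|. On the strip the distance to the profile is at most eta M with eta =
    C N^6 exp(- e N), so |u| is at most (|A| + 432 eta M) sin(pi y) at x near X. [cap_bound] carries
    this into the cap, whence M <= 32 m (|A| + 432 eta M), and eta is small enough to absorb the
    last term. *)
Lemma apriori m S e : (0 < m)%N -> 0 <= S -> 0 < e -> exists2 C, 0 < C &
  forall N phi lam u, between0 phi S -> open (dom phi N) -> large m S e N ->
    efun phi N lam u -> lam <= pi ^+ 2 + (m%:R * pi / N) ^+ 2 ->
    (exists x y, dom phi N (x, y) /\ u 0%N 0%N x y != 0) ->
    C * N ^+ 6 * expR (- (e * N)) <= e / (64 * 64 * (m%:R * m%:R)) -> e <= 1 / 16 ->
  exists k, let A := amp m N k u in
  [/\ lam = pi ^+ 2 + k ^+ 2, pi / 4 <= k * N <= m%:R * pi, A != 0,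
    (forall x y, dom phi N (x, y) -> `|u 0%N 0%N x y| <= 64 * m%:R * `|A|) /\
    (forall x y, dom phi N (x, y) -> x < N / (4 * m%:R) ->
      `|u 0%N 0%N x y| <= 64 * m%:R * `|A| * (sin (k * (x + S + 1)) * sin (pi * y))) &
    (forall x y, 2 * (e * N) <= x < N -> 0 < y < 1 -> `|remd N k A u 0 0 x y| <=
       64 * m%:R * (C * N ^+ 6 * expR (- (e * N))) * `|A|)].
Proof.
move=> m0 S0 e0; have [C C0 HC] := @strip_asymp R m m0; exists C => //.
move=> N phi lam u phiS dO lg ef lamN [x0 [y0 [ O0 u0] ] ] etaE e16.
set mu : R := m%:R in HC lamN etaE *; have mu1 : 1 <= mu by rewrite /mu ler1n.
have [lgS lgm lg1 lge lgSe] := lg; rewrite -/mu in lgS lgm lge.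
have pib := @pi_bounds R.
have N32 : 32 <= N by move: mu1 lgm; clear; qlra.
have N0 : 0 < N by move: N32; clear; qlra.
(* Otherwise [efun_small_lam] would make u vanish. Hence the square root k below satisfies k N >= pi
   / 4. *)
have lamlb : pi ^+ 2 + (pi / (4 * N)) ^+ 2 < lam.
  rewrite ltNge; apply/negP => le; move/eqP: u0; apply.
  by apply: (efun_small_lam phiS dO _ S0 le ef O0); move: mu1 lgS S0; clear; nra.
pose k := Num.sqrt (lam - pi ^+ 2).
have k2 : k ^+ 2 = lam - pi ^+ 2.
  by rewrite sqr_sqrtr//; have := sqr_ge0 (pi / (4 * N)); move: lamlb; clear; qlra.
have lamE : lam = pi ^+ 2 + k ^+ 2 by rewrite k2; ring.
have k0 : 0 <= k by exact: sqrtr_ge0.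
have kN : pi / 4 <= k * N <= mu * pi.
  have p4 : pi / 4 = pi / (4 * N) * N by field; rewrite gt_eqF.
  have mp : mu * pi = mu * pi / N * N by rewrite divfK ?gt_eqF.
  rewrite {1}p4 mp !ler_pM2r//; apply/andP; split.
    rewrite -(@ler_pXn2r _ 2) ?nnegrE ?divr_ge0 ?mulr_ge0 ?k2//; try by move: pib N0; clear; qlra.
    by move: lamlb; clear; qlra.
  rewrite -(@ler_pXn2r _ 2) ?nnegrE ?divr_ge0 ?mulr_ge0 ?k2//; try by move: pib N0 mu1; clear; qlra.
  by move: lamN; clear; qlra.
have kp : 0 < k.
  by rewrite lt_def k0 andbT; apply/eqP => kk; move: kN; rewrite kk mul0r; move: pib; clear; qlra.
have k8 : k <= 1 / 8.
  have : k * N <= 1 / 8 * N by move: kN pib lgm; clear; nra.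
  by rewrite ler_pM2r.
have m40 : 0 < 4 * mu by move: mu1; clear; qlra.
pose X := N / (4 * mu); have XE : X * (4 * mu) = N by rewrite /X divfK ?gt_eqF.
have lgX : e * N + 3 <= X / 2 by rewrite (_ : X / 2 = N / (8 * mu))// /X; field; move: mu1; clear; qlra.
have kNX : k * N = k * X * (4 * mu) by rewrite -XE; ring.
have kX : k * X <= pi / 4 by rewrite -(ler_pM2r m40) -kNX; move: kN; clear; qlra.
have kX8 : 1 <= 8 * mu * (k * X) by move: kN kNX pib; clear; qlra.
have X8 : 8 <= X by move: lgX lg1; clear; qlra.
have XN : 4 * X <= N by rewrite -XE; move: X8 mu1; clear; nra.
set eta := C * N ^+ 6 * expR (- (e * N)) in etaE *.
have eta0 : 0 <= eta by rewrite !mulr_ge0 ?expR_ge0 ?exprn_ge0// ltW.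
exists k; set A := amp m N k u => /=.
have [M [xM [yM [M0 OM uM Mub]]]] := vanishing_max (ef_van ef)
   (fun x y Oxy => let: And3 c _ _ := ef_jets ef 0 0 Oxy in c) O0 u0.
have sub := rect_dom (N := N) phiS (lexx 0).
have [sol sr] := efun_strip_sol phiS (lexx 0) ef lamE
   (ltac:(by rewrite k0; move: k8; clear; qlra)) (fun x y r => Mub x y (sub _ r)).
have remb x y : 2 * (e * N) <= x < N -> 0 < y < 1 -> `|remd N k A u 0 0 x y| <= eta * M.
  move=> xI y01; have := HC 0 N k lam 0 M M (e * N) u u sol sr (lexx 0) lg1 k8 kN.
  rewrite -/X => /(_ ltac:(move: lgX; clear; qlra) ltac:(move: lgX XN X8; clear; qlra)) /(_ x y).
  move=> /(_ ltac:(move: xI lgSe S0; clear; qlra) y01).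
  have -> : C * N ^+ 6 * (M * expR (- (e * N)) + `|0 : R| * M) = eta * M.
    by rewrite normr0 /eta; clear; ring.
  by rewrite rem00.
have sX : 1 <= 32 * mu * sin (k * X).
  have := @sin_ge_lin R (k * X) ltac:(move: kX kX8 mu1 pib kp X8; clear; nra).
  by move: kX8 mu1; clear; nra.
have sX0 : 0 < sin (k * X) by move: sX mu1; clear; nra.
have rsin x y : 2 * (e * N) + 1 / 2 <= x <= N - 1 / 2 -> 0 < y < 1 ->
    `|remd N k A u 0 0 x y| <= 432 * (eta * M) * sin (pi * y).
  move=> xI y01; have a0 : 0 <= 2 * (e * N) by move: lg1; clear; qlra.
  have sub2 : rect (2 * (e * N)) N `<=` rect 0 N.
    by move=> -[s t] [/= s0 t0]; split => //=; move: s0 a0; clear; qlra.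
  have rs := rem_strip (A := A) lamE (ltac:(by rewrite k0; move: k8; clear; qlra) : 0 <= k <= 1)
    (jets_sub (subset_trans sub2 sub) (ef_jets ef))
    (fun s t r => ef_eq ef (sub _ (sub2 _ r)))
    (fun s t (r : rect (2 * (e * N)) N (s, t)) => remb s t
       (ltac:(by have [/= ? _] := r; qlra)) r.2).
  have s0 : side0 (2 * (e * N)) N (remd N k A u 0%N 0%N).
    exact: side0_sub a0 (side0_rem k A (sol_W0 sol)).
  have := strip_sin rs s0 xI y01.
  by rewrite (_ : 24 * (eta * M + 17 * (eta * M)) = 432 * (eta * M)); last by clear; ring.
pose B := `|A| + 432 * (eta * M).
have eM0 : 0 <= eta * M by rewrite mulr_ge0// ltW.
have B0 : 0 <= B by have := normr_ge0 A; move: eM0; rewrite /B; clear; qlra.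
(* The cap lengthens X by S + 1 only, and k (S + 2) <= pi / 4 by [lg_S]; so all angles k (x + S + 1)
   up to x = X remain where the sine increases. *)
have keX (c : R) : 0 <= c -> c <= X + S + 1 -> k * c <= pi / 2.
  move=> c0 cX; apply: (@le_trans _ _ (k * X + k * (S + 1))).
    by rewrite -mulrDr ler_wpM2l//; move: cX; clear; qlra.
  have : k * (S + 2) * (4 * mu) <= mu * pi.
    by rewrite -mulrA; have := ler_wpM2l k0 lgS; move: kN; clear; qlra.
  rewrite (_ : k * (S + 2) * (4 * mu) = mu * (4 * (k * (S + 2)))); last by clear; ring.
  rewrite ler_pM2l; last by move: mu1; clear; qlra.
  by move: kX kp; clear; qlra.
have left x y : dom phi N (x, y) -> x < X ->
    `|u 0%N 0%N x y| <= 32 * mu * B * (sin (k * (x + S + 1)) * sin (pi * y)).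
  apply: (cap_bound phiS dO (lam := lam)) => //.
  - by rewrite lamE ltrDl exprn_gt0.
  - by rewrite lamE.
  - by apply: keX => //; move: S0 X8; clear; qlra.
  - by move: k8; clear; qlra.
  - by move: X8 XN; clear; qlra.
  - move=> s t Ost _; split; first by have [] := ef_jets ef 0 0 Ost.
    exists (- (lam * u 0%N 0%N s t)); first exact: lap_efun dO ef Ost.
    by rewrite addNr normr0 lamE subrr mul0r.
  - exact: ef_van ef.
  - by rewrite !mulr_ge0//; move: mu1; clear; qlra.
  exists 1 => // s t t01 sI; have st := sinpi_gt0 t01.
  have sI' : 2 * (e * N) + 1 / 2 <= s <= N - 1 / 2 by move: sI lgX lg1 XN X8; clear; qlra.
  have r := rsin s t sI' t01; have {r} : `|u 0%N 0%N s t| <= B * sin (pi * t).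
    rewrite -(subrK (A * (sin (k * (N - s)) * sin (pi * t))) (u 0%N 0%N s t)) -rem00.
    apply: le_trans (ler_normD _ _) _; rewrite [leLHS]addrC.
    rewrite [B * _]mulrDl; apply: lerD => //.
    rewrite (normrM A) (normrM (sin _)) (gtr0_norm st) mulrA ler_pM2r// ler_piMr ?sin_max//.
  move/le_trans; apply; rewrite mulrA ler_pM2r//.
  have ss : sin (k * X) <= sin (k * (s + S + 1)).
    apply: sin_ge_mid; first by rewrite mulr_ge0//; move: X8; clear; qlra.
    apply/andP; split; first by rewrite ler_pM2l//; move: sI S0; clear; qlra.
    have := @keX (s + S + 1) ltac:(move: sI S0 X8; clear; qlra) ltac:(move: sI; clear; qlra).
    by move: kX pib; clear; qlra.
  rewrite mulrAC -[leLHS]mul1r ler_wpM2r//; apply: le_trans sX _.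
  by rewrite ler_pM2l//; move: mu1; clear; qlra.
have mB : B <= 32 * mu * B by rewrite ler_peMl//; move: mu1; clear; qlra.
have MB : M <= 32 * mu * B.
  rewrite -uM; have [xX|xX] := ltP xM X.
    apply: le_trans (left _ _ OM xX) _; rewrite -[leRHS]mulr1; apply: ler_wpM2l.
      by rewrite !mulr_ge0//; move: mu1; clear; qlra.
    apply: le_trans (ler_norm _) _; rewrite normrM.
    by rewrite -[leRHS]mulr1 ler_pM ?sin_max.
  apply: le_trans mB; have [/= y01 /= xMN] := OM.
  have := remb xM yM ltac:(move: xX xMN lgX lg1; clear; qlra) y01; rewrite rem00 => r.
  rewrite -(subrK (A * (sin (k * (N - xM)) * sin (pi * yM))) (u 0%N 0%N xM yM)).
  apply: le_trans (ler_normD _ _) _; rewrite /B [leLHS]addrC; apply: lerD.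
    by rewrite (normrM A) ler_piMr// normrM -[leRHS]mulr1 ler_pM ?sin_max.
  by apply: le_trans r _; move: eM0; clear; qlra.
have etam : eta * (64 * 64 * (mu * mu)) <= e by rewrite -ler_pdivlMr// !mulr_gt0//; move: mu1; clear; qlra.
have h : eta * mu * (64 * 64) <= 1 / 16.
  apply: le_trans e16; apply: le_trans etam.
  rewrite (_ : eta * (64 * 64 * (mu * mu)) = eta * mu * (64 * 64) * mu); last by clear; ring.
  have h0 : 0 <= eta * mu * (64 * 64).
    by move: eta0 mu1; move: (eta) => z; clear; nra.
  by rewrite -[leLHS]mulr1 ler_wpM2l.
have MA : M <= 64 * mu * `|A|.
  have : 32 * mu * (432 * (eta * M)) <= M / 2.
    have := ler_wpM2r (ltW M0) h.
    by move: M0; clear; qlra.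
  by move: MB; rewrite /B; clear; qlra.
have etaM : eta * M <= 64 * mu * eta * `|A|.
  by have := ler_wpM2l eta0 MA; move: eta0; clear; qlra.
split => //.
- by apply/eqP => A0; move: MA; rewrite A0 normr0 mulr0 leNgt M0.
- split => x y Oxy; first exact: le_trans (Mub _ _ Oxy) MA.
  move=> xX; apply: le_trans (left _ _ Oxy xX) _.
  have [/= y01 /= xN] := Oxy; have pS := phiS _ y01.
  rewrite ler_wpM2r//.
    rewrite mulr_ge0 ?ltW ?sinpi_gt0// ?sin_gt0_pi//.
    have x1 : 0 < x + S + 1 by move: pS xN; clear; qlra.
    have := @keX (x + S + 1) (ltW x1) ltac:(move: xX; rewrite -/X; clear; qlra).
    by rewrite mulr_gt0//=; move: pib; clear; qlra.
  have : 32 * mu * (432 * (eta * M)) <= 32 * mu * `|A|.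
    rewrite ler_wpM2l//; first by move: mu1; clear; qlra.
    have := ler_wpM2r (normr_ge0 A) h; have := normr_ge0 A; move: etaM.
    by clear; qlra.
  by rewrite /B; clear; qlra.
- move=> x y xI y01; apply: le_trans (remb x y xI y01) _; exact: etaM.
Qed.

End Apriori.

(** * Classes of eigenfunctions and uniqueness inside a class *)

Section Profile.
Context {R : realType}.
Implicit Types (phi : R -> R) (N S lam k x y t e eta d X K : R)
  (u w : nat -> nat -> R -> R -> R) (m j : nat).

Record profile m S e eta N phi lam u k : Prop := Profile {
  pr_lam : lam = pi ^+ 2 + k ^+ 2;
  pr_k : pi / 4 <= k * N <= m%:R * pi;
  pr_A : amp m N k u != 0;
  pr_glob : forall x y, dom phi N (x, y) -> `|u 0%N 0%N x y| <= 64 * m%:R * `|amp m N k u|;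
  pr_cap : forall x y, dom phi N (x, y) -> x < N / (4 * m%:R) ->
    `|u 0%N 0%N x y| <= 64 * m%:R * `|amp m N k u| * (sin (k * (x + S + 1)) * sin (pi * y));
  pr_rem : forall x y, 2 * (e * N) <= x < N -> 0 < y < 1 ->
    `|remd N k (amp m N k u) u 0 0 x y| <= 64 * m%:R * eta * `|amp m N k u| }.

Lemma apriori_profile m S e : (0 < m)%N -> 0 <= S -> 0 < e -> exists2 C, 0 < C &
  forall N phi lam u, between0 phi S -> open (dom phi N) -> large m S e N ->
    efun phi N lam u -> lam <= pi ^+ 2 + (m%:R * pi / N) ^+ 2 ->
    (exists x y, dom phi N (x, y) /\ u 0%N 0%N x y != 0) ->
    C * N ^+ 6 * expR (- (e * N)) <= e / (64 * 64 * (m%:R * m%:R)) -> e <= 1 / 16 ->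
  exists k, profile m S e (C * N ^+ 6 * expR (- (e * N))) N phi lam u k.
Proof.
move=> m0 S0 e0; have [C C0 H] := @apriori R m S e m0 S0 e0; exists C => //.
move=> N phi lam u phiS dO lg ef lamN nz h e16.
by have [k /= [? ? ? [? ?] ?]] := H N phi lam u phiS dO lg ef lamN nz h e16; exists k.
Qed.

Lemma profile_range m k N : (0 < m)%N -> 32 * m%:R <= N -> pi / 4 <= k * N <= m%:R * pi ->
  [/\ 0 < k, k <= 1 / 8, k * (N / (4 * m%:R)) <= pi / 4 & 
      1 <= 32 * m%:R * sin (k * (N / (4 * m%:R)))].
Proof.
move=> m0; set mu : R := m%:R; have mu1 : 1 <= mu by rewrite /mu ler1n.
move: (mu) mu1 => {}mu mu1 lgm kN; have pib := @pi_bounds R.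
have N0 : 0 < N by move: mu1 lgm; clear; qlra.
have kp : 0 < k by rewrite -(pmulr_lgt0 _ N0); move: kN pib; clear; qlra.
have k8 : k <= 1 / 8.
  have : k * N <= 1 / 8 * N by move: kN pib lgm; clear; nra.
  by rewrite ler_pM2r.
have m40 : 0 < 4 * mu by move: mu1; clear; qlra.
pose X := N / (4 * mu); have XE : X * (4 * mu) = N by rewrite /X divfK ?gt_eqF.
have kNX : k * N = k * X * (4 * mu) by rewrite -XE; ring.
have kX : k * X <= pi / 4 by rewrite -(ler_pM2r m40) -kNX; move: kN; clear; qlra.
have kX8 : 1 <= 8 * mu * (k * X) by move: kN kNX pib; clear; qlra.
have kX0 : 0 < k * X by rewrite mulr_gt0// /X divr_gt0.
split => //; rewrite -/X.
have := @sin_ge_lin R (k * X) ltac:(move: kX kX0 pib; clear; qlra).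
by move: kX8 mu1; clear; nra.
Qed.

(** Both descriptions of u hold at x0 = 2 e N. The cap bound makes u(x0, 1/2) of size e |A|, and the
    remainder bound compares it with A sin(k (N - x0)). So this sine is O(e); as k x0 is O(e) too, k
    N is within O(e) of some j pi. The bounds pi / 4 <= k N <= m pi exclude j = 0 and j > m. *)
Lemma profile_class m S e eta N phi lam u k : (0 < m)%N -> 0 <= S -> 0 < e ->
    between0 phi S -> large m S e N -> profile m S e eta N phi lam u k ->
    0 <= eta -> eta <= e / (64 * 64 * (m%:R * m%:R)) -> 64 * 64 * (m%:R * m%:R) * e <= 1 / 4 ->
  exists j, (0 < j <= m)%N /\ `|k * N - j%:R * pi| <= 64 * 64 * (m%:R * m%:R) * e.
Proof.
move=> m0 S0 e0 phiS lg pr eta0.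
have mu1 : 1 <= m%:R :> R by rewrite ler1n.
have [_ k0 _ _] := profile_range m0 (lg_m lg) (pr_k pr).
have [kp k8 kX sX] := profile_range m0 (lg_m lg) (pr_k pr).
case: lg pr; set A := amp m N k u; move: (mu1); set mu : R := m%:R => {}mu1.
move=> lgS lgm lg1 lge lgSe [lamE kN A0 _ cap remb] etae e4.
rewrite -/mu -/A in A0 cap remb kN.
have pib := @pi_bounds R.
have N0 : 0 < N by move: mu1 lgm; clear; qlra.
have muN : N / (8 * mu) <= N / (4 * mu).
  by rewrite ler_pM2l// lef_pV2 ?posrE; move: mu1; clear; qlra.
have NX : N / (4 * mu) <= N by rewrite ler_pdivrMr; move: mu1 N0; clear; nra.
pose x0 := 2 * (e * N).
have mu40 : 0 < 4 * mu by move: mu1; clear; qlra.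
have eX : 2 * (e * N) + 6 <= N / (4 * mu).
  have : N / (4 * mu) = 2 * (N / (8 * mu)) by field; move: mu1; clear; qlra.
  by move: lge; clear; qlra.
have y01 : 0 < (1 / 2 : R) < 1 by qlra.
have s12 : sin (pi * (1 / 2)) = 1 :> R by rewrite mul1r sin_pihalf.
have Ox0 : dom phi N (x0, 1 / 2).
  by apply: (rect_dom phiS (lexx 0)); split => //=; move: lg1 eX NX; rewrite /x0; clear; qlra.
have c0 := cap x0 (1 / 2) Ox0 ltac:(move: eX; rewrite /x0; clear; qlra).
have r0 := remb x0 (1 / 2) ltac:(move: eX NX; rewrite /x0; clear; qlra) y01.
rewrite rem00 in r0; rewrite s12 !mulr1 in r0 c0.
have kx0 : k * x0 <= 8 * mu * e.
  have : k * x0 = 2 * e * (k * N) by rewrite /x0; ring.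
  have := ler_wpM2l (ltW e0) (proj2 (andP kN)); move: pib mu1 e0 => pib mu1 e0.
  have : mu * pi <= 4 * mu by move: pib mu1; clear; nra.
  by move=> h1 /le_trans h2; have := h2 _ (ler_wpM2l (ltW e0) h1); clear; qlra.
have kx03 : k * (x0 + S + 1) <= 12 * mu * e.
  have : k * (x0 + S + 1) <= k * (x0 + e * N) by rewrite ler_pM2l//; move: lgSe; clear; qlra.
  have : k * (x0 + e * N) = k * x0 + k * x0 / 2 by rewrite /x0; field.
  by move: kx0; clear; qlra.
have s0 : sin (k * (x0 + S + 1)) <= 12 * mu * e.
  apply: le_trans (ler_norm _) _; apply: le_trans (norm_sin_le _) _; rewrite gtr0_norm//.
  by rewrite mulr_gt0//; move: S0 lg1; rewrite /x0; clear; qlra.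
have eta64 : 64 * mu * eta <= e.
  have h : eta * (64 * 64 * (mu * mu)) <= e by rewrite -ler_pdivlMr// !mulr_gt0//; move: mu1; clear; qlra.
  apply: le_trans h; rewrite (_ : eta * (64 * 64 * (mu * mu)) = 64 * mu * eta * (64 * mu)); last by clear; ring.
  rewrite -[leLHS]mulr1 ler_wpM2l//; first by rewrite !mulr_ge0//; move: mu1; clear; qlra.
  by move: mu1; clear; qlra.
have An : 0 < `|A| by rewrite normr_gt0.
have sk : `|sin (k * (N - x0))| <= 769 * (mu * mu * e).
  rewrite -(ler_pM2l An) -normrM.
  have : `|A * sin (k * (N - x0))| <= 64 * mu * eta * `|A| + 64 * mu * `|A| * sin (k * (x0 + S + 1)).
    move: r0 c0; rewrite (ler_distlC (u 0%N 0%N x0 (1 / 2))) !ler_norml.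
    by move: (A * sin _) (u 0%N 0%N _ _) (64 * mu * eta * `|A|) (64 * mu * `|A| * _) => a b c d; clear; qlra.
  move/le_trans; apply.
  have e1 : e <= mu * mu * e := ler_peMl (ltW e0) (mulr_ege1 mu1 mu1).
  have := ler_wpM2l (ltW An) eta64; have := ler_wpM2l (ltW An) e1.
  have mA : 0 <= 64 * mu * `|A| by rewrite !mulr_ge0//; move: mu1; clear; qlra.
  by have := ler_wpM2l mA s0; clear; qlra.
have kNx : 0 < k * (N - x0) by rewrite mulr_gt0//; move: eX NX; rewrite /x0; clear; qlra.
have [j jP] := sin_small kNx sk; exists j.
have jb : `|k * N - j%:R * pi| <= 64 * 64 * (mu * mu) * e.
  have kx00 : 0 < k * x0 by rewrite mulr_gt0// /x0; move: lg1; clear; qlra.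
  have mm : 8 * mu * e <= 8 * (mu * mu * e).
    have me : 0 <= mu * e by rewrite mulr_ge0 ?ltW//; move: mu1; clear; qlra.
    by have := ler_peMl me mu1; clear; qlra.
  have mme : 0 < mu * mu * e by rewrite !mulr_gt0//; move: mu1; clear; qlra.
  move: jP; rewrite !ler_norml mulrBr; move: kx0 kx00 mm mme.
  by move: (k * N) (k * x0) (j%:R * pi) => a b c; clear; qlra.
split => //; move: jb => /le_trans/(_ e4); rewrite ler_norml => jb.
rewrite lt0n -ltnS; apply/andP; split.
  by apply/eqP => jE; move: jb; rewrite jE mul0r; move: kN pib; clear; qlra.
rewrite -(@ltr_nat R) -(@natr1 R m) -/mu -(@ltr_pM2r _ pi); last by move: pib; clear; qlra.
by rewrite mulrDl mul1r; move: kN jb pib; clear; qlra.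
Qed.

(** The profile in t = N - x, normalised to 1 at t = X. [k] comes last because the function is
    differentiated in [k]. *)
Definition ratio X t k : R := sin (k * t) / sin (k * X).

Lemma is_derive_ratio X t k : sin (k * X) != 0 ->
  is_derive k 1 (ratio X t)
    ((t * cos (k * t) * sin (k * X) - X * sin (k * t) * cos (k * X)) / sin (k * X) ^+ 2).
Proof.
move=> s0; have ds c : is_derive k 1 (fun z : R => sin (z * c)) (c * cos (k * c)).
  have := @is_derive_affine _ (@sin R) c 0 k (cos (k * c)); rewrite addr0 (mulrC c k).
  under eq_fun do rewrite addr0 (mulrC c); apply; exact: is_derive_sin.
have dV := is_deriveV s0 (ds X).
apply: is_derive_eq (is_deriveM (ds t) dV) _.
by rewrite /GRing.scale/=; field.
Qed.

Lemma ratio_lip m N k k' t : (0 < m)%N -> 32 * m%:R <= N ->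
    pi / 4 <= k * N <= m%:R * pi -> pi / 4 <= k' * N <= m%:R * pi -> 0 <= t <= N ->
  `|ratio (N / (4 * m%:R)) t k' - ratio (N / (4 * m%:R)) t k| <=
    2048 * (m%:R * m%:R) * N * `|k' - k|.
Proof.
move=> m0 lgm kN kN' tN; have mu1 : 1 <= m%:R :> R by rewrite ler1n.
have N0 : 0 < N by move: mu1 lgm; clear; qlra.
pose X := N / (4 * m%:R); apply: (@mvt_le _ _ (fun z =>
  (t * cos (z * t) * sin (z * X) - X * sin (z * t) * cos (z * X)) / sin (z * X) ^+ 2)) => z zI.
have zN : pi / 4 <= z * N <= m%:R * pi.
  move: zI; rewrite /Num.min /Num.max; case: ifP => _ /andP[h1 h2];
  by have := ler_wpM2r (ltW N0) h1; have := ler_wpM2r (ltW N0) h2; move: kN kN'; clear; qlra.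
have [_ _ _ sX] := profile_range m0 lgm zN; rewrite -/X in sX *.
move: mu1 lgm sX; set mu : R := m%:R => mu1 lgm sX.
have sX0 : 0 < sin (z * X) by move: sX mu1; clear; nra.
split; first by apply: is_derive_ratio; rewrite gt_eqF.
have X0 : 0 <= X <= N.
  have m4 : 0 < 4 * mu by move: mu1; clear; qlra.
  rewrite /X -/mu divr_ge0 ?(ltW m4) ?(ltW N0)//= ler_pdivrMr//.
  by move: mu1 N0; clear; nra.
rewrite normrM normfV (ger0_norm (sqr_ge0 _)) ler_pdivrMr ?exprn_gt0//.
have nn (a b c : R) : 0 <= a <= N -> `|b| <= 1 -> `|c| <= 1 -> `|a * b * c| <= N.
  move=> /andP[a0 aN] b1 c1; rewrite !normrM (ger0_norm a0) -mulrA -[leRHS]mulr1.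
  by apply: ler_pM => //; rewrite -[leRHS]mulr1; apply: ler_pM.
apply: le_trans (ler_normB _ _) _.
apply: (@le_trans _ _ (N + N)); first by apply: lerD; apply: nn; rewrite ?sin_max ?cos_max.
have sq : 1 <= (32 * mu * sin (z * X)) ^+ 2 by rewrite expr_ge1 ?(le_trans ler01 sX).
have -> : 2048 * (mu * mu) * N * sin (z * X) ^+ 2 = 2 * N * (32 * mu * sin (z * X)) ^+ 2.
  by clear; ring.
by have := ler_wpM2l (ltW N0) sq; clear; qlra.
Qed.

(* At distance about j pi / k from the right end, where sin (k t) nearly
   vanishes, the normalised profile is still sensitive to k. *)
Lemma ratio_sep m N k k' t (j : nat) d : (0 < m)%N -> 32 * m%:R <= N ->
    pi / 4 <= k * N <= m%:R * pi -> pi / 4 <= k' * N <= m%:R * pi -> N / 2 <= t <= N ->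
    `|k * t - j%:R * pi| <= d -> `|k' * t - j%:R * pi| <= d -> d <= 1 / 64 ->
  N / (256 * m%:R) * `|k' - k| <=
  `|ratio (N / (4 * m%:R)) t k' - ratio (N / (4 * m%:R)) t k|.
Proof.
move=> m0 lgm; wlog kk : k k' / k < k'.
  move=> H kN kN' tN jk jk' d64.
  have [/H|/H|->] := ltgtP k k'; [exact|by move=> /(_ kN' kN tN jk' jk d64); rewrite distrC [leRHS]distrC|].
  by rewrite !subrr normr0 mulr0.
move=> kN kN' tN jk jk' d64; have mu1 : 1 <= m%:R :> R by rewrite ler1n.
have N0 : 0 < N by move: mu1 lgm; clear; qlra.
have zN z : k <= z <= k' -> pi / 4 <= z * N <= m%:R * pi.
  move=> /andP[h1 h2]; have := ler_wpM2r (ltW N0) h1; have := ler_wpM2r (ltW N0) h2.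
  by move: kN kN'; clear; qlra.
set X := N / (4 * m%:R); have dz z : k <= z <= k' -> 0 < sin (z * X) /\ is_derive z 1 (ratio X t)
    ((t * cos (z * t) * sin (z * X) - X * sin (z * t) * cos (z * X)) / sin (z * X) ^+ 2).
  move=> zI; have [_ _ _ sX] := profile_range m0 lgm (zN z zI).
  have sX0 : 0 < sin (z * X) by rewrite -/X in sX; move: sX mu1; move: (m%:R) => mu; clear; nra.
  by split => //; apply: is_derive_ratio; rewrite gt_eqF.
have [c ckk ->] := mvt kk (fun z zI => (dz z zI).2).
have cI : k <= c <= k' by move: ckk; clear; qlra.
rewrite normrM ler_wpM2r//; have [sX0 _] := dz c cI.
have [_ _ _] := profile_range m0 lgm (zN c cI); rewrite -/X => sX.
have t0 : 0 < t by move: tN N0; clear; qlra.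
have jc : `|c * t - j%:R * pi| <= d.
  have h1 : k * t < c * t by rewrite ltr_pM2r//; case/andP: ckk.
  have h2 : c * t < k' * t by rewrite ltr_pM2r//; case/andP: ckk.
  by move: jk jk' h1 h2; rewrite !ler_norml; clear; qlra.
have sc : `|sin (c * t)| <= 1 / 64.
  by rewrite -(sinB_natpi j); apply: le_trans (norm_sin_le _) _; exact: le_trans jc d64.
have cc : 1 / 2 <= `|cos (c * t)|.
  rewrite -(@ler_pXn2r _ 2) ?nnegrE// real_normK ?num_real// cos2sin2.
  have : sin (c * t) ^+ 2 <= (1 / 64) ^+ 2.
    by rewrite -real_normK ?num_real// lerXn2r ?nnegrE//; clear; qlra.
  by clear; qlra.
rewrite normrM normfV (ger0_norm (sqr_ge0 _)) ler_pdivlMr ?exprn_gt0//.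
have [mu40 X0 XE] : [/\ 0 < 4 * (m%:R : R), 0 < X & X * (4 * m%:R) = N].
  have m4 : 0 < 4 * (m%:R : R) by move: mu1; clear; qlra.
  by rewrite /X divfK ?gt_eqF// divr_gt0.
(* In the numerator of the derivative the term with cos(c t) wins: |cos(c t)| >= 1/2 and t >= N / 2,
   whereas |sin(c t)| <= 1/64. *)
have b1 : N / 4 * sin (c * X) <= `|t * cos (c * t) * sin (c * X)|.
  rewrite !normrM (gtr0_norm sX0) ler_pM2r// gtr0_norm//.
  have : t * (1 / 2) <= t * `|cos (c * t)| by rewrite ler_pM2l.
  by move: tN; clear; qlra.
have b2 : `|X * sin (c * t) * cos (c * X)| <= X / 64.
  rewrite (normrM (X * _)) (normrM X) (gtr0_norm X0) -mulrA ler_pM2l//.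
  by rewrite -[leRHS]mulr1; apply: ler_pM => //; [rewrite -div1r|exact: cos_max].
have b3 : `|t * cos (c * t) * sin (c * X)| - `|X * sin (c * t) * cos (c * X)| <=
   `|t * cos (c * t) * sin (c * X) - X * sin (c * t) * cos (c * X)| by exact: lerB_dist.
apply: le_trans b3; have s1 : sin (c * X) <= 1 by exact: sin_le1.
have b4 : N / (256 * m%:R) * sin (c * X) ^+ 2 <= N / 4 * sin (c * X) / 2.
  have -> : N / (256 * m%:R) = X / 64 by rewrite -XE; field; rewrite pnatr_eq0 -lt0n.
  rewrite -XE; move: mu1 sX0 s1 X0; set mu : R := m%:R; move: (sin _) => s.
  move=> mu1 sX0 s1 X0; have : s ^+ 2 <= s by rewrite expr2 ler_piMr// ltW.
  move=> /(ler_wpM2l (ltW X0)); have : X * s <= X * s * mu by rewrite ler_peMr// mulr_ge0// ltW.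
  have : 0 < X * s by rewrite mulr_gt0.
  by clear; qlra.
have b5 : X / 64 <= N / 4 * sin (c * X) / 2.
  rewrite -XE; have := ler_wpM2l (ltW X0) sX; clear; qlra.
by move: b1 b2 b4 b5; clear; qlra.
Qed.

Lemma vanishing_lin (O : set (R * R)) c d (u v : R -> R -> R) :
    (forall x y, O (x, y) -> ctn u x y /\ ctn v x y) ->
  vanishing O u -> vanishing O v -> vanishing O (fun x y => c * u x y + d * v x y).
Proof.
move=> cuv vu vv e e0; pose f := e / (2 * (1 + `|c| + `|d|)).
have n0 : 0 < 1 + `|c| + `|d| by rewrite -addrA ltr_wpDr// addr_ge0.
have f0 : 0 < f by rewrite divr_gt0// mulr_gt0.
have cK := compactU (vu f f0) (vv f f0); set K := _ `|` _ in cK.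
have KO p : K p -> O p by case=> -[].
pose h (p : R * R) := `|c * u p.1 p.2 + d * v p.1 p.2|.
have := @compact_ge _ _ h e cK; have -> : [set p | K p /\ e <= h p] =
    [set p | O p /\ e <= `|c * u p.1 p.2 + d * v p.1 p.2|].
  apply/seteqP; split => -[x y] [Kp eh]; split => //; first exact: KO.
  apply: contrapT => /not_orP[/not_andP[//|/negP]]; rewrite -ltNge => uf /not_andP[//|/negP].
  rewrite -ltNge => vf; move: eh; rewrite leNgt => /negP; apply.
  apply: le_lt_trans (ler_normD _ _) _; rewrite !normrM.
  have := ler_wpM2l (normr_ge0 c) (ltW uf); have := ler_wpM2l (normr_ge0 d) (ltW vf).
  have : (1 + `|c| + `|d|) * f = e / 2 by rewrite /f; field; rewrite gt_eqF.
  by move: f0 e0; rewrite !mulrDl /=; clear; qlra.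
apply; move=> [x y] /KO/cuv[cu cv]; apply: cvg_norm.
by apply: cvgD; (apply: cvgM; first exact: cvg_cst).
Qed.

Lemma efun_lin phi N lam c d u v : efun phi N lam u -> efun phi N lam v ->
  efun phi N lam (fun i j x y => c * u i j x y + d * v i j x y).
Proof.
move=> [Ju Eu Vu] [Jv Ev Vv]; split.
- exact: jets_lin.
- move=> x y Oxy; have := Eu _ _ Oxy; have := Ev _ _ Oxy => E1 E2.
  rewrite [LHS](_ : _ = c * (u 2%N 0%N x y + u 0%N 2%N x y + lam * u 0%N 0%N x y) +
    d * (v 2%N 0%N x y + v 0%N 2%N x y + lam * v 0%N 0%N x y)); last by ring.
  by rewrite E1 E2 !mulr0 addr0.
- apply: vanishing_lin => // x y Oxy; split; first by have [] := Ju 0%N 0%N _ _ Oxy.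
  by have [] := Jv 0%N 0%N _ _ Oxy.
Qed.

Lemma side0_lin a b c d (u v : R -> R -> R) : side0 a b u -> side0 a b v ->
  side0 a b (fun x y => c * u x y + d * v x y).
Proof.
move=> su sv e e0; pose f := e / (2 * (1 + `|c| + `|d|)).
have n0 : 0 < 1 + `|c| + `|d| by rewrite -addrA ltr_wpDr// addr_ge0.
have f0 : 0 < f by rewrite divr_gt0// mulr_gt0.
have [d1 d10 H1] := su f f0; have [d2 d20 H2] := sv f f0.
exists (Num.min d1 d2); first by rewrite lt_min d10.
move=> x y rxy yd; have l1 : Num.min d1 d2 <= d1 by rewrite ge_min lexx.
have l2 : Num.min d1 d2 <= d2 by rewrite ge_min lexx orbT.
have uf : `|u x y| <= f by apply: H1 rxy _; case: yd => ?; [left|right]; qlra.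
have vf : `|v x y| <= f by apply: H2 rxy _; case: yd => ?; [left|right]; qlra.
apply: le_trans (ler_normD _ _) _; rewrite !normrM.
have := ler_wpM2l (normr_ge0 c) uf; have := ler_wpM2l (normr_ge0 d) vf.
have : (1 + `|c| + `|d|) * f = e / 2 by rewrite /f; field; rewrite gt_eqF.
by move: f0 e0; rewrite !mulrDl /=; clear; qlra.
Qed.

Lemma side_right_lin a b c d (u v : R -> R -> R) : side_right a b u -> side_right a b v ->
  side_right a b (fun x y => c * u x y + d * v x y).
Proof.
move=> su sv e e0; pose f := e / (2 * (1 + `|c| + `|d|)).
have n0 : 0 < 1 + `|c| + `|d| by rewrite -addrA ltr_wpDr// addr_ge0.
have f0 : 0 < f by rewrite divr_gt0// mulr_gt0.
have [d1 d10 H1] := su f f0; have [d2 d20 H2] := sv f f0.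
exists (Num.min d1 d2); first by rewrite lt_min d10.
move=> x y rxy yd; have l1 : Num.min d1 d2 <= d1 by rewrite ge_min lexx.
have l2 : Num.min d1 d2 <= d2 by rewrite ge_min lexx orbT.
have uf : `|u x y| <= f by apply: H1 rxy _; qlra.
have vf : `|v x y| <= f by apply: H2 rxy _; qlra.
apply: le_trans (ler_normD _ _) _; rewrite !normrM.
have := ler_wpM2l (normr_ge0 c) uf; have := ler_wpM2l (normr_ge0 d) vf.
have : (1 + `|c| + `|d|) * f = e / 2 by rewrite /f; field; rewrite gt_eqF.
by move: f0 e0; rewrite !mulrDl /=; clear; qlra.
Qed.

Lemma side_right_rem a N k A u : side_right a N (u 0%N 0%N) ->
  side_right a N (remd N k A u 0%N 0%N).
Proof.
move=> su e e0; have [d1 d10 H1] := su (e / 2) ltac:(qlra).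
have c0 : 0 < 1 + `|A| * `|k| by rewrite ltr_wpDr// mulr_ge0.
pose d2 := e / (2 * (1 + `|A| * `|k|)); have d20 : 0 < d2 by rewrite divr_gt0// mulr_gt0.
exists (Num.min d1 d2); first by rewrite lt_min d10.
move=> x y rxy xd; have l1 : Num.min d1 d2 <= d1 by rewrite ge_min lexx.
have l2 : Num.min d1 d2 <= d2 by rewrite ge_min lexx orbT.
have uf : `|u 0%N 0%N x y| <= e / 2 by apply: H1 rxy _; qlra.
rewrite rem00; apply: le_trans (ler_normB _ _) _.
have [/= /andP[_ xN] _] := rxy; have Nx : `|N - x| <= d2 by rewrite gtr0_norm; qlra.
have sn : `|sin (k * (N - x)) * sin (pi * y)| <= `|k| * d2.
  rewrite normrM -[leRHS]mulr1; apply: ler_pM => //; last exact: sin_max.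
  by apply: le_trans (norm_sin_le _) _; rewrite normrM ler_wpM2l.
have : `|A * (sin (k * (N - x)) * sin (pi * y))| <= `|A| * (`|k| * d2).
  by rewrite normrM ler_wpM2l.
have : (1 + `|A| * `|k|) * d2 = e / 2 by rewrite /d2; field; rewrite gt_eqF.
by move: d20 uf; clear; qlra.
Qed.

(** Let w = u - u', M = max |w| and d = |k - k'|. On the strip w is the difference W of the
    remainders minus a difference of ratios. The former is at most tau, of order N^7 (exp(- e N) +
    eta) (M + d), the latter is O(N d). [cap_bound] extends this to the cap, giving M <= 2 K N d.
    Just outside the cap w is even O(e) N d, but there [ratio_sep] bounds it below by N d / (256 m)
    up to tau. For small e this is impossible unless w = 0. *)
Lemma class_unique m S : (0 < m)%N -> 0 <= S -> exists2 C, 0 < C &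
  forall e eta N phi lam lam' u u' k k' j, 0 < e -> between0 phi S -> open (dom phi N) ->
    large m S e N -> efun phi N lam u -> efun phi N lam' u' ->
    profile m S e eta N phi lam u k -> profile m S e eta N phi lam' u' k' ->
    u 0%N 0%N (N - N / (4 * m%:R)) (1 / 2) = 1 ->
    u' 0%N 0%N (N - N / (4 * m%:R)) (1 / 2) = 1 ->
    `|k * N - j%:R * pi| <= 64 * 64 * (m%:R * m%:R) * e ->
    `|k' * N - j%:R * pi| <= 64 * 64 * (m%:R * m%:R) * e -> 0 <= eta ->
    let K := 512 * 1024 * (m%:R * m%:R * m%:R) in
    K * (64 * 64 * 16 * (m%:R * m%:R)) * e <= 1 ->
    K * (64 * 64 * (m%:R * m%:R)) * (C * N ^+ 7 * (expR (- (e * N)) + eta)) <= 1 ->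
  lam = lam' /\ forall x y, dom phi N (x, y) -> u 0%N 0%N x y = u' 0%N 0%N x y.
Proof.
move=> m0 S0; have [C0 C00 asym] := @strip_asymp R m m0; exists (C0 + 1); first qlra.
move=> e eta N phi lam lam' u u' k k' j e0 phiS dO lg ef ef' pr pr' u1 u1' kj kj' eta0.
move: u1 u1' kj kj' pr pr' asym (lg); rewrite /=; set mu : R := m%:R.
have mu1 : 1 <= mu by rewrite /mu ler1n.
set X := N / (4 * mu); set K := 512 * _ * _.
move=> u1 u1' kj kj' pr pr' asym [lgS lgm lg1 _ lgSe] eK hK; rewrite -/mu in lgS lgm.
have pib := @pi_bounds R.
have [kp k8 kX sX] := profile_range m0 lgm (pr_k pr); rewrite -/mu -/X in kX sX.
have [kp' k8' kX' sX'] := profile_range m0 lgm (pr_k pr'); rewrite -/mu -/X in kX' sX'.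
have [lamE kN A0 _ _ remb] := pr; have [lamE' kN' A0' _ cap' remb'] := pr'.
have sX0 : 0 < sin (k * X) by move: sX mu1; clear; nra.
have sX0' : 0 < sin (k' * X) by move: sX' mu1; clear; nra.
have mm1 : 1 <= mu * mu := mulr_ege1 mu1 mu1.
have [c2 c20 c2E] : exists2 c, 0 < c & 2048 * (mu * mu) = c.
  by eexists; last reflexivity; move: mm1; clear; qlra.
have mmm1 : 1 <= mu * mu * mu := mulr_ege1 mm1 mu1.
have K1 : 512 * 1024 <= K by rewrite /K; move: mmm1; clear; qlra.
have Kmm : 512 * 1024 * (mu * mu) <= K.
  by rewrite /K; have := ler_peMr (le_trans ler01 mm1) mu1; clear; qlra.
have Km : 512 * 1024 * mu <= K.
  have mm : mu <= mu * mu by rewrite ler_peMr// (le_trans ler01).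
  by move: Kmm mm; clear; qlra.
have N32 : 32 <= N by move: mu1 lgm; clear; qlra.
have N0 : 0 < N by move: N32; clear; qlra.
have m40 : 0 < 4 * mu by move: mu1; clear; qlra.
have XE : X * (4 * mu) = N by rewrite /X divfK ?gt_eqF.
have X0 : 0 < X by rewrite /X divr_gt0.
set E := e * N in lg1 lgSe remb remb' cap'.
have emm : 512 * 1024 * (64 * 64 * 16) * ((mu * mu) * e) <= 1.
  have h0 : 0 <= (mu * mu) * e by rewrite !mulr_ge0 ?(ltW e0)// (le_trans ler01).
  by have := ler_wpM2r h0 K1; move: eK; clear; qlra.
have EX : 96 * E <= X.
  rewrite -(ler_pM2r m40) XE /E.
  have : mu * e <= mu * mu * e by rewrite ler_wpM2r ?(ltW e0)// ler_peMr// (le_trans ler01).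
  move=> h; have := ler_wpM2r (ltW N0) (le_trans (ler_wpM2l (ltac:(clear; qlra) : 0 <= 512 * 1024 * (64 * 64 * 16) :> R) h) emm).
  by move: N0; clear; nra.
have emmk : 64 * K * mu * e * (1024 * mu) <= 1.
  by apply: le_trans eK; rewrite le_eqVlt; apply/orP; left; apply/eqP; clear; ring.
have F1 : 128 * mu * c2 <= K.
  rewrite -c2E /K; have : 0 <= mu * mu * mu by rewrite (le_trans ler01).
  by clear; qlra.
have F2 : 256 * c2 <= K by rewrite -c2E; move: Kmm mm1; clear; qlra.
have F3 : 512 * 1024 * mu <= K by [].
have K0 : 0 < K by move: F2 c20; clear; qlra.
clearbody K.
have XN : 4 * X <= N by rewrite -XE; have := ler_wpM2l (ltW X0) mu1; clear; qlra.
pose A := amp m N k u; pose A' := amp m N k' u'.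
have AE : A = (sin (k * X))^-1 by rewrite /A /amp -/mu -/X u1 mul1r.
have AE' : A' = (sin (k' * X))^-1 by rewrite /A' /amp -/mu -/X u1' mul1r.
rewrite -/A -/mu in remb A0; rewrite -/A' -/mu -/X in remb' A0' cap'.
have Ab' : `|A'| <= 32 * mu.
  by rewrite AE' gtr0_norm ?invr_gt0// -[leLHS]div1r ler_pdivrMr.
pose d := `|k' - k|; have d0 : 0 <= d by exact: normr_ge0.
pose kk := Num.max k k'; have kk0 : 0 < kk by rewrite /kk lt_max kp.
have kkk : k <= kk /\ k' <= kk by rewrite /kk !le_max !lexx orbT.
have kkX : kk * X <= pi / 4 by rewrite /kk /Num.max; case: ifP.
have kk8 : kk <= 1 / 8 by rewrite /kk /Num.max; case: ifP.
have kkN : pi / 4 <= kk * N <= mu * pi by rewrite /kk /Num.max; case: ifP.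
have deE : `|lam' - lam| <= 2 * kk * d.
  have -> : lam' - lam = (k' - k) * (k + k') by rewrite lamE lamE'; ring.
  rewrite normrM mulrC ler_wpM2r// gtr0_norm; last by move: kp kp'; clear; qlra.
  by move: kkk; clear; qlra.
pose w i j x y := 1 * u i j x y + (-1) * u' i j x y.
(* Comparing the remainders instead of u and u' replaces the source (lam' - lam) u' by lam' - lam
   times a remainder, which has the small factor eta. Moreover W vanishes at (N - X, 1/2), so its
   own amplitude in [strip_asymp] is zero. *)
pose W i j x y := 1 * remd N k A u i j x y + (-1) * remd N k' A' u' i j x y.
have wW x y : w 0%N 0%N x y = W 0%N 0%N x y - (ratio X (N - x) k' - ratio X (N - x) k) * sin (pi * y).
  by rewrite /W /w !rem00 AE AE' /ratio; ring.
have rl x y : 0 <= x <= N -> 0 < y < 1 ->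
  `|(ratio X (N - x) k' - ratio X (N - x) k) * sin (pi * y)| <= c2 * N * d * sin (pi * y).
  move=> xN y01; have sy := sinpi_gt0 y01; rewrite normrM (gtr0_norm sy) ler_pM2r//.
  by rewrite -c2E; apply: (ratio_lip m0 lgm kN kN'); move: xN; clear; qlra.
have sin1 y : sin (pi * y) <= 1 :> R by exact: sin_le1.
have rl1 x y : 0 <= x <= N -> 0 < y < 1 ->
  `|(ratio X (N - x) k' - ratio X (N - x) k) * sin (pi * y)| <= c2 * N * d.
  move=> xN y01; apply: le_trans (rl x y xN y01) _; rewrite ler_piMr//.
  by rewrite !mulr_ge0// ltW.
have Jw : jets (dom phi N) w by apply: jets_lin (ef_jets ef) (ef_jets ef').
have vw : vanishing (dom phi N) (w 0%N 0%N).
  apply: vanishing_lin (ef_van ef) (ef_van ef') => x y Oxy.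
  by have [? _ _] := ef_jets ef 0 0 Oxy; have [? _ _] := ef_jets ef' 0 0 Oxy.
have sub := rect_dom (N := N) phiS (lexx 0).
have Opt : dom phi N (N - X, 1 / 2).
  by apply: sub; split => /=; move: X0 XN N0; clear; qlra.
have [[x0 [y0 [ O0 w0] ] ]|nz] := pselect (exists x y, dom phi N (x, y) /\ w 0%N 0%N x y != 0); last first.
  have wz x y : dom phi N (x, y) -> w 0%N 0%N x y = 0.
    by move=> Oxy; apply/eqP/negPn/negP => h; apply: nz; exists x, y.
  split; last by move=> x y /wz; rewrite /w mul1r mulN1r => /eqP; rewrite subr_eq0 => /eqP.
  (* All derivatives of u and u' agree too, so their two equations at a point where both functions
     are 1 force lam = lam'. *)
  have := jets0 dO Jw wz; move=> jz.
  have := ef_eq ef Opt; have := ef_eq ef' Opt; rewrite u1 u1'.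
  have := jz 2%N 0%N _ _ Opt; have := jz 0%N 2%N _ _ Opt; rewrite /w.
  by clear; qlra.
exfalso; have [M [xM [yM [M0 OM wM Mub] ] ] ] := vanishing_max vw
   (fun x y Oxy => let: And3 c _ _ := Jw 0%N 0%N x y Oxy in c) O0 w0.
pose T' := 64 * mu * eta * `|A'|.
pose MW := M + c2 * N * d.
have lam17 : 0 <= lam' <= 17 by rewrite lamE'; move: pib kp' k8'; clear; nra.
have lam17' : 0 <= lam <= 17 by rewrite lamE; move: pib kp k8; clear; nra.
have E20 : 0 <= 2 * E by move: lg1; clear; qlra.
have subE : rect (2 * E) N `<=` dom phi N by exact: rect_dom phiS E20.
have side uu : vanishing (dom phi N) uu -> side0 (2 * E) N uu.
  by move=> v; apply: vanishing_side0 v _ subE => p [].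
have sol : strip_sol (2 * E) N k lam' (lam' - lam) MW T' W (remd N k' A' u').
  have Jr : jets (rect (2 * E) N) (remd N k A u) by exact/jets_rem/(jets_sub subE)/(ef_jets ef).
  have Jr' : jets (rect (2 * E) N) (remd N k' A' u') by exact/jets_rem/(jets_sub subE)/(ef_jets ef').
  split => //.
  - by move: kp k8; clear; qlra.
  - exact: jets_lin.
  - move=> x y rxy; rewrite -lamE /W.
    have := @rem_eq _ _ N k A u lam lamE (fun x y => @ef_eq _ _ _ _ _ ef x y) x y (subE _ rxy).
    have := @rem_eq _ _ N k' A' u' lam' lamE' (fun x y => @ef_eq _ _ _ _ _ ef' x y) x y (subE _ rxy).
    by clear; qlra.
  - exact: rem_eq lamE' (fun x y rxy => ef_eq ef' (subE _ rxy)).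
  - move=> x y rxy; have := wW x y; have [/= xI y01] := rxy => /eqP.
    rewrite eq_sym subr_eq => /eqP ->; apply: le_trans (ler_normD _ _) _; apply: lerD.
      exact: Mub (subE _ rxy).
    by apply: rl1 => //; move: xI E20; clear; qlra.
  - by move=> x y [/= xI y01]; apply: remb' => //; move: xI; clear; qlra.
  - by apply: side0_lin; apply: side0_rem; apply: side; [exact: ef_van ef|exact: ef_van ef'].
  - by apply: side0_rem; apply: side; exact: ef_van ef'.
have sr : side_right (2 * E) N (W 0%N 0%N).
  by apply: side_right_lin; apply: side_right_rem;
    [apply: vanishing_right (ef_van ef) _ subE|apply: vanishing_right (ef_van ef') _ subE] => p [_ /andP[]].
have T'E : T' <= c2 * eta.
  rewrite /T' -c2E; have := ler_wpM2l (mulr_ge0 (le_trans ler01 mu1) eta0) Ab'; clear; qlra.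
have T'0 : 0 <= T' by rewrite /T' !mulr_ge0//; move: mu1; clear; qlra.
set de := lam' - lam in deE sol.
pose tau := (C0 + 1) * N ^+ 6 * (MW * expR (- E) + `|de| * T').
have N6 : 1 <= N ^+ 6 by rewrite exprn_ege1//; move: N32; clear; qlra.
have MW0 : 0 <= MW.
  by apply: addr_ge0; [exact: ltW|rewrite mulr_ge0// mulr_ge0// ltW].
have in0 : 0 <= MW * expR (- E) + `|de| * T' by rewrite addr_ge0 ?mulr_ge0 ?expR_ge0.
have C01 : 1 <= (C0 + 1) * N ^+ 6 by apply: mulr_ege1 => //; move: C00; clear; qlra.
have detau : `|de| * T' <= tau.
  have h : `|de| * T' <= MW * expR (- E) + `|de| * T' by rewrite lerDr mulr_ge0 ?expR_ge0.
  by apply: le_trans h _; rewrite /tau ler_peMl.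
have tau0 : 0 <= tau by apply: le_trans detau; rewrite mulr_ge0.
have s12 : sin (pi * (1 / 2)) = 1 :> R by rewrite mul1r sin_pihalf.
have Wtau x y : 3 * E + 3 / 2 <= x < N -> 0 < y < 1 -> `|W 0%N 0%N x y| <= tau.
  move=> xI y01; have := asym _ _ _ _ _ _ _ E _ _ sol sr E20 lg1 k8 kN.
  rewrite -/X => /(_ ltac:(move: EX lg1; clear; qlra) ltac:(move: EX lg1 XN; clear; qlra)) /(_ x y).
  move=> /(_ ltac:(move: xI; clear; qlra) y01).
  have -> : W 0%N 0%N (N - X) (1 / 2) = 0.
    rewrite /W !rem00 s12 u1 u1' AE AE' (_ : N - (N - X) = X); last by clear; ring.
    by rewrite !mulr1 !mulVf ?gt_eqF// subrr !mulr0 addr0.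
  rewrite !mul0r subr0 => /le_trans; apply; rewrite /tau ler_wpM2r//.
  by rewrite ler_wpM2r ?(le_trans ler01)//; clear; qlra.
have sub3 : rect (3 * E + 3 / 2) N `<=` rect (2 * E) N.
  by move=> -[x y] [/= xI y01]; split => //=; move: xI lg1; clear; qlra.
have Wsin x y : 3 * E + 2 <= x <= N - 1 / 2 -> 0 < y < 1 ->
    `|W 0%N 0%N x y| <= 456 * tau * sin (pi * y).
  move=> xI y01; have -> : 456 * tau = 24 * (tau + 18 * tau) by clear; ring.
  apply: (@strip_sin _ (3 * E + 3 / 2) N) => //; last by move: xI; clear; qlra.
  - move=> s t rst; have [/= sI t01] := rst.
    have Wt : `|W 0%N 0%N s t| <= tau by apply: Wtau => //; move: sI; clear; qlra.
    split => //; first by have [] := sol_W sol 0 0 (sub3 _ rst).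
    eexists; first exact: jets_lap (@open_rect R (2 * E) N 0 1) (sol_W sol) (sub3 _ rst).
    rewrite (canRL (addrK _) (sol_eqW sol (sub3 _ rst))).
    apply: le_trans (ler_normB _ _) _; have -> : 18 * tau = tau + 17 * tau by clear; ring.
    apply: lerD; last first.
      rewrite normrM -lamE ger0_norm; last by case/andP: lam17'.
      by apply: ler_pM => //; case/andP: lam17'.
    by rewrite normrM; apply: le_trans detau; rewrite ler_wpM2l// (sol_T sol)//; exact: sub3.
  - exact: side0_sub (ltac:(move: lg1; clear; qlra) : 2 * E <= 3 * E + 3 / 2) (sol_W0 sol).
(* Twice the larger of k and k': the surplus pi^2 + al^2 - lam >= 3 kk^2 allowed by [cap_bound]
   absorbs the source (lam' - lam) u' in the cap, where |lam' - lam| <= 2 kk d. *)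
pose al := 2 * kk; pose T := K * (N * d + tau).
have Nd0 : 0 <= N * d by rewrite mulr_ge0// ltW.
have T0 : 0 <= T by rewrite /T mulr_ge0 ?addr_ge0// ltW.
have kX8 : 1 <= 8 * mu * (k * X) by move: kN pib; rewrite -XE; clear; qlra.
have angle x y : dom phi N (x, y) -> x < X / 4 -> 0 < x + S + 1 /\ al * (x + S + 1) <= pi / 2.
  move=> [/= y01 xN] xX; have pS := phiS _ y01; split; first by move: pS xN; clear; qlra.
  apply: (@le_trans _ _ (al * X)); last by move: kkX; rewrite /al; clear; qlra.
  by rewrite ler_pM2l ?mulr_gt0//; move: xX lgSe EX lg1; clear; qlra.
have left x y : dom phi N (x, y) -> x < X / 4 ->
    `|w 0%N 0%N x y| <= T * (sin (al * (x + S + 1)) * sin (pi * y)).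
  apply: (cap_bound phiS dO (lam := lam)) => //.
  - by rewrite lamE ltrDl exprn_gt0.
  - by rewrite lamE lerD2l; apply: lerXn2r; rewrite ?nnegrE /al; move: kkk kp kk0; clear; qlra.
  - by rewrite mulr_gt0.
  - apply: (@le_trans _ _ (al * X)); last by move: kkX; rewrite /al; clear; qlra.
    by rewrite ler_pM2l ?mulr_gt0//; move: lgSe EX lg1; clear; qlra.
  - by rewrite /al; move: kk8; clear; qlra.
  - by move: X0 XN; clear; qlra.
  - move=> s t Ost sX4; have [cw _ _] := Jw 0%N 0%N s t Ost; split => //.
    eexists; first exact: jets_lap dO Jw Ost.
    rewrite (_ : w 2%N 0%N s t + w 0%N 2%N s t + _ = de * u' 0%N 0%N s t); last first.
      by have := ef_eq ef Ost; have := ef_eq ef' Ost; rewrite /w /de; clear; qlra.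
    have [/= t01 sN] := Ost; have st := sinpi_gt0 t01; have [sS alS] := angle _ _ Ost sX4.
    have c' := cap' s t Ost ltac:(move: sX4 X0; clear; qlra).
    set P := sin (al * (s + S + 1)) * sin (pi * t).
    have P0 : 0 <= P.
      by rewrite mulr_ge0 ?(ltW st)// ltW// sin_gt0_pi// mulr_gt0 ?mulr_gt0//=; move: alS pib; clear; qlra.
    have kP : sin (k' * (s + S + 1)) * sin (pi * t) <= P.
      rewrite ler_wpM2r ?(ltW st)//; apply: sin_ge_mid; first by rewrite mulr_ge0 ?ltW.
      apply/andP; split; first by rewrite ler_pM2r// /al; move: kkk kk0; clear; qlra.
      have : k' * (s + S + 1) <= al * (s + S + 1) by rewrite ler_pM2r// /al; move: kkk kk0; clear; qlra.
      by move: alS; clear; qlra.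
    have uP : `|u' 0%N 0%N s t| <= c2 * P.
      have b1 : 0 <= 64 * mu * `|A'| by rewrite !mulr_ge0//; move: mu1; clear; qlra.
      have b2 : 0 <= sin (k' * (s + S + 1)) * sin (pi * t).
        rewrite mulr_ge0 ?(ltW st)// ltW// sin_gt0_pi// mulr_gt0//=.
        by have := ler_wpM2r (ltW sS) kkk.2; have := mulr_gt0 kk0 sS; move: alS pib; rewrite /al; clear; qlra.
      have b3 : 64 * mu * `|A'| <= c2 by rewrite -c2E; have := ler_wpM2l (le_trans ler01 mu1) Ab'; clear; qlra.
      exact: le_trans c' (ler_pM b1 b2 b3 kP).
    rewrite normrM; apply: (@le_trans _ _ (2 * kk * d * (c2 * P))).
      by apply: ler_pM.
    rewrite mulrA (mulrA _ T) ler_wpM2r//.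
    have h1 : 3 * (kk * kk) <= pi ^+ 2 + al ^+ 2 - lam.
      have : k * k <= kk * kk by apply: ler_pM => //; rewrite ?(ltW kp)//; case: kkk.
      by rewrite lamE /al; clear; qlra.
    apply: le_trans (ler_wpM2r T0 h1).
    have TN : 256 * c2 * (N * d) <= T.
      have := ler_wpM2r Nd0 F2; have := mulr_ge0 (ltW K0) tau0; rewrite /T; clear; qlra.
    have kk2 : 0 <= 3 * (kk * kk) by rewrite !mulr_ge0// ltW.
    apply: le_trans (ler_wpM2l kk2 TN).
    have h2 : 1 / 2 <= kk * N by move: kkN pib; clear; qlra.
    have h3 : 0 <= kk * c2 * d by rewrite !mulr_ge0// ltW.
    by have := ler_wpM2l h3 h2; move: h3; clear; qlra.
  - exists 1 => // s t t01 sI; have st := sinpi_gt0 t01.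
    have sI' : 3 * E + 2 <= s <= N - 1 / 2 by move: sI EX XN lg1; clear; qlra.
    have r1 := Wsin s t sI' t01.
    have r2 := rl s t ltac:(move: sI' lg1; clear; qlra) t01.
    rewrite wW; apply: le_trans (ler_normB _ _) _.
    rewrite mulrA; apply: (@le_trans _ _ ((456 * tau + c2 * N * d) * sin (pi * t))).
      by move: r1 r2; rewrite (mulrDl _ _ (sin _)); clear; qlra.
    rewrite ler_pM2r//.
    have a1 : k * X / 2 <= al * (s + S + 1).
      have : k * (X / 4) <= kk * (s + S + 1).
        by apply: ler_pM; rewrite ?(ltW kp)//; [move: X0; clear; qlra|case: kkk|move: sI S0; clear; qlra].
      by rewrite /al; clear; qlra.
    have a2 : al * (s + S + 1) <= pi / 2.
      apply: (@le_trans _ _ (al * X)); last by move: kkX; rewrite /al; clear; qlra.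
      by rewrite ler_pM2l ?mulr_gt0//; move: sI lgSe EX lg1; clear; qlra.
    have kX0 : 0 < k * X by rewrite mulr_gt0.
    have := @sin_ge_lin R (al * (s + S + 1)) ltac:(move: a1 a2 kX0; clear; qlra) => sl.
    have mu0 : 0 < mu by move: mu1; clear; qlra.
    have s64 : 1 <= 64 * mu * sin (al * (s + S + 1)).
      have := ler_wpM2l (ltW mu0) sl; have := ler_wpM2l (ltW mu0) a1; move: kX8; clear; qlra.
    rewrite /T -(@ler_pM2l _ (64 * mu)) ?mulr_gt0//.
    have NT : 0 <= K * (N * d + tau) by [].
    have := ler_wpM2l NT s64.
    have := ler_wpM2r Nd0 F1; have := ler_wpM2r tau0 F3; have := mulr_ge0 (ltW mu0) tau0.
    have := mulr_ge0 (mulr_ge0 (ltW mu0) (ltW c20)) Nd0.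
    by clear; qlra.
have sn1 (a b : R) : sin a * sin b <= 1.
  by apply: le_trans (ler_norm _) _; rewrite normrM -[leRHS]mulr1; apply: ler_pM => //; exact: sin_max.
have K1' : 1 <= K by move: F3 mu1; clear; qlra.
have MT : M <= T.
  rewrite -wM; have [xX|xX] := ltP xM (X / 4).
    apply: le_trans (left _ _ OM xX) _; rewrite -[leRHS]mulr1; exact: ler_wpM2l.
  have [/= y01 xMN] := OM.
  have r1 := Wtau xM yM ltac:(move: xX xMN EX lg1; clear; qlra) y01.
  have r2 := rl1 xM yM ltac:(move: xX xMN X0; clear; qlra) y01.
  rewrite wW; apply: le_trans (ler_normB _ _) _.
  have := ler_wpM2r Nd0 F2; have := ler_wpM2r tau0 K1'; move: r1 r2 (mulr_ge0 (ltW c20) Nd0).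
  by rewrite /T; clear; qlra.
pose h := (C0 + 1) * N ^+ 7 * (expR (- E) + eta).
have h0 : 0 <= h.
  by rewrite /h mulr_ge0 ?addr_ge0 ?expR_ge0// mulr_ge0 ?exprn_ge0 ?(ltW N0)//; move: C00; clear; qlra.
have tauh : tau <= h * (M + c2 * d).
  have -> : h * (M + c2 * d) = (C0 + 1) * N ^+ 6 * (N * (expR (- E) + eta) * (M + c2 * d)).
    by rewrite /h; clear; ring.
  rewrite /tau ler_wpM2l ?(le_trans ler01 C01)//.
  have c2d : 0 <= c2 * d by rewrite mulr_ge0// ltW.
  have x0' := expR_ge0 (- E); have N1 : 1 <= N by move: N32; clear; qlra.
  have e1 : `|de| * T' <= d * (c2 * eta).
    by apply: ler_pM => //; apply: le_trans deE _; rewrite ler_piMl//; move: kk8; clear; qlra.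
  have e2 := ler_wpM2r (mulr_ge0 x0' (ltW M0)) N1.
  have e3 := ler_wpM2r (mulr_ge0 eta0 (mulr_ge0 (ltW c20) d0)) N1.
  have e4 := mulr_ge0 (mulr_ge0 (ltW N0) eta0) (ltW M0).
  by rewrite /MW; move: e1 e2 e3 e4; clear; qlra.
have hK4 : h * K * (64 * 64 * (mu * mu)) <= 1.
  by apply: le_trans hK; rewrite le_eqVlt; apply/orP; left; apply/eqP; rewrite /h; clear; ring.
have hK0 : 0 <= h * K by rewrite mulr_ge0// ltW.
have hK1 : h * K <= 1 / (64 * 64).
  by have := ler_wpM2l hK0 mm1; move: hK4; clear; qlra.
have hKc : h * K * c2 <= 1 / 2 by rewrite -c2E; move: hK4; clear; qlra.
have Ktau : K * tau <= M / (64 * 64) + d / 2.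
  have := ler_wpM2l (ltW K0) tauh; have := ler_wpM2r (ltW M0) hK1; have := ler_wpM2r d0 hKc.
  by clear; qlra.
have dq : 32 * d <= N * d by rewrite ler_wpM2r.
have KNd : N * d <= K * (N * d) by rewrite ler_peMl.
have M2 : M <= 2 * (K * (N * d)).
  by move: MT; rewrite /T; move: Ktau dq KNd d0 Nd0; clear; qlra.
have q0 : 0 < N * d.
  rewrite lt_def Nd0 andbT; apply/eqP => q; move: M2; rewrite q !mulr0; move: M0; clear; qlra.
have taumu : tau * (64 * 64 * mu) <= 3 * (N * d).
  have hKm : h * K * (64 * 64 * mu) <= 1.
    apply: le_trans hK4; rewrite ler_wpM2l//.
    by have := ler_peMr (le_trans ler01 mu1) mu1; clear; qlra.
  have t1 : tau <= h * K * (2 * (N * d)) + h * K * d.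
    apply: le_trans tauh _; have := ler_wpM2l h0 M2.
    have := ler_wpM2l (mulr_ge0 h0 d0) (le_trans (ltac:(move: c20; clear; qlra) : c2 <= 256 * c2) F2).
    by clear; qlra.
  have mm0 : 0 <= 64 * 64 * mu by move: mu1; clear; qlra.
  have := ler_wpM2r mm0 t1; have := ler_wpM2r Nd0 hKm; have := ler_wpM2r d0 hKm.
  by move: dq d0; clear; qlra.
have T2 : T <= 2 * (K * (N * d)).
  by rewrite /T; move: Ktau M2 dq KNd d0 Nd0; clear; qlra.
(* The point of the contradiction: x < X / 4, so the cap bound [left] applies with an angle O(e),
   and [Wtau] already holds there. *)
pose xl := 3 * E + 2.
have y01 : 0 < (1 / 2 : R) < 1 by clear; qlra.
have Oxl : dom phi N (xl, 1 / 2).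
  by apply: sub; split => //=; move: lg1 EX XN X0; rewrite /xl; clear; qlra.
have wl := left xl (1 / 2) Oxl ltac:(move: EX lg1; rewrite /xl; clear; qlra).
rewrite s12 mulr1 in wl.
have alx : al * (xl + S + 1) <= 32 * mu * e.
  apply: (@le_trans _ _ (al * (4 * E))); first by rewrite ler_pM2l ?mulr_gt0//; move: lgSe; rewrite /xl; clear; qlra.
  have -> : al * (4 * E) = 8 * e * (kk * N) by rewrite /al /E; clear; ring.
  have : mu * pi <= 4 * mu by move: pib mu1; clear; nra.
  move=> h1; have := ler_wpM2l (ltW e0) (le_trans (proj2 (andP kkN)) h1); clear; qlra.
have wl2 : `|w 0%N 0%N xl (1 / 2)| * (1024 * mu) <= N * d.
  have sl : sin (al * (xl + S + 1)) <= 32 * mu * e.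
    apply: le_trans alx; apply: le_trans (ler_norm _) _; apply: le_trans (norm_sin_le _) _.
    by rewrite ger0_norm// mulr_ge0 ?mulr_ge0 ?(ltW kk0)//; move: lg1 S0; rewrite /xl; clear; qlra.
  have me0 : 0 <= 32 * mu * e by rewrite !mulr_ge0 ?(ltW e0)//; move: mu1; clear; qlra.
  have w1 := le_trans wl (ler_wpM2l T0 sl); have w2 := le_trans w1 (ler_wpM2r me0 T2).
  have mm0 : 0 <= 1024 * mu by move: mu1; clear; qlra.
  by have := ler_wpM2r mm0 w2; have := ler_wpM2r Nd0 emmk; clear; qlra.
have jb kz : 0 < kz -> kz * N <= mu * pi -> `|kz * N - j%:R * pi| <= 64 * 64 * (mu * mu) * e ->
    `|kz * (N - xl) - j%:R * pi| <= 1 / 64.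
  move=> kz0 kzN; have h1 : 0 <= kz * xl by rewrite mulr_ge0 ?(ltW kz0)//; move: lg1; rewrite /xl; clear; qlra.
  have h2 : kz * xl <= 20 * (mu * mu * e).
    apply: (@le_trans _ _ (kz * (5 * E))); first by rewrite ler_pM2l//; move: lg1; rewrite /xl; clear; qlra.
    have -> : kz * (5 * E) = 5 * e * (kz * N) by rewrite /E; clear; ring.
    have h3 : mu * pi <= 4 * mu by move: pib mu1; clear; nra.
    have := ler_wpM2l (ltW e0) (le_trans kzN h3).
    by have := ler_wpM2r (ltW e0) (ler_peMl (le_trans ler01 mu1) mu1); clear; qlra.
  rewrite !ler_norml mulrBr; move: h1 h2 emm.
  by move: (kz * N) (kz * xl) (j%:R * pi) => a b c; clear; qlra.
have := @ratio_sep m N k k' (N - xl) j (1 / 64) m0 lgm kN kN' ltac:(move: EX XN lg1 X0; rewrite /xl; clear; qlra)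
  (jb k kp (proj2 (andP kN)) kj) (jb k' kp' (proj2 (andP kN')) kj') (lexx _).
rewrite -/mu -/X -/d; have := wW xl (1 / 2); rewrite s12 mulr1.
have := Wtau xl (1 / 2) ltac:(move: EX XN lg1 X0; rewrite /xl; clear; qlra) y01.
set r := ratio X (N - xl) k' - _ => Wt wr rs.
have mu0 : 0 < mu by move: mu1; clear; qlra.
have rb : `|r| <= `|w 0%N 0%N xl (1 / 2)| + tau.
  have -> : r = W 0%N 0%N xl (1 / 2) - w 0%N 0%N xl (1 / 2) by rewrite wr; clear; ring.
  by apply: le_trans (ler_normB _ _) _; rewrite addrC lerD2l.
have : N * d <= 256 * mu * (`|w 0%N 0%N xl (1 / 2)| + tau).
  have -> : N * d = 256 * mu * (N / (256 * mu) * d) by field; rewrite gt_eqF.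
  have m256 : 0 <= 256 * mu by move: mu0; clear; qlra.
  exact: ler_wpM2l m256 _ _ (le_trans rs rb).
by move: wl2 taumu q0; clear; qlra.
Qed.

End Profile.

(** * Finite differences and their limits *)

Section Grid.
Context {R : realType}.
Implicit Types (a b h r M L P t x y : R) (F G g : nat -> nat -> R) (i j n k : nat).

Definition D1 a F i j := (F i.+1 j - F i j) / a.
Definition D2 b F i j := (F i j.+1 - F i j) / b.

(* The five-point Laplacian centred at (i.+1, j.+1). *)
Definition dlap a b F i j := D1 a (D1 a F) i j.+1 + D2 b (D2 b F) i.+1 j.

Lemma dlapE a b F i j : dlap a b F i j =
  (F i.+2 j.+1 + F i j.+1 - 2 * F i.+1 j.+1) / a / a +
  (F i.+1 j.+2 + F i.+1 j - 2 * F i.+1 j.+1) / b / b.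
Proof. by rewrite /dlap /D1 /D2 -!mulrBl; congr (_ / _ / _ + _ / _ / _); ring. Qed.

Lemma finite_min (D : pred (nat * nat)) m n g p0 :
  (forall p, D p -> (p.1 < m)%N && (p.2 < n)%N) -> D p0 ->
  exists2 p, D p & forall q, D q -> g p.1 p.2 <= g q.1 q.2.
Proof.
move=> Db D0; have /andP[h1 h2] := Db _ D0.
pose f (p : 'I_m * 'I_n) : nat * nat := (p.1 : nat, p.2 : nat).
have D0' : D (f (Ordinal h1, Ordinal h2)) by rewrite /f /= -surjective_pairing.
case: (@arg_minP _ _ _ (Ordinal h1, Ordinal h2) (fun p => D (f p)) (fun p => g p.1 p.2) D0').
move=> p Dp Hp; exists (f p) => // q Dq; have /andP[q1 q2] := Db _ Dq.
by apply: (Hp (Ordinal q1, Ordinal q2)); rewrite /f /= -surjective_pairing.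
Qed.

Lemma sdiff_min (g0 gp gm : R) h : 0 < h -> g0 <= gp -> g0 <= gm -> 0 <= (gp + gm - 2 * g0) / h / h.
Proof. by move=> h0 p1 p2; rewrite !divr_ge0 ?(ltW h0)//; qlra. Qed.

(* Odd reflection at the midpoint of i0 and i0.+1, and comparison on the half
   box with the barrier P (Y^2 + 3 X r - 2 X^2 + a^2) / r^2. *)
Lemma grid_diff_le a b r M L F i0 j0 n k : 0 < a -> 0 < b -> 0 < r -> 4 * a <= r -> 0 < M ->
    0 <= L -> r <= n%:R * a <= r + a -> r <= k%:R * b -> (n <= i0)%N -> (k <= j0)%N ->
    (forall i j, (i0 - n <= i <= i0 + n.+1)%N -> (j0 - k <= j <= j0 + k)%N -> `|F i j| <= M) ->
    (forall i j, (i0 - n <= i)%N -> (i.+2 <= i0 + n.+1)%N -> (j0 - k <= j)%N -> (j.+2 <= j0 + k)%N ->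
      `|dlap a b F i j| <= L) ->
  F i0.+1 j0 - F i0 j0 <= 2 * a * (8 * M + 2 * L * r ^+ 2) / r.
Proof.
move=> a0 b0 r0 ar M0 L0 nr kr ni kj FM FL.
pose P := 8 * M + 2 * L * r ^+ 2.
have r20 : 0 < r ^+ 2 by rewrite exprn_gt0.
have P0 : 0 < P by rewrite ltr_pwDl ?mulr_gt0// mulr_ge0 ?mulr_ge0// ltW.
pose q := P / r ^+ 2; have q0 : 0 < q by rewrite divr_gt0.
have qr : q * r ^+ 2 = P by rewrite /q divfK// gt_eqF.
pose X i : R := (i%:R + 1 / 2) * a.
pose be (x y : R) := q * (y ^+ 2 + 3 * (x * r) - 2 * x ^+ 2 + a ^+ 2).
pose Y j : R := (j%:R - j0%:R) * b.
pose w i j := F (i0 + i).+1 j - F (i0 - i)%N j.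
pose g i j := be (X i) (Y j) - w i j.
pose D := [pred p : nat * nat | (p.1 < n)%N && (j0 - k < p.2 < j0 + k)%N].
have n0 : (0 < n)%N by rewrite lt0n; apply/eqP => n0; move: nr; rewrite n0 mul0r; qlra.
have k0 : (0 < k)%N by rewrite lt0n; apply/eqP => k0; move: kr; rewrite k0 mul0r; qlra.
have D00 : D (0%N, j0) by rewrite /D /= n0/= ltn_subLR// -addn1 addnC leq_add2r k0 -[X in (X < _)%N]addn0 ltn_add2l k0.
have Db p : D p -> (p.1 < n)%N && (p.2 < (j0 + k))%N by move=> /andP[-> /andP[_ ->]].
suff g0 : 0 <= g 0%N j0.
  move: g0; rewrite /g /w /be /X /Y subrr mul0r expr0n addn0 subn0 add0r /=.
  have -> : 2 * a * (8 * M + 2 * L * r ^+ 2) / r = q * (2 * a * r).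
    by rewrite /q /P; field; rewrite gt_eqF.
  have ra : 0 <= r - a by qlra.
  have aq := mulr_ge0 (mulr_ge0 (ltW q0) (ltW a0)) ra.
  have aq2 := mulr_ge0 (mulr_ge0 (ltW q0) (ltW a0)) (ltW a0).
  by move: aq aq2; clear; qlra.
rewrite leNgt; apply/negP => gneg.
have [[i j] /= /andP[/= iN /andP[j1 j2]] gmin] := finite_min g Db D00.
have gij : g i j < 0 by apply: le_lt_trans gneg; exact: gmin D00.
have bX i' : (i' <= n)%N -> 0 <= X i' <= 3 / 2 * r.
  move=> i'n; have i'n' : i'%:R * a <= n%:R * a by rewrite ler_pM2r// ler_nat.
  have : 0 <= i'%:R * a by rewrite mulr_ge0// ltW.
  by rewrite /X; move: ar nr a0 i'n'; clear; qlra.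
have be0 x y : 0 <= x <= 3 / 2 * r -> 0 <= be x y.
  move=> x0; rewrite /be mulr_ge0 ?(ltW q0)//.
  have h1 : 0 <= x * (3 * r - 2 * x) by rewrite mulr_ge0//; move: x0; clear; qlra.
  by have := sqr_ge0 y; have := sqr_ge0 a; move: h1; clear; qlra.
have wM i' j' : (i' <= n)%N -> (j0 - k <= j' <= j0 + k)%N -> `|w i' j'| <= 2 * M.
  move=> i'n j'k; apply: le_trans (ler_normB _ _) _.
  have h1 := @FM (i0 + i').+1 j' ltac:(move: i'n; clear; lia) j'k.
  have h2 := @FM (i0 - i')%N j' ltac:(move: i'n; clear; lia) j'k.
  by move: h1 h2; clear; qlra.
have gb i' j' : (i' <= n)%N -> (j0 - k <= j' <= j0 + k)%N -> g i j <= g i' j'.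
  move=> i'n j'k; have [Dij|nD] := boolP (D (i', j')); first exact: gmin Dij.
  apply: (le_trans (ltW gij)); rewrite /g subr_ge0.
  apply: (le_trans (ler_norm _)); apply: le_trans (wM _ _ i'n j'k) _.
  have bb : be (X i') (Y j') >= P / 4 -> 2 * M <= be (X i') (Y j').
    apply: le_trans; rewrite /P; have : 0 <= L * r ^+ 2 by rewrite mulr_ge0// ltW.
    by move: M0; clear; qlra.
  apply: bb; have xb := bX i' i'n.
  have h1 : 0 <= X i' * (3 * r - 2 * X i') by rewrite mulr_ge0//; move: xb; clear; qlra.
  have [i'E|i'n'] := eqVneq i' n.
    have xr : r <= X i' <= 11 / 8 * r.
      by rewrite /X i'E; move: nr a0 ar; clear; qlra.
    rewrite /be -qr -mulrA ler_pM2l//.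
    have h2 : 0 <= (X i' - r) * (11 / 8 * r - X i') by rewrite mulr_ge0//; move: xr; clear; qlra.
    have h3 : 0 <= r * (X i' - r) by rewrite mulr_ge0 ?(ltW r0)//; move: xr; clear; qlra.
    have h4 : 0 <= r * (11 / 8 * r - X i') by rewrite mulr_ge0 ?(ltW r0)//; move: xr; clear; qlra.
    by have := sqr_ge0 (Y j'); have := sqr_ge0 a; move: h2 h3 h4; clear; qlra.
  have yk : r ^+ 2 <= Y j' ^+ 2.
    have kb : r <= `|Y j'|.
      have jj : j' = (j0 - k)%N \/ j' = (j0 + k)%N.
        by move: nD; rewrite /D /=; move: i'n i'n' j'k; clear; lia.
      apply: (le_trans kr); rewrite /Y normrM (gtr0_norm b0) ler_pM2r//.
      by case: jj => ->; rewrite ?natrD ?natrB// addrAC subrr add0r ?normrN normr_nat.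
    by rewrite -(real_normK (num_real (Y j'))) lerXn2r ?nnegrE ?(ltW r0).
  rewrite /be -qr -mulrA ler_pM2l//.
  by have := sqr_ge0 a; move: yk h1 r20; clear; qlra.
have [j' jE] : exists j', j = j'.+1 by exists j.-1; rewrite prednK//; move: j1; clear; lia.
have ii0 : (i < i0)%N by exact: leq_trans iN ni.
(* The value of [w] in the column to the left. For i = 0 that column lies beyond the mirror, and
   oddness makes the value - w(0, j). *)
pose wm := F (i0 + i)%N j - F (i0 - i).+1 j.
have gm : g i j <= be (X i - a) (Y j) - wm.
  case E : i => [|i']; last first.
    have -> : be (X i'.+1 - a) (Y j) - wm = g i' j.
      rewrite /g /w /wm E addnS subnS prednK ?subn_gt0; last by move: ii0; rewrite E; clear; lia.
      by congr (be _ _ - _); rewrite /X -natr1; ring.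
    by rewrite -E; apply: gb; [move: iN; rewrite E; clear; lia|move: j1 j2; clear; lia].
  rewrite -E; have -> : wm = - w i j by rewrite /wm /w E addn0 subn0; ring.
  have wb : be (X i) (Y j) <= w i j by move: gij; rewrite /g subr_lt0 => /ltW.
  suff : 0 <= be (X i) (Y j) + be (X i - a) (Y j).
    by rewrite /g; move: wb; clear; qlra.
  rewrite /be /X E add0r.
  have h1 : 0 <= q * Y j ^+ 2 by rewrite mulr_ge0 ?(ltW q0) ?sqr_ge0.
  have h2 : 0 <= q * a ^+ 2 by rewrite mulr_ge0 ?(ltW q0) ?sqr_ge0.
  by move: h1 h2; clear; qlra.
have s1 := sdiff_min a0 (gb i.+1 j iN ltac:(move: j1 j2; clear; lia)) gm.
have s2 := sdiff_min b0 (gb i j.+1 (ltnW iN) ltac:(move: j1 j2; clear; lia))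
   (gb i j' (ltnW iN) ltac:(move: j1 j2; rewrite jE; clear; lia)).
have l1 := FL (i0 + i)%N j' ltac:(clear; lia) ltac:(move: iN; clear; lia)
   ltac:(move: j1; rewrite jE; clear; lia) ltac:(move: j2; rewrite jE; clear; lia).
have l2 := FL (i0 - i.+1)%N j' ltac:(move: iN; clear; lia) ltac:(move: iN; clear; lia)
   ltac:(move: j1; rewrite jE; clear; lia) ltac:(move: j2; rewrite jE; clear; lia).
have e1 : (i0 - i.+1).+1 = (i0 - i)%N by move: ii0; clear; lia.
have sE : (g i.+1 j + (be (X i - a) (Y j) - wm) - 2 * g i j) / a / a +
   (g i j.+1 + g i j' - 2 * g i j) / b / b =
   - 2 * q - dlap a b F (i0 + i) j' + dlap a b F (i0 - i.+1) j'.
  rewrite !dlapE -jE e1 /g /w /wm /be /X /Y jE addnS -!natr1.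
  by field; rewrite !gt_eqF.
have q2 : 2 * L < 2 * q.
  rewrite ltr_pM2l// /q ltr_pdivlMr// /P; have : 0 <= L * r ^+ 2 by rewrite mulr_ge0// ltW.
  by move: M0; clear; qlra.
move: l1 l2; rewrite !ler_norml; move: s1 s2 sE q2; clear; qlra.
Qed.

Lemma dlapN a b F i j : dlap a b (fun i j => - F i j) i j = - dlap a b F i j.
Proof. by rewrite !dlapE; ring. Qed.

Lemma grid_grad1 a b r M L F i0 j0 n k : 0 < a -> 0 < b -> 0 < r -> 4 * a <= r -> 0 < M ->
    0 <= L -> r <= n%:R * a <= r + a -> r <= k%:R * b -> (n <= i0)%N -> (k <= j0)%N ->
    (forall i j, (i0 - n <= i <= i0 + n.+1)%N -> (j0 - k <= j <= j0 + k)%N -> `|F i j| <= M) ->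
    (forall i j, (i0 - n <= i)%N -> (i.+2 <= i0 + n.+1)%N -> (j0 - k <= j)%N -> (j.+2 <= j0 + k)%N ->
      `|dlap a b F i j| <= L) ->
  `|D1 a F i0 j0| <= 2 * (8 * M + 2 * L * r ^+ 2) / r.
Proof.
move=> a0 b0 r0 ar M0 L0 nr kr ni kj FM FL.
rewrite /D1 normrM normfV (gtr0_norm a0) ler_pdivrMr//.
have E : 2 * (8 * M + 2 * L * r ^+ 2) / r * a = 2 * a * (8 * M + 2 * L * r ^+ 2) / r by ring.
have h1 := grid_diff_le a0 b0 r0 ar M0 L0 nr kr ni kj FM FL.
have := @grid_diff_le a b r M L (fun i j => - F i j) i0 j0 n k a0 b0 r0 ar M0 L0 nr kr ni kj.
have FM' i j : (i0 - n <= i <= i0 + n.+1)%N -> (j0 - k <= j <= j0 + k)%N -> `|- F i j| <= M.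
  by move=> *; rewrite normrN; exact: FM.
have FL' i j : (i0 - n <= i)%N -> (i.+2 <= i0 + n.+1)%N -> (j0 - k <= j)%N -> (j.+2 <= j0 + k)%N ->
    `|dlap a b (fun i j => - F i j) i j| <= L.
  by move=> *; rewrite dlapN normrN; exact: FL.
move=> /(_ FM' FL'); rewrite E ler_norml; move: h1; clear; qlra.
Qed.

Lemma grid_grad2 a b r M L F i0 j0 n k : 0 < a -> 0 < b -> 0 < r -> 4 * b <= r -> 0 < M ->
    0 <= L -> r <= n%:R * a -> r <= k%:R * b <= r + b -> (n <= i0)%N -> (k <= j0)%N ->
    (forall i j, (i0 - n <= i <= i0 + n)%N -> (j0 - k <= j <= j0 + k.+1)%N -> `|F i j| <= M) ->
    (forall i j, (i0 - n <= i)%N -> (i.+2 <= i0 + n)%N -> (j0 - k <= j)%N -> (j.+2 <= j0 + k.+1)%N ->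
      `|dlap a b F i j| <= L) ->
  `|D2 b F i0 j0| <= 2 * (8 * M + 2 * L * r ^+ 2) / r.
Proof.
move=> a0 b0 r0 br M0 L0 nr kr ni kj FM FL.
have := @grid_grad1 b a r M L (fun i j => F j i) j0 i0 k n b0 a0 r0 br M0 L0 kr nr kj ni.
apply; first by move=> i j h h'; exact: FM.
move=> i j h1 h2 h3 h4; rewrite (_ : dlap b a _ i j = dlap a b F j i); first exact: FL.
by rewrite !dlapE addrC.
Qed.

End Grid.

(** * Limits of grid functions along an ultrafilter *)

Section Ultra.
Context {R : realType}.
Variable W : set_system nat.
Hypothesis WU : UltraFilter W.

Lemma ultra_cvg (s : nat -> R) (C : R) : (\forall nu \near W, `|s nu| <= C) -> cvg (s nu @[nu --> W]).
Proof.
move=> sC; have PW := @ultra_proper _ _ WU.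
have [|l [_ cl]] := @segment_compact R (- C) C (s @ W) (fmap_proper_filter s PW).
  by apply: filterS sC => nu; rewrite /= in_itv /= ler_norml.
apply/cvg_ex; exists l; apply/cvgrPdist_le => e e0.
have [//|nW] := in_ultra_setVsetC [set nu | `|l - s nu| <= e] WU.
have nW' : W [set nu | e < `|l - s nu|].
  by apply: filterS nW => nu /= /negP; rewrite -ltNge.
have [z [/= zn zb]] := cl [set z | e < `|l - z|] (ball l e) nW' (nbhsx_ballx l e e0).
by move: zb; rewrite /ball/= ltNge (ltW zn).
Qed.

End Ultra.

Section Mesh.
Context {R : realType}.
Implicit Types (h r C M P t x y : R) (F : nat -> nat -> R) (G : nat -> nat -> nat -> R)
  (i j n k l nu : nat).

Lemma tele (f : nat -> R) C n1 n2 :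
    (forall n, (minn n1 n2 <= n < maxn n1 n2)%N -> `|f n.+1 - f n| <= C) ->
  `|f n2 - f n1| <= C * `|n2%:R - n1%:R|.
Proof.
wlog le : n1 n2 / (n1 <= n2)%N.
  move=> H fC; have [le|/ltnW le] := leqP n1 n2; first exact: H.
  by rewrite distrC [X in C * X]distrC; apply: H => // n; rewrite minnC maxnC; exact: fC.
rewrite (minn_idPl le) (maxn_idPr le) => fC.
have -> : n2%:R - n1%:R = (n2 - n1)%:R :> R by rewrite natrB.
rewrite normr_nat; elim: n2 le fC => [|n2 IH].
  by rewrite leqn0 => /eqP -> _; rewrite !subrr normr0 mulr0.
rewrite leq_eqVlt => /predU1P[<- _|le fC]; first by rewrite subnn !subrr normr0 mulr0.
rewrite subSn// -natr1 mulrDr mulr1 -(subrK (f n2) (f n2.+1)) -addrA.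
apply: le_trans (ler_normD _ _) _; rewrite [leRHS]addrC; apply: lerD.
  by apply: fC; rewrite -ltnS le /=.
by apply: IH => // n /andP[h1 h2]; apply: fC; rewrite h1 ltnS ltnW.
Qed.

Definition idx h t : nat := Num.trunc (t / h).

Lemma idxP h t : 0 < h -> 0 <= t -> `|(idx h t)%:R * h - t| <= h.
Proof.
move=> h0 t0; have /andP[h1 h2] : (idx h t)%:R <= t / h < (idx h t).+1%:R.
  by apply: trunc_itv; rewrite divr_ge0// ltW.
move: h1 h2; rewrite ler_pdivlMr// ltr_pdivrMr// -(@natr1 R (idx h t)) mulrDl mul1r => h1 h2.
by rewrite ler_norml; lra.
Qed.

Record mesh (a b : nat -> R) : Prop := Mesh {
  mesh_a0 : forall nu, 0 < a nu;
  mesh_b0 : forall nu, 0 < b nu;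
  mesh_a : a nu @[nu --> \oo] --> 0;
  mesh_b : b nu @[nu --> \oo] --> 0 }.

Variables a b : nat -> R.
Hypothesis ab : mesh a b.

Definition locp t y (Q : nat -> nat -> nat -> Prop) := exists2 r, 0 < r &
  \forall nu \near \oo, forall i j, `|i%:R * a nu - t| <= r -> `|j%:R * b nu - y| <= r -> Q nu i j.

Definition tamep t y G := exists C, locp t y (fun nu i j => `|G nu i j| <= C).

Lemma mesh_small r : 0 < r -> \forall nu \near \oo, a nu <= r /\ b nu <= r.
Proof.
move=> r0; have [_ _ /cvgrPdist_le/(_ r r0) ha /cvgrPdist_le/(_ r r0) hb] := ab.
apply: filterS2 ha hb => nu; rewrite !sub0r !normrN.
by move=> /(le_trans (ler_norm _)) h1 /(le_trans (ler_norm _)) h2.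
Qed.

Lemma locpI t y Q Q' : locp t y Q -> locp t y Q' -> locp t y (fun nu i j => Q nu i j /\ Q' nu i j).
Proof.
move=> [r r0 H] [r' r0' H']; exists (Num.min r r'); first by rewrite lt_min r0.
apply: filterS2 H H' => nu H H' i j ir jr; split.
  by apply: H; [apply: le_trans ir _|apply: le_trans jr _]; rewrite ge_min lexx.
by apply: H'; [apply: le_trans ir _|apply: le_trans jr _]; rewrite ge_min lexx orbT.
Qed.

Lemma locpS t y (Q Q' : nat -> nat -> nat -> Prop) : (forall nu i j, Q nu i j -> Q' nu i j) ->
  locp t y Q -> locp t y Q'.
Proof. by move=> QQ [r r0 H]; exists r => //; apply: filterS H => nu H i j ir jr; apply/QQ/H. Qed.

Lemma locp_sh t y Q : locp t y Q ->
  locp t y (fun nu i j => [/\ Q nu i.+1 j, Q nu i j.+1 & Q nu i.+1 j.+1]).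
Proof.
move=> [r r0 H]; exists (r / 2); first by rewrite divr_gt0.
have r4 : 0 < r / 4 by rewrite divr_gt0.
apply: filterS2 H (mesh_small r4) => nu H [ar br] i j ir jr.
have a0 := mesh_a0 ab nu; have b0 := mesh_b0 ab nu.
have i1 : `|i.+1%:R * a nu - t| <= r.
  by rewrite -(@natr1 R i) mulrDl mul1r; move: ir; rewrite !ler_norml; move: r0 ar a0; clear; lra.
have j1 : `|j.+1%:R * b nu - y| <= r.
  by rewrite -(@natr1 R j) mulrDl mul1r; move: jr; rewrite !ler_norml; move: r0 br b0; clear; lra.
have rr (z : R) : z <= r / 2 -> z <= r by move: r0; clear; lra.
by split; apply: H => //; exact: rr.
Qed.

Lemma tamep_sh t y G : tamep t y G -> tamep t y (fun nu i j => G nu i.+1 j.+1).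
Proof. by move=> [C H]; exists C; apply: locpS (locp_sh H) => nu i j []. Qed.

Lemma tamepZ t y G (c : nat -> R) D : (forall nu, `|c nu| <= D) -> tamep t y G ->
  tamep t y (fun nu i j => c nu * G nu i j).
Proof.
move=> cD [C H]; exists (D * C); apply: locpS H => nu i j H.
by rewrite normrM ler_pM.
Qed.

Lemma tamepB t y G G' : tamep t y G -> tamep t y G' ->
  tamep t y (fun nu i j => G nu i j - G' nu i j).
Proof.
move=> [C H] [C' H']; exists (C + C'); apply: locpS (locpI H H') => nu i j [h h'].
by apply: le_trans (ler_normB _ _) _; exact: lerD.
Qed.

Lemma steps r h : 0 < h -> h <= r -> exists n, r <= n%:R * h <= r + h.
Proof.
move=> h0 hr; exists (idx h r).+1; have r0 : 0 <= r by rewrite (le_trans (ltW h0)).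
have /andP[h1 h2] : (idx h r)%:R <= r / h < (idx h r).+1%:R.
  by apply: trunc_itv; rewrite divr_ge0// ltW.
move: h1 h2; rewrite ler_pdivlMr// ltr_pdivrMr// -(@natr1 R (idx h r)) => h1 h2.
by rewrite (ltW h2) mulrDl mul1r lerD2r.
Qed.

Lemma near_box r h t n i0 i : 0 < h -> 8 * h <= r -> n%:R * h <= r / 4 + h ->
  `|i0%:R * h - t| <= r / 4 -> (i0 - n <= i)%N -> (i <= i0 + n.+1)%N -> `|i%:R * h - t| <= r.
Proof.
move=> h0 hr nr it l1 l2.
have m1 : (i%:R : R) <= i0%:R + n%:R + 1 by rewrite -natrD natr1 ler_nat -addnS.
have m2 : (i0%:R : R) <= i%:R + n%:R by rewrite -natrD ler_nat; lia.
have := ler_wpM2r (ltW h0) m1; have := ler_wpM2r (ltW h0) m2; move: it.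
by rewrite !ler_norml; move: nr hr; clear; nra.
Qed.

(** The interior estimates [grid_grad1] and [grid_grad2] on boxes of fixed radius r / 4. Differences
    of a solution of the discrete eigenvalue equation solve it again, so iterating this lemma bounds
    difference quotients of every order; the smoothness of the limit comes from there. *)
Lemma tamep_D t y G : 0 < t -> 0 < y -> tamep t y G ->
    tamep t y (fun nu => dlap (a nu) (b nu) (G nu)) ->
  tamep t y (fun nu => D1 (a nu) (G nu)) /\ tamep t y (fun nu => D2 (b nu) (G nu)).
Proof.
move=> t0 y0 [C HC] [L HL].
have [r0 r00 H] := locpI HC HL; pose r := Num.min r0 (Num.min t y).
have rr0 : 0 < r by rewrite !lt_min r00 t0.
have rE : [/\ r <= r0, r <= t & r <= y] by rewrite /r !ge_min !lexx !orbT.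
pose K := 2 * (8 * (`|C| + 1) + 2 * `|L| * (r / 4) ^+ 2) / (r / 4).
have r4 : 0 < r / 4 by rewrite divr_gt0.
have r32 : 0 < r / 32 by rewrite divr_gt0.
suff KK : locp t y (fun nu i j => `|D1 (a nu) (G nu) i j| <= K /\ `|D2 (b nu) (G nu) i j| <= K).
  by split; exists K; apply: locpS KK => nu i j [].
exists (r / 4) => //; apply: filterS2 H (mesh_small r32) => nu H [ar br] i0 j0 it jy.
have a0 := mesh_a0 ab nu; have b0 := mesh_b0 ab nu.
have [rr1 rt ry] := rE.
have [n nr] := steps a0 (ltac:(move: ar rr0; clear; lra) : a nu <= r / 4).
have [k kr] := steps b0 (ltac:(move: br rr0; clear; lra) : b nu <= r / 4).
have ni : (n <= i0)%N.
  rewrite -(@ler_nat R) -(@ler_pM2r _ (a nu))//; move: it nr rt ar rr0; rewrite ler_norml; clear; lra.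
have kj : (k <= j0)%N.
  rewrite -(@ler_nat R) -(@ler_pM2r _ (b nu))//; move: jy kr ry br rr0; rewrite ler_norml; clear; lra.
have C1 : 0 < `|C| + 1 by rewrite ltr_wpDl.
have bx i j : (i0 - n <= i)%N -> (i <= i0 + n.+1)%N -> (j0 - k <= j)%N -> (j <= j0 + k.+1)%N ->
    `|G nu i j| <= `|C| + 1 /\ `|dlap (a nu) (b nu) (G nu) i j| <= `|L|.
  move=> l1 l2 l3 l4.
  have h1 : `|i%:R * a nu - t| <= r0.
    apply: le_trans rr1; apply: (near_box a0 _ _ it l1 l2); last by case/andP: nr.
    by move: ar rr0; clear; lra.
  have h2 : `|j%:R * b nu - y| <= r0.
    apply: le_trans rr1; apply: (near_box b0 _ _ jy l3 l4); last by case/andP: kr.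
    by move: br rr0; clear; lra.
  have [g1 g2] := H i j h1 h2; split; last by apply: le_trans g2 (ler_norm _).
  by apply: (le_trans g1); apply: (le_trans (ler_norm _)); rewrite lerDl.
have [/andP[kr1 kr2] /andP[nr1 nr2]] := (kr, nr).
split.
  apply: (@grid_grad1 _ (a nu) (b nu) (r / 4) (`|C| + 1) `|L| (G nu) i0 j0 n k) => //.
  - by move: ar rr0; clear; lra.
  - by move=> i j /andP[l1 l2] /andP[l3 l4]; apply: (bx i j _ _ _ _).1; rewrite // addnS leqW.
  - by move=> i j l1 l2 l3 l4; apply: (bx i j _ _ _ _).2; move: l1 l2 l3 l4; clear; lia.
apply: (@grid_grad2 _ (a nu) (b nu) (r / 4) (`|C| + 1) `|L| (G nu) i0 j0 n k) => //.
- by move: br rr0; clear; lra.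
- by move=> i j /andP[l1 l2] /andP[l3 l4]; apply: (bx i j _ _ _ _).1; rewrite // addnS leqW.
- by move=> i j l1 l2 l3 l4; apply: (bx i j _ _ _ _).2; move: l1 l2 l3 l4; clear; lia.
Qed.

End Mesh.

Lemma mesh_swap {R : realType} (a b : nat -> R) : mesh a b -> mesh b a.
Proof. by case. Qed.

Lemma locp_swap {R : realType} (a b : nat -> R) t y Q : locp a b t y Q ->
  locp b a y t (fun nu i j => Q nu j i).
Proof. by move=> [r r0 H]; exists r => //; apply: filterS H => nu H i j ir jr; exact: H. Qed.

Lemma tamep_swap {R : realType} (a b : nat -> R) t y G : tamep a b t y G ->
  tamep b a y t (fun nu i j => G nu j i).
Proof. by move=> [C H]; exists C; exact: locp_swap. Qed.

Lemma D12 {R : realType} (a b : R) F : D2 b (D1 a F) = D1 a (D2 b F).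
Proof.
apply: funext => i; apply: funext => j; rewrite /D1 /D2 -!mulrBl mulrAC; congr (_ / _ / _); ring.
Qed.

Lemma ctn_lip {R : realType} (f : R -> R -> R) x y r C : 0 < r ->
  (forall s t, `|s - x| <= r -> `|t - y| <= r -> `|f s t - f x y| <= C * (`|s - x| + `|t - y|)) ->
  ctn f x y.
Proof.
move=> r0 H; apply/cvgrPdist_le => e e0.
have C1 : 0 < 2 * (`|C| + 1) by rewrite mulr_gt0// ltr_wpDl.
pose d := Num.min r (e / (2 * (`|C| + 1))).
have d0 : 0 < d by rewrite lt_min r0 divr_gt0.
exists (ball x d, ball y d); first by split; exact: nbhsx_ballx.
move=> -[s t] [/= bs bt]; rewrite /ball/= distrC in bs; rewrite /ball/= distrC in bt.
have dr : d <= r by rewrite ge_min lexx.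
have de : d <= e / (2 * (`|C| + 1)) by rewrite ge_min lexx orbT.
rewrite distrC; apply: (le_trans (H s t _ _)); try by apply: le_trans dr; exact: ltW.
move: de; rewrite ler_pdivlMr// => de; apply: le_trans de.
have := ler_norm C; have := normr_ge0 C; have := normr_ge0 (s - x); have := normr_ge0 (t - y).
by move: bs bt; clear; nra.
Qed.

Section Limit.
Context {R : realType}.
Implicit Types (h r C t y s x mu lam : R) (G u : nat -> nat -> nat -> R) (i j n k l nu : nat).
Variables (W : set_system nat) (a b : nat -> R).
Hypotheses (WU : UltraFilter W) (Woo : \oo `<=` W) (ab : mesh a b).

Definition gval G t y nu := G nu (idx (a nu) t) (idx (b nu) y).
(** Bounded sequences converge along an ultrafilter, so one [W] serves all functions, all points and
    all difference quotients at once, in place of a diagonal extraction. *)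
Definition glim G t y : R := lim (gval G t y nu @[nu --> W]).

Lemma locp_idx t y Q : 0 < t -> 0 < y -> locp a b t y Q -> exists2 r, 0 < r &
  forall s x, `|s - t| <= r -> `|x - y| <= r -> 
    [/\ 0 < s, 0 < x & \forall nu \near \oo, Q nu (idx (a nu) s) (idx (b nu) x)].
Proof.
move=> t0 y0 [r r0 H]; have r2 : 0 < r / 2 by rewrite divr_gt0.
pose d := Num.min (r / 2) (Num.min (t / 2) (y / 2)).
have dE : [/\ d <= r / 2, d <= t / 2 & d <= y / 2] by rewrite /d !ge_min !lexx !orbT.
have [d1 d2 d3] := dE.
exists d; first by rewrite !lt_min r2 !divr_gt0.
move=> s x sd xd.
have s0 : 0 < s by move: sd t0 d2; rewrite ler_norml; clear; lra.
have x0 : 0 < x by move: xd y0 d3; rewrite ler_norml; clear; lra.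
split => //; apply: filterS2 H (mesh_small ab r2) => nu H [ar br]; apply: H.
  have := idxP (mesh_a0 ab nu) (ltW s0); move: sd d1 ar.
  by rewrite !ler_norml; clear; lra.
have := idxP (mesh_b0 ab nu) (ltW x0); move: xd d1 br.
by rewrite !ler_norml; clear; lra.
Qed.

Lemma glim_cvg t y G : 0 < t -> 0 < y -> tamep a b t y G -> exists2 r, 0 < r &
  forall s x, `|s - t| <= r -> `|x - y| <= r -> gval G s x nu @[nu --> W] --> glim G s x.
Proof.
move=> t0 y0 [C H]; have [r r0 Hr] := locp_idx t0 y0 H; exists r => // s x sr xr.
have [_ _ Hn] := Hr s x sr xr; apply: (@ultra_cvg _ W WU _ C); exact: Woo.
Qed.

Lemma idx_cvg h s : (forall nu, 0 < a nu) -> 0 <= s -> (idx (a nu) s)%:R * a nu @[nu --> W] --> s.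
Proof.
move=> a0 s0; apply/cvgrPdist_le => e e0; apply: Woo.
apply: filterS (mesh_small ab e0) => nu [ae _]; rewrite distrC.
exact: le_trans (idxP (a0 nu) s0) ae.
Qed.

Lemma grid_lip t y G : tamep a b t y (fun nu => D1 (a nu) (G nu)) ->
    tamep a b t y (fun nu => D2 (b nu) (G nu)) -> exists2 C, 0 <= C & exists2 r, 0 < r &
  \forall nu \near \oo, forall i j i' j', 
    `|i%:R * a nu - t| <= r -> `|j%:R * b nu - y| <= r ->
    `|i'%:R * a nu - t| <= r -> `|j'%:R * b nu - y| <= r ->
    `|G nu i' j' - G nu i j| <= C * (`|i'%:R * a nu - i%:R * a nu| + `|j'%:R * b nu - j%:R * b nu|).
Proof.
move=> [C1 H1] [C2 H2]; have [r r0 H] := locpI H1 H2.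
exists (`|C1| + `|C2|); first by rewrite addr_ge0.
exists r => //; apply: filterS H => nu H i j i' j' ir jr ir' jr'.
have a0 := mesh_a0 ab nu; have b0 := mesh_b0 ab nu.
have btw h t' n1 n2 n : 0 < h -> `|n1%:R * h - t'| <= r -> `|n2%:R * h - t'| <= r ->
    (minn n1 n2 <= n < maxn n1 n2)%N -> `|n%:R * h - t'| <= r.
  move=> h0; wlog le : n1 n2 / (n1 <= n2)%N.
    move=> K r1 r2 nb; have /orP[le|le] := leq_total n1 n2; first exact: (K n1 n2).
    by apply: (K n2 n1) => //; rewrite minnC maxnC.
  rewrite (minn_idPl le) (maxn_idPr le) => r1 r2 /andP[l1 /ltnW l2].
  have := ler_wpM2r (ltW h0) (ltac:(by rewrite ler_nat) : n1%:R <= n%:R :> R).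
  have := ler_wpM2r (ltW h0) (ltac:(by rewrite ler_nat) : n%:R <= n2%:R :> R).
  by move: r1 r2; rewrite !ler_norml; clear; lra.
have t1 := @tele _ (fun n => G nu n j) (`|C1| * a nu) i i'.
have t2 := @tele _ (G nu i') (`|C2| * b nu) j j'.
rewrite -(subrKA (G nu i' j)); apply: le_trans (ler_normD _ _) _.
rewrite mulrDr addrC; apply: lerD.
  apply: (@le_trans _ _ (`|C1| * `|i'%:R * a nu - i%:R * a nu|)); last by rewrite ler_wpM2r// lerDl.
  rewrite -mulrBl normrM (gtr0_norm a0) (mulrC `|_ - _|) mulrA; apply: t1 => n nb.
  have [h _] := H n j (btw _ _ _ _ _ a0 ir ir' nb) jr.
  move: h; rewrite /D1 normrM normfV (gtr0_norm a0) ler_pdivrMr// => /le_trans; apply.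
  by rewrite ler_wpM2r ?ler_norm// ltW.
apply: (@le_trans _ _ (`|C2| * `|j'%:R * b nu - j%:R * b nu|)); last by rewrite ler_wpM2r// lerDr.
rewrite -mulrBl normrM (gtr0_norm b0) (mulrC `|_ - _|) mulrA; apply: t2 => n nb.
have [_ h] := H i' n ir' (btw _ _ _ _ _ b0 jr jr' nb).
move: h; rewrite /D2 normrM normfV (gtr0_norm b0) ler_pdivrMr// => /le_trans; apply.
by rewrite ler_wpM2r ?ler_norm// ltW.
Qed.

(** Bounded difference quotients make a shift by one cell invisible in the limit. This is used
    because [dlap] is indexed by a corner of its stencil while the eigenvalue equation evaluates the
    function at the centre. *)
Lemma glim_step t y G : 0 < t -> 0 < y -> tamep a b t y (fun nu => D1 (a nu) (G nu)) ->
    tamep a b t y (fun nu => D2 (b nu) (G nu)) -> tamep a b t y G ->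
  (fun nu => G nu (idx (a nu) t).+1 (idx (b nu) y)) @ W --> glim G t y /\
  (fun nu => G nu (idx (a nu) t) (idx (b nu) y).+1) @ W --> glim G t y.
Proof.
move=> t0 y0 T1 T2 T; have [r r0 Hr] := glim_cvg t0 y0 T.
have cv := Hr t y ltac:(by rewrite subrr normr0 ltW) ltac:(by rewrite subrr normr0 ltW).
have [C C0 [q q0 Hq]] := grid_lip T1 T2; have q2 : 0 < q / 2 by rewrite divr_gt0.
have PW := @ultra_proper _ _ WU.
have ball0 : \forall nu \near \oo, [/\ `|(idx (a nu) t)%:R * a nu - t| <= q,
     `|(idx (a nu) t).+1%:R * a nu - t| <= q, `|(idx (b nu) y)%:R * b nu - y| <= q
     & `|(idx (b nu) y).+1%:R * b nu - y| <= q].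
  apply: filterS (mesh_small ab q2) => nu [aq bq].
  have := idxP (mesh_a0 ab nu) (ltW t0); have := idxP (mesh_b0 ab nu) (ltW y0).
  rewrite -(@natr1 R (idx (a nu) t)) -(@natr1 R (idx (b nu) y)) !mulrDl !mul1r.
  have := mesh_a0 ab nu; have := mesh_b0 ab nu.
  by rewrite !ler_norml => h1 h2 h3 h4; split; move: h1 h2 h3 h4 aq bq; clear; lra.
have small e : 0 < e -> \forall nu \near \oo, C * a nu <= e /\ C * b nu <= e.
  move=> e0; have C1 : 0 < C + 1 by rewrite ltr_wpDl.
  have ec : 0 < e / (C + 1) by rewrite divr_gt0.
  apply: filterS (mesh_small ab ec) => nu; rewrite !ler_pdivlMr// => -[h1 h2].
  by have := mesh_a0 ab nu; have := mesh_b0 ab nu; move: h1 h2; clear; lra.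
have shift (s s' : nat -> R) : s @ W --> glim G t y ->
    (\forall nu \near \oo, `|s' nu - s nu| <= C * a nu + C * b nu) -> s' @ W --> glim G t y.
  move=> cs ss; rewrite (_ : s' = s \+ (s' \- s)); last first.
    by apply: funext => nu /=; rewrite addrC subrK.
  rewrite -[glim G t y]addr0; apply: cvgD cs _; apply/cvgrPdist_le => e e0.
  have e2 : 0 < e / 2 by rewrite divr_gt0.
  apply: Woo; apply: filterS2 ss (small _ e2) => nu h [h1 h2] /=.
  by rewrite sub0r normrN; apply: le_trans h _; move: h1 h2; clear; lra.
split; apply: (shift _ _ cv); apply: filterS2 Hq ball0 => nu H [b1 b2 b3 b4].
  apply: (le_trans (H _ _ _ _ b1 b3 b2 b3)); rewrite subrr normr0 addr0.
  rewrite -(@natr1 R (idx (a nu) t)) mulrDl mul1r addrAC subrr add0r gtr0_norm ?(mesh_a0 ab)//.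
  by rewrite lerDl mulr_ge0// ltW// (mesh_b0 ab).
apply: (le_trans (H _ _ _ _ b1 b3 b1 b4)); rewrite subrr normr0 add0r.
rewrite -(@natr1 R (idx (b nu) y)) mulrDl mul1r addrAC subrr add0r gtr0_norm ?(mesh_b0 ab)//.
by rewrite lerDr mulr_ge0// ltW// (mesh_a0 ab).
Qed.

Lemma idx_cvg2 h s : (forall nu, 0 < b nu) -> 0 <= s -> (idx (b nu) s)%:R * b nu @[nu --> W] --> s.
Proof.
move=> b0 s0; apply/cvgrPdist_le => e e0; apply: Woo.
apply: filterS (mesh_small ab e0) => nu [_ be]; rewrite distrC.
exact: le_trans (idxP (b0 nu) s0) be.
Qed.

Lemma glim_ctn t y G : 0 < t -> 0 < y -> tamep a b t y (fun nu => D1 (a nu) (G nu)) ->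
    tamep a b t y (fun nu => D2 (b nu) (G nu)) -> tamep a b t y G -> ctn (glim G) t y.
Proof.
move=> t0 y0 T1 T2 T; have [r r0 Hr] := glim_cvg t0 y0 T.
have [C C0 [q q0 Hq]] := grid_lip T1 T2; have PW := @ultra_proper _ _ WU.
pose d := Num.min (Num.min r (q / 2)) (Num.min (t / 2) (y / 2)).
have dE : [/\ d <= r, d <= q / 2, d <= t / 2 & d <= y / 2] by rewrite /d !ge_min !lexx !orbT.
have [d1 d2 d3 d4] := dE; apply: (@ctn_lip _ _ _ _ d C).
  by rewrite !lt_min r0 !divr_gt0.
move=> s x sd xd; have s0 : 0 < s by move: sd d3 t0; rewrite ler_norml; clear; lra.
have x0 : 0 < x by move: xd d4 y0; rewrite ler_norml; clear; lra.
have dr (z : R) : z <= d -> z <= r by move/le_trans; apply.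
have cs := Hr s x (dr _ sd) (dr _ xd).
have ct := Hr t y ltac:(by rewrite subrr normr0 ltW) ltac:(by rewrite subrr normr0 ltW).
have q2 : 0 < q / 2 by rewrite divr_gt0.
pose sp nu := C * (`|(idx (a nu) s)%:R * a nu - (idx (a nu) t)%:R * a nu| +
   `|(idx (b nu) x)%:R * b nu - (idx (b nu) y)%:R * b nu|).
have csp : sp @ W --> C * (`|s - t| + `|x - y|).
  apply: cvgM; first exact: cvg_cst.
  apply: cvgD; apply: cvg_norm; apply: cvgB; (apply: (@idx_cvg 0) || apply: (@idx_cvg2 0));
    rewrite ?ltW//; try exact: mesh_a0 ab; exact: mesh_b0 ab.
have cd : `|gval G s x nu - gval G t y nu| @[nu --> W] --> `|glim G s x - glim G t y|.
  by apply: cvg_norm; exact: cvgB cs ct.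
apply: (ler_cvg_to cd csp); apply: Woo.
apply: filterS2 Hq (mesh_small ab q2) => nu H [aq bq].
have nr z z' : 0 < z -> `|z - z'| <= q / 2 -> `|(idx (a nu) z)%:R * a nu - z'| <= q.
  move=> z0 zz; have := idxP (mesh_a0 ab nu) (ltW z0); move: zz; rewrite !ler_norml.
  by move: aq; clear; lra.
have nr' z z' : 0 < z -> `|z - z'| <= q / 2 -> `|(idx (b nu) z)%:R * b nu - z'| <= q.
  move=> z0 zz; have := idxP (mesh_b0 ab nu) (ltW z0); move: zz; rewrite !ler_norml.
  by move: bq; clear; lra.
have dq (z : R) : z <= d -> z <= q / 2 by move/le_trans; apply.
by apply: H; [apply: nr|apply: nr'|apply: nr|apply: nr'] => //;
  rewrite ?subrr ?normr0 ?(ltW q2)//; exact: dq.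
Qed.

(** A discrete Taylor formula. Subtracting from G(n) the tangent D1 G(i1) n a leaves increments of
    size C |st| a, because D1 G is Lipschitz uniformly in the mesh; summing gives the error C st^2,
    which passes to the limit as C h^2. *)
Lemma glim_der1 t y G : 0 < t -> 0 < y -> tamep a b t y G ->
    tamep a b t y (fun nu => D1 (a nu) (G nu)) ->
    tamep a b t y (fun nu => D1 (a nu) (D1 (a nu) (G nu))) ->
    tamep a b t y (fun nu => D2 (b nu) (D1 (a nu) (G nu))) ->
  is_derive t 1 (glim G ^~ y) (glim (fun nu => D1 (a nu) (G nu)) t y).
Proof.
move=> t0 y0 T T1 T11 T21; have [r r0 Hr] := glim_cvg t0 y0 T.
have [r1 r10 Hr1] := glim_cvg t0 y0 T1.
have [C C0 [q q0 Hq]] := grid_lip T11 T21; have PW := @ultra_proper _ _ WU.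
pose d := Num.min (Num.min r (q / 2)) (t / 2).
have dE : [/\ d <= r, d <= q / 2 & d <= t / 2] by rewrite /d !ge_min !lexx !orbT.
have [d1 d2 d3] := dE; have d0 : 0 < d by rewrite !lt_min r0 !divr_gt0.
have q2 : 0 < q / 2 by rewrite divr_gt0.
have z0 : `|y - y| <= r by rewrite subrr normr0 ltW.
suff key h : `|h| <= d -> `|glim G (t + h) y - glim G t y -
    glim (fun nu => D1 (a nu) (G nu)) t y * h| <= C * (`|h| * `|h|).
  apply/is_deriveP => e e0; exists (Num.min d (e / (C + 1))).
    by rewrite lt_min d0 divr_gt0// ltr_wpDl.
  move=> h hd; have hd' : `|h| < d by apply: lt_le_trans hd _; rewrite ge_min lexx.
  apply: (le_trans (key h (ltW hd'))); rewrite mulrA ler_wpM2r//.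
  have : `|h| < e / (C + 1) by apply: lt_le_trans hd _; rewrite ge_min lexx orbT.
  rewrite ltr_pdivlMr; last by rewrite ltr_wpDl.
  by move=> /ltW; apply: le_trans; rewrite mulrC mulrDr mulr1 lerDl.
move=> hd; have s0 : 0 < t + h by move: hd d3 t0; rewrite ler_norml; clear; lra.
have cs := Hr (t + h) y ltac:(by rewrite addrAC subrr add0r; exact: le_trans d1) z0.
have ct := Hr t y ltac:(by rewrite subrr normr0 ltW) z0.
have ct1 := Hr1 t y ltac:(by rewrite subrr normr0 ltW) ltac:(by rewrite subrr normr0 ltW).
pose st nu := (idx (a nu) (t + h))%:R * a nu - (idx (a nu) t)%:R * a nu.
have cst : st @ W --> h.
  have -> : h = t + h - t by ring.
  by apply: cvgB; apply: (@idx_cvg 0); rewrite ?ltW//; exact: mesh_a0 ab.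
have cL : `|gval G (t + h) y nu - gval G t y nu - 
   gval (fun nu => D1 (a nu) (G nu)) t y nu * st nu| @[nu --> W] -->
   `|glim G (t + h) y - glim G t y - glim (fun nu => D1 (a nu) (G nu)) t y * h|.
  by apply: cvg_norm; apply: cvgB; [exact: cvgB cs ct|exact: cvgM ct1 cst].
have cR : C * (`|st nu| * `|st nu|) @[nu --> W] --> C * (`|h| * `|h|).
  by apply: cvgM; [exact: cvg_cst|apply: cvgM; exact: cvg_norm].
apply: (ler_cvg_to cL cR); apply: Woo.
apply: filterS2 Hq (mesh_small ab q2) => nu H [aq bq].
have a0 := mesh_a0 ab nu; have b0 := mesh_b0 ab nu.
set i1 := idx (a nu) t; set j1 := idx (b nu) y; set i2 := idx (a nu) (t + h).
have j1q : `|j1%:R * b nu - y| <= q.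
  by apply: le_trans (idxP b0 (ltW y0)) _; move: bq q0; lra.
have i1q : `|i1%:R * a nu - t| <= q.
  by apply: le_trans (idxP a0 (ltW t0)) _; move: aq q0; lra.
have i2q : `|i2%:R * a nu - t| <= q.
  by have := idxP a0 (ltW s0); rewrite -/i2; move: hd d2 aq; rewrite !ler_norml; clear; lra.
pose f n := G nu n j1 - D1 (a nu) (G nu) i1 j1 * (n%:R * a nu).
have -> : gval G (t + h) y nu - gval G t y nu -
   gval (fun nu => D1 (a nu) (G nu)) t y nu * st nu = f i2 - f i1.
  by rewrite /gval /f /st -/i1 -/i2 -/j1; ring.
have stE : `|st nu| = `|i2%:R - i1%:R| * a nu by rewrite /st -mulrBl normrM (gtr0_norm a0).
apply: (@le_trans _ _ (C * `|st nu| * a nu * `|i2%:R - i1%:R|)); last first.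
  by rewrite stE le_eqVlt; apply/orP; left; apply/eqP; ring.
apply: tele => n nb.
have -> : f n.+1 - f n = (D1 (a nu) (G nu) n j1 - D1 (a nu) (G nu) i1 j1) * a nu.
  by rewrite /f -(@natr1 R n) /D1; field; rewrite gt_eqF.
rewrite normrM (gtr0_norm a0) ler_pM2r//.
have [nq nst] : `|n%:R * a nu - t| <= q /\ `|n%:R * a nu - i1%:R * a nu| <= `|st nu|.
  have mono p p' : (p <= p')%N -> p%:R * a nu <= p'%:R * a nu.
    by move=> pp; rewrite ler_pM2r// ler_nat.
  have /orP[le|le] := leq_total i1 i2.
    move: nb; rewrite (minn_idPl le) (maxn_idPr le) => /andP[l1 /ltnW l2].
    have h1 := mono _ _ l1; have h2 := mono _ _ l2.
    split; first by move: i1q i2q h1 h2; rewrite !ler_norml; clear; lra.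
    have l12 := le_trans h1 h2.
    by rewrite /st -/i1 -/i2 ger0_norm ?subr_ge0// ger0_norm ?subr_ge0// lerD2r.
  move: nb; rewrite (minn_idPr le) (maxn_idPl le) => /andP[l1 /ltnW l2].
  have h1 := mono _ _ l1; have h2 := mono _ _ l2.
  split; first by move: i1q i2q h1 h2; rewrite !ler_norml; clear; lra.
  have l12 := le_trans h1 h2.
  by rewrite /st -/i1 -/i2 ler0_norm ?subr_le0// ler0_norm ?subr_le0// lerN2 lerD2r.
apply: (le_trans (H _ _ _ _ i1q j1q nq j1q)); rewrite subrr normr0 addr0.
by rewrite ler_wpM2l.
Qed.

End Limit.

(** * Rayleigh quotients of symmetric matrices *)

Section Rayleigh.
Context {R : realType}.
Implicit Types (n m k : nat) (t s mu : R).

Definition dotr {n} (v w : 'rV[R]_n) : R := (v *m w^T) 0 0.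

Lemma dotrD n (u v w : 'rV[R]_n) : dotr (u + v) w = dotr u w + dotr v w.
Proof. by rewrite /dotr mulmxDl mxE. Qed.

Lemma dotrZ n t (v w : 'rV[R]_n) : dotr (t *: v) w = t * dotr v w.
Proof. by rewrite /dotr -scalemxAl mxE. Qed.

Lemma dotrE n (v w : 'rV[R]_n) : dotr v w = \sum_i v 0 i * w 0 i.
Proof. by rewrite /dotr mxE; apply: eq_bigr => i _; rewrite mxE. Qed.

Lemma dotrC n (v w : 'rV[R]_n) : dotr v w = dotr w v.
Proof. by rewrite !dotrE; apply: eq_bigr => i _; rewrite mulrC. Qed.

Lemma dotrDr n (u v w : 'rV[R]_n) : dotr u (v + w) = dotr u v + dotr u w.
Proof. by rewrite dotrC dotrD !(dotrC _ u). Qed.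

Lemma dotrZr n t (v w : 'rV[R]_n) : dotr v (t *: w) = t * dotr v w.
Proof. by rewrite dotrC dotrZ (dotrC w). Qed.

Lemma dotr_ge0 n (v : 'rV[R]_n) : 0 <= dotr v v.
Proof. by rewrite dotrE sumr_ge0// => i _; rewrite -expr2 sqr_ge0. Qed.

Lemma dotr_eq0 n (v : 'rV[R]_n) : dotr v v = 0 -> v = 0.
Proof.
rewrite dotrE => /eqP; rewrite psumr_eq0 => [/allP h|i _]; last by rewrite -expr2 sqr_ge0.
by apply/rowP => i; have := h i (mem_index_enum _); rewrite /= mulf_eq0 orbb mxE => /eqP.
Qed.

Lemma dotrM n (A : 'M[R]_n) (v w : 'rV[R]_n) : A^T = A -> dotr (v *m A) w = dotr v (w *m A).
Proof. by move=> sA; rewrite /dotr trmx_mul sA mulmxA. Qed.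

Lemma continuous_sum (T : topologicalType) (I : Type) (r : seq I) (F : I -> T -> R) :
  (forall i, continuous (F i)) -> continuous (fun v => \sum_(i <- r) F i v).
Proof.
move=> cF v; elim: r => [|i r IH]; rewrite /continuous_at.
  by rewrite big_nil; under eq_fun do rewrite big_nil; exact: cvg_cst.
by rewrite big_cons; under eq_fun do rewrite big_cons; apply: cvgD => //; exact: cF.
Qed.

Lemma contM (T : topologicalType) (f g : T -> R) v : {for v, continuous f} ->
  {for v, continuous g} -> {for v, continuous (fun x => f x * g x)}.
Proof. by move=> cf cg; exact: cvgM cf cg. Qed.

Lemma contMr (T : topologicalType) (f : T -> R) c v : {for v, continuous f} ->
  {for v, continuous (fun x => f x * c)}.
Proof. by move=> cf; apply: cvgM cf _; exact: cvg_cst. Qed.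

Lemma coord_cont n (i : 'I_n) : continuous (fun v : 'rV[R]_n => v 0 i).
Proof. by move=> v; exact: coord_continuous. Qed.

Lemma dotr1_continuous n (w : 'rV[R]_n) : continuous (fun v => dotr v w).
Proof.
rewrite (_ : (fun _ => _) = fun v : 'rV[R]_n => \sum_i v 0 i * w 0 i); last first.
  by apply: funext => v; rewrite dotrE.
apply: continuous_sum => i v; apply: contMr; exact: coord_cont.
Qed.

Lemma dotr_continuous n (A : 'M[R]_n) : continuous (fun v : 'rV[R]_n => dotr (v *m A) v).
Proof.
rewrite (_ : (fun _ => _) = fun v : 'rV[R]_n => \sum_j dotr v (row j A^T) * v 0 j); last first.
  apply: funext => v; rewrite dotrE; apply: eq_bigr => j _; rewrite mxE dotrE; congr (_ * _).
  by apply: eq_bigr => i _; rewrite !mxE.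
apply: continuous_sum => j v.
apply: (@contM _ (fun v : 'rV[R]_n => dotr v (row j A^T)) (fun v : 'rV[R]_n => v 0 j)); [exact: dotr1_continuous|exact: coord_cont].
Qed.

(** The quadratic form attains its minimum q on the unit sphere of the orthogonal complement of the
    earlier eigenvectors. Since A is symmetric, z = v A - q v lies in that complement as well, and
    moving from v along - z would lower the quotient unless z = 0. *)
Lemma rayleigh_min n (A : 'M[R]_n) k (w : nat -> 'rV[R]_n) (mu : nat -> R) v0 mu0 : A^T = A ->
    (forall j, (j < k)%N -> w j *m A = mu j *: w j) ->
    v0 != 0 -> (forall j, (j < k)%N -> dotr v0 (w j) = 0) -> dotr (v0 *m A) v0 <= mu0 * dotr v0 v0 ->
  exists v mu', [/\ v != 0, v *m A = mu' *: v, mu' <= mu0 & forall j, (j < k)%N -> dotr v (w j) = 0].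
Proof.
move=> sA eig v00 v0w v0mu.
have d0 : 0 < dotr v0 v0.
  by rewrite lt_def dotr_ge0 andbT; apply: contraNneq v00 => /dotr_eq0 ->.
pose S := [set v : 'rV[R]_n | dotr v v = 1 /\ forall j, (j < k)%N -> dotr v (w j) = 0].
pose s0 := (Num.sqrt (dotr v0 v0))^-1.
have s02 : s0 * s0 * dotr v0 v0 = 1.
  by rewrite -expr2 exprVn sqr_sqrtr ?dotr_ge0// mulVf// gt_eqF.
have Sv0 : S (s0 *: v0).
  split; first by rewrite dotrZ dotrC dotrZ mulrA.
  by move=> j jk; rewrite dotrZ v0w// mulr0.
have cS : compact S.
  apply: (@subclosed_compact _ _ [set v : 'rV[R]_n | forall i, v 0 i \in `[-1, 1]]).
  - rewrite (_ : S = [set v | dotr v v = 1] `&`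
      \bigcap_(j in [set j | (j < k)%N]) [set v | dotr v (w j) = 0]); last first.
      by apply/seteqP; split => v.
    apply: closedI.
      have := @dotr_continuous n 1%:M; under eq_fun do rewrite mulmx1.
      by move=> c1; apply: (closed_comp (f := fun v => dotr v v) (D := [set 1 : R])) => //; exact: closed_eq.
    apply: closed_bigI => j _.
    apply: (closed_comp (f := fun v => dotr v (w j)) (D := [set 0 : R])); last exact: closed_eq.
    by move=> v _; exact: dotr1_continuous.
  - apply: (@rV_compact _ _ (fun=> `[(- 1 : R), 1]%classic)) => _; exact: segment_compact.
  - move=> v [v1 _] i; have : v 0 i ^+ 2 <= 1.
      rewrite -v1 dotrE (bigD1 i)//= -expr2 lerDl sumr_ge0// => j _.
      by rewrite -expr2 sqr_ge0.
    by rewrite in_itv /=; move: (v 0 i) => x; clear; nra.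
have [v Sv vmin] := @compact_EVT_min _ _ (fun v : 'rV[R]_n => dotr (v *m A) v) S
  (ltac:(by exists (s0 *: v0))) cS (continuous_subspaceT (@dotr_continuous n A)).
have [v1 vw] := set_mem Sv; set q := dotr (v *m A) v in vmin.
have hom z : (forall j, (j < k)%N -> dotr z (w j) = 0) -> q * dotr z z <= dotr (z *m A) z.
  move=> zw; have [->|z0] := eqVneq z 0.
    by rewrite mul0mx /dotr mul0mx mxE mulr0.
  have dz : 0 < dotr z z.
    by rewrite lt_def dotr_ge0 andbT; apply: contraNneq z0 => /dotr_eq0 ->.
  pose s := (Num.sqrt (dotr z z))^-1.
  have s2 : s * s * dotr z z = 1.
    by rewrite -expr2 exprVn sqr_sqrtr ?dotr_ge0// mulVf// gt_eqF.
  have Sz : S (s *: z).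
    split; first by rewrite dotrZ dotrC dotrZ mulrA.
    by move=> j jk; rewrite dotrZ zw// mulr0.
  have := vmin _ (mem_set Sz); rewrite -scalemxAl dotrZ dotrC dotrZ dotrC mulrA => le.
  have := ler_wpM2r (ltW dz) le; rewrite mulrAC s2 mul1r; exact.
exists v, q; have zE : v *m A - q *: v = 0.
  set z := _ - _; have zw j : (j < k)%N -> dotr z (w j) = 0.
    move=> jk; rewrite /z dotrD -scaleNr dotrZ vw// mulr0 addr0 dotrM// eig// dotrC dotrZ.
    by rewrite dotrC vw// mulr0.
  apply: dotr_eq0; apply/eqP; rewrite eq_le dotr_ge0 andbT.
  pose qz := dotr (z *m A) z - q * dotr z z.
  have vz : dotr (v *m A) z - q * dotr v z = dotr z z.
    have -> : dotr z z = dotr (v *m A + (- q) *: v) z by rewrite scaleNr.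
    by rewrite dotrD dotrZ mulNr.
  clearbody z.
  have ineq s : 2 * s * dotr z z <= s * s * qz.
    have zs j : (j < k)%N -> dotr (v + (- s) *: z) (w j) = 0.
      by move=> jk; rewrite dotrD dotrZ vw// zw// mulr0 addr0.
    have := hom _ zs; rewrite mulmxDl -scalemxAl !(dotrD, dotrZ, dotrDr, dotrZr).
    rewrite -/q v1 (dotrM z v sA) (dotrC z (v *m A)) (dotrC z v) /qz -vz.
    by clear; nra.
  rewrite leNgt; apply/negP => zz.
  have qz0 : 0 < qz by have := ineq 1; move: zz; clear; lra.
  (* The value of s that minimises s^2 qz - 2 s |z|^2. *)
  have := ineq (dotr z z / qz); rewrite -[leRHS]mulrA divfK ?gt_eqF//.
  have : 0 < dotr z z / qz * dotr z z by rewrite mulr_gt0// divr_gt0.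
  by clear; lra.
split => //.
- by apply/eqP => v0E; move: v1; rewrite v0E /dotr mul0mx mxE => /eqP; rewrite eq_sym oner_eq0.
- by apply/eqP; rewrite -subr_eq0 zE.
- have := vmin _ (mem_set Sv0); rewrite -scalemxAl dotrZ dotrC dotrZ dotrC mulrA => /le_trans; apply.
  have := ler_wpM2l (ltac:(by rewrite -expr2 sqr_ge0) : 0 <= s0 * s0) v0mu.
  by rewrite mulrCA s02 mulr1.
Qed.

(* Courant-Fischer, by successive minimisation. *)
Lemma sym_eigen n (A : 'M[R]_n) m (T : 'M[R]_(m, n)) mu0 : A^T = A -> row_free T ->
    (forall c : 'rV[R]_m, dotr (c *m T *m A) (c *m T) <= mu0 * dotr (c *m T) (c *m T)) ->
  exists (w : nat -> 'rV[R]_n) (mu : nat -> R), forall i, (i < m)%N ->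
    [/\ w i != 0, w i *m A = mu i *: w i, mu i <= mu0 & forall j, (j < i)%N -> dotr (w i) (w j) = 0].
Proof.
move=> sA fT Tmu; suff H k : (k <= m)%N -> exists (w : nat -> 'rV[R]_n) (mu : nat -> R),
    forall i, (i < k)%N ->
    [/\ w i != 0, w i *m A = mu i *: w i, mu i <= mu0 & forall j, (j < i)%N -> dotr (w i) (w j) = 0].
  exact: H.
elim: k => [_|k IH km]; first by exists (fun=> 0), (fun=> 0).
have [w [mu H]] := IH (ltnW km).
pose B := T *m (\matrix_(j < k) w j)^T.
(* A dimension count: k < m linear conditions leave a nonzero combination of the m test vectors
   orthogonal to the k eigenvectors already found. *)
have : kermx B != 0.
  rewrite -mxrank_eq0 mxrank_ker -lt0n subn_gt0; apply: leq_ltn_trans km.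
  exact: rank_leq_col.
move=> /rowV0Pn[c /sub_kermxP cB c0].
have := @rayleigh_min n A k w mu (c *m T) mu0 sA (fun j jk => let: And4 _ e _ _ := H j jk in e).
rewrite mulmx_free_eq0// => /(_ c0) [j jk|//|v [mu' [v0 ve vmu vw]]].
  have := congr1 (fun M : 'rV_k => M 0 (Ordinal jk)) cB; rewrite /B mulmxA !mxE => <-.
  by rewrite dotrE; apply: eq_bigr => i _; rewrite !mxE.
exists (fun i => if i == k then v else w i), (fun i => if i == k then mu' else mu i).
move=> i; rewrite ltnS leq_eqVlt => /predU1P[->|ik].
  by rewrite eqxx; split => // j jk; rewrite ltn_eqF// vw.
rewrite ltn_eqF//; have [? ? ? ww] := H i ik; split => // j ji.
by rewrite ltn_eqF ?ww// (ltn_trans ji).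
Qed.

End Rayleigh.

Section Family.
Context {R : realType}.
Implicit Types (t y lam D : R) (u G : nat -> nat -> nat -> R) (i j k l nu : nat) (mu : nat -> R).

Definition gfam (a b : nat -> R) u k l nu : nat -> nat -> R :=
  iter k (D1 (a nu)) (iter l (D2 (b nu)) (u nu)).

Lemma gfam_D2 (a b : nat -> R) u k l nu : D2 (b nu) (gfam a b u k l nu) = gfam a b u k l.+1 nu.
Proof. by rewrite /gfam; elim: k => [//|k IH] /=; rewrite D12 IH. Qed.

Definition eigp (a b : nat -> R) mu t y G := locp a b t y (fun nu i j =>
  dlap (a nu) (b nu) (G nu) i j = - mu nu * G nu i.+1 j.+1).

Lemma dlap_D1 (a b : R) F i j : dlap a b (D1 a F) i j = (dlap a b F i.+1 j - dlap a b F i j) / a.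
Proof.
by rewrite !dlapE /D1; ring.
Qed.

Lemma dlap_D2 (a b : R) F i j : dlap a b (D2 b F) i j = (dlap a b F i j.+1 - dlap a b F i j) / b.
Proof. by rewrite /dlap -!D12 /D1 /D2; ring. Qed.

Lemma eigp_D (a b : nat -> R) mu t y G : mesh a b -> eigp a b mu t y G ->
  eigp a b mu t y (fun nu => D1 (a nu) (G nu)) /\ eigp a b mu t y (fun nu => D2 (b nu) (G nu)).
Proof.
move=> ab H; have H2 := locpI H (locp_sh ab H).
split; apply: locpS H2 => nu i j [h0 [h1 h2 _]].
  by rewrite dlap_D1 h0 h1 /D1; ring.
by rewrite dlap_D2 h0 h2 /D2; ring.
Qed.

Lemma eigp_tame (a b : nat -> R) mu D t y G : mesh a b -> (forall nu, `|mu nu| <= D) -> tamep a b t y G ->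
  eigp a b mu t y G -> tamep a b t y (fun nu => dlap (a nu) (b nu) (G nu)).
Proof.
move=> ab muD TG EG; have muD' nu : `|- mu nu| <= D by rewrite normrN.
have [C HC] := tamepZ muD' (tamep_sh ab TG).
by exists C; apply: locpS (locpI EG HC) => nu i j [->].
Qed.

Lemma gfam_tame (a b : nat -> R) mu D t y u k l : mesh a b -> (forall nu, `|mu nu| <= D) -> 0 < t -> 0 < y ->
    tamep a b t y u -> eigp a b mu t y u ->
  tamep a b t y (gfam a b u k l) /\ eigp a b mu t y (gfam a b u k l).
Proof.
move=> ab muD t0 y0 Tu Eu.
have S1 G : tamep a b t y G /\ eigp a b mu t y G ->
    (tamep a b t y (fun nu => D1 (a nu) (G nu)) /\ eigp a b mu t y (fun nu => D1 (a nu) (G nu))) /\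
    (tamep a b t y (fun nu => D2 (b nu) (G nu)) /\ eigp a b mu t y (fun nu => D2 (b nu) (G nu))).
  move=> [TG EG]; have [T1 T2] := tamep_D ab t0 y0 TG (eigp_tame ab muD TG EG).
  by have [E1 E2] := eigp_D ab EG.
elim: k => [|k IH]; last exact: (S1 _ IH).1.
by elim: l => [//|l IH]; exact: (S1 _ IH).2.
Qed.

Variables (W : set_system nat) (a b : nat -> R).
Hypotheses (WU : UltraFilter W) (Woo : \oo `<=` W) (ab : mesh a b).

Definition glimf u k l t y : R := glim W a b (gfam a b u k l) t y.

Lemma glim_jets O u mu lam D : (forall t y, O (t, y) -> 0 < t /\ 0 < y) ->
    (forall nu, `|mu nu| <= D) -> mu @ W --> lam ->
    (forall t y, O (t, y) -> tamep a b t y u /\ eigp a b mu t y u) ->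
  jets O (glimf u) /\ forall t y, O (t, y) ->
    glimf u 2 0 t y + glimf u 0 2 t y + lam * glimf u 0 0 t y = 0.
Proof.
move=> O0 muD mulam Ou.
have T k l t y : O (t, y) -> tamep a b t y (gfam a b u k l).
  move=> Oty; have [t0 y0] := O0 _ _ Oty; have [Tu Eu] := Ou _ _ Oty.
  exact: (gfam_tame k l ab muD t0 y0 Tu Eu).1.
have D2E k l : (fun nu => D2 (b nu) (gfam a b u k l nu)) = gfam a b u k l.+1.
  by apply: funext => nu; exact: gfam_D2.
split=> [k l t y Oty|t y Oty]; have [t0 y0] := O0 _ _ Oty.
  split.
  - apply: glim_ctn => //; last exact: T; first exact: (T k.+1 l _ _ Oty).
    by rewrite D2E; exact: T.
  - apply: glim_der1 => //; [exact: T|exact: (T k.+1 l _ _ Oty)|exact: (T k.+2 l _ _ Oty)|].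
    by have := D2E k.+1 l; rewrite /gfam /= => ->; exact: (T k.+1 l.+1 _ _ Oty).
  (* The y-derivative is [glim_der1] for the transposed family on the mesh with exchanged steps. *)
  - have ba := mesh_swap ab.
    have sw k' l' : tamep b a y t (fun nu i j => gfam a b u k' l' nu j i) by exact/tamep_swap/T.
    have e1 : (fun nu => D1 (b nu) (fun i j => gfam a b u k l nu j i)) =
        (fun nu i j => gfam a b u k l.+1 nu j i).
      by rewrite -D2E.
    have e2 : (fun nu => D1 (b nu) (D1 (b nu) (fun i j => gfam a b u k l nu j i))) =
        (fun nu i j => gfam a b u k l.+2 nu j i).
      rewrite -D2E; apply: funext => nu; apply: funext => i; apply: funext => j.
      by have /(congr1 (fun f => f nu)) := e1; rewrite /= => ->.
    have e3 : (fun nu => D2 (a nu) (D1 (b nu) (fun i j => gfam a b u k l nu j i))) =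
        (fun nu i j => gfam a b u k.+1 l.+1 nu j i).
      apply: funext => nu; apply: funext => i; apply: funext => j.
      by have /(congr1 (fun f => f nu)) := e1; rewrite /= => ->.
    have := @glim_der1 R W b a WU Woo ba y t (fun nu i j => gfam a b u k l nu j i) y0 t0.
    by rewrite e2 e3 e1; apply; exact: sw.
have [Tu Eu] := Ou _ _ Oty; have PW := @ultra_proper _ _ WU.
have ns k l : _ /\ _ := glim_step WU Woo ab t0 y0 (T k.+1 l _ _ Oty)
   (ltac:(by rewrite D2E; exact: T)) (T k l _ _ Oty).
have [_ c1] := ns 2%N 0%N; have [c2 _] := ns 0%N 2%N.
have [r r0 Hr] := locp_idx ab t0 y0 Eu.
have [_ _ Hn] := Hr t y ltac:(by rewrite subrr normr0 ltW) ltac:(by rewrite subrr normr0 ltW).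
(* The eigenvalue equation holds at the centre of the stencil, one step away from the rounded point
   in each direction; two uses of [glim_step] identify the limit there. *)
have s11 : (fun nu => u nu (idx (a nu) t).+1 (idx (b nu) y).+1) @ W --> glimf u 0 0 t y.
  have T1 k l : tamep a b t y (fun nu i j => gfam a b u k l nu i.+1 j).
    have [C HC] := T k l _ _ Oty; exists C.
    by apply: locpS (locp_sh ab HC) => nu i j [].
  have [_ c3] := glim_step WU Woo ab t0 y0 (G := fun nu i j => u nu i.+1 j) (T1 1%N 0%N) (T1 0%N 1%N) (T1 0%N 0%N).
  have [c0 _] := ns 0%N 0%N.
  suff -> : glimf u 0 0 t y = glim W a b (fun nu i j => u nu i.+1 j) t y by [].
  by apply/esym/cvg_lim => //; exact: c0.
have /(_ (@filter_filter _ _ PW)) cl := cvgD c1 c2; have cr : (fun nu => - mu nu * u nu (idx (a nu) t).+1 (idx (b nu) y).+1) @ W --> - lam * glimf u 0 0 t y.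
  by apply: cvgM s11; exact: cvgN.
have E : (fun nu => - mu nu * u nu (idx (a nu) t).+1 (idx (b nu) y).+1) @ W --> glimf u 2 0 t y + glimf u 0 2 t y.
  apply/cvgrPdist_le => e e0; move/cvgrPdist_le: cl => /(_ e e0) cl.
  by apply: filterS2 (Woo Hn) cl => nu <-.
have := cvg_unique _ E cr; rewrite mulNr => ->; first by rewrite addNr.
exact: norm_hausdorff.
Qed.

End Family.

(** * The discrete Dirichlet problem: test functions and barriers *)

Section GridEigen.
Context {R : realType}.
Implicit Types (a b : R) (D : pred (nat * nat)) (f g : nat -> nat -> R).

Definition discrete_eigen a b D mu f :=
  (forall p, ~~ D p -> f p.1 p.2 = 0) /\
  (forall i j, D (i.+1, j.+1) -> dlap a b f i j = - mu * f i.+1 j.+1).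

(** Minus the five-point Laplacian on functions supported in D is a symmetric matrix. Tested against
    one another the functions [t l] behave like eigenfunctions for mu0, so the Rayleigh quotient is
    mu0 on their whole span; the private point of each [t l] makes them independent. [sym_eigen]
    then yields m eigenvectors with eigenvalue at most mu0. *)
Lemma grid_eigen a b D P Q m mu0 (t : 'I_m -> nat -> nat -> R) :
    0 < a -> 0 < b -> (forall p, D p -> (0 < p.1 < P)%N && (0 < p.2 < Q)%N) ->
    (forall l p, ~~ D p -> t l p.1 p.2 = 0) ->
    (forall l, exists p, [/\ D p, t l p.1 p.2 != 0 & forall l', l' != l -> t l' p.1 p.2 = 0]) ->
    (forall l l' i j, D (i.+1, j.+1) ->
       dlap a b (t l) i j * t l' i.+1 j.+1 = - mu0 * (t l i.+1 j.+1 * t l' i.+1 j.+1)) ->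
  exists (w : nat -> nat -> nat -> R) (mu : nat -> R), forall l, (l < m)%N ->
    [/\ discrete_eigen a b D (mu l) (w l), mu l <= mu0, exists p, D p /\ w l p.1 p.2 != 0
      & forall l', (l' < l)%N -> \sum_(i < P) \sum_(j < Q) w l i j * w l' i j = 0].
Proof.
move=> a0 b0 DPQ t0 tne tE.
pose T := {p : 'I_P * 'I_Q | D (p.1 : nat, p.2 : nat)}; pose n := #|{: T}|.
pose pt (k : 'I_n) : nat * nat := let p := val (enum_val k : T) in (p.1 : nat, p.2 : nat).
have Dpt k : D (pt k) by exact: (valP (enum_val k : T)).
have pt_inj : injective pt.
  move=> k k'; rewrite /pt => -[e1 e2]; apply: enum_val_inj; apply: val_inj.
  by rewrite [LHS]surjective_pairing [RHS]surjective_pairing; congr pair; exact: val_inj.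
have ptP p : D p -> exists k, pt k = p.
  move=> Dp; have /andP[/andP[_ h1] /andP[_ h2]] := DPQ _ Dp.
  have Dp' : D ((Ordinal h1, Ordinal h2).1 : nat, (Ordinal h1, Ordinal h2).2 : nat).
    by rewrite /= -surjective_pairing.
  exists (enum_rank (exist (fun p : 'I_P * 'I_Q => D (p.1 : nat, p.2 : nat)) _ Dp' : T)).
  by rewrite /pt enum_rankK /= -surjective_pairing.
clearbody pt.
pose F (v : 'rV[R]_n) i j : R := \sum_k v 0 k * (pt k == (i, j))%:R.
have Fpt v k : F v (pt k).1 (pt k).2 = v 0 k.
  rewrite /F (bigD1 k)//= -surjective_pairing eqxx mulr1 big1 ?addr0// => k' k'k.
  by rewrite (inj_eq pt_inj) (negbTE k'k) mulr0.
have Foff v p : ~~ D p -> F v p.1 p.2 = 0.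
  move=> nD; rewrite /F big1// => k _; rewrite -surjective_pairing.
  by case: eqP => [E|_]; [move: nD; rewrite -E Dpt|rewrite mulr0].
pose nb (x y : nat) : R := (x == y.+1)%:R + (y == x.+1)%:R.
pose A : 'M[R]_n := \matrix_(k, k') ((2 / a / a + 2 / b / b) * (pt k == pt k')%:R
  - nb (pt k).1 (pt k').1 * ((pt k).2 == (pt k').2)%:R / a / a
  - ((pt k).1 == (pt k').1)%:R * nb (pt k).2 (pt k').2 / b / b).
have sA : A^T = A.
  apply/matrixP => k k'; rewrite !mxE /nb (eq_sym (pt k')) (eq_sym (pt k').2 (pt k).2).
  rewrite (eq_sym (pt k').1 (pt k).1) (addrC ((pt k').1 == _)%:R) (addrC ((pt k').2 == _)%:R).
  by [].
have AF v i j k : pt k = (i.+1, j.+1) -> (v *m A) 0 k = - dlap a b (F v) i j.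
  move=> pk; have -> : - dlap a b (F v) i j = (2 / a / a + 2 / b / b) * F v i.+1 j.+1
      - (F v i.+2 j.+1 + F v i j.+1) / a / a - (F v i.+1 j.+2 + F v i.+1 j) / b / b.
    by rewrite dlapE; ring.
  rewrite mxE /F -!big_split /= !mulr_suml mulr_sumr -!sumrB; apply: eq_bigr => q _.
  rewrite mxE pk /nb; case: (pt q) => x y /=; rewrite !xpair_eqE (eq_sym i.+1 x.+1) (eq_sym j.+1 y.+1) !eqSS.
  by rewrite -!mulnb !natrM; ring.
pose Tm : 'M[R]_(m, n) := \matrix_(l, k) t l (pt k).1 (pt k).2.
have FT l : F (row l Tm) = t l.
  apply: funext => i; apply: funext => j; have [Dij|nD] := boolP (D (i, j)).
    have [k pk] := ptP _ Dij; have := Fpt (row l Tm) k.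
    by rewrite pk /= => ->; rewrite !mxE pk.
  by rewrite (Foff _ (i, j) nD) (t0 l (i, j) nD).
have pS k : exists i j, pt k = (i.+1, j.+1).
  have := DPQ _ (Dpt k); case: (pt k) => [[|i] [|j]] //=; first by rewrite andbF.
  by exists i, j.
have TAT : Tm *m A *m Tm^T = mu0 *: (Tm *m Tm^T).
  apply/matrixP => l l'; rewrite mxE [RHS]mxE [in RHS]mxE mulr_sumr; apply: eq_bigr => k _.
  have [i [j pk]] := pS k; have -> : (Tm *m A) l k = (row l Tm *m A) 0 k.
    by rewrite -row_mul [RHS]mxE.
  rewrite (AF _ _ _ _ pk) FT !mxE pk /=; have := tE l l' i j; rewrite -pk => /(_ (Dpt k)).
  by move=> e; rewrite [LHS]mulNr e mulNr opprK.
have fT : row_free Tm.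
  rewrite -kermx_eq0; apply/eqP/eqP/rowV0P => c /sub_kermxP cT.
  apply/rowP => l; rewrite mxE; have [p [Dp tp tp']] := tne l.
  have [k pk] := ptP _ Dp; have := congr1 (fun v : 'rV_n => v 0 k) cT.
  rewrite !mxE (bigD1 l)//= big1 ?addr0 => [|l' ll']; last by rewrite mxE pk tp' ?mulr0.
  by rewrite mxE pk => /eqP; rewrite mulf_eq0 (negbTE tp) orbF => /eqP.
have Tmu (c : 'rV[R]_m) : dotr (c *m Tm *m A) (c *m Tm) <= mu0 * dotr (c *m Tm) (c *m Tm).
  rewrite /dotr trmx_mul.
  rewrite le_eqVlt; apply/orP; left; apply/eqP.
  rewrite !mulmxA -(mulmxA _ A) -(mulmxA c) (mulmxA Tm) TAT.
  by rewrite -scalemxAr -scalemxAl mxE !mulmxA.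
have [w [mu H]] := sym_eigen sA fT Tmu.
exists (fun l => F (w l)), mu => l lm; have [w0 wA wmu ww] := H l lm; split => //.
- split=> [p nD|i j Dij]; first exact: Foff.
  have [k pk] := ptP _ Dij; have := AF (w l) i j k pk; rewrite wA mxE => e.
  by have := Fpt (w l) k; rewrite pk /= => ->; rewrite mulNr e opprK.
- have [k wk] : exists k, w l 0 k != 0.
    apply: contrapT => nz; move/eqP: w0; apply; apply/rowP => k; rewrite mxE.
    by apply/eqP/negPn/negP => h; apply: nz; exists k.
  by exists (pt k); rewrite Fpt.
- move=> l' l'l; transitivity (dotr (w l) (w l')); last exact: ww.
  rewrite dotrE pair_bigA /=.
  under eq_bigr do rewrite {1}/F mulr_suml.
  rewrite exchange_big /=; apply: eq_bigr => k _.
  have /andP[/andP[_ h1] /andP[_ h2]] := DPQ _ (Dpt k).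
  rewrite (bigD1 (Ordinal h1, Ordinal h2))//= big1 ?addr0 => [|p pk].
    by rewrite -surjective_pairing eqxx mulr1 -(Fpt (w l') k).
  suff -> : (pt k == (p.1 : nat, p.2 : nat)) = false by rewrite mulr0 mul0r.
  apply: contraNF pk => /eqP pk; apply/eqP.
  by rewrite [LHS]surjective_pairing; congr pair; apply: val_inj; rewrite /= pk.
Qed.

(** The first index measures t = N - x from the flat right end, so that indices are natural numbers
    and the flat side is a grid line. *)
Definition gdom (phi : R -> R) (N a b : R) (n : nat) : pred (nat * nat) :=
  [pred p | [&& (0 < p.1)%N, (0 < p.2 < n)%N & p.1%:R * a < N + phi (p.2%:R * b)]].

Lemma sin_natpi (j : nat) : sin (j%:R * pi) = 0 :> R.
Proof.
by apply/eqP; rewrite -normr_eq0 -(sinB_natpi j) subrr sin0 normr0.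
Qed.

(** Cut the rectangle of length N into m blocks and put on each the product of discrete sines
    vanishing on its edges. These are exact discrete eigenfunctions of the block, with eigenvalue (2
    - 2 cos th) (1 / a^2 + 1 / b^2) <= pi^2 + (m pi / N)^2, the first eigenvalue of an N / m by 1
    rectangle; this is where the threshold comes from. The blocks lie in the domain because phi >=
    0. *)
Lemma block_eigen phi N S m n P : between0 phi S -> 0 < N -> (0 < m)%N -> (1 < n)%N ->
    let a := N / (m%:R * n%:R) in let b := n%:R^-1 in N + S < P%:R * a ->
  exists (w : nat -> nat -> nat -> R) (mu : nat -> R), forall l, (l < m)%N ->
    [/\ discrete_eigen a b (gdom phi N a b n) (mu l) (w l), mu l <= pi ^+ 2 + (m%:R * pi / N) ^+ 2,
      exists p, gdom phi N a b n p /\ w l p.1 p.2 != 0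
      & forall l', (l' < l)%N -> \sum_(i < P) \sum_(j < n) w l i j * w l' i j = 0].
Proof.
move=> phiS N0 m0 n1 a b Pa.
have n0 : 0 < n%:R :> R by rewrite ltr0n ltnW.
have mr0 : 0 < m%:R :> R by rewrite ltr0n.
have a0 : 0 < a by rewrite divr_gt0// mulr_gt0.
have b0 : 0 < b by rewrite invr_gt0.
have amn : (m * n)%:R * a = N by rewrite natrM /a mulrC divfK// gt_eqF// mulr_gt0.
have bn : n%:R * b = 1 by rewrite /b mulfV// gt_eqF.
pose th : R := pi / n%:R; have thn l : th * (l * n)%:R = l%:R * pi.
  by rewrite natrM /th; field; rewrite gt_eqF.
have sn0 l : sin (th * (l * n)%:R) = 0 by rewrite thn sin_natpi.
have jb j : (0 < j < n)%N -> 0 < j%:R * b < 1.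
  move=> /andP[j0 jn]; apply/andP; split; first by rewrite mulr_gt0 ?ltr0n.
  have jn' : j%:R < n%:R :> R by rewrite ltr_nat.
  by rewrite /b ltr_pdivrMr// mul1r.
have ltmn i : (i < m * n)%N -> i%:R * a < N by move=> imn; rewrite -amn ltr_pM2r// ltr_nat.
pose t (l : 'I_m) i j : R := if [&& (l * n <= i)%N, (i <= l.+1 * n)%N & (j <= n)%N]
  then sin (th * i%:R) * sin (th * j%:R) else 0.
pose mu0 := (2 - 2 * cos th) / a / a + (2 - 2 * cos th) / b / b.
have mu0b : mu0 <= pi ^+ 2 + (m%:R * pi / N) ^+ 2.
  have c2 : 2 - 2 * cos th <= th ^+ 2 by have := @cos_ge_quad R th; clear; lra.
  have e1 : th ^+ 2 / a / a = (m%:R * pi / N) ^+ 2.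
    by rewrite /th /a; field; rewrite ?(gt_eqF n0) ?(gt_eqF mr0) ?(gt_eqF N0).
  have e2 : th ^+ 2 / b / b = pi ^+ 2 by rewrite /th /b; field; rewrite (gt_eqF n0).
  by rewrite -e1 -e2 addrC; apply: lerD; rewrite ler_pM2r ?invr_gt0// ler_pM2r ?invr_gt0.
have := @grid_eigen a b (gdom phi N a b n) P n m mu0 t a0 b0.
case.
- move=> [i j] /and3P[/= i0 jn ia]; rewrite i0 jn andbT /=.
  have := phiS _ (jb j jn) => pS; rewrite -(ltr_nat R) -(ltr_pM2r a0).
  by move: pS ia Pa; clear; lra.
- move=> l [i j] /= nD; rewrite /t; case: ifP => // /and3P[li il jn].
  have [->|i0] := posnP i; first by rewrite mulr0 sin0 mul0r.
  have [->|j0] := posnP j; first by rewrite mulr0 sin0 mulr0.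
  have [->|jn'] := eqVneq j n; first by have := sn0 1%N; rewrite mul1n => ->; rewrite mulr0.
  have jn2 : (0 < j < n)%N by rewrite j0 ltn_neqAle jn' jn.
  have [->|imn] := eqVneq i (m * n)%N; first by rewrite sn0 mul0r.
  have imn' : (i < m * n)%N.
    by rewrite ltn_neqAle imn /=; apply: (leq_trans il); rewrite leq_mul2r ltn_ord orbT.
  exfalso; move/negP: nD; apply; apply/and3P; split => //=.
  by apply: (lt_le_trans (ltmn i imn')); have := phiS _ (jb j jn2); clear; lra.
- move=> l; exists ((l * n).+1, 1%N); split => /=.
  + apply/and3P; split => //=; have lmn : ((l * n).+1 < m * n)%N.
      have := leq_mul (ltn_ord l) (leqnn n); rewrite mulSn; move: n1; clear; lia.
    by apply: (lt_le_trans (ltmn _ lmn)); rewrite lerDl; case/andP: (phiS _ (jb 1%N n1)).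
  + rewrite /t leqnSn mulSn (ltnW n1) /= ifT; last by move: n1; clear; lia.
    have sth : 0 < sin th.
      rewrite sin_gt0_pi// /th divr_gt0 ?pi_gt0//= ltr_pdivrMr// ltr_pMr ?pi_gt0//.
      by rewrite ltr1n.
    rewrite mulf_neq0//; last by rewrite mulr1 gt_eqF.
    rewrite -normr_gt0 -(sinB_natpi l) -(@natr1 R (l * n)%N) mulrDr mulr1 thn addrAC subrr add0r.
    by rewrite gtr0_norm.
  + move=> l' l'l; rewrite /t ifF//; apply/negP => /and3P[h1 h2 _].
    have : (l' < l)%N \/ (l < l')%N by move: l'l; rewrite -val_eqE /=; clear; lia.
    case=> ll; first by have := leq_mul ll (leqnn n); move: h2; clear; lia.
    by have := leq_mul ll (leqnn n); rewrite mulSn; move: h1 n1; clear; lia.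
- move=> l l' i j /and3P[/= _ jn _].
  have [bl|nbl] := boolP ((l' * n < i.+1) && (i.+1 < l'.+1 * n))%N; last first.
    suff -> : t l' i.+1 j.+1 = 0 by rewrite !mulr0.
    rewrite /t; case: ifP => // /and3P[h1 h2 _].
    have : i.+1 = (l' * n)%N \/ i.+1 = (l'.+1 * n)%N by move: nbl h1 h2; clear; lia.
    by case=> ->; rewrite sn0 mul0r.
  (* The stencil of an interior point of block l' stays in the closed block. There [t l] is the sine
     product for l = l' and zero otherwise, also on a shared edge, where the sine itself
     vanishes. *)
  have claim i' j' : (l' * n <= i' <= l'.+1 * n)%N -> (j' <= n)%N ->
      t l i' j' = (l == l')%:R * (sin (th * i'%:R) * sin (th * j'%:R)).
    move=> /andP[h1 h2] jn'; rewrite /t jn' andbT; have [->|ll] := eqVneq l l'.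
      by rewrite h1 h2 mul1r.
    rewrite mul0r; case: ifP => // /andP[h3 h4].
    have : (l' < l)%N \/ (l < l')%N by move: ll; rewrite -val_eqE /=; clear; lia.
    case=> lt; have := leq_mul lt (leqnn n) => h5.
      by have -> : i' = (l * n)%N; [move: h2 h3 h5; clear; lia|rewrite sn0 mul0r].
    by have -> : i' = (l' * n)%N; [move: h1 h4 h5; clear; lia|rewrite sn0 mul0r].
  have sE k : sin (th * k.+2%:R) + sin (th * k%:R) = 2 * cos th * sin (th * k.+1%:R) :> R.
    have -> : th * k.+2%:R = th * k.+1%:R + th by rewrite -(@natr1 R k.+1); ring.
    have -> : th * k%:R = th * k.+1%:R - th by rewrite -(@natr1 R k); ring.
    by rewrite sinD sinB; ring.
  suff -> : dlap a b (t l) i j = - mu0 * t l i.+1 j.+1 by rewrite mulrA.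
  rewrite dlapE !claim; try (move: bl jn; clear; lia).
  have s1 := sE i; have s2 := sE j; rewrite /mu0.
  rewrite (_ : sin (th * i.+2%:R) = 2 * cos th * sin (th * i.+1%:R) - sin (th * i%:R)); last by rewrite -s1; ring.
  rewrite (_ : sin (th * j.+2%:R) = 2 * cos th * sin (th * j.+1%:R) - sin (th * j%:R)); last by rewrite -s2; ring.
  by ring.
move=> w [mu H]; exists w, mu => l lm; have [h1 h2 h3 h4] := H l lm.
by split => //; exact: le_trans h2 mu0b.
Qed.

(** Barrier K ell (2 B - ell): as ell is affine, its five-point Laplacian is exactly - 2 K (c1^2 +
    c2^2), and 2 K = L + 1 beats |mu f| <= L. The margin [tau] inside ell keeps the barrier
    nonnegative at the neighbours of D, where f is zero. *)
Lemma grid_barrier a b D P Q mu L f c0 c1 c2 B tau : 0 < a -> 0 < b ->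
    (forall p, D p -> (0 < p.1 < P)%N && (0 < p.2 < Q)%N) -> discrete_eigen a b D mu f ->
    0 <= mu <= L -> (forall i j, `|f i j| <= 1) -> 1 <= c1 ^+ 2 + c2 ^+ 2 -> 0 < B ->
    let ell i j := c0 + c1 * (i%:R * a) + c2 * (j%:R * b) + tau in
    (forall i j, D (i.+1, j.+1) -> forall i' j', (i <= i' <= i.+2)%N -> (j <= j' <= j.+2)%N ->
       0 <= ell i' j' <= 2 * B) ->
  forall i j, D (i, j) -> `|f i j| <= (L + 1) * B * ell i j.
Proof.
move=> a0 b0 DPQ [foff feq] muL f1 cc B0 ell ellB i j Dij.
have L0 : 0 <= L by case/andP: muL; exact: le_trans.
pose K := (L + 1) / 2; pose be i j := K * (ell i j * (2 * B - ell i j)).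
have K0 : 0 < K by rewrite divr_gt0// ltr_wpDl.
have side s : s = 1 \/ s = -1 -> 0 <= be i j - s * f i j.
  move=> sE; pose g i j := be i j - s * f i j; rewrite leNgt; apply/negP => gneg.
  have DPQ' p : D p -> (p.1 < P)%N && (p.2 < Q)%N by move=> /DPQ /andP[/andP[_ ->] /andP[_ ->]].
  have [[x y] /= Dxy gmin] := finite_min g DPQ' Dij.
  have gxy : g x y < 0 by apply: le_lt_trans gneg; exact: gmin (i, j) Dij.
  have [x' xE] : exists x', x = x'.+1.
    by have := DPQ _ Dxy; case: (x) => [//|x'] _; exists x'.
  have [y' yE] : exists y', y = y'.+1.
    by have := DPQ _ Dxy; case: (y) => [|y' _]; [rewrite andbF|exists y'].
  rewrite xE yE in Dxy gmin gxy.
  have nbr p q : (x' <= p <= x'.+2)%N -> (y' <= q <= y'.+2)%N -> g x'.+1 y'.+1 <= g p q.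
    move=> px qy; have [Dpq|nD] := boolP (D (p, q)); first exact: gmin (p, q) Dpq.
    apply: (le_trans (ltW gxy)); rewrite /g (foff (p, q) nD) mulr0 subr0.
    have eb := ellB _ _ Dxy p q px qy; rewrite /be mulr_ge0 ?(ltW K0)// mulr_ge0//.
      by case/andP: eb.
    by move: eb; clear; lra.
  have s1 := sdiff_min a0 (nbr x'.+2 y'.+1 ltac:(clear; lia) ltac:(clear; lia))
    (nbr x' y'.+1 ltac:(clear; lia) ltac:(clear; lia)).
  have s2 := sdiff_min b0 (nbr x'.+1 y'.+2 ltac:(clear; lia) ltac:(clear; lia))
    (nbr x'.+1 y' ltac:(clear; lia) ltac:(clear; lia)).
  have dE : (g x'.+2 y'.+1 + g x' y'.+1 - 2 * g x'.+1 y'.+1) / a / a +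
     (g x'.+1 y'.+2 + g x'.+1 y' - 2 * g x'.+1 y'.+1) / b / b =
     - 2 * K * (c1 ^+ 2 + c2 ^+ 2) - s * dlap a b f x' y'.
    rewrite dlapE /g /be /ell -(@natr1 R x'.+1) -(@natr1 R x') -(@natr1 R y'.+1) -(@natr1 R y').
    by field; rewrite !gt_eqF.
  move: s1 s2 dE; rewrite (feq _ _ Dxy).
  have sf : s * f x'.+1 y'.+1 <= 1.
    have := f1 x'.+1 y'.+1; rewrite ler_norml; case: sE => ->; rewrite ?mul1r ?mulN1r; clear; lra.
  have h1 : mu * (s * f x'.+1 y'.+1) <= L.
    have /andP[mu0 muL'] := muL.
    by apply: le_trans muL'; rewrite -[leRHS]mulr1 ler_wpM2l.
  have h2 : 2 * K <= 2 * K * (c1 ^+ 2 + c2 ^+ 2) by rewrite ler_peMr// mulr_ge0// ltW.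
  by move: h1 h2; rewrite /K; clear; lra.
have ij : exists i' j', i = i'.+1 /\ j = j'.+1.
  have := DPQ _ Dij; case: (i) (j) => [//|i'] [|j'] /=; first by rewrite andbF.
  by move=> _; exists i', j'.
have eb : 0 <= ell i j <= 2 * B.
  by move: Dij; have [i' [j' [-> ->]]] := ij => Dij; apply: (ellB _ _ Dij); clear; lia.
have beb : be i j <= (L + 1) * B * ell i j.
  have : 0 <= K * (ell i j * ell i j) by rewrite mulr_ge0 ?(ltW K0)// -expr2 sqr_ge0.
  by rewrite /be /K; clear; lra.
have := side 1 (or_introl erefl); have := side (-1) (or_intror erefl).
by rewrite ler_norml; move: beb; clear; lra.
Qed.

End GridEigen.

(** * Existence of eigenfunctions *)

(** [sh_sup] is the form in which concavity is exploited: at each height a supporting line of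
    bounded slope lies above the graph, and the half-plane that it bounds contains the domain and
    supplies an affine function for [grid_barrier]. *)
Record cap_shape {R : realType} (phi : R -> R) (S Lp : R) : Prop := Shape {
  sh_S0 : 0 <= S;
  sh_L0 : 0 <= Lp;
  sh_S : between0 phi S;
  sh_lip : forall y y', 0 < y < 1 -> 0 < y' < 1 -> `|phi y - phi y'| <= Lp * `|y - y'|;
  sh_sup : forall y0, 0 < y0 < 1 -> exists2 s, `|s| <= Lp &
    forall y, 0 < y < 1 -> phi y <= phi y0 + s * (y - y0) }.

Section Counting.
Context {R : realType}.

Lemma sum_window (g : nat -> R) P i0 k c : (i0 + k <= P)%N -> (forall i, 0 <= g i) ->
  (forall i, (i0 <= i < i0 + k)%N -> c <= g i) -> c * k%:R <= \sum_(i < P) g i.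
Proof.
move=> kP g0 gc; rewrite -(big_mkord xpredT g).
have i0P : (i0 <= P)%N by apply: leq_trans kP; exact: leq_addr.
rewrite (@big_cat_nat _ _ _ i0)//= (@big_cat_nat _ _ _ (i0 + k) i0)//= ?leq_addr//.
have h1 : 0 <= \sum_(0 <= i < i0) g i by exact: sumr_ge0.
have h2 : 0 <= \sum_(i0 + k <= i < P) g i by exact: sumr_ge0.
have h3 : c * k%:R <= \sum_(i0 <= i < i0 + k) g i.
  have -> : c * k%:R = \sum_(i0 <= i < i0 + k) c by rewrite sumr_const_nat addKn mulr_natr.
  exact: ler_sum_nat.
by move: h1 h2 h3; lra.
Qed.

(** Expanding the vanishing sum, c times the sum of u^2 equals minus the sum of u (v - c u), at most
    e P Q in absolute value; the window alone contributes k k' / 4 to the sum of u^2. *)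
Lemma orth_count (u v : nat -> nat -> R) P Q i0 k j0 k' c e : (i0 + k <= P)%N -> (j0 + k' <= Q)%N ->
    (forall i j, `|u i j| <= 1) -> (forall i j, `|v i j - c * u i j| <= e) ->
    (forall i j, (i0 <= i < i0 + k)%N -> (j0 <= j < j0 + k')%N -> 1 / 2 <= `|u i j|) ->
    \sum_(i < P) \sum_(j < Q) u i j * v i j = 0 ->
  `|c| * (k%:R * k'%:R) <= 4 * e * (P%:R * Q%:R).
Proof.
move=> kP kQ u1 ve uw uv0.
have h1 : 1 / 4 * k'%:R * k%:R <= \sum_(i < P) \sum_(j < Q) u i j ^+ 2.
  apply: (sum_window (g := fun i => \sum_(j < Q) u i j ^+ 2) kP) => [i|i ik].
    by apply: sumr_ge0 => j _; exact: sqr_ge0.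
  apply: (sum_window (g := fun j => u i j ^+ 2) kQ) => [j|j jk]; first exact: sqr_ge0.
  have := uw i j ik jk; rewrite -real_normK ?num_real//; move: `|_| => z z2.
  by nra.
have h2 : c * (\sum_(i < P) \sum_(j < Q) u i j ^+ 2) = - \sum_(i < P) \sum_(j < Q) u i j * (v i j - c * u i j).
  have E : \sum_(i < P) \sum_(j < Q) u i j * v i j = c * (\sum_(i < P) \sum_(j < Q) u i j ^+ 2) +
      \sum_(i < P) \sum_(j < Q) u i j * (v i j - c * u i j).
    rewrite mulr_sumr -big_split /=; apply: eq_bigr => i _.
    rewrite mulr_sumr -big_split /=; apply: eq_bigr => j _; ring.
  by move: E; rewrite uv0; move: (\sum_(i < P) _) (\sum_(i < P) _) => z z'; lra.
have h3 : `|\sum_(i < P) \sum_(j < Q) u i j * (v i j - c * u i j)| <= e * (P%:R * Q%:R).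
  apply: le_trans (ler_norm_sum _ _ _) _.
  have -> : e * (P%:R * Q%:R) = \sum_(i < P) (e * Q%:R).
    by rewrite sumr_const card_ord -mulr_natr; ring.
  apply: ler_sum => i _; apply: le_trans (ler_norm_sum _ _ _) _.
  have -> : e * Q%:R = \sum_(j < Q) e by rewrite sumr_const card_ord mulr_natr.
  apply: ler_sum => j _; rewrite normrM -[leRHS]mul1r; exact: ler_pM.
have : `|c * (\sum_(i < P) \sum_(j < Q) u i j ^+ 2)| <= e * (P%:R * Q%:R) by rewrite h2 normrN.
rewrite normrM (@ger0_norm _ (\sum_(i < P) _)); last first.
  by apply: sumr_ge0 => i _; apply: sumr_ge0 => j _; exact: sqr_ge0.
have := ler_wpM2l (normr_ge0 c) h1.
by move: (\sum_(i < P) _) => z; lra.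
Qed.

Lemma idx_le (h z : R) : 0 < h -> 0 <= z -> (idx h z)%:R * h <= z.
Proof.
move=> h0 z0; have /andP[+ _] := trunc_itv (divr_ge0 z0 (ltW h0)).
by rewrite ler_pdivlMr.
Qed.

Lemma window_near (h z rr r : R) (p q : nat) : 0 < h -> h <= rr / 2 -> rr <= r / 2 -> 0 < z ->
    q%:R * h <= rr -> (idx h z <= p < idx h z + q)%N ->
  `|p%:R * h - z| <= r /\ `|p%:R * h - (idx h z)%:R * h| <= rr.
Proof.
move=> h0 hr rrr z0 qr /andP[p1 /ltnW p2]; have zz := idxP h0 (ltW z0).
have := ler_wpM2r (ltW h0) (ltac:(by rewrite ler_nat) : (idx h z)%:R <= p%:R :> R).
have := ler_wpM2r (ltW h0) (ltac:(by rewrite ler_nat) : p%:R <= (idx h z + q)%:R :> R).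
move=> l2 l1; rewrite natrD mulrDl in l2; rewrite (ger0_norm (x := _ - (idx h z)%:R * h)) ?subr_ge0//.
by move: zz l1 l2 qr hr rrr; rewrite !ler_norml; clear; lra.
Qed.

(* Two discrete functions that are orthogonal and almost proportional are small on a
   fixed proportion of the grid. *)
Lemma orth_window (h h' t y rr r C' c e : R) (u v : nat -> nat -> R) P Q : 0 < h -> 0 < h' ->
    0 < t -> 0 < y -> 0 < rr -> h <= rr / 2 -> h' <= rr / 2 -> rr <= r / 2 -> 0 <= C' ->
    C' * (rr + rr) <= 1 / 4 -> t + rr <= P%:R * h -> y + rr <= Q%:R * h' ->
    (forall i j i' j', `|i%:R * h - t| <= r -> `|j%:R * h' - y| <= r ->
      `|i'%:R * h - t| <= r -> `|j'%:R * h' - y| <= r ->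
      `|u i' j' - u i j| <= C' * (`|i'%:R * h - i%:R * h| + `|j'%:R * h' - j%:R * h'|)) ->
    3 / 4 <= `|u (idx h t) (idx h' y)| -> (forall i j, `|u i j| <= 1) ->
    (forall i j, `|v i j - c * u i j| <= e) -> \sum_(i < P) \sum_(j < Q) u i j * v i j = 0 ->
  `|c| * (rr / 2 / h * (rr / 2 / h')) <= 4 * e * (P%:R * Q%:R).
Proof.
move=> h0 h0' t0 y0 rr0 hr hr' rrr C'0 C4 tP yQ H u34 u1 vE uv0.
have f1 := idx_le h0 (ltW t0); have f2 := idx_le h0' (ltW y0).
have f3 := idx_le h0 (ltW rr0); have f4 := idx_le h0' (ltW rr0).
have kr := idxP h0 (ltW rr0); have kr' := idxP h0' (ltW rr0).
have ikP : (idx h t + idx h rr <= P)%N.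
  by rewrite -(ler_nat R) -(ler_pM2r h0) natrD mulrDl; lra.
have jkQ : (idx h' y + idx h' rr <= Q)%N.
  by rewrite -(ler_nat R) -(ler_pM2r h0') natrD mulrDl; lra.
have it : `|(idx h t)%:R * h - t| <= r by have := idxP h0 (ltW t0); lra.
have jy : `|(idx h' y)%:R * h' - y| <= r by have := idxP h0' (ltW y0); lra.
have uw i j : (idx h t <= i < idx h t + idx h rr)%N -> (idx h' y <= j < idx h' y + idx h' rr)%N ->
    1 / 2 <= `|u i j|.
  move=> ik jk; have [w1 w2] := window_near h0 hr rrr t0 f3 ik.
  have [w3 w4] := window_near h0' hr' rrr y0 f4 jk.
  have hh := H _ _ i j it jy w1 w3; have hC := ler_wpM2l C'0 (lerD w2 w4).
  have : `|u (idx h t) (idx h' y)| - `|u i j| <= `|u i j - u (idx h t) (idx h' y)|.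
    by rewrite distrC; exact: lerB_dist.
  by move: hh hC C4 u34; clear; lra.
apply: le_trans (orth_count ikP jkQ u1 vE uw uv0); rewrite ler_wpM2l//.
have k1 : rr / 2 / h <= (idx h rr)%:R.
  by rewrite ler_pdivrMr//; move: kr hr; rewrite ler_norml; clear; lra.
have k2 : rr / 2 / h' <= (idx h' rr)%:R.
  by rewrite ler_pdivrMr//; move: kr' hr'; rewrite ler_norml; clear; lra.
by apply: ler_pM => //; rewrite divr_ge0 ?divr_ge0// ltW.
Qed.

End Counting.

Section Existence.
Context {R : realType}.
Implicit Types (t y x e C c r lam : R) (i j k l nu : nat).
Variables (phi : R -> R) (S Lp N : R) (m : nat).
Hypotheses (sh : cap_shape phi S Lp) (N0 : 0 < N) (m0 : (0 < m)%N).

Let n nu := nu.+2.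
Let a nu : R := N / (m%:R * (n nu)%:R).
Let b nu : R := (n nu)%:R^-1.
Let thr : R := pi ^+ 2 + (m%:R * pi / N) ^+ 2.
Let Dg nu := gdom phi N (a nu) (b nu) (n nu).
(** An upper bound for how far a stencil reaches beyond the domain, measured by the affine functions
    of [eigen_decay], whose slopes are at most 1 in t and 1 + Lp in y. *)
Let tau nu : R := (1 + Lp) * (a nu + b nu).
Let Bb : R := (1 + Lp) * (4 * N + S + 4).
Let CC : R := (thr + 1) * Bb.

Lemma grid_mesh : mesh a b.
Proof.
have n0 nu : 0 < (n nu)%:R :> R by rewrite ltr0n.
have mr : 0 < m%:R :> R by rewrite ltr0n.
have b0 : b @ \oo --> 0 by have h := @cvg_harmonic R; rewrite -cvg_shiftS in h.
split => //.
- by move=> nu; rewrite divr_gt0// mulr_gt0.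
- by move=> nu; rewrite invr_gt0.
have -> : a = fun nu => N / m%:R * b nu by apply: funext => nu; rewrite /a /b invfM mulrA.
by rewrite -[0](mulr0 (N / m%:R)); apply: cvgM => //; exact: cvg_cst.
Qed.

Lemma grid_small nu : a nu <= N / 2 /\ b nu <= 1 / 2.
Proof.
have n2 : 2 <= (n nu)%:R :> R by rewrite ler_nat.
have n0 : 0 < (n nu)%:R :> R by rewrite ltr0n.
have mr : 1 <= m%:R :> R by rewrite ler1n.
split.
  rewrite /a ler_pdivrMr ?mulr_gt0// ?ltr0n//.
  have h : 2 <= m%:R * (n nu)%:R :> R by apply: (le_trans n2); rewrite ler_peMl// ltW.
  have NN : 0 < N by [].
  by have := ler_wpM2l (ltW N0) h; lra.
by rewrite /b -div1r ler_pdivrMr//; lra.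
Qed.

(** Linear decay at the four sides, up to an error that vanishes with the mesh. Being uniform in the
    mesh it survives the limit, where it becomes the Dirichlet condition. *)
Definition decay nu (C : R) (f : nat -> nat -> R) := forall i j, Dg nu (i, j) ->
  [/\ `|f i j| <= C * (i%:R * a nu + tau nu), `|f i j| <= C * (j%:R * b nu + tau nu),
      `|f i j| <= C * (1 - j%:R * b nu + tau nu)
    & `|f i j| <= C * (N + phi (j%:R * b nu) - i%:R * a nu + tau nu)].

Lemma gdom_ty nu i j : Dg nu (i, j) -> [/\ 0 < i%:R * a nu, 0 < j%:R * b nu < 1
  & i%:R * a nu < N + phi (j%:R * b nu)].
Proof.
have [a0 b0 _ _] := grid_mesh => /and3P[/= i0 /andP[j0 jn] ia]; split => //.
  by rewrite mulr_gt0 ?ltr0n.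
apply/andP; split; first by rewrite mulr_gt0 ?ltr0n.
by rewrite /b ltr_pdivrMr ?ltr0n// mul1r ltr_nat.
Qed.

Lemma grid_index : exists2 M : nat, (0 < M)%N & forall nu,
  N + S < (M * n nu)%:R * a nu /\ forall p, Dg nu p -> (0 < p.1 < M * n nu)%N && (0 < p.2 < n nu)%N.
Proof.
have mr : 0 < m%:R :> R by rewrite ltr0n.
have [a0 b0 _ _] := grid_mesh.
pose q : R := (N + S) * m%:R / N; have q0 : 0 <= q.
  by rewrite divr_ge0 ?ltW// mulr_gt0// ltr_wpDr// (sh_S0 sh).
exists (Num.trunc q).+1 => // nu.
have qM : q < (Num.trunc q).+1%:R by case/andP: (trunc_itv q0).
have Ma : (((Num.trunc q).+1 * n nu)%:R : R) * a nu = (Num.trunc q).+1%:R * (N / m%:R).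
  by rewrite natrM /a; field; rewrite gt_eqF//= pnatr_eq0.
have NS : N + S < ((Num.trunc q).+1 * n nu)%:R * a nu.
  rewrite Ma (_ : N + S = q * (N / m%:R)) ?ltr_pM2r ?divr_gt0//.
  by rewrite /q; field; rewrite !gt_eqF.
split => // -[i j] Dp; have [_ yb ib] := gdom_ty Dp; have /and3P[/= -> -> _] := Dp.
rewrite !andbT /= -(ltr_nat R) -(ltr_pM2r (a0 nu)).
by have := sh_S sh yb; move: ib NS; lra.
Qed.

Lemma eigen_decay nu mu f : discrete_eigen (a nu) (b nu) (Dg nu) mu f -> 0 <= mu <= thr ->
  (forall i j, `|f i j| <= 1) -> decay nu CC f.
Proof.
move=> ef muL f1 i j Dij; have [a0 b0 _ _] := grid_mesh.
have [M M0 /(_ nu)[NS DP]] := grid_index; have [asm bs] := grid_small nu.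
have L0 := sh_L0 sh; have S0 := sh_S0 sh; have NN : 0 < N by [].
have B0 : 0 < Bb by rewrite /Bb mulr_gt0//; lra.
have LN : 0 <= Lp * N by rewrite mulr_ge0// ltW.
have LS : 0 <= Lp * S by rewrite mulr_ge0.
have Lb : 0 <= Lp * b nu := mulr_ge0 L0 (ltW (b0 nu)).
have La : 0 <= Lp * a nu := mulr_ge0 L0 (ltW (a0 nu)).
have Lb' : Lp * b nu <= Lp / 2 by have := ler_wpM2l L0 bs; lra.
have La' : Lp * a nu <= Lp * N / 2 by have := ler_wpM2l L0 asm; lra.
have a0' := a0 nu; have b0' := b0 nu.
have nat_ge (h : R) p q : 0 < h -> (p <= q)%N -> p%:R * h <= q%:R * h.
  by move=> h0 pq; rewrite ler_pM2r// ler_nat.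
have near i0 j0 i' j' : Dg nu (i0.+1, j0.+1) -> (i0 <= i' <= i0.+2)%N -> (j0 <= j' <= j0.+2)%N ->
   [/\ 0 <= i'%:R * a nu, i'%:R * a nu <= i0.+1%:R * a nu + a nu,
       i0.+1%:R * a nu < N + phi (j0.+1%:R * b nu),
       0 <= j'%:R * b nu <= 1 & `|j'%:R * b nu - j0.+1%:R * b nu| <= b nu].
  move=> D0 /andP[i1 i2] /andP[j1 j2]; have [_ yb ib] := gdom_ty D0.
  have /and3P[/= _ jn _] := D0.
  have h1 := nat_ge _ _ _ a0' i2; have h2 := nat_ge _ _ _ b0' j1; have h3 := nat_ge _ _ _ b0' j2.
  have h4 : j0.+2%:R * b nu <= 1.
    by rewrite /b ler_pdivrMr ?ltr0n// mul1r ler_nat.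
  rewrite -(@natr1 R i0.+1) mulrDl mul1r in h1.
  rewrite -(@natr1 R j0.+1) mulrDl mul1r in h3 h4.
  have h5 : j0.+1%:R * b nu = j0%:R * b nu + b nu by rewrite -(@natr1 R j0) mulrDl mul1r.
  have j0b : 0 <= j0%:R * b nu := mulr_ge0 (ler0n _ _) (ltW b0').
  split => //; first exact: mulr_ge0 (ler0n _ _) (ltW a0').
    by move: h2 h3 h4 j0b; lra.
  by rewrite ler_norml h5; move: h2 h3; rewrite h5; lra.
have bar c0 c1 c2 : 1 <= c1 ^+ 2 + c2 ^+ 2 ->
    (forall i0 j0 i' j', Dg nu (i0.+1, j0.+1) -> (i0 <= i' <= i0.+2)%N -> (j0 <= j' <= j0.+2)%N ->
       0 <= c0 + c1 * (i'%:R * a nu) + c2 * (j'%:R * b nu) + tau nu <= 2 * Bb) ->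
    `|f i j| <= CC * (c0 + c1 * (i%:R * a nu) + c2 * (j%:R * b nu) + tau nu).
  move=> c12 H.
  by apply: (grid_barrier a0' b0' DP ef muL f1 c12 B0 (fun i0 j0 D0 i' j' => H i0 j0 i' j' D0) Dij).
have tb : 0 <= tau nu <= (1 + Lp) * (N / 2 + 1 / 2).
  by rewrite /tau; move: La La' Lb Lb' asm bs a0' b0' L0; lra.
have B2 : (1 + Lp) * (N / 2 + 1 / 2) + 3 * N + S + 3 + 3 * Lp <= 2 * Bb.
  by rewrite /Bb; move: LN LS L0 S0 NN; lra.
split.
- have := bar 0 1 0; rewrite add0r mul1r mul0r addr0 => -> //; first by rewrite expr1n expr0n addr0.
  move=> i0 j0 i' j' D0 hi hj; have [h1 h2 h3 h4 h5] := near i0 j0 i' j' D0 hi hj.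
  have [_ yb _] := gdom_ty D0; have := sh_S sh yb.
  by move: h1 h2 h3 tb B2 asm; lra.
- have := bar 0 0 1; rewrite add0r mul1r mul0r add0r => -> //; first by rewrite expr1n expr0n add0r.
  move=> i0 j0 i' j' D0 hi hj; have [h1 h2 h3 h4 h5] := near i0 j0 i' j' D0 hi hj.
  by move: h4 tb B2 asm NN S0 L0; lra.
- have := bar 1 0 (-1); rewrite mulN1r mul0r addr0 => -> //; first by rewrite sqrrN expr1n expr0n add0r.
  move=> i0 j0 i' j' D0 hi hj; have [h1 h2 h3 h4 h5] := near i0 j0 i' j' D0 hi hj.
  by move: h4 tb B2 asm NN S0 L0; lra.
(* For the curved side the affine function is built from the supporting line at the height of (i, j)
   itself: it equals N + phi(y) - t at this point and is at least that elsewhere. *)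
have [_ yb _] := gdom_ty Dij; have [s sL sP] := sh_sup sh yb.
set y0 := j%:R * b nu in yb sP *.
have := bar (N + phi y0 - s * y0) (-1) s.
rewrite -/y0 (_ : _ + _ + _ + tau nu = N + phi y0 - i%:R * a nu + tau nu); last by ring.
move=> -> //; first by rewrite sqrrN expr1n lerDl sqr_ge0.
move=> i0 j0 i' j' D0 hi hj; have [h1 h2 h3 h4 h5] := near i0 j0 i' j' D0 hi hj.
have [_ yb1 _] := gdom_ty D0; have p1 := sP _ yb1; have p2 := sh_S sh yb.
have sb : `|s * (j'%:R * b nu - j0.+1%:R * b nu)| <= Lp * b nu by rewrite normrM; apply: ler_pM.
have sy : `|s * (j'%:R * b nu - y0)| <= Lp.
  by rewrite normrM -[leRHS]mulr1; apply: ler_pM => //; rewrite ler_norml; move: yb h4; lra.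
move: sb sy; rewrite !ler_norml /tau => sb sy.
by move: p1 p2 sb sy h1 h2 h3 La La' Lb Lb' asm bs B2 L0; rewrite /tau in tb; move: tb; lra.
Qed.

Lemma dlapZ (h h' c : R) f i j : dlap h h' (fun i j => c * f i j) i j = c * dlap h h' f i j.
Proof. by rewrite !dlapE; ring. Qed.

Lemma gdom_S nu p : Dg nu p -> exists i j, p = (i.+1, j.+1).
Proof.
by case: p => i j /and3P[/= i0 /andP[j0 _] _]; exists i.-1, j.-1; rewrite !prednK.
Qed.

Lemma eigen_normalised nu (M : nat) : N + S < (M * n nu)%:R * a nu ->
    (forall p, Dg nu p -> (0 < p.1 < M * n nu)%N && (0 < p.2 < n nu)%N) ->
  exists (w : nat -> nat -> nat -> R) (mu : nat -> R), forall l, (l < m)%N ->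
    [/\ discrete_eigen (a nu) (b nu) (Dg nu) (mu l) (w l), 0 <= mu l <= thr,
      forall i j, `|w l i j| <= 1, exists p, Dg nu p /\ `|w l p.1 p.2| = 1
      & forall l', (l' < l)%N -> \sum_(i < M * n nu) \sum_(j < n nu) w l i j * w l' i j = 0].
Proof.
move=> NS DP; have [a0 b0 _ _] := grid_mesh.
have [w [mu H]] := @block_eigen R phi N S m (n nu) (M * n nu) (sh_S sh) N0 m0 isT NS.
have /choice[c cP] l : exists c : R, (l < m)%N -> [/\ 0 < c, forall i j, `|w l i j| <= c &
    exists p, Dg nu p /\ `|w l p.1 p.2| = c].
  have [lm|/negP nlm] := boolP (l < m)%N; last by exists 0.
  have [[woff _] _ [p0 [Dp0 wp0]] _] := H l lm.
  have DP' p : Dg nu p -> (p.1 < M * n nu)%N && (p.2 < n nu)%N.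
    by move=> /DP /andP[/andP[_ ->] /andP[_ ->]].
  have [p Dp pmin] := finite_min (fun i j => - `|w l i j|) DP' Dp0.
  exists `|w l p.1 p.2| => _; have p0p := pmin _ Dp0; rewrite lerN2 in p0p; split.
  - by apply: lt_le_trans p0p; rewrite normr_gt0.
  - move=> i j; have [Dij|nD] := boolP (Dg nu (i, j)); first by have := pmin _ Dij; rewrite lerN2.
    by rewrite (woff (i, j) nD) normr0.
  - by exists p.
exists (fun l i j => (c l)^-1 * w l i j), mu => l lm.
have [[woff weq] wmu _ worth] := H l lm; have [c0 wc [p [Dp pc]]] := cP l lm.
have f1 i j : `|(c l)^-1 * w l i j| <= 1.
  by rewrite normrM gtr0_norm ?invr_gt0// mulrC ler_pdivrMr// mul1r.
have eq1 i j : Dg nu (i.+1, j.+1) -> dlap (a nu) (b nu) (fun i j => (c l)^-1 * w l i j) i j =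
    - mu l * ((c l)^-1 * w l i.+1 j.+1).
  by move=> Dij; rewrite dlapZ weq//; ring.
have p1 : `|(c l)^-1 * w l p.1 p.2| = 1.
  by rewrite normrM gtr0_norm ?invr_gt0// pc mulVf// gt_eqF.
split => //.
- by split => // q nD; rewrite woff// mulr0.
(* Sign of the eigenvalue: where s f attains its maximum 1, its discrete Laplacian is nonpositive,
   and it equals - mu there. *)
- rewrite wmu andbT; have [i [j pE]] := gdom_S Dp; move: p1 Dp; rewrite pE /=.
  set f := fun i j => (c l)^-1 * w l i j; rewrite -/(f i.+1 j.+1) => p1 Dij.
  have [s sE sf] : exists2 s : R, s = 1 \/ s = -1 & s * f i.+1 j.+1 = 1.
    have [f0|f0] := leP 0 (f i.+1 j.+1).
      by exists 1; [left|rewrite mul1r -p1 ger0_norm].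
    by exists (-1); [right|rewrite mulN1r -p1 ltr0_norm].
  have nbr i' j' : - (s * f i.+1 j.+1) <= - (s * f i' j').
    rewrite lerN2 sf; have := f1 i' j'; rewrite ler_norml -/(f i' j').
    by case: sE => ->; lra.
  have s1 := sdiff_min (a0 nu) (nbr i.+2 j.+1) (nbr i j.+1).
  have s2 := sdiff_min (b0 nu) (nbr i.+1 j.+2) (nbr i.+1 j).
  have := eq1 i j Dij; rewrite -/f dlapE => /(congr1 (fun z => s * z)) E.
  have : 0 <= mu l * (s * f i.+1 j.+1).
    have -> : mu l * (s * f i.+1 j.+1) = - (s * (- mu l * f i.+1 j.+1)) by ring.
    rewrite -[X in - (s * X)]/(- mu l * f i.+1 j.+1) -E.
    by move: (addr_ge0 s1 s2); congr (0 <= _); ring.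
  by rewrite sf mulr1.
- by exists p.
- move=> l' l'l; have h := worth l' l'l.
  transitivity ((c l)^-1 * (c l')^-1 * \sum_(i < M * n nu) \sum_(j < n nu) w l i j * w l' i j).
    rewrite mulr_sumr; apply: eq_bigr => i _; rewrite mulr_sumr; apply: eq_bigr => j _; ring.
  by rewrite h mulr0.
Qed.

Definition Og : set (R * R) := [set p | 0 < p.2 < 1 /\ 0 < p.1 < N + phi p.2].

Lemma gdom_near t y : Og (t, y) -> locp a b t y (fun nu i j => Dg nu (i.+1, j.+1)).
Proof.
move=> [/= y01 tI]; have L0 := sh_L0 sh; pose d := N + phi y - t.
have d0 : 0 < d by rewrite /d; move: tI; lra.
pose r := Num.min (Num.min (y / 4) ((1 - y) / 4)) (d / (4 * (1 + Lp))).
have rE : [/\ r <= y / 4, r <= (1 - y) / 4 & r <= d / (4 * (1 + Lp))].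
  by rewrite /r !ge_min !lexx !orbT.
have L1 : 0 < 4 * (1 + Lp) by lra.
have r0 : 0 < r by rewrite !lt_min !divr_gt0//; move: y01; lra.
have [r1 r2 r3] := rE; exists r => //.
apply: filterS (mesh_small grid_mesh r0) => nu [ar br] i j ir jr.
have [a0 b0 _ _] := grid_mesh; have a0' := a0 nu; have b0' := b0 nu.
have jy : `|j.+1%:R * b nu - y| <= 2 * r.
  by rewrite -(@natr1 R j) mulrDl mul1r; move: jr; rewrite !ler_norml; move: br b0'; lra.
have jb : 0 < j.+1%:R * b nu < 1 by move: jy; rewrite ler_norml; move: r1 r2 y01; lra.
apply/and3P; split => //=.
  rewrite -(ltr_nat R) -(mul1r (n nu)%:R) -ltr_pdivrMr ?ltr0n//.
  by case/andP: jb.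
have := sh_lip sh jb y01; have := ler_wpM2l L0 jy.
rewrite ler_pdivlMr// in r3; rewrite -(@natr1 R i) mulrDl mul1r.
by move: ir; rewrite !ler_norml; move: r3 r0 ar L0 d0; rewrite /d; lra.
Qed.

Section WithUltra.
Variable W : set_system nat.
Hypotheses (WU : UltraFilter W) (Woo : \oo `<=` W).

Lemma tau_cvg : tau @ W --> 0.
Proof.
have [_ _ ca cb] := grid_mesh; have PW := @ultra_proper _ _ WU.
have tn : tau nu @[nu --> \oo] --> (1 + Lp) * (0 + 0).
  by apply: cvgM; [exact: cvg_cst|exact: cvgD].
by rewrite addr0 mulr0 in tn; move=> A /tn; exact: Woo.
Qed.

(** Large values are not lost in the limit. The grid points where |v| >= e converge along W; the
    decay keeps their limit away from the sides by e / (C + 1), hence inside the domain; the uniform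
    Lipschitz bound transfers the value to the limit point. *)
Lemma glim_sup (v : nat -> nat -> nat -> R) C e : 0 <= C -> 0 < e ->
    (forall t y, Og (t, y) -> [/\ tamep a b t y v, tamep a b t y (fun nu => D1 (a nu) (v nu))
       & tamep a b t y (fun nu => D2 (b nu) (v nu))]) ->
    (forall nu, decay nu C (v nu)) ->
    (\forall nu \near W, exists p, Dg nu p /\ e <= `|v nu p.1 p.2|) ->
  exists t y, Og (t, y) /\ e <= `|glim W a b v t y|.
Proof.
move=> C0 e0 tv dv Wv; have PW := @ultra_proper _ _ WU.
have /choice[p pP] nu : exists p, (exists p, Dg nu p /\ e <= `|v nu p.1 p.2|) ->
    Dg nu p /\ e <= `|v nu p.1 p.2|.
  have [[p h]|nh] := pselect (exists p, Dg nu p /\ e <= `|v nu p.1 p.2|); first by exists p.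
  by exists (0%N, 0%N).
have Wp : \forall nu \near W, Dg nu (p nu) /\ e <= `|v nu (p nu).1 (p nu).2|.
  by apply: filterS Wv => nu; exact: pP.
pose T nu := (p nu).1%:R * a nu; pose Y nu := (p nu).2%:R * b nu.
have TY nu : Dg nu (p nu) -> [/\ 0 < T nu, 0 < Y nu < 1 & T nu < N + phi (Y nu)].
  by rewrite [p nu]surjective_pairing => /gdom_ty.
have cT : cvg (T @ W).
  apply: (ultra_cvg WU (C := N + S)); apply: filterS Wp => nu [/TY[h1 h2 h3] _].
  by have := sh_S sh h2; rewrite -/(T nu) gtr0_norm//; move: h3; lra.
have cY : cvg (Y @ W).
  apply: (ultra_cvg WU (C := 1)); apply: filterS Wp => nu [/TY[h1 h2 h3] _].
  by rewrite -/(Y nu) gtr0_norm; move: h2; lra.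
set t := lim (T @ W) in cT; set y := lim (Y @ W) in cY; exists t, y.
pose d := e / (C + 1); have C1 : 0 < C + 1 by rewrite ltr_wpDl.
have d0 : 0 < d by rewrite divr_gt0.
have lowd z nu : 0 < z + tau nu -> e <= C * (z + tau nu) -> d <= z + tau nu.
  by move=> z0 h; rewrite ler_pdivrMr// mulrDr mulr1; move: h z0; rewrite mulrC; lra.
have t0 nu : 0 < tau nu.
  have [a0 b0 _ _] := grid_mesh; apply: mulr_gt0; last exact: addr_gt0.
  by have := sh_L0 sh; lra.
have lims (s : nat -> R) z : s @ W --> z -> (\forall nu \near W, d <= s nu + tau nu) -> d <= z.
  move=> cs ds; have := @cvgD _ _ _ _ _ _ _ _ _ cs tau_cvg; rewrite addr0 => /(_ (@filter_filter _ _ PW)) cst.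
  have cd : (fun _ : nat => d) @ W --> d by exact: cvg_cst.
  exact: (ler_cvg_to cd cst ds).
have dec : \forall nu \near W, [/\ d <= T nu + tau nu, d <= Y nu + tau nu,
    d <= 1 - Y nu + tau nu & d <= N + phi (Y nu) - T nu + tau nu].
  apply: filterS Wp => nu [Dp ep]; have [h1 h2 h3] := TY _ Dp.
  move: (dv nu (p nu).1 (p nu).2); rewrite -surjective_pairing => /(_ Dp)[d1 d2 d3 d4].
  have tn := t0 nu; split; apply: lowd; try (by apply: le_trans ep _); move: h1 h2 h3 tn; lra.
have td : d <= t by apply: (lims T) => //; apply: filterS dec => nu [].
have yd : d <= y by apply: (lims Y) => //; apply: filterS dec => nu [].
have yd1 : d <= 1 - y.
  apply: (lims (fun nu => 1 - Y nu)); last by apply: filterS dec => nu [].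
  by apply: cvgB => //; exact: cvg_cst.
have y01 : 0 < y < 1 by move: yd yd1 d0; lra.
have cphi : phi (Y nu) @[nu --> W] --> phi y.
  apply/cvgrPdist_le => f f0; have L1 : 0 < Lp + 1 by have := sh_L0 sh; lra.
  move/cvgrPdist_le: (cY) => /(_ (f / (Lp + 1)) (divr_gt0 f0 L1)) cY'.
  apply: filterS2 Wp cY' => nu [/TY[_ h2 _] _] yY; apply: (le_trans (sh_lip sh y01 h2)).
  rewrite ler_pdivlMr// in yY; apply: le_trans yY; rewrite mulrC ler_wpM2l//.
  by rewrite lerDl.
have tphi : d <= N + phi y - t.
  apply: (lims (fun nu => N + phi (Y nu) - T nu)); last by apply: filterS dec => nu [].
  by apply: cvgB => //; apply: cvgD => //; exact: cvg_cst.
have Oty : Og (t, y) by split => //=; move: td tphi d0; lra.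
split => //; have [tp0 tp1 tp2] := tv _ _ Oty.
have [_ /= tI] := Oty; have tpos : 0 < t by case/andP: tI.
have ypos : 0 < y by case/andP: y01.
have [C' C'0 [r r0 Hr]] := grid_lip grid_mesh tp1 tp2.
have [q q0 Hq] := glim_cvg WU Woo grid_mesh tpos ypos tp0.
have cg := Hq t y ltac:(by rewrite subrr normr0 ltW) ltac:(by rewrite subrr normr0 ltW).
have [a0 b0 _ _] := grid_mesh.
have ci := @idx_cvg R W a b WU Woo grid_mesh 0 t a0 (ltW tpos).
have cj := @idx_cvg2 R W a b WU Woo grid_mesh 0 y b0 (ltW ypos).
pose er nu := C' * (`|T nu - (idx (a nu) t)%:R * a nu| + `|Y nu - (idx (b nu) y)%:R * b nu|).
have cer : er @ W --> C' * (`|t - t| + `|y - y|).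
  by apply: cvgM; [exact: cvg_cst|apply: cvgD; apply: cvg_norm; apply: cvgB].
rewrite !subrr normr0 addr0 mulr0 in cer.
have cL : e - er nu @[nu --> W] --> e - 0 by apply: cvgB cer; exact: cvg_cst.
rewrite subr0 in cL; apply: (ler_cvg_to cL (cvg_norm cg)).
move/cvgrPdist_le: (cT) => /(_ r r0) cTr; move/cvgrPdist_le: (cY) => /(_ r r0) cYr.
move/cvgrPdist_le: ci => /(_ r r0) cir; move/cvgrPdist_le: cj => /(_ r r0) cjr.
have c1 : \forall nu \near W, `|t - T nu| <= r /\ `|y - Y nu| <= r by apply: filterS2 cTr cYr.
have c2 : \forall nu \near W, `|t - (idx (a nu) t)%:R * a nu| <= r /\
    `|y - (idx (b nu) y)%:R * b nu| <= r by apply: filterS2 cir cjr.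
have WI P Q : W P -> W Q -> W (P `&` Q) by exact: filterI.
have big := WI _ _ (WI _ _ c1 c2) (WI _ _ (Woo Hr) Wp).
apply: (filterS _ big) => nu [ [ [h1 h2] [h3 h4] ] [H [Dp ep] ] ].
have := H (idx (a nu) t) (idx (b nu) y) (p nu).1 (p nu).2.
rewrite !(distrC _ t) !(distrC _ y) => /(_ h3 h4 h1 h2); rewrite -/(er nu) => h.
have := lerB_dist (v nu (p nu).1 (p nu).2) (v nu (idx (a nu) t) (idx (b nu) y)).
by move: h ep; rewrite /gval -/(T nu) -/(Y nu); lra.
Qed.

Lemma locp_pred t y (Q : nat -> nat -> nat -> Prop) : 0 < t -> 0 < y ->
  locp a b t y (fun nu i j => Q nu i.+1 j.+1) -> locp a b t y Q.
Proof.
move=> t0 y0 [r r0 H]; pose d := Num.min (r / 2) (Num.min (t / 2) (y / 2)).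
have dE : [/\ d <= r / 2, d <= t / 2 & d <= y / 2] by rewrite /d !ge_min !lexx !orbT.
have [d1 d2 d3] := dE; exists d; first by rewrite !lt_min !divr_gt0.
have r2 : 0 < r / 2 by rewrite divr_gt0.
apply: filterS2 H (mesh_small grid_mesh r2) => nu H [ar br] [|i] [|j] ir jr.
- by exfalso; move: ir; rewrite mul0r ler_norml; lra.
- by exfalso; move: ir; rewrite mul0r ler_norml; lra.
- by exfalso; move: jr; rewrite mul0r ler_norml; lra.
have [a0 b0 _ _] := grid_mesh; have a0' := a0 nu; have b0' := b0 nu.
move: ir jr; rewrite -(@natr1 R i) -(@natr1 R j) !mulrDl !mul1r !ler_norml => ir jr.
by apply: H; rewrite ler_norml; lra.
Qed.

Lemma phi_cont y : 0 < y < 1 -> {for y, continuous phi}.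
Proof.
move=> y01; apply/cvgrPdist_le => e e0; have L1 : 0 < Lp + 1 by have := sh_L0 sh; lra.
pose d := Num.min (e / (Lp + 1)) (Num.min y (1 - y)).
have dE : [/\ d <= e / (Lp + 1), d <= y & d <= 1 - y] by rewrite /d !ge_min !lexx !orbT.
have [d1 d2 d3] := dE; have d0 : 0 < d by rewrite !lt_min divr_gt0//; lra.
apply/nbhs_ballP; exists d => //= z; rewrite /ball/= => zy.
have z01 : 0 < z < 1 by move: zy; rewrite ltr_norml; lra.
apply: (le_trans (sh_lip sh y01 z01)).
have := le_trans (ltW zy) d1; rewrite ler_pdivlMr//; apply: le_trans.
by rewrite mulrC ler_wpM2l// lerDl.
Qed.

Lemma glim_decay (v : nat -> nat -> nat -> R) C t y : Og (t, y) -> tamep a b t y v ->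
    (forall nu, decay nu C (v nu)) ->
  [/\ `|glim W a b v t y| <= C * t, `|glim W a b v t y| <= C * y,
      `|glim W a b v t y| <= C * (1 - y) & `|glim W a b v t y| <= C * (N + phi y - t)].
Proof.
move=> Oty tv dv; have PW := @ultra_proper _ _ WU; have [/= y01 tI] := Oty.
have t0 : 0 < t by case/andP: tI.
have y0 : 0 < y by case/andP: y01.
have [a0 b0 _ _] := grid_mesh.
have [q q0 Hq] := glim_cvg WU Woo grid_mesh t0 y0 tv.
have cg := Hq t y ltac:(by rewrite subrr normr0 ltW) ltac:(by rewrite subrr normr0 ltW).
have ci := @idx_cvg R W a b WU Woo grid_mesh 0 t a0 (ltW t0).
have cj := @idx_cvg2 R W a b WU Woo grid_mesh 0 y b0 (ltW y0).
have [r r0 Hr] := locp_idx grid_mesh t0 y0 (@locp_pred t y (fun nu i j => Dg nu (i, j)) t0 y0 (gdom_near Oty)).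
have [_ _ Hn] := Hr t y ltac:(by rewrite subrr normr0 ltW) ltac:(by rewrite subrr normr0 ltW).
have ctau := tau_cvg.
have cphi : phi ((idx (b nu) y)%:R * b nu) @[nu --> W] --> phi y.
  by apply: cvg_comp cj _; exact: phi_cont.
have key (s : nat -> R) z : s @ W --> z -> (forall nu, Dg nu (idx (a nu) t, idx (b nu) y) ->
    `|v nu (idx (a nu) t) (idx (b nu) y)| <= C * (s nu + tau nu)) -> `|glim W a b v t y| <= C * z.
  move=> cs Hs; have cC : C * (s nu + tau nu) @[nu --> W] --> C * (z + 0).
    by apply: cvgM; [exact: cvg_cst|exact: cvgD].
  rewrite addr0 in cC; apply: (ler_cvg_to (cvg_norm cg) cC); apply: Woo.
  by apply: filterS Hn => nu; exact: Hs.
split.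
- by apply: (key _ _ ci) => nu /(dv nu)[].
- by apply: (key _ _ cj) => nu /(dv nu)[].
- apply: (key (fun nu => 1 - (idx (b nu) y)%:R * b nu)); last by move=> nu /(dv nu)[].
  by apply: cvgB => //; exact: cvg_cst.
- apply: (key (fun nu => N + phi ((idx (b nu) y)%:R * b nu) - (idx (a nu) t)%:R * a nu)); last by move=> nu /(dv nu)[].
  by apply: cvgB => //; apply: cvgD => //; exact: cvg_cst.
Qed.

Lemma dom_Og x y : dom phi N (x, y) <-> Og (N - x, y).
Proof. by split => -[/= y01 xI]; split => //=; lra. Qed.

(** By the linear decay, points where the function is at least e in absolute value are at least e /
    (C + 1) away from all four sides. They lie in a compact subset of the domain, on which the
    superlevel set of a continuous function is compact. *)
Lemma van_flip V C : jets Og V -> 0 <= C -> (forall t y, Og (t, y) ->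
  [/\ `|V 0%N 0%N t y| <= C * t, `|V 0%N 0%N t y| <= C * y, `|V 0%N 0%N t y| <= C * (1 - y)
    & `|V 0%N 0%N t y| <= C * (N + phi y - t)]) -> vanishing (dom phi N) (flip N V 0%N 0%N).
Proof.
move=> JV C0 dV e e0; have C1 : 0 < C + 1 by rewrite ltr_wpDl.
pose d := e / (C + 1); have d0 : 0 < d by rewrite divr_gt0.
have JF := jets_flip (fun x y => (dom_Og x y).1) JV.
have k1 := @compact_box R (- S) N d (1 - d).
have k2 := @compact_ge _ _ (fun p : R * R => (-1) * p.1 + N) d k1 (fun p _ => @cont_fst_aff R (-1) N p).
have k3 := @compact_ge _ _ (fun p : R * R => p.1 + phi p.2) d k2.
have cph p : [set p : R * R | [set p : R * R | - S <= p.1 <= N /\ d <= p.2 <= 1 - d] p /\ d <= -1 * p.1 + N] p ->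
    {for p, continuous (fun p : R * R => p.1 + phi p.2)}.
  move=> [[/= _ yd] _]; apply: cvgD; first exact: cvg_fst.
  apply: (@cvg_comp _ _ _ (@snd R R) phi (nbhs p) (nbhs p.2)); first exact: cvg_snd.
  by apply: phi_cont; move: yd d0; lra.
have := k3 cph; set K := mkset _ => cK.
have KO p : K p -> dom phi N p.
  by move=> [[[/= xS yd] xN] xp]; split; move: xS yd xN xp d0; lra.
have k4 := @compact_ge _ K (fun p : R * R => `|flip N V 0%N 0%N p.1 p.2|) e cK.
have ck p : K p -> {for p, continuous (fun p : R * R => `|flip N V 0%N 0%N p.1 p.2|)}.
  by case: p => x y /KO Oxy; have [c _ _] := JF 0%N 0%N _ _ Oxy; exact: cvg_norm c.
have := k4 ck; congr compact; apply/seteqP; split => -[x y] /= [].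
  by move=> /KO Oxy ex.
move=> Oxy ex; split => //; have := dV _ _ ((dom_Og x y).1 Oxy) => -[].
have low z : 0 < z -> e <= C * z -> d <= z.
  by move=> z0 h; rewrite ler_pdivrMr// mulrDr mulr1 mulrC; lra.
move: ex; rewrite /flip expr0 mul1r => ex h1 h2 h3 h4; have [/= y01 xI] := Oxy.
have pS := sh_S sh y01.
have l1 := low (N - x) ltac:(lra) (le_trans ex h1); have l2 := low y ltac:(lra) (le_trans ex h2).
have l3 := low (1 - y) ltac:(lra) (le_trans ex h3).
have l4 := low (N + phi y - (N - x)) ltac:(lra) (le_trans ex h4).
by repeat split => /=; lra.
Qed.

End WithUltra.

(** Orthogonality is available only before the limit. If two limits were proportional, [glim_sup]
    applied to u_l' - c u_l would make this difference uniformly small for W-many meshes, and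
    [orth_window] would contradict the discrete orthogonality. *)
Lemma efun_exists : exists (U : nat -> nat -> nat -> R -> R -> R) (lam : nat -> R), forall l, (l < m)%N ->
  [/\ efun phi N (lam l) (U l), lam l <= pi ^+ 2 + (m%:R * pi / N) ^+ 2,
    exists x y, dom phi N (x, y) /\ U l 0%N 0%N x y != 0
    & forall l', (l' < l)%N -> ~ exists c, forall x y, dom phi N (x, y) ->
        U l' 0%N 0%N x y = c * U l 0%N 0%N x y].
Proof.
have [W [WU Woo]] := ultraFilterLemma eventually_filter; have PW := @ultra_proper _ _ WU.
have [M M0 HM] := grid_index; have [a0 b0 _ _] := grid_mesh.
have /choice[w wP] nu : exists wm : (nat -> nat -> nat -> R) * (nat -> R), forall l, (l < m)%N ->
    [/\ discrete_eigen (a nu) (b nu) (Dg nu) (wm.2 l) (wm.1 l), 0 <= wm.2 l <= thr,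
      forall i j, `|wm.1 l i j| <= 1, exists p, Dg nu p /\ `|wm.1 l p.1 p.2| = 1
      & forall l', (l' < l)%N -> \sum_(i < M * n nu) \sum_(j < n nu) wm.1 l i j * wm.1 l' i j = 0].
  have [h1 h2] := HM nu; have [w [mu H]] := eigen_normalised h1 h2.
  by exists (w, mu).
pose u l nu := (w nu).1 l; pose mu l nu := (w nu).2 l.
pose lam l : R := lim (mu l @ W).
have mub l nu : (l < m)%N -> `|mu l nu| <= thr.
  by move=> lm; have [_ /andP[h1 h2] _ _ _] := wP nu l lm; rewrite ger0_norm.
have mulam l : (l < m)%N -> mu l @ W --> lam l.
  by move=> lm; apply: (ultra_cvg WU (C := thr)); apply: (@filterE _ W) => nu; exact: mub.
have tu l t y : (l < m)%N -> Og (t, y) -> tamep a b t y (u l) /\ eigp a b (mu l) t y (u l).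
  move=> lm Oty; split.
    exists 1, 1 => //; apply: (@filterE _ \oo) => nu i j _ _.
    by have [_ _ h _ _] := wP nu l lm; exact: h.
  apply: locpS (gdom_near Oty) => nu i j Dij.
  by have [[_ h] _ _ _ _] := wP nu l lm; exact: h.
have tD l t y : (l < m)%N -> Og (t, y) -> tamep a b t y (fun nu => D1 (a nu) (u l nu)) /\
    tamep a b t y (fun nu => D2 (b nu) (u l nu)).
  move=> lm Oty; have [T E] := tu l t y lm Oty; have [/= y01 tI] := Oty.
  apply: (tamep_D grid_mesh) => //; try lra.
  exact: eigp_tame grid_mesh (fun nu => mub l nu lm) T E.
have thr0 : 0 <= thr by rewrite addr_ge0 ?sqr_ge0.
have CC0 : 0 <= CC.
  have L0 := sh_L0 sh; have S0 := sh_S0 sh; have NN : 0 < N by [].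
  by rewrite /CC /Bb mulr_ge0 ?mulr_ge0//; lra.
have du l nu : (l < m)%N -> decay nu CC (u l nu).
  by move=> lm; have [h1 h2 h3 _ _] := wP nu l lm; exact: eigen_decay h1 h2 h3.
pose V l := glimf W a b (u l).
have JV l : (l < m)%N -> jets Og (V l) /\ forall t y, Og (t, y) ->
    V l 2%N 0%N t y + V l 0%N 2%N t y + lam l * V l 0%N 0%N t y = 0.
  move=> lm; apply: (glim_jets WU Woo grid_mesh (mu := mu l) (D := thr)) => //.
  - by move=> t y [/= y01 tI]; lra.
  - by move=> nu; exact: mub.
  - exact: mulam.
  - by move=> t y; exact: tu.
have dV l t y : (l < m)%N -> Og (t, y) -> _ := fun lm Oty =>
  glim_decay WU Woo Oty (tu l t y lm Oty).1 (fun nu => du l nu lm).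
have V1 l : (l < m)%N -> exists t y, Og (t, y) /\ 1 <= `|V l 0%N 0%N t y|.
  move=> lm; apply: (glim_sup WU Woo CC0 ltr01 _ (fun nu => du l nu lm)).
    by move=> t y Oty; have [h1 _] := tu l t y lm Oty; have [h2 h3] := tD l t y lm Oty.
  by apply: (@filterE _ W) => nu; have [_ _ _ [p [Dp p1]] _] := wP nu l lm; exists p; rewrite /u p1.
exists (fun l => flip N (V l)), lam => l lm; have [Jl El] := JV l lm; split.
- split; first exact: jets_flip (fun x y => (dom_Og x y).1) Jl.
    move=> x y /dom_Og Oxy; rewrite /flip !expr0 expr2 !mulN1r opprK !mul1r.
    exact: El.
  by apply: van_flip Jl CC0 _ => t y; exact: dV.
- have cth : (fun _ : nat => thr) @ W --> thr by exact: cvg_cst.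
  apply: (ler_cvg_to (mulam l lm) cth); apply: (@filterE _ W) => nu.
  exact: le_trans (ler_norm _) (mub l nu lm).
- have [t [y [Oty V0]]] := V1 l lm; exists (N - t), y; split.
    by apply/dom_Og; rewrite subKr.
  by rewrite /flip expr0 mul1r subKr -normr_gt0; apply: lt_le_trans V0.
move=> l' l'l [c cE]; have lm' : (l' < m)%N by exact: ltn_trans lm.
have VE t y : Og (t, y) -> V l' 0%N 0%N t y = c * V l 0%N 0%N t y.
  move=> Oty; have := cE (N - t) y; rewrite /flip !expr0 !mul1r subKr; apply.
  by apply/dom_Og; rewrite subKr.
have c0 : 0 < `|c|.
  rewrite normr_gt0; apply/eqP => c0; have [t [y [Oty h]]] := V1 l' lm'.
  by move: h; rewrite VE// c0 mul0r normr0; lra.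
pose v nu i j := u l' nu i j - c * u l nu i j.
have tv t y : Og (t, y) -> [/\ tamep a b t y v, tamep a b t y (fun nu => D1 (a nu) (v nu))
       & tamep a b t y (fun nu => D2 (b nu) (v nu))].
  move=> Oty; have [h1 _] := tu l t y lm Oty; have [h1' _] := tu l' t y lm' Oty.
  have [h2 h3] := tD l t y lm Oty; have [h2' h3'] := tD l' t y lm' Oty.
  have cb (G G' : nat -> nat -> nat -> R) : tamep a b t y G -> tamep a b t y G' ->
      tamep a b t y (fun nu i j => G' nu i j - c * G nu i j).
    by move=> TG TG'; apply: tamepB => //; apply: (tamepZ (c := fun=> c) (D := `|c|)).
  split; first exact: cb.
    have [C HC] := cb _ _ h2 h2'; exists C; apply: locpS HC => nu i j.
    by rewrite (_ : D1 _ (v nu) i j = D1 (a nu) (u l' nu) i j - c * D1 (a nu) (u l nu) i j)// /D1 /v; ring.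
  have [C HC] := cb _ _ h3 h3'; exists C; apply: locpS HC => nu i j.
  by rewrite (_ : D2 _ (v nu) i j = D2 (b nu) (u l' nu) i j - c * D2 (b nu) (u l nu) i j)// /D2 /v; ring.
have dv nu : decay nu ((1 + `|c|) * CC) (v nu).
  move=> i j Dij; have [p1 p2 p3 p4] := du l nu lm i j Dij; have [q1 q2 q3 q4] := du l' nu lm' i j Dij.
  have key z : `|u l nu i j| <= CC * z -> `|u l' nu i j| <= CC * z -> `|v nu i j| <= (1 + `|c|) * CC * z.
    move=> h h'; apply: (le_trans (ler_normB _ _)); rewrite normrM.
    by have := ler_wpM2l (normr_ge0 c) h; lra.
  by split; apply: key.
have v0 t y : Og (t, y) -> glim W a b v t y = 0.
  move=> Oty; have [/= y01 tI] := Oty; have t0 : 0 < t by case/andP: tI.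
  have y0 : 0 < y by case/andP: y01.
  have cg k (km : (k < m)%N) : gval a b (u k) t y nu @[nu --> W] --> V k 0%N 0%N t y.
    have [q q0 Hq] := glim_cvg WU Woo grid_mesh t0 y0 (tu k t y km Oty).1.
    by apply: Hq; rewrite subrr normr0 ltW.
  apply: cvg_lim; first exact: norm_hausdorff.
  have := VE t y Oty => /eqP; rewrite -subr_eq0 => /eqP <-.
  by apply: cvgB; [exact: cg|apply: cvgM; [exact: cvg_cst|exact: cg]].
have [t [y [Oty V0]]] := V1 l lm; have [/= y01 tI] := Oty.
have t0 : 0 < t by case/andP: tI.
have y0 : 0 < y by case/andP: y01.
have [h1 _] := tu l t y lm Oty; have [h2 h3] := tD l t y lm Oty.
have [C' C'0 [r r0 Hr]] := grid_lip grid_mesh h2 h3.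
have [q q0 Hq] := glim_cvg WU Woo grid_mesh t0 y0 h1.
have cg := Hq t y ltac:(by rewrite subrr normr0 ltW) ltac:(by rewrite subrr normr0 ltW).
(* A window so small that u_l varies by at most 1/4 on it, and that it stays within the bounds of
   the grid. *)
pose rr := Num.min (Num.min (r / 2) (1 / (8 * (C' + 1)))) (Num.min ((1 - y) / 2) ((N + phi y - t) / 2)).
have C1 : 0 < C' + 1 by rewrite ltr_wpDl.
have rE : [/\ rr <= r / 2, rr <= 1 / (8 * (C' + 1)), rr <= (1 - y) / 2 & rr <= (N + phi y - t) / 2].
  by rewrite /rr !ge_min !lexx !orbT.
have y1 : 0 < 1 - y by rewrite subr_gt0; case/andP: y01.
have ty : 0 < N + phi y - t by rewrite subr_gt0; case/andP: tI.
have rr0 : 0 < rr by rewrite !lt_min !divr_gt0// mulr_gt0.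
have [r1 r2 r3 r4] := rE.
have mr : 0 < m%:R :> R by rewrite ltr0n.
have Mr : 0 < M%:R :> R by rewrite ltr0n.
(* [ep] is tuned so that [orth_window] would read ka n^2 <= ka n^2 / 2. *)
pose ka : R := `|c| * (rr / 2 * (m%:R / N) * (rr / 2)); have ka0 : 0 < ka.
  by rewrite /ka !mulr_gt0 ?invr_gt0.
pose ep := ka / (8 * M%:R); have ep0 : 0 < ep by rewrite divr_gt0// mulr_gt0.
have Wv : \forall nu \near W, ~ exists p, Dg nu p /\ ep <= `|v nu p.1 p.2|.
  have [Wn|//] := in_ultra_setVsetC [set nu | exists p, Dg nu p /\ ep <= `|v nu p.1 p.2|] WU.
  have C20 : 0 <= (1 + `|c|) * CC by rewrite mulr_ge0// addr_ge0.
  have [s [z [Osz]]] := glim_sup WU Woo C20 ep0 tv dv Wn.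
  by rewrite v0// normr0 leNgt ep0.
have rr2 : 0 < rr / 2 by rewrite divr_gt0.
have WI P Q : W P -> W Q -> W (P `&` Q) by exact: filterI.
have q4 : 0 < (1 / 4 : R) by rewrite divr_gt0.
have cn : `|gval a b (u l) t y nu| @[nu --> W] --> `|glim W a b (u l) t y| by exact: cvg_norm cg.
move/cvgrPdist_le: cn => /(_ _ q4) cg4.
have big := WI _ _ (WI _ _ (Woo _ Hr) (Woo _ (mesh_small grid_mesh rr2))) (WI _ _ Wv cg4).
have [nu [[H [ar br]] [vs g4]]] := @filter_ex _ W PW _ big.
have a0' := a0 nu; have b0' := b0 nu.
have [_ _ u1 _ worth] := wP nu l lm.
have vE i j : `|u l' nu i j - c * u l nu i j| <= ep.
  have [Dij|nD] := boolP (Dg nu (i, j)).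
    by rewrite leNgt; apply/negP => /ltW h; apply: vs; exists (i, j).
  have [ [z1 _] _ _ _ _] := wP nu l lm; have [ [z2 _] _ _ _ _] := wP nu l' lm'.
  by rewrite /u (z1 (i, j) nD) (z2 (i, j) nD) mulr0 subrr normr0 ltW.
have C4 : C' * (rr + rr) <= 1 / 4.
  rewrite ler_pdivlMr ?mulr_gt0// in r2; apply: le_trans (_ : 2 * (rr * (C' + 1)) <= _).
    by rewrite (_ : C' * (rr + rr) = 2 * (rr * C')); [rewrite ler_pM2l// ler_pM2l// lerDl|ring].
  have -> : 2 * (rr * (C' + 1)) = rr * (8 * (C' + 1)) / 4 by field.
  by rewrite ler_pM2r.
have nn : 0 < (n nu)%:R :> R by rewrite ltr0n.
have Qb : (n nu)%:R * b nu = 1 by rewrite /b mulfV// gt_eqF.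
have tP : t + rr <= (M * n nu)%:R * a nu.
  have [NS _] := HM nu; apply: le_trans (ltW NS); apply: (@le_trans _ _ (N + phi y)).
    by rewrite -lerBrDl; apply: (le_trans r4); rewrite ler_pdivrMr// ler_peMr ?(ltW ty)// ler1n.
  by rewrite lerD2l; case/andP: (sh_S sh y01).
have yQ : y + rr <= (n nu)%:R * b nu.
  by rewrite Qb -lerBrDl; apply: (le_trans r3); rewrite ler_pdivrMr// ler_peMr ?(ltW y1)// ler1n.
have u34 : 3 / 4 <= `|u l nu (idx (a nu) t) (idx (b nu) y)|.
  have -> : 3 / 4 = 1 - 1 / 4 :> R by field.
  rewrite lerBlDr; apply: (le_trans V0).
  by rewrite -lerBlDl; apply: le_trans (ler_norm _) _.
have := orth_window a0' b0' t0 y0 rr0 ar br r1 C'0 C4 tP yQ H u34 u1 vE (worth l' l'l).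
rewrite leNgt => /negP; apply; rewrite natrM.
have -> : 4 * ep * (M%:R * (n nu)%:R * (n nu)%:R) = ka / 2 * ((n nu)%:R * (n nu)%:R).
  by rewrite /ep; field; rewrite gt_eqF.
have -> : `|c| * (rr / 2 / a nu * (rr / 2 / b nu)) = ka * ((n nu)%:R * (n nu)%:R).
  by rewrite /ka /a /b; field; rewrite ?(gt_eqF nn) ?(gt_eqF N0) ?(gt_eqF mr).
by rewrite ltr_pM2r ?mulr_gt0// ltr_pdivrMr// ltr_pMr// ltr1n.
Qed.

End Existence.

(** * Critical points *)

Section CapMonotonicity.
Context {R : realType}.
Implicit Types (x y e r h : R) (v : R -> R -> R).

Lemma lap_shift v h x y a b : d2 (v^~ y) (x + h) a -> d2 (v (x + h)) y b ->
  lap (fun s t => v (s + h) t) x y (a + b).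
Proof.
move=> da db; exists a, b; split => //.
have := @d2_affine _ (v^~ y) 1 h x a; rewrite !mul1r => /(_ da).
by apply: d2_near; apply: (@filterE _ (nbhs x)) => t; rewrite mul1r.
Qed.

(* Comparison with the subsolution (exp (th (x - xa)) - 1) cos (th (y - y0)), which
   vanishes on three sides of the rectangle. *)
Lemma rect_pos v xa x1 x2 y0 r c : xa < x1 < x2 -> 0 < r -> 0 < c ->
    (forall x y, xa <= x <= x2 -> `|y - y0| <= r -> [/\ ctn v x y, 0 <= v x y &
       exists2 l, lap v x y l & l <= 0]) ->
    (forall x y, x1 <= x <= x2 -> `|y - y0| <= r -> c <= v x y) ->
  forall x, xa < x < x2 -> 0 < v x y0.
Proof.
move=> xx r0 c0 H Hc x xI; pose th : R := pi / (2 * r).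
have th0 : 0 < th by rewrite divr_gt0 ?pi_gt0// mulr_gt0.
have thr : th * r = pi / 2 by rewrite /th; field; rewrite gt_eqF.
pose f s := expR (th * s + - (th * xa)) - 1; pose g s := cos (th * s + - (th * y0)).
have df s : d2 f s (th * (th * expR (th * s + - (th * xa))) + -1 * 0).
  have de (z : R) : d2 (@expR R) z (expR z).
    by apply: (@d2_ext _ _ (@expR R)) => *; exact: is_derive_expR.
  have := d2D (d2_affine (de (th * s + - (th * xa)))) (d2Z (-1) (d2C 1 s)).
  by apply: d2_near; apply: (@filterE _ (nbhs s)) => t; rewrite mulr1.
have dg s : d2 g s (th * (th * - cos (th * s + - (th * y0)))).
  exact: (@d2_affine _ cos) (d2_cos _).
have f0 s : xa < s -> 0 < f s.
  by move=> xs; rewrite subr_gt0 -expR0 ltr_expR -mulrBr mulr_gt0 ?subr_gt0.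
have fm s : s <= x2 -> f s <= f x2.
  by move=> sx; rewrite lerD2r ler_expR lerD2r ler_pM2l.
have g0 y : `|y - y0| < r -> 0 < g y.
  rewrite ltr_norml => yr; apply: cos_gt0_pihalf; rewrite -mulrBr -thr; apply/andP; split.
    by rewrite -mulrN ltr_pM2l//; case/andP: yr.
  by rewrite ltr_pM2l//; case/andP: yr.
have fx2 : 0 < f x2 by apply: f0; qlra.
have g1 s : g s <= 1 by exact: cos_le1.
pose c' := c / f x2; have c'0 : 0 < c' by exact: divr_gt0.
pose O := [set p : R * R | xa < p.1 < x2 /\ - r + y0 < p.2 < r + y0].
have Oy s y : O (s, y) -> `|y - y0| < r by move=> [_ /= h]; rewrite ltr_norml; qlra.
have cf := cvg_affine; have oO : open O.
  have c1 : continuous (fun p : R * R => p.1) by move=> p; exact: cvg_fst.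
  have c2 : continuous (fun p : R * R => p.2) by move=> p; exact: cvg_snd.
  have oI (h : R * R -> R) a b : continuous h -> open [set p | a < h p < b].
    move=> ch; rewrite (_ : [set p | _] = [set p | a < h p] `&` [set p | h p < b]).
      by apply: openI; apply: open_ltf => // p; exact: cvg_cst.
    by apply/seteqP; split => p /= => [/andP[]|[-> ->]].
  exact: openI (oI _ _ _ c1) (oI _ _ _ c2).
have key : 0 <= v x y0 - c' * (f x * g y0).
  apply: (@max_princ0 _ O (fun s y => v s y - c' * (f s * g y)) (`|xa| + `|x2|)) => //.
  - move=> s y Osy; have [s1 _] : xa < s < x2 /\ True by case: Osy.
    have [cv _ _] := H s y ltac:(qlra) (ltW (Oy _ _ Osy)); split.
      by apply: ctnB => //; apply: ctnM; [exact: ctnC|exact: ctnM1].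
    have h1 := ler_norm x2; have h2 := ler_norm (- xa); rewrite normrN in h2.
    have h3 := normr_ge0 xa; have h4 := normr_ge0 x2.
    by rewrite ler_norml; move: h1 h2 h3 h4 s1; clear; qlra.
  - move=> s y Osy; have [s1 _] : xa < s < x2 /\ True by case: Osy.
    have [_ _ [l lv l0]] := H s y ltac:(qlra) (ltW (Oy _ _ Osy)).
    eexists; first exact: lapB lv (lapZ c' (lapM1 (df s) (dg y))).
    move=> _; rewrite subr_le0; apply: (le_trans l0); apply: mulr_ge0; first exact: ltW.
    rewrite [leRHS](_ : _ = th * th * g y); last by rewrite /f /g; ring.
    by rewrite mulr_ge0 ?(ltW (g0 _ (Oy _ _ Osy)))// mulr_ge0// ltW.
  - move=> e e0; exists [set p : R * R | (xa <= p.1 <= x1 /\ - r + y0 <= p.2 <= r + y0) /\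
       e <= c' * (f p.1 * g p.2)]; split.
    + apply: compact_ge; first exact: compact_box.
      move=> -[s y] _; have : ctn (fun s y => c' * (f s * g y)) s y.
        by apply: ctnM; [exact: ctnC|exact: ctnM1].
      by [].
    + move=> -[s y] [[/= s1 y1] ep]; have [E|sx] := eqVneq s xa.
        by move: ep; rewrite E /f subrr expR0 subrr mul0r mulr0; qlra.
      have sx' : xa < s by rewrite lt_def sx; qlra.
      have [E|yy] := eqVneq (g y) 0; first by move: ep; rewrite E !mulr0; qlra.
      split => /=; first by qlra.
      suff : `|y - y0| != r.
        move=> yr; have : `|y - y0| < r by rewrite lt_def eq_sym yr ler_norml; qlra.
        by rewrite ltr_norml; qlra.
      apply: contra_neq yy => yr; have : y - y0 = r \/ y - y0 = - r.
        by move: yr; case: (ler0P (y - y0)) => _ <-; [right|left] => //; rewrite opprK.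
      by rewrite /g -mulrBr => -[->|->]; rewrite ?mulrN ?cosN thr cos_pihalf.
    + move=> s y Osy nK; have [s1 y1] := Osy; rewrite /= in s1 y1.
      have [_ v0 _] := H s y ltac:(qlra) (ltW (Oy _ _ Osy)).
      have [sx|sx] := leP s x1.
        have : c' * (f s * g y) < e.
          by rewrite ltNge; apply/negP => ?; apply: nK; split => //=; split; qlra.
        by qlra.
      have := Hc s y ltac:(qlra) (ltW (Oy _ _ Osy)).
      have : c' * (f s * g y) <= c.
        rewrite [leRHS](_ : _ = c' * (f x2 * 1)); last by rewrite /c' mulr1 divfK ?gt_eqF.
        rewrite ler_pM2l// ler_pM ?(ltW (g0 _ (Oy _ _ Osy))) ?(ltW (f0 _ _))//; first by qlra.
        by apply: fm; qlra.
      by qlra.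
  by split => //=; qlra.
rewrite subr_ge0 in key; apply: lt_le_trans key.
have gy : 0 < g y0 by apply: g0; rewrite subrr normr0.
have fx : 0 < f x by apply: f0; qlra.
exact: mulr_gt0 c'0 (mulr_gt0 fx gy).
Qed.

(* The difference quotients u(x + h, y) - u(x, y) are nonnegative by the maximum principle:
   on the curved side the first term is nonnegative and the second one vanishes. *)
Lemma cap_mono (O : set (R * R)) u k c x1 x2 d : open O -> jets O u -> 0 < k <= 1 -> 0 < d ->
    x1 < x2 ->
    (forall x y, O (x, y) -> u 2%N 0%N x y + u 0%N 2%N x y + (pi ^+ 2 + k ^+ 2) * u 0%N 0%N x y = 0) ->
    (forall x y, O (x, y) -> 0 < y < 1 /\ x < x2) ->
    (forall x y, O (x, y) -> x < x1 -> 1 / 2 <= x + c /\ 2 * (k * (x + c)) <= pi - k) ->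
    (forall x y x', O (x, y) -> x < x' < x2 -> O (x', y)) ->
    (forall e, 0 < e -> compact [set p | O p /\ p.1 <= x1 /\ e <= `|u 0%N 0%N p.1 p.2|]) ->
    (forall x y, O (x, y) -> x1 - d < x -> 0 <= u 0%N 0%N x y /\ 0 < u 1%N 0%N x y) ->
  forall x y, O (x, y) -> 0 < u 1%N 0%N x y.
Proof.
move=> oO Ju k01 d0 x12 Eu O1 Oc Oh van slab; have k0 : 0 < k by case/andP: k01.
have pib := @pi_bounds R.
pose U := [set p : R * R | O p /\ p.1 < x1].
have oU : open U.
  by apply: openI => //; apply: open_ltf => p; [exact: cvg_fst|exact: cvg_cst].
pose be := Num.sqrt (pi ^+ 2 - k ^+ 2).
have be2 : be ^+ 2 = pi ^+ 2 - k ^+ 2 by rewrite sqr_sqrtr//; move: k01 pib; clear; nra.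
have beb : 0 < be < pi.
  have be0 : 0 < be by rewrite sqrtr_gt0; move: k01 pib; clear; nra.
  rewrite be0 -(ltr_pXn2r (n := 2)) ?nnegrE ?be2//; move: be0 k01 pib; clear; nra.
pose lam : R := pi ^+ 2 + k ^+ 2.
have MP w : (forall x y, U (x, y) -> ctn w x y /\ lap w x y (- (lam * w x y))) ->
    (forall e, 0 < e -> forall x y, U (x, y) -> `|u 0%N 0%N x y| < e \/ x1 - d / 2 < x ->
       - e <= w x y) -> forall x y, U (x, y) -> 0 <= w x y.
  move=> Hw He; apply: (@max_princ_sin _ U w (2 * k) be 1 c lam k) => //.
  - by move=> x y /Hw[].
  - by move: k01 pib; clear; qlra.
  - by rewrite expr1n.
  - by rewrite be2 /lam; move: k0; clear; nra.
  - move=> x y [Oxy /= xx1]; have [y01 _] := O1 _ _ Oxy; split => //.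
    have [h1 h2] := Oc _ _ Oxy xx1; rewrite mul1r -mulrA h2 andbT.
    by move: h1 k0; clear; nra.
  - move=> x y /Hw[_ lw]; eexists; first exact: lw.
    by rewrite addNr.
  - move=> e e0; exists [set p | [set p | O p /\ p.1 <= x1 /\ e <= `|u 0%N 0%N p.1 p.2|] p /\
       0 <= (-1) * p.1 + (x1 - d / 2)]; split.
    + apply: compact_cut (van e e0) _; exact: cont_fst_aff.
    + by move=> -[x y] [[Oxy _] /= xx]; split => //=; qlra.
    + move=> x y Uxy nK; apply: He => //; have [Oxy /= xx1] := Uxy.
      have [xd|] := ltP (x1 - d / 2) x; [by right|move=> xd; left].
      rewrite ltNge; apply/negP => ?; apply: nK; split => /=; last by qlra.
      by split => //; split => //; exact: ltW.
have lapu x y : O (x, y) -> lap (u 0%N 0%N) x y (- (lam * u 0%N 0%N x y)).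
  move=> Oxy; have := jets_lap 0 0 oO Ju Oxy.
  by have := Eu _ _ Oxy => /eqP; rewrite addr_eq0 => /eqP ->.
have u0 x y : O (x, y) -> 0 <= u 0%N 0%N x y.
  move=> Oxy; have [xx|xx] := ltP (x1 - d) x; first by have [] := slab _ _ Oxy xx.
  have Uxy : U (x, y) by split => //=; qlra.
  move: x y Uxy {Oxy xx}; apply: (MP (u 0%N 0%N)) => [x y [Oxy' _]|e e0 x y [Oxy' _]].
    by split; [have [] := Ju 0%N 0%N x y Oxy'|exact: lapu].
  case=> [|xx']; first by rewrite ltr_norml => /andP[/ltW].
  by have [] := slab x y Oxy' ltac:(qlra); qlra.
have wh h : 0 < h -> h < x2 - x1 -> h < d / 2 -> forall x y, U (x, y) ->
    0 <= u 0%N 0%N (x + h) y - u 0%N 0%N x y.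
  move=> h0 h1 h2; have sh s t : U (s, t) -> O (s + h, t).
    by move=> [/= Ost ss]; apply: Oh Ost _; qlra.
  apply: (MP (fun x y => u 0%N 0%N (x + h) y - u 0%N 0%N x y)) => [x y Uxy|e e0 x y Uxy xe].
    have [Oxy _] := Uxy; split.
      apply: ctnB; last by have [] := Ju 0%N 0%N x y Oxy.
      have [cu _ _] := Ju 0%N 0%N _ _ (sh _ _ Uxy).
      have := @ctn_affine _ (u 0%N 0%N) 1 h 1 0 x y; rewrite !mul1r addr0 => /(_ cu).
      by apply: ctn_eq => s t; rewrite !mul1r addr0.
    have [a [b [da db E]]] := lapu _ _ (sh _ _ Uxy).
    have := lapB (lap_shift da db) (lapu _ _ Oxy); rewrite -E.
    by rewrite (_ : - _ - - _ = - (lam * (u 0%N 0%N (x + h) y - u 0%N 0%N x y))); last by ring.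
  have [Oxy /= xx1] := Uxy; have up := u0 _ _ (sh _ _ Uxy); case: xe => [|xd].
    by rewrite ltr_norml => /andP[]; qlra.
  have [||z zI ->] := @mvt _ ((u 0%N 0%N)^~ y) ((u 1%N 0%N)^~ y) x (x + h); first by qlra.
    move=> z zI; have Oz : O (z, y).
      by have [->//|zx] := eqVneq z x; apply: Oh Oxy _; rewrite lt_def zx/=; qlra.
    by have [] := Ju 0%N 0%N _ _ Oz.
  have Oz : O (z, y) by apply: Oh Oxy _; qlra.
  have [_ uz] := slab _ _ Oz ltac:(qlra); apply: (@le_trans _ _ 0); first by qlra.
  by rewrite mulr_ge0 ?(ltW uz)//; qlra.
have ux0 x y : O (x, y) -> 0 <= u 1%N 0%N x y.
  move=> Oxy; have [xx|xx] := ltP (x1 - d) x; first by have [_ /ltW] := slab _ _ Oxy xx.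
  have Uxy : U (x, y) by split => //=; qlra.
  have [_ /is_deriveP du _] := Ju 0%N 0%N x y Oxy.
  rewrite leNgt; apply/negP => un.
  have [d' d'0 Hd] := du (- u 1%N 0%N x y / 2) ltac:(qlra).
  pose h := Num.min (Num.min (d / 4) ((x2 - x1) / 2)) (d' / 2).
  have h0 : 0 < h by rewrite !lt_min; qlra.
  have hE : [/\ h <= d / 4, h <= (x2 - x1) / 2 & h <= d' / 2] by rewrite /h !ge_min !lexx !orbT.
  have [e1 e2 e3] := hE; have := Hd h ltac:(by rewrite gtr0_norm//; qlra).
  have wp := wh h h0 ltac:(qlra) ltac:(qlra) x y Uxy.
  rewrite (gtr0_norm h0) ler_norml => /andP[_].
  by move: wp un h0; clear; nra.
move=> x y Oxy; have [xx|xx] := ltP (x1 - d) x; first by have [] := slab _ _ Oxy xx.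
(* Strictness is propagated leftwards from the slab by [rect_pos]: there u_x has a positive minimum
   on a compact box, and u_x >= 0 makes its Laplacian - lam u_x nonpositive. *)
pose xb := x1 - d / 2; pose xc := x1.
have /nbhs_ballP[r0 /= r00 Hr] : nbhs (x, y) O by exact: open_nbhs_nbhs.
pose r := r0 / 2; have rp : 0 < r by rewrite divr_gt0.
have Or s t : x - r <= s -> s < x2 -> `|t - y| <= r -> O (s, t).
  move=> s1 s2 ty; have Oxt : O (x - r, t).
    apply: Hr; split; rewrite /ball/= ?opprB ?[x + _]addrC ?subrK; last first.
      by rewrite distrC; apply: (le_lt_trans ty); rewrite /r; qlra.
    by rewrite gtr0_norm// /r; qlra.
  by have [->//|sx] := eqVneq s (x - r); apply: Oh Oxt _; rewrite lt_def sx/=; qlra.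
have J1 := jets_shift 1 0 Ju.
have [c0 c00 Hc] : exists2 c0, 0 < c0 & forall s t, xb <= s <= xc -> `|t - y| <= r -> c0 <= u 1%N 0%N s t.
  have cK := @compact_box _ xb xc (y - r) (y + r).
  have [||[s t] [/= sI tI] smin] := @compact_argmin _ _ (fun p => u 1%N 0%N p.1 p.2) cK.
  - by exists (xb, y); split => /=; rewrite /xb /xc; qlra.
  - move=> [s t] [/= sI tI]; have : O (s, t).
      by apply: Or; rewrite ?ler_norml; rewrite /xb /xc in sI; qlra.
    by move=> Ost; have [] := Ju 1%N 0%N s t Ost.
  exists (u 1%N 0%N s t) => [|s' t' s'I t'I].
    apply: (slab _ _ _ _).2; last by rewrite /xb in sI; qlra.
    by apply: Or; rewrite ?ler_norml; rewrite /xb /xc in sI; qlra.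
  by apply: (smin (s', t')); split => //=; move: t'I; rewrite ler_norml; qlra.
apply: (@rect_pos _ (x - r) xb xc y r c0) => //; rewrite /xb /xc; try qlra.
move=> s t sI ty; have Ost : O (s, t) by apply: Or => //; qlra.
split; [by have [] := Ju 1%N 0%N s t Ost|exact: ux0|].
have ls := jets_lap 1 0 oO Ju Ost; exists (u 3%N 0%N s t + u 1%N 2%N s t) => //.
have JE := jets_eq (d := 0) oO Ju Ju (fun x y H => etrans (Eu x y H) (esym (mul0r (u 0%N 0%N x y)))) 1%N 0%N Ost.
have := ux0 _ _ Ost; rewrite mul0r in JE => u1.
have lam0 : 0 <= (pi ^+ 2 + k ^+ 2 : R) by rewrite addr_ge0 ?sqr_ge0.
by have := mulr_ge0 lam0 u1; qlra.
Qed.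

End CapMonotonicity.

(** * Bounds for derivatives up to second order *)

Section StripBounds.
Context {R : realType}.
Implicit Types (F : nat -> nat -> R -> R -> R) (a b B lam x y h : R).

Lemma diff_bound (f f' : R -> R) x h K : 0 < h ->
    (forall z, x <= z <= x + h -> is_derive z 1 f (f' z) /\ `|f' z| <= K) ->
  `|f (x + h) - f x| <= K * h.
Proof.
move=> h0 H; have := @mvt_le R f f' K x (x + h).
have xh : x <= x + h by rewrite lerDl ltW.
rewrite (min_idPl xh) (max_idPr xh) => /(_ H).
by rewrite [x + h - x]addrC addKr (gtr0_norm h0).
Qed.

(** To get the factor sin(pi y) for F_x one needs vanishing at the sides, which is known for F
    alone; so [strip_sin] is applied to the differences F(x + h) - F(x), of size h, and then h tends
    to 0. The constants c1, c2, c3 belong to the gradient, to F_x with its sine factor, and to the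
    second derivatives. *)
Lemma strip_jets_bound : exists2 C : R, 0 < C & forall F a b B lam,
    jets (rect a b) F -> 0 <= lam <= 17 ->
    (forall x y, rect a b (x, y) -> F 2%N 0%N x y + F 0%N 2%N x y + lam * F 0%N 0%N x y = 0) ->
    (forall x y, rect a b (x, y) -> `|F 0%N 0%N x y| <= B) -> side0 a b (F 0%N 0%N) ->
  forall x y, a + 3 <= x <= b - 3 -> 0 < y < 1 ->
    [/\ `|F 0%N 0%N x y| <= C * B * sin (pi * y), `|F 1%N 0%N x y| <= C * B * sin (pi * y),
        `|F 0%N 1%N x y| <= C * B & `|y - 1 / 2| <= 1 / 4 ->
          [/\ `|F 2%N 0%N x y| <= C * B, `|F 1%N 1%N x y| <= C * B & `|F 0%N 2%N x y| <= C * B]].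
Proof.
have [c1 c10 c1E] : exists2 c : R, 1 <= c & 220 * (1 + 17) <= c.
  by exists (220 * 18); qlra.
have [c2 c20 c2E] : exists2 c : R, c1 <= c & 24 * (c1 + 17 * c1) <= c.
  by exists (24 * (c1 + 17 * c1)) => //; qlra.
have [c3 c30 c3E] : exists2 c : R, c2 <= c & 3 * (2 * c2 / (1 / 4) + 17 * c2 * (1 / 4)) + 17 <= c.
  by exists (3 * (2 * c2 / (1 / 4) + 17 * c2 * (1 / 4)) + 17) => //; qlra.
exists c3; first by qlra.
move=> F a b B lam JF lam17 EF FB sF x y xI y01.
have xr : rect a b (x, y) by split => /=; qlra.
have B0 : 0 <= B by apply: le_trans (FB _ _ xr).
have oO : open (rect a b) := @open_rect R a b 0 1.
have lapF i j s t : rect a b (s, t) -> lap (F i j) s t (- (lam * F i j s t)).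
  move=> rst; have := jets_lap i j oO JF rst.
  have := jets_eq (d := 0) oO JF JF (fun x y H => etrans (EF x y H) (esym (mul0r (F 0%N 0%N x y)))) i j rst.
  by rewrite mul0r => /eqP; rewrite addr_eq0 => /eqP ->.
have lamB z K : `|z| <= K -> `|- (lam * z)| <= 17 * K.
  move=> zK; rewrite normrN normrM ger0_norm; last by case/andP: lam17.
  by have := normr_ge0 z; move: lam17 zK; clear; nra.
have uP s t : rect a b (s, t) -> [/\ ctn (F 0%N 0%N) s t,
    exists2 v, lap (F 0%N 0%N) s t v & `|v| <= 17 * B & `|F 0%N 0%N s t| <= B].
  move=> rst; have [cF _ _] := JF 0%N 0%N s t rst; split => //; last exact: FB.
  by exists (- (lam * F 0%N 0%N s t)); [exact: lapF|exact: lamB (FB _ _ rst)].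
have g1 s t : a + 1 <= s <= b - 1 -> 0 < t < 1 ->
    `|F 1%N 0%N s t| <= c1 * B /\ `|F 0%N 1%N s t| <= c1 * B.
  move=> sI tI; have rst : rect a b (s, t) by split => /=; qlra.
  have [_ dx dy] := JF 0%N 0%N s t rst.
  have KE : 220 * (B + 17 * B) <= c1 * B by rewrite [leLHS](_ : _ = 220 * (1 + 17) * B) ?ler_wpM2r//; ring.
  split; apply: le_trans KE.
    by have h := @strip_grad R a b (F 0%N 0%N) B (17 * B) uP sF s t _ sI tI (or_introl dx).
  by have h := @strip_grad R a b (F 0%N 0%N) B (17 * B) uP sF s t _ sI tI (or_intror dy).
have s0 : 0 <= sin (pi * y) by exact: ltW (sinpi_gt0 y01).
have g2 s t : a + 2 <= s <= b - 2 -> 0 < t < 1 -> `|F 1%N 0%N s t| <= c2 * B * sin (pi * t).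
  move=> sI tI; have rst : rect a b (s, t) by split => /=; qlra.
  have [_ /is_deriveP dx _] := JF 0%N 0%N s t rst.
  apply/ler_addgt0Pr => ep ep0; have [d d0 Hd] := dx ep ep0.
  pose h := Num.min (d / 2) (1 / 4); have h0 : 0 < h by rewrite lt_min; qlra.
  have [hE1 hE2] : h <= d / 2 /\ h <= 1 / 4 by rewrite /h !ge_min !lexx orbT.
  have := Hd h ltac:(by rewrite gtr0_norm//; qlra).
  pose w s t := F 0%N 0%N (s + h) t - F 0%N 0%N s t.
  have rw p q : rect (a + 1) (b - 5 / 4) (p, q) -> rect a b (p, q) /\ rect a b (p + h, q).
    by move=> [/= p1 q1]; split; split => //=; move: p1 hE2 h0; clear; qlra.
  have wP p q : rect (a + 1) (b - 5 / 4) (p, q) -> [/\ ctn w p q,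
      exists2 v, lap w p q v & `|v| <= 17 * (c1 * B * h) & `|w p q| <= c1 * B * h].
    move=> rpq; have [r1 r2] := rw _ _ rpq; have [/= p1 q1] := rpq.
    have wb : `|w p q| <= c1 * B * h.
      apply: (@diff_bound ((F 0%N 0%N)^~ q) ((F 1%N 0%N)^~ q)) => // z zI.
      have zr : a + 1 <= z <= b - 1 by move: zI p1 hE2; clear; qlra.
      have [|_ dz _] := JF 0%N 0%N z q; first by split => //=; move: zr; clear; qlra.
      by split => //; have [] := g1 z q zr q1.
    split => //.
      apply: ctnB; last by have [] := JF 0%N 0%N _ _ r1.
      have [cu _ _] := JF 0%N 0%N _ _ r2.
      have := @ctn_affine _ (F 0%N 0%N) 1 h 1 0 p q; rewrite !mul1r addr0 => /(_ cu).
      by apply: ctn_eq => s' t'; rewrite !mul1r addr0.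
    exists (- (lam * w p q)); last exact: lamB.
    have [a' [b' [da db E]]] := lapF 0%N 0%N _ _ r2.
    have := lapB (lap_shift da db) (lapF 0%N 0%N _ _ r1); rewrite -E.
    by rewrite (_ : - _ - - _ = - (lam * w p q)); last by rewrite /w; ring.
  have sw : side0 (a + 1) (b - 5 / 4) w.
    move=> e e0; have [d1 d10 H1] := sF (e / 2) ltac:(qlra); exists d1 => // p q rpq qd.
    have [r1 r2] := rw _ _ rpq; apply: (le_trans (ler_normB _ _)).
    by have := H1 _ _ r1 qd; have := H1 _ _ r2 qd; qlra.
  have := strip_sin wP sw (x := s) (y := t) ltac:(qlra) tI => wb.
  rewrite (gtr0_norm h0) => hd; have st0 := ltW (sinpi_gt0 tI).
  have : `|F 1%N 0%N s t * h| <= `|w s t| + ep * h.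
    have -> : F 1%N 0%N s t * h = w s t - (w s t - F 1%N 0%N s t * h) by ring.
    by apply: (le_trans (ler_normB _ _)); rewrite lerD2l.
  rewrite normrM (gtr0_norm h0) => H1; rewrite -(ler_pM2r h0); apply: (le_trans H1).
  rewrite mulrDl lerD2r; apply: (le_trans wb).
  rewrite [leLHS](_ : _ = 24 * (c1 + 17 * c1) * (B * sin (pi * t) * h)); last by ring.
  rewrite [leRHS](_ : _ = c2 * (B * sin (pi * t) * h)); last by ring.
  by rewrite ler_wpM2r// mulr_ge0 ?(ltW h0)// mulr_ge0.
have le3 K z : K <= c3 -> z <= K * B -> z <= c3 * B.
  by move=> Kc zK; apply: (le_trans zK); rewrite ler_wpM2r.
have cc : c1 <= c3 by qlra.
split.
- have := strip_sin uP sF (x := x) (y := y) ltac:(qlra) y01 => /le_trans; apply.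
  by rewrite ler_wpM2r// [leLHS](_ : _ = 24 * (1 + 17) * B) ?ler_wpM2r//; [qlra|ring].
- have /le_trans : `|F 1%N 0%N x y| <= c2 * B * sin (pi * y) by apply: g2 => //; qlra.
  by apply; rewrite ler_wpM2r// ler_wpM2r.
- by have [_ h] := g1 x y ltac:(qlra) y01; exact: le3 h.
move=> y4; have y4' : 1 / 4 <= y <= 3 / 4 by move: y4; rewrite ler_norml; qlra.
have gb s t : `|s - x| < 1 / 4 -> `|t - y| < 1 / 4 -> [/\ ctn (F 1%N 0%N) s t,
    exists2 v, lap (F 1%N 0%N) s t v & `|v| <= 17 * (c2 * B) & `|F 1%N 0%N s t| <= c2 * B].
  rewrite !ltr_norml => sx ty; have rst : rect a b (s, t) by split => /=; qlra.
  have b1 : `|F 1%N 0%N s t| <= c2 * B.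
    have sI : a + 2 <= s <= b - 2 by move: sx xI; clear; qlra.
    have tI : 0 < t < 1 by move: ty y4'; clear; qlra.
    apply: le_trans (g2 s t sI tI) _.
    by rewrite ler_piMr ?sin_le1// mulr_ge0//; qlra.
  have [c _ _] := JF 1%N 0%N s t rst; split => //.
  by exists (- (lam * F 1%N 0%N s t)); [exact: lapF|exact: lamB].
have q4 : 0 < (1 / 4 : R) by qlra.
have [_ d20 d11] := JF 1%N 0%N x y xr.
have E20 := grad_bound q4 gb d20; have E11 := grad_bound_y q4 gb d11.
have KE : 3 * (2 * (c2 * B) / (1 / 4) + 17 * (c2 * B) * (1 / 4)) + 17 * B <= c3 * B.
  rewrite [leLHS](_ : _ = (3 * (2 * c2 / (1 / 4) + 17 * c2 * (1 / 4)) + 17) * B); last by ring.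
  by rewrite ler_wpM2r.
have B17 : 0 <= 17 * B by qlra.
split; [by qlra|by qlra|].
have -> : F 0%N 2%N x y = - (lam * F 0%N 0%N x y) - F 2%N 0%N x y by have := EF _ _ xr; qlra.
apply: (le_trans (ler_normB _ _)); have := lamB _ _ (FB _ _ xr); qlra.
Qed.

End StripBounds.

(** * One critical point in each box *)

Section Boxes.
Context {R : realType}.
Implicit Types (x y k N th z : R) (v : nat -> nat -> R -> R -> R) (O : set (R * R)) (i : nat).

Lemma mvt_between (f f' : R -> R) a b :
    (forall x, Num.min a b <= x <= Num.max a b -> is_derive x 1 f (f' x)) ->
  exists2 c, Num.min a b <= c <= Num.max a b & f b - f a = f' c * (b - a).
Proof.
have H s t : s <= t -> (forall x, s <= x <= t -> is_derive x 1 f (f' x)) ->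
    exists2 c, s <= c <= t & f t - f s = f' c * (t - s).
  move=> st df; have [->|tns] := eqVneq s t; first by exists t; rewrite ?lexx// !subrr mulr0.
  have [|c cI E] := @mvt R f f' s t _ df; first by rewrite lt_def eq_sym tns.
  by exists c => //; qlra.
have [ab|/ltW ba] := leP a b => df; first exact: H.
have [c cI E] := H b a ba df; exists c => //.
by rewrite -opprB E -mulrN opprB.
Qed.

Lemma cos_le_quad z : `|z| <= pi -> cos z <= 1 - z ^+ 2 / 32.
Proof.
move=> zpi; wlog z0 : z zpi / 0 <= z.
  move=> H; have [/H->//|/ltW z0] := leP 0 z.
  by rewrite -cosN -(sqrrN z); apply: H; rewrite ?normrN ?oppr_ge0.
rewrite ger0_norm// in zpi.
have := @sin_ge_lin R (z / 2) ltac:(qlra); have := cos_mulr2n (z / 2).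
rewrite (_ : (z / 2) *+ 2 = z); last by rewrite mulr2n; qlra.
move=> -> h; have := cos2Dsin2 (z / 2); rewrite mulr2n.
have : (z / 2 / 4) ^+ 2 <= sin (z / 2) ^+ 2 by rewrite lerXn2r ?nnegrE//; qlra.
by rewrite !expr_div_n; qlra.
Qed.

Lemma sin_box i z : sin (z + (i%:R * pi + pi / 2)) = (-1) ^+ i * cos z :> R.
Proof.
elim: i => [|i IH]; first by rewrite mul0r add0r sinDpihalf expr0 mul1r.
rewrite -natr1 mulrDl mul1r (_ : z + _ = z + (i%:R * pi + pi / 2) + pi); last by ring.
by rewrite sinDpi IH exprS; ring.
Qed.

Lemma cos_box i z : cos (z + (i%:R * pi + pi / 2)) = - ((-1) ^+ i * sin z) :> R.
Proof.
elim: i => [|i IH]; first by rewrite mul0r add0r cosDpihalf expr0 mul1r.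
rewrite -natr1 mulrDl mul1r (_ : z + _ = z + (i%:R * pi + pi / 2) + pi); last by ring.
by rewrite cosDpi IH exprS; ring.
Qed.

(** Centred at the i-th extremum of sin(k (N - x)) sin(pi y). Measuring the horizontal size by the
    phase k (N - x) makes all boxes alike, whatever N. *)
Definition inbox k N i x y := `|k * (N - x) - (i%:R * pi + pi / 2)| <= 1 / 8 /\ `|y - 1 / 2| <= 1 / 8.

Lemma remd_box k N v i x y (c := i%:R * pi + pi / 2) (s := (-1) ^+ i)
    (z := k * (N - x) - c) (t := pi * (y - 1 / 2)) :
  [/\ v 0%N 0%N x y = s * (cos z * cos t) + remd N k 1 v 0 0 x y,
      v 1%N 0%N x y = s * (k * sin z * cos t) + remd N k 1 v 1 0 x y &
      v 0%N 1%N x y = - (s * (pi * cos z * sin t)) + remd N k 1 v 0 1 x y] /\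
  [/\ v 2%N 0%N x y = - (s * (k ^+ 2 * cos z * cos t)) + remd N k 1 v 2 0 x y,
      v 1%N 1%N x y = - (s * (k * pi * (sin z * sin t))) + remd N k 1 v 1 1 x y &
      v 0%N 2%N x y = - (s * (pi ^+ 2 * cos z * cos t)) + remd N k 1 v 0 2 x y].
Proof.
have sE0 : sinj (- k) (k * N) 0 x = s * cos z.
  rewrite /sinj expr0 mul1r mul0r addr0 -(sin_box i); congr sin; rewrite /z /c; ring.
have sE1 : sinj (- k) (k * N) 1 x = s * (k * sin z).
  rewrite /sinj expr1 mul1r sinDpihalf (_ : - k * x + k * N = z + c); last by rewrite /z /c; ring.
  rewrite cos_box -/s; ring.
have pE0 : sinj pi 0 0 y = cos t.
  rewrite /sinj expr0 mul1r mul0r !addr0 (_ : pi * y = t + (0%:R * pi + pi / 2)).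
    by rewrite sin_box expr0 mul1r.
  by rewrite /t mul0r add0r; field.
have pE1 : sinj pi 0 1 y = - (pi * sin t).
  rewrite /sinj expr1 mul1r addr0 sinDpihalf (_ : pi * y = t + (0%:R * pi + pi / 2)).
    by rewrite cos_box expr0 mul1r; ring.
  by rewrite /t mul0r add0r; field.
by rewrite /remd !sinj2 sE0 sE1 pE0 pE1; split; split; ring.
Qed.

(** In the box both cosines are at least 7/8 and |sin z sin t| <= 1/16, so the pure second
    derivatives are at least k^2 / 2 and pi^2 / 2 in absolute value, with equal signs, and the mixed
    one is at most k pi / 8. The remainders scale with the matching powers of k, so the comparison
    is uniform in N. *)
Lemma box_second k N v i x y th : 0 < k <= 1 -> 0 <= th -> th * (64 * 256) <= 1 -> inbox k N i x y ->
    `|remd N k 1 v 2 0 x y| <= th * k ^+ 2 -> `|remd N k 1 v 1 1 x y| <= th * k ->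
    `|remd N k 1 v 0 2 x y| <= th ->
  [/\ k ^+ 2 / 2 <= `|v 2%N 0%N x y|, `|v 1%N 1%N x y| <= k * (pi / 8),
      pi ^+ 2 / 2 <= `|v 0%N 2%N x y| & 
      v 1%N 1%N x y ^+ 2 < v 2%N 0%N x y * v 0%N 2%N x y].
Proof.
move=> k01 th0 th1 [xb yb] r20 r11 r02.
have [_ [-> -> ->]] := remd_box k N v i x y.
move: xb; set z := k * _ - _ => zb; set t := pi * _.
have pib := @pi_bounds R; have tb : `|t| <= 1 / 2.
  by rewrite normrM gtr0_norm ?pi_gt0//; have := normr_ge0 (y - 1 / 2); move: yb pib; clear; nra.
have cz : 7 / 8 <= cos z <= 1.
  rewrite cos_le1 andbT; apply: le_trans (cos_ge_quad z).
  by rewrite -real_normK ?num_real//; have := normr_ge0 z; move: zb; clear; nra.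
have ct : 7 / 8 <= cos t <= 1.
  rewrite cos_le1 andbT; apply: le_trans (cos_ge_quad t).
  by rewrite -real_normK ?num_real//; have := normr_ge0 t; move: tb; clear; nra.
have sz := le_trans (norm_sin_le z) zb; have st := le_trans (norm_sin_le t) tb.
have cc : 3 / 4 <= cos z * cos t by move: cz ct; clear; nra.
have ss : `|sin z * sin t| <= 1 / 16.
  by rewrite normrM; have := normr_ge0 (sin z); have := normr_ge0 (sin t); move: sz st; clear; nra.
have s1 : `|(-1) ^+ i : R| = 1 by rewrite normrX normrN1 expr1n.
set s := (-1) ^+ i; rewrite -/s in s1.
have sn a : `|s * a| = `|a| by rewrite normrM s1 mul1r.
have lowE q e : 0 <= q -> `|e| <= th * q ->
    exists2 a, q / 2 <= a & - (s * (q * cos z * cos t)) + e = - (s * a).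
  move=> q0 eb; exists (q * (cos z * cos t) - s * e).
    have := ler_norm (s * e); rewrite sn; move: eb cc th1 q0; clear; nra.
  have ss1 : s * s = 1 by rewrite /s -exprMn mulrN1 opprK expr1n.
  by rewrite mulrBr [s * (s * e)]mulrA ss1; ring.
have k20 : 0 <= k ^+ 2 by exact: sqr_ge0.
have p20 : 0 <= pi ^+ 2 :> R by exact: sqr_ge0.
have [a1 a1b ->] := lowE _ _ k20 ltac:(exact: r20).
have r02' : `|remd N k 1 v 0 2 x y| <= th * pi ^+ 2.
  apply: (le_trans r02); rewrite ler_peMr// expr2.
  by move: pib; clear; nra.
have [a2 a2b ->] := lowE _ _ p20 r02'.
have v11 : `|- (s * (k * pi * (sin z * sin t))) + remd N k 1 v 1 1 x y| <= k * (pi / 8).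
  apply: (le_trans (ler_normD _ _)); rewrite normrN sn normrM.
  rewrite (gtr0_norm (_ : 0 < k * pi)); last by rewrite mulr_gt0 ?pi_gt0//; case/andP: k01.
  have kp : 0 <= k * pi by rewrite mulr_ge0 ?(ltW (pi_gt0 _))//; qlra.
  have := ler_wpM2l kp ss; move: r11 k01 pib th0 th1; clear => r11 k01 pib th0 th1 h.
  have : th * k <= k * (pi / 16) by rewrite mulrC ler_wpM2l//; qlra.
  by qlra.
have a10 : 0 <= a1 by qlra.
have a20 : 0 <= a2 by qlra.
rewrite !normrN !sn (ger0_norm a10) (ger0_norm a20); split => //.
have ss1 : s * s = 1 by rewrite /s -exprMn mulrN1 opprK expr1n.
rewrite [ltRHS]mulrNN [ltRHS]mulrACA ss1 mul1r.
rewrite -real_normK ?num_real//; apply: (@le_lt_trans _ _ ((k * (pi / 8)) ^+ 2)).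
  by rewrite lerXn2r ?nnegrE// mulr_ge0 ?divr_ge0 ?(ltW (pi_gt0 _))//; qlra.
apply: lt_le_trans (ler_pM _ _ a1b a2b); rewrite ?divr_ge0// exprMn.
have : 0 < k ^+ 2 * pi ^+ 2 by rewrite mulr_gt0 ?exprn_gt0 ?pi_gt0//; qlra.
by rewrite expr_div_n; qlra.
Qed.

(** A value close to 1 forces both cosines close to 1, hence a position strictly inside the box: the
    maximum over the closed box is an interior one. *)
Lemma box_value k N v i x y th : 0 < k <= 1 -> th * (64 * 256) <= 1 -> inbox k N i x y ->
    `|remd N k 1 v 0 0 x y| <= th -> 1 - th <= (-1) ^+ i * v 0%N 0%N x y ->
  `|k * (N - x) - (i%:R * pi + pi / 2)| < 1 / 8 /\ `|y - 1 / 2| < 1 / 8.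
Proof.
move=> k01 th1 [zb yb] r0; have [[-> _ _] _] := remd_box k N v i x y.
move: zb; set z := k * _ - _ => zb; set t := pi * _.
set s := (-1) ^+ i; have pib := @pi_bounds R.
have ss1 : s * s = 1 by rewrite /s -exprMn mulrN1 opprK expr1n.
have sn : s * remd N k 1 v 0 0 x y <= th.
  apply: le_trans (ler_norm _) _.
  by rewrite normrM {1}/s normrX normrN1 expr1n mul1r.
rewrite mulrDr mulrA ss1 mul1r => h; have {h sn} cc : 1 - 2 * th <= cos z * cos t by qlra.
have tE : `|t| = pi * `|y - 1 / 2| by rewrite normrM gtr0_norm ?pi_gt0.
have t1 : `|t| <= 1 / 2.
  by rewrite tE; have := normr_ge0 (y - 1 / 2); move: yb pib; clear; nra.
have tp : `|t| <= pi by qlra.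
have zp : `|z| <= pi by qlra.
have q1 := cos_le_quad tp; have q2 := cos_le_quad zp.
have c1 := cos_ge_quad t; have c2 := cos_ge_quad z.
have c3 := cos_le1 t; have c4 := cos_le1 z.
have z2 : z ^+ 2 = `|z| ^+ 2 by rewrite real_normK ?num_real.
have t2 : t ^+ 2 = `|t| ^+ 2 by rewrite real_normK ?num_real.
have z3 : z ^+ 2 <= 1 / 64.
  by rewrite z2; have := normr_ge0 z; move: zb; clear; nra.
have t3 : t ^+ 2 <= 1 / 4.
  by rewrite t2; have := normr_ge0 t; move: t1; clear; nra.
have a1 : 1 - 2 * th <= cos t by move: cc c2 z3 c1 t3 c4 c3; clear; nra.
have a2 : 1 - 2 * th <= cos z by move: cc c2 z3 c1 t3 c4 c3; clear; nra.
split.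
  rewrite ltNge; apply/negP => zl; have : 1 / 64 <= z ^+ 2.
    by rewrite z2; move: zl; clear; nra.
  by qlra.
rewrite ltNge; apply/negP => yl; have : 1 / 64 <= t ^+ 2.
  have : 1 / 4 <= `|t| by rewrite tE; move: yl pib; clear; nra.
  by rewrite t2; clear; nra.
by qlra.
Qed.

Lemma min_dir (f : R -> R) l x d : 0 < d -> (forall z, `|z - x| < d -> f x <= f z) ->
  is_derive x 1 f l -> l = 0.
Proof.
move=> d0 H; apply: is_derive_min0; apply/nbhs_ballP; exists d => // z /=.
by rewrite /ball/= distrC; exact: H.
Qed.

Lemma box_crit O k N v i th : jets O v -> 0 < k <= 1 -> 0 <= th -> th * (64 * 256) <= 1 ->
    (forall x y, inbox k N i x y -> [/\ O (x, y), `|remd N k 1 v 0 0 x y| <= th,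
       `|remd N k 1 v 2 0 x y| <= th * k ^+ 2, `|remd N k 1 v 1 1 x y| <= th * k
       & `|remd N k 1 v 0 2 x y| <= th]) ->
  exists x y, [/\ inbox k N i x y, v 1%N 0%N x y = 0, v 0%N 1%N x y = 0,
    forall x' y', inbox k N i x' y' -> v 1%N 0%N x' y' = 0 -> v 0%N 1%N x' y' = 0 -> x' = x /\ y' = y
    & exists2 d, 0 < d & forall x' y', `|x' - x| < d -> `|y' - y| < d ->
      (-1) ^+ i * v 0%N 0%N x' y' <= (-1) ^+ i * v 0%N 0%N x y].
Proof.
move=> Jv k01 th0 th1 H; have [k0 k1] : 0 < k /\ k <= 1 by apply/andP.
set s := (-1) ^+ i; pose c : R := i%:R * pi + pi / 2.
have bxE x y : inbox k N i x y <-> (N - (c + 1 / 8) / k <= x <= N - (c - 1 / 8) / k /\ 3 / 8 <= y <= 5 / 8).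
  have e1 : (N - (c + 1 / 8) / k <= x) = (k * (N - x) <= c + 1 / 8).
    by rewrite lerBlDr -lerBlDl ler_pdivlMr// [(N - x) * k]mulrC.
  have e2 : (x <= N - (c - 1 / 8) / k) = (c - 1 / 8 <= k * (N - x)).
    by rewrite lerBrDr -lerBrDl ler_pdivrMr// [(N - x) * k]mulrC.
  rewrite /inbox -/c e1 e2 !ler_norml; clear -c; move: (k * (N - x)) (c) => {c}a c.
  by split; qlra.
have cK := @compact_box R (N - (c + 1 / 8) / k) (N - (c - 1 / 8) / k) (3 / 8) (5 / 8).
have cen : inbox k N i (N - c / k) (1 / 2).
  rewrite /inbox -/c subKr mulrC divfK ?gt_eqF// !subrr normr0; split; qlra.
have [|[x0 y0] [/= h]|[x y] /bxE bxy vmin] :=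
    @compact_argmin _ _ (fun p => - (s * v 0%N 0%N p.1 p.2)) cK.
- by exists (N - c / k, 1 / 2); apply/bxE.
- move=> h'; have /H[Oxy _ _ _ _] : inbox k N i x0 y0 by apply/bxE.
  apply: cvgN; apply: cvgM; first exact: cvg_cst.
  by have [] := Jv 0%N 0%N x0 y0 Oxy.
have vmax x' y' : inbox k N i x' y' -> s * v 0%N 0%N x' y' <= s * v 0%N 0%N x y.
  by move=> /bxE b'; have := vmin (x', y') b'; rewrite lerN2.
have vcen : 1 - th <= s * v 0%N 0%N x y.
  apply: le_trans (vmax _ _ cen); have [_ r0 _ _ _] := H _ _ cen.
  have [[-> _ _] _] := remd_box k N v i (N - c / k) (1 / 2).
  rewrite -/c subKr [k * _]mulrC divfK ?gt_eqF// !subrr mulr0 cos0 -/s !mulr1.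
  have -> : s * (s + remd N k 1 v 0 0 (N - c / k) (1 / 2)) =
      1 + s * remd N k 1 v 0 0 (N - c / k) (1 / 2).
    by rewrite mulrDr -{1}exprMn mulrN1 opprK expr1n.
  have : `|s * remd N k 1 v 0 0 (N - c / k) (1 / 2)| <= th.
    have s1 : `|(-1) ^+ i : R| = 1 by rewrite normrX normrN1 expr1n.
    by rewrite normrM s1 [leLHS]mul1r.
  by rewrite ler_norml; qlra.
have [Oxy r0 _ _ _] := H _ _ bxy.
have [zi yi] := box_value k01 th1 bxy r0 vcen; rewrite -/c in zi.
pose d := Num.min (1 / 8 - `|k * (N - x) - c|) (1 / 8 - `|y - 1 / 2|).
have d0 : 0 < d by rewrite lt_min !subr_gt0 zi yi.
have [d1 d2] : d <= 1 / 8 - `|k * (N - x) - c| /\ d <= 1 / 8 - `|y - 1 / 2|.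
  by rewrite /d !ge_min !lexx orbT.
have dbox x' y' : `|x' - x| < d -> `|y' - y| < d -> inbox k N i x' y'.
  move=> xd yd; split.
    rewrite -/c (_ : k * (N - x') - c = k * (N - x) - c - k * (x' - x)); last by ring.
    apply: (le_trans (ler_normB _ _)); rewrite normrM gtr0_norm//.
    have h1 : k * `|x' - x| <= `|x' - x| by rewrite ler_piMl.
    by move: h1 xd d1; clear; qlra.
  rewrite (_ : y' - 1 / 2 = y - 1 / 2 + (y' - y)); last by ring.
  by apply: (le_trans (ler_normD _ _)); move: yd d2; clear; qlra.
have s0 : s != 0 by rewrite signr_eq0.
have [_ dx dy] := Jv 0%N 0%N x y Oxy.
have sd l : - (s * l) = 0 -> l = 0.
  by move/eqP; rewrite oppr_eq0 mulf_eq0 (negbTE s0) => /eqP.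
have vx0 : v 1%N 0%N x y = 0.
  have h := is_deriveN (is_deriveZ s dx); apply: sd; apply: (min_dir d0 _ h) => z zx.
  by rewrite lerN2; apply: vmax; apply: dbox => //; rewrite subrr normr0.
have vy0 : v 0%N 1%N x y = 0.
  have h := is_deriveN (is_deriveZ s dy); apply: sd; apply: (min_dir d0 _ h) => z zx.
  by rewrite lerN2; apply: vmax; apply: dbox => //; rewrite subrr normr0.
exists x, y; split => // [x' y' b' vx' vy'|]; last first.
  by exists d => // x' y' xd yd; apply: vmax; exact: dbox.
have bw (a a' b lo hi : R) : lo <= a <= hi -> lo <= a' <= hi -> Num.min a a' <= b <= Num.max a a' -> lo <= b <= hi.
  by clear; case: (leP a a'); qlra.
have hx z : Num.min x x' <= z <= Num.max x x' -> inbox k N i z y'.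
  move=> zI; have /bxE [h1 h2] := bxy; have /bxE [h3 h4] := b'; apply/bxE; split => //.
  exact: bw h1 h3 zI.
have hy z : Num.min y y' <= z <= Num.max y y' -> inbox k N i x z.
  move=> zI; have /bxE [h1 h2] := bxy; have /bxE [h3 h4] := b'; apply/bxE; split => //.
  exact: bw h2 h4 zI.
have J j l z t : inbox k N i z t -> is_derive z 1 ((v j l)^~ t) (v j.+1 l z t) /\
    is_derive t 1 (v j l z) (v j l.+1 z t).
  by move=> /H[Ozt _ _ _ _]; have [] := Jv j l z t Ozt.
have B z t : inbox k N i z t -> _ := fun b => let: And5 _ _ b1 b2 b3 := H z t b in
  box_second k01 th0 th1 b b1 b2 b3.
(* Uniqueness. Go from (x, y) to (x', y') through (x, y'): v_x and v_y vanish at both ends, so the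
   mean value theorem bounds k |x' - x| by pi / 4 |y' - y| and pi |y' - y| by k |x' - x| / 4, and
   both distances are 0. *)
have [z1 /hx/B[l1 _ _ _] E1] := mvt_between (fun z h => (J 1%N 0%N z y' (hx z h)).1).
have [z2 /hy/B[_ l2 _ _] E2] := mvt_between (fun z h => (J 1%N 0%N x z (hy z h)).2).
have [z3 /hx/B[_ l3 _ _] E3] := mvt_between (fun z h => (J 0%N 1%N z y' (hx z h)).1).
have [z4 /hy/B[_ _ l4 _] E4] := mvt_between (fun z h => (J 0%N 1%N x z (hy z h)).2).
have e1 : `|v 2%N 0%N z1 y'| * `|x' - x| = `|v 1%N 1%N x z2| * `|y' - y|.
  by rewrite -!normrM -E1 -E2 vx' vx0 subr0 sub0r normrN.
have e2 : `|v 0%N 2%N x z4| * `|y' - y| = `|v 1%N 1%N z3 y'| * `|x' - x|.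
  by rewrite -!normrM -E4 -E3 vy' vy0 subr0 sub0r normrN.
have pib := @pi_bounds R.
have n1 := normr_ge0 (x' - x); have n2 := normr_ge0 (y' - y).
have f1 : k ^+ 2 / 2 * `|x' - x| <= k * (pi / 8) * `|y' - y|.
  by apply: le_trans (ler_wpM2r n2 l2); rewrite -e1 ler_wpM2r.
have f2 : pi ^+ 2 / 2 * `|y' - y| <= k * (pi / 8) * `|x' - x|.
  by apply: le_trans (ler_wpM2r n1 l3); rewrite -e2 ler_wpM2r.
have p0 : 0 < pi :> R := pi_gt0 R.
have g1 : k * `|x' - x| <= pi / 4 * `|y' - y|.
  rewrite -(ler_pM2l k0); move: f1; clear; qlra.
have g2 : pi * `|y' - y| <= k * `|x' - x| / 4.
  rewrite -(ler_pM2l p0); move: f2; clear; qlra.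
have yy : `|y' - y| = 0 by move: g1 g2 pib n2; clear; nra.
have xx : `|x' - x| = 0 by move: g1; rewrite yy mulr0; move: n1 k0; clear; nra.
by split; apply/eqP; rewrite -subr_eq0 -normr_eq0; apply/eqP.
Qed.

End Boxes.

(** * Critical points of a function close to the sine profile *)

Section NearSine.
Context {R : realType}.
Implicit Types (phi : R -> R) (S N k th q x y : R) (m : nat) (v : nat -> nat -> R -> R -> R).

(** The eigenfunction of class m divided by its amplitude. The remainder is controlled for q <= x <=
    N - q, where k q is about pi / 16; each bound carries the power of k that the corresponding
    derivative of the profile has. *)
Record near_sine phi S N k th q m v : Prop := NearSine {
  ns_m : (0 < m)%N;
  ns_phi : between0 phi S;
  ns_open : open (dom phi N);
  ns_S : 4 * m%:R * (S + 2) <= N;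
  ns_q : q = N / (16 * m%:R);
  ns_N : 32 * m%:R <= N;
  ns_efun : efun phi N (pi ^+ 2 + k ^+ 2) v;
  ns_k : m%:R * pi - 1 / 64 <= k * N <= m%:R * pi;
  ns_th : 0 <= th /\ th * (64 * 256) <= 1;
  ns_near : forall x y, q <= x <= N - q -> 0 < y < 1 ->
    [/\ `|remd N k 1 v 0 0 x y| <= th * sin (pi * y),
        `|remd N k 1 v 1 0 x y| <= th * k * sin (pi * y),
        `|remd N k 1 v 0 1 x y| <= th & `|y - 1 / 2| <= 1 / 4 ->
        [/\ `|remd N k 1 v 2 0 x y| <= th * k ^+ 2, `|remd N k 1 v 1 1 x y| <= th * k
          & `|remd N k 1 v 0 2 x y| <= th] ] }.

Lemma ns_basic phi S N k th q m v : near_sine phi S N k th q m v ->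
  [/\ 1 <= m%:R :> R, 0 < N, 0 < k <= 1 / 8, 0 < q /\ 4 * q < N &
     pi / 16 - 1 / 1024 <= k * q <= pi / 16].
Proof.
move=> [m0 _ _ _ -> lgm _ kN _ _]; have mu1 : 1 <= m%:R :> R by rewrite ler1n.
move: mu1 lgm kN; move: (m%:R) => mu mu1 lgm kN.
have pib := @pi_bounds R; have N0 : 0 < N by move: mu1 lgm; clear; qlra.
have mp : pi <= mu * pi by rewrite ler_peMl// pi_ge0.
have kp : 0 < k by rewrite -(pmulr_lgt0 _ N0); move: kN mp pib; clear; qlra.
have k8 : k <= 1 / 8.
  rewrite -(ler_pM2r N0); apply: (@le_trans _ _ (mu * pi)); first by case/andP: kN.
  by move: pib mu1 lgm; clear; nra.
have mu16 : 0 < 16 * mu by move: mu1; clear; qlra.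
have kq : pi / 16 - 1 / 1024 <= k * (N / (16 * mu)) <= pi / 16.
  by rewrite mulrA ler_pdivlMr// ler_pdivrMr//; move: kN mu1; clear; nra.
split; rewrite ?kp//; split; first by rewrite divr_gt0.
by rewrite -(ltr_pM2l kp); move: kq mp kN pib; clear; qlra.
Qed.

Lemma ns_cos y : cos (pi * (y - 1 / 2)) = sin (pi * y) :> R.
Proof.
have -> : pi * y = pi * (y - 1 / 2) + pi / 2 by field.
by rewrite sinDpihalf.
Qed.

Lemma compact_cap (O : set (R * R)) (u : R -> R -> R) x1 x2 e : vanishing O u -> 0 < e -> x1 < x2 ->
  compact [set p | (O p /\ p.1 < x2) /\ p.1 <= x1 /\ e <= `|u p.1 p.2|].
Proof.
move=> van e0 x12; have := compact_cut (van e e0) (@cont_fst_aff R (-1) x1).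
congr compact; apply/seteqP; split => p /=; first by move=> [[Op up] xx]; do !split => //; qlra.
by move=> [[Op _] [xx up]]; do !split => //; qlra.
Qed.

(** As k N is nearly m pi, the profile is (-1)^(m - 1) sin(k x) up to a small phase, and it
    increases while k x < pi / 2. So (-1)^(m - 1) v satisfies the hypotheses of [cap_mono], with the
    slab q < x < 2 q in which the profile is known. *)
Lemma left_cap phi S N k th q m v x y : near_sine phi S N k th q m v ->
  dom phi N (x, y) -> x < 2 * q -> v 1%N 0%N x y != 0.
Proof.
move=> ns Oxy xq; have [mu1 N0 k8 [q0 qN] kq] := ns_basic ns; have pib := @pi_bounds R.
have [m0 phiS dO lgS _ lgm [Jv Ev Vv] kN [th0 th1] near] := ns; have kp : 0 < k by case/andP: k8.
pose s : R := (-1) ^+ m.-1.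
have ss1 : s * s = 1 by rewrite /s -exprMn mulrN1 opprK expr1n.
have s1 : `|s| = 1 by rewrite /s normrX normrN1 expr1n.
have Jw := jets_lin s 0 Jv Jv.
suff : 0 < s * v 1%N 0%N x y + 0 * v 1%N 0%N x y.
  by rewrite mul0r addr0 => h; apply/eqP => v0; move: h; rewrite v0 mulr0 ltxx.
apply: (@cap_mono _ [set p | dom phi N p /\ p.1 < 2 * q] (fun i j s' t => s * v i j s' t + 0 * v i j s' t)
  k (S + 1) (3 / 2 * q) (2 * q) (q / 2)) => //.
- exact: open_dom_lt.
- by apply: jets_sub Jw => p [].
- by move: k8; clear; qlra.
- by rewrite divr_gt0.
- by move: q0; clear; qlra.
- move=> s' t [/Ev E _].
  rewrite [LHS](_ : _ = s * (v 2%N 0%N s' t + v 0%N 2%N s' t + (pi ^+ 2 + k ^+ 2) * v 0%N 0%N s' t)).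
    by rewrite E mulr0.
  by ring.
- by move=> s' t [[/= tI _] sq].
- move=> s' t [[/= tI sI] _] sq; have pS := phiS _ tI; split; first by move: pS sI; clear; qlra.
  have h1 : k * s' <= k * (2 * q) by rewrite ler_pM2l//; move: sq q0; clear; qlra.
  have h2 : k * (4 * m%:R * (S + 2)) <= k * N by rewrite ler_pM2l.
  have h3 : 2 * (k * (S + 1)) <= pi / 2.
    have mr : 0 < m%:R :> R by rewrite ltr0n.
    rewrite -(ler_pM2l mr); move: h2 kN k8 mu1; clear; nra.
  by move: h1 h3 kq k8 pib; clear; nra.
- move=> s' t x' [[/= tI sI] sq] xI; have pS := phiS _ tI.
  by do !split => //=; move: sI xI qN N0; clear; qlra.
- move=> e e0; apply: (@compact_cap (dom phi N) (fun s' t => s * v 0%N 0%N s' t + 0 * v 0%N 0%N s' t)) => //;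
    last by move: q0; clear; qlra.
  by apply: vanishing_lin (Vv) (Vv) => s' t Ost; have [] := Jv 0%N 0%N s' t Ost.
move=> s' t [[/= tI sI] sq] sq'.
have qI : q <= s' <= N - q.
  by move: sq sq' qN q0; clear; qlra.
have [r0 r1 _ _] := near _ _ qI tI; have st := sinpi_gt0 tI.
have sr z B : `|z| <= B -> - B <= s * z.
  by move=> zB; have : `|s * z| <= B by [rewrite normrM s1 mul1r]; rewrite ler_norml => /andP[].
have [[-> -> _] _] := remd_box k N v m.-1 s' t; rewrite ns_cos -/s !mul0r !addr0.
set z := k * _ - _; have zE : z = pi / 2 - (k * s' - (k * N - m%:R * pi)).
  by rewrite /z -{2}(prednK m0) -natr1; field.
set w := k * s' - _ in zE; have wI : 1 / 10 <= w <= 1.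
  have : k * q <= k * s' <= k * (2 * q) by rewrite !ler_pM2l//; move: qI sq; clear; qlra.
  by rewrite /w; move: kq kN pib; clear; qlra.
have -> : cos z = sin w by rewrite zE cosB cos_pihalf sin_pihalf mul0r mul1r add0r.
have -> : sin z = cos w by rewrite zE sinB cos_pihalf sin_pihalf mul0r mul1r subr0.
have cw : 1 / 2 <= cos w by have := cos_ge_quad w; move: wI; clear; nra.
have sw : 1 / 40 <= sin w by have := @sin_ge_lin R w ltac:(move: wI pib; clear; qlra); move: wI; clear; qlra.
move: (sr _ _ r0) (sr _ _ r1); move: (remd N k 1 v 0 0 s' t) (remd N k 1 v 1 0 s' t) => a b e0 e1.
rewrite !mulrDr !mulrA ss1 !mul1r -!mulrA.
split.
  have : 0 <= (sin w - th) * sin (pi * t) by rewrite mulr_ge0 ?(ltW st)//; move: sw th0 th1; clear; qlra.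
  by move: e0; clear; qlra.
have : 0 < k * ((cos w - th) * sin (pi * t)).
  apply: mulr_gt0; first by move: k8; clear; qlra.
  by apply: mulr_gt0 st; move: cw th0 th1; clear; qlra.
by move: e1; clear; qlra.
Qed.

(** The mirror image of [left_cap]: in t = N - x the end is flat, and the profile sin(k t) increases
    from the side t = 0 without any sign to correct. *)
Lemma right_cap phi S N k th q m v x y : near_sine phi S N k th q m v ->
  dom phi N (x, y) -> N - 2 * q < x -> v 1%N 0%N x y != 0.
Proof.
move=> ns Oxy xq; have [mu1 N0 k8 [q0 qN] kq] := ns_basic ns; have pib := @pi_bounds R.
have [m0 phiS dO lgS _ lgm [Jv Ev Vv] kN [th0 th1] near] := ns; have kp : 0 < k by case/andP: k8.
have sub s' t : rect 0 N (s', t) -> dom phi N (N - s', t).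
  by move=> [/= sI tI]; have pS := phiS _ tI; do !split => //=; move: sI pS; clear; qlra.
suff : 0 < flip N v 1%N 0%N (N - x) y.
  by rewrite /flip expr1 subKr => h; apply/eqP => v0; move: h; rewrite v0 mulr0 ltxx.
have [/= yI xI] := Oxy.
apply: (@cap_mono _ [set p | rect 0 N p /\ p.1 < 2 * q] (flip N v)
  k 1 (3 / 2 * q) (2 * q) (q / 2)) => //.
- apply: openI; first exact: (@open_rect R 0 N 0 1).
  by apply: open_ltf => p; [exact: cvg_fst|exact: cvg_cst].
- by apply: jets_flip Jv => s' t [/sub].
- by move: k8; clear; qlra.
- by rewrite divr_gt0.
- by move: q0; clear; qlra.
- by move=> s' t [/sub/Ev E _]; rewrite /flip !expr0 expr2 !mulN1r opprK !mul1r.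
- by move=> s' t [[/= sI tI] sq].
- move=> s' t [[/= sI tI] _] sq; split; first by move: sI; clear; qlra.
  have h1 : k * s' <= k * (2 * q) by rewrite ler_pM2l//; move: sq q0; clear; qlra.
  by move: h1 kq k8 pib; clear; nra.
- move=> s' t x' [[/= sI tI] sq] x'I.
  by do !split => //=; move: sI x'I qN N0; clear; qlra.
- move=> e e0; have cK := compact_cut (Vv e e0) (@cont_fst_aff R 1 (3 / 2 * q - N)).
  pose f (p : R * R) := (N - p.1, p.2).
  have cf : continuous f.
    move=> p; apply: (@cvg_pair _ _ _ (nbhs p) (nbhs (N - p.1)) (nbhs p.2)); last exact: cvg_snd.
    by apply: cvgB; [exact: cvg_cst|exact: cvg_fst].
  have := continuous_compact (continuous_subspaceT cf) cK.
  congr compact; apply/seteqP; split => [_ /= [[s' t] [[[/= tI sI] up] /= xx] <-]|[s' t] /=].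
    by rewrite /f /flip /= subKr expr0 mul1r; do !split => //=; move: sI xx q0 qN; clear; qlra.
  rewrite /flip expr0 mul1r => -[[rst sq] [sx up]]; exists (N - s', t); last by rewrite /f /= subKr.
  by split => /=; [split => //; exact: sub|move: sx; clear; qlra].
- move=> s' t [[/= sI tI] sq] sq'.
  have qI : q <= N - s' <= N - q by move: sq sq' qN q0; clear; qlra.
  have [r0 r1 _ _] := near _ _ qI tI; have st := sinpi_gt0 tI.
  have [[E0 E1 _] _] := remd_box k N v 0 (N - s') t; rewrite ns_cos subKr !mul0r !add0r in E0 E1.
  rewrite /flip expr0 expr1 E0 E1 cosB sinB cos_pihalf sin_pihalf !mulr0 !mulr1 add0r sub0r !expr0 !mul1r.
  have wI : 1 / 10 <= k * s' <= 1.
    have : k * q <= k * s' <= k * (2 * q) by rewrite !ler_pM2l//; move: qI sq; clear; qlra.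
    by move: kq kN pib; clear; qlra.
  move: (k * s') wI => w wI; have cw : 1 / 2 <= cos w by have := cos_ge_quad w; move: wI; clear; nra.
  have sw : 1 / 40 <= sin w by have := @sin_ge_lin R w ltac:(move: wI pib; clear; qlra); move: wI; clear; qlra.
  move: r0 r1; rewrite !ler_norml => /andP[e0 _] /andP[_ e1]; split.
    have : 0 <= (sin w - th) * sin (pi * t) by rewrite mulr_ge0 ?(ltW st)//; move: sw th0 th1; clear; qlra.
    by move: e0; clear; qlra.
  have : 0 < k * ((cos w - th) * sin (pi * t)).
    apply: mulr_gt0; first by move: k8; clear; qlra.
    by apply: mulr_gt0 st; move: cw th0 th1; clear; qlra.
  by move: e1; clear; qlra.
by do !split => //=; move: xI xq qN; clear; qlra.
Qed.

Lemma inbox_mid phi S N k th q m v i x y : near_sine phi S N k th q m v -> (i < m)%N ->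
  inbox k N i x y -> q <= x <= N - q /\ 0 < y < 1.
Proof.
move=> ns im [zb yb]; have [mu1 N0 k8 [q0 qN] kq] := ns_basic ns; have pib := @pi_bounds R.
have [_ _ _ _ _ _ _ kN _ _] := ns; have kp : 0 < k by case/andP: k8.
split; last by move: yb; rewrite ler_norml; clear; qlra.
have i1 : i%:R * pi + pi <= m%:R * pi :> R.
  by rewrite -{2}(mul1r pi) -mulrDl natr1 ler_pM2r ?pi_gt0// ler_nat.
have i0 : 0 <= i%:R * pi :> R by rewrite mulr_ge0 ?pi_ge0.
rewrite -(ler_pM2l kp) -[_ <= N - q](ler_pM2l kp); move: zb.
by rewrite ler_norml !mulrBr; move: i0 i1 kN kq pib; clear; qlra.
Qed.

Lemma ns_box phi S N k th q m v i x y : near_sine phi S N k th q m v -> (i < m)%N ->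
    inbox k N i x y -> [/\ dom phi N (x, y), `|remd N k 1 v 0 0 x y| <= th,
       `|remd N k 1 v 2 0 x y| <= th * k ^+ 2, `|remd N k 1 v 1 1 x y| <= th * k
       & `|remd N k 1 v 0 2 x y| <= th].
Proof.
move=> ns im b; have [xI yI] := inbox_mid ns im b.
have [mu1 N0 k8 [q0 qN] kq] := ns_basic ns.
have [_ phiS _ _ _ _ _ _ [th0 _] near] := ns.
have [r0 _ _ /(_ _)[|r20 r11 r02]] := near _ _ xI yI.
  by have [_ yb] := b; apply: (le_trans yb); qlra.
split => //; first by have pS := phiS _ yI; do !split => //=; move: xI pS q0; clear; qlra.
by apply: (le_trans r0); rewrite ler_piMr// sin_le1.
Qed.

(** Critical points avoid both end zones. In between, v_x = 0 forces |sin z| <= th, hence |cos z| >=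
    1/2, and then v_y = 0 forces |sin t| <= th: the phase z is close to a multiple of pi and y is
    close to 1/2. *)
Lemma crit_in_box phi S N k th q m v x y : near_sine phi S N k th q m v ->
    dom phi N (x, y) -> v 1%N 0%N x y = 0 -> v 0%N 1%N x y = 0 ->
  exists2 i, (i < m)%N & inbox k N i x y.
Proof.
move=> ns Oxy v10 v01; have [mu1 N0 k8 [q0 qN] kq] := ns_basic ns; have pib := @pi_bounds R.
have [m0 phiS _ _ _ _ _ kN [th0 th1] near] := ns; have kp : 0 < k by case/andP: k8.
have [/= yI xI] := Oxy.
have xq : 2 * q <= x <= N - 2 * q.
  apply/andP; split; rewrite leNgt; apply/negP => h.
    by have /eqP := left_cap ns Oxy h.
  by have /eqP := right_cap ns Oxy h.
have [_ r1 r2 _] := near x y ltac:(move: xq q0; clear; qlra) yI; have st := sinpi_gt0 yI.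
have [[_ E1 E2] _] := remd_box k N v 0 x y; rewrite mul0r add0r in E1 E2.
rewrite v10 ns_cos expr0 mul1r in E1; rewrite v01 expr0 mul1r in E2.
set z := k * (N - x) - pi / 2 in E1 E2; set t := pi * (y - 1 / 2) in E2.
have sz : `|sin z| <= th.
  have ks : 0 < k * sin (pi * y) by exact: mulr_gt0.
  rewrite -(ler_pM2r ks) -{1}(gtr0_norm ks) -normrM (_ : th * _ = th * k * sin (pi * y)); last by ring.
  apply: le_trans r1; rewrite (_ : remd N k 1 v 1 0 x y = - (sin z * (k * sin (pi * y)))) ?normrN//.
  by move: E1; clear; qlra.
have th4 : 4 * th <= 1 / 8 by move: th0 th1; clear; qlra.
have cz : 1 / 2 <= `|cos z|.
  have := cos2Dsin2 z; rewrite -(real_normK (num_real (cos z))) -(real_normK (num_real (sin z))).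
  by have := normr_ge0 (cos z); have := normr_ge0 (sin z); move: sz th4; clear; nra.
have sty : `|sin t| <= th.
  have : pi * `|cos z| * `|sin t| <= th.
    rewrite -(gtr0_norm (pi_gt0 R)) -!normrM (_ : pi * _ * _ = remd N k 1 v 0 1 x y)//.
    by move: E2; clear; qlra.
  by apply: le_trans; rewrite ler_peMl//; move: cz pib; clear; nra.
have ty : `|t| <= 4 * th.
  have tp : `|t| <= pi / 2.
    by rewrite /t normrM gtr0_norm ?pi_gt0// ler_pM2l ?pi_gt0// ler_norml; move: yI; clear; qlra.
  have : `|t| / 4 <= sin `|t| by apply: sin_ge_lin; rewrite normr_ge0.
  have : sin `|t| <= `|sin t|.
    have [h|h] := leP 0 t; first by rewrite (ger0_norm h) ler_norm.
    by rewrite (ltr0_norm h) sinN -[`|sin t|]normrN ler_norm.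
  by move: sty; clear; qlra.
have yb : `|y - 1 / 2| <= 1 / 8.
  have : pi * `|y - 1 / 2| <= 4 * th by rewrite -{1}(gtr0_norm (pi_gt0 R)) -normrM.
  by have := normr_ge0 (y - 1 / 2); move: th4 pib; clear; nra.
have kx : k * (2 * q) <= k * (N - x) <= k * (N - 2 * q).
  by rewrite !ler_pM2l//; move: xq; clear; qlra.
have zI : - (pi / 2) < z < m%:R * pi - pi / 2.
  by rewrite /z; move: kx; rewrite mulrBr; move: kq kN pib; clear; qlra.
(* Adding pi makes the argument positive, as [sin_small] requires; the index therefore comes out as
   j = i + 1. *)
have [|j jz] := @sin_small R (z + pi) th _ ltac:(by rewrite sinDpi normrN).
  by move: zI pib; clear; qlra.
rewrite ler_norml in jz; have p0 := pi_gt0 R.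
have [i ji] : exists i, j = i.+1.
  by case: j jz => [|i _]; [rewrite mul0r; move: zI th4 pib; clear; qlra|exists i].
exists i; last first.
  split => //; move: jz; rewrite ji -natr1 mulrDl mul1r ler_norml /z; move: th4; clear; qlra.
rewrite -(ltr_nat R) -(ltr_pM2r p0); move: jz; rewrite ji -natr1 mulrDl mul1r; move: zI th4 pib; clear; qlra.
Qed.

(* (-1) ^ i v has a maximum in the box centred at k t = (i + 1/2) pi, y = 1/2; by the
   mean value theorem a negative definite Hessian leaves no room for a second critical point. *)
Lemma near_sine_crit phi S N k th q m v : near_sine phi S N k th q m v ->
  exists p : nat -> R * R,
  [/\ forall i, (i < m)%N -> [/\ dom phi N (p i), v 1%N 0%N (p i).1 (p i).2 = 0,
      v 0%N 1%N (p i).1 (p i).2 = 0,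
      v 1%N 1%N (p i).1 (p i).2 ^+ 2 < v 2%N 0%N (p i).1 (p i).2 * v 0%N 2%N (p i).1 (p i).2
      & exists2 d, 0 < d & forall x' y', `|x' - (p i).1| < d -> `|y' - (p i).2| < d ->
      (-1) ^+ i * v 0%N 0%N x' y' <= (-1) ^+ i * v 0%N 0%N (p i).1 (p i).2],
    forall x y, dom phi N (x, y) -> v 1%N 0%N x y = 0 -> v 0%N 1%N x y = 0 ->
      exists2 i, (i < m)%N & p i = (x, y)
    & forall i j, (i < m)%N -> (j < m)%N -> p i = p j -> i = j].
Proof.
move=> ns; have [mu1 N0 k8 [q0 qN] kq] := ns_basic ns; have pib := @pi_bounds R.
have [_ _ _ _ _ _ [Jv _ _] _ [th0 th1] _] := ns.
have k1 : 0 < k <= 1 by move: k8; clear; qlra.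
have /choice[p pP] i : exists p : R * R, (i < m)%N -> [/\ inbox k N i p.1 p.2,
    v 1%N 0%N p.1 p.2 = 0, v 0%N 1%N p.1 p.2 = 0,
    forall x' y', inbox k N i x' y' -> v 1%N 0%N x' y' = 0 -> v 0%N 1%N x' y' = 0 -> x' = p.1 /\ y' = p.2
    & exists2 d, 0 < d & forall x' y', `|x' - p.1| < d -> `|y' - p.2| < d ->
      (-1) ^+ i * v 0%N 0%N x' y' <= (-1) ^+ i * v 0%N 0%N p.1 p.2].
  have [im|_] := boolP (i < m)%N; last by exists (0, 0).
  have [x [y h]] := box_crit Jv k1 th0 th1 (fun x y => @ns_box _ _ _ _ _ _ _ _ i x y ns im).
  by exists (x, y).
exists p; split.
- move=> i im; have [b v10 v01 _ mx] := pP i im.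
  have [Op _ r20 r11 r02] := ns_box ns im b.
  have [_ _ _ h] := box_second k1 th0 th1 b r20 r11 r02.
  by rewrite -surjective_pairing in Op.
- move=> x y Oxy v10 v01; have [i im b] := crit_in_box ns Oxy v10 v01; exists i => //.
  have [_ _ _ H _] := pP i im; have [-> ->] := H x y b v10 v01.
  by rewrite -surjective_pairing.
move=> i j im jm pE; have [[bi _] _ _ _ _] := pP i im; have [[bj _] _ _ _ _] := pP j jm.
rewrite -pE in bj; move: bi bj; rewrite !ler_norml; move: (k * _) => w bi bj.
have h (a b : nat) : (a < b)%N -> a%:R * pi + pi <= b%:R * pi :> R.
  by move=> ab; rewrite -{2}(mul1r pi) -mulrDl natr1 ler_pM2r ?pi_gt0// ler_nat.
by have [/h ij|/h ij|//] := ltngtP i j; exfalso; move: ij bi bj pib; clear; qlra.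
Qed.

End NearSine.

(** * Choice of the constants: facts valid for all large N *)

Section LargeN.
Context {R : realType}.
Implicit Types (phi : R -> R) (S N lam k x y e c : R) (u v : nat -> nat -> R -> R -> R) (m j : nat).

Definition nonzero phi N u := exists x y, dom phi N (x, y) /\ u 0%N 0%N x y != 0.

Definition in_class N lam j := exists k : R,
  [/\ 0 < k, lam = pi ^+ 2 + k ^+ 2 & `|k * N - j%:R * pi| <= 1 / 64].

Definition threshold m N : R := pi ^+ 2 + (m%:R * pi / N) ^+ 2.

Lemma in_class_lt N lam lam' j j' : 0 < N -> in_class N lam j -> in_class N lam' j' ->
  (j < j')%N -> lam < lam'.
Proof.
move=> N0 [k [k0 -> kj]] [k' [k0' -> kj']] jj; have pib := @pi_bounds R.
have jp : j%:R * pi + pi <= j'%:R * pi :> R.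
  by rewrite -{2}(mul1r pi) -mulrDl natr1 ler_pM2r ?pi_gt0// ler_nat.
have kk : k < k'.
  by rewrite -(ltr_pM2r N0); move: kj kj' jp pib; rewrite !ler_norml; clear; qlra.
by rewrite ltrD2l ltrXn2r// ltW.
Qed.

Lemma amp_lin m N k c u : amp m N k (fun i j x y => c * u i j x y + 0 * u i j x y) = c * amp m N k u.
Proof. by rewrite /amp mul0r addr0 -[LHS]mulrA. Qed.

Lemma profile_scale m S e eta N phi lam u k c : c != 0 -> profile m S e eta N phi lam u k ->
  profile m S e eta N phi lam (fun i j x y => c * u i j x y + 0 * u i j x y) k.
Proof.
move=> c0 [h1 h2 h3 h4 h5 h6]; split; rewrite ?amp_lin//.
- by rewrite mulf_neq0.
- move=> x y Oxy; rewrite mul0r addr0 !(normrM c) [leRHS]mulrCA ler_wpM2l//; exact: h4.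
- move=> x y Oxy xx; rewrite mul0r addr0 !(normrM c).
  rewrite [leRHS](_ : _ = `|c| * (64 * m%:R * `|amp m N k u| * (sin (k * (x + S + 1)) * sin (pi * y)))); last by ring.
  by rewrite ler_wpM2l//; exact: h5.
move=> x y xI yI.
have -> : remd N k (c * amp m N k u) (fun i j x y => c * u i j x y + 0 * u i j x y) 0 0 x y =
    c * remd N k (amp m N k u) u 0 0 x y by rewrite /remd; ring.
rewrite !(normrM c) [leRHS](_ : _ = `|c| * (64 * m%:R * eta * `|amp m N k u|)); last by ring.
by rewrite ler_wpM2l//; exact: h6.
Qed.

(** The smallness conditions on e involve m only, so e can be fixed before N grows. *)
Lemma constants m : (0 < m)%N -> let mu : R := m%:R in let D := 64 * 64 * (mu * mu) in
  exists2 e : R, 0 < e & [/\ D * e <= 1 / 64, e <= 1 / 16, 64 * mu * e <= 1 &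
    512 * 1024 * (mu * mu * mu) * (64 * 64 * 16 * (mu * mu)) * e <= 1].
Proof.
move=> m0 mu D; have mu1 : 1 <= mu by rewrite ler1n.
have [c c0 cE] : exists2 c : R, 1 <= c & 512 * 1024 * (mu * mu * mu) = 64 * mu * c.
  by exists (8 * 1024 * (mu * mu)); [nra|ring].
have mu0 : 0 < mu by exact: lt_le_trans mu1.
have D0 : 0 < D by rewrite /D !mulr_gt0.
exists (64 * mu * c * (16 * D))^-1; first by rewrite invr_gt0 !mulr_gt0//; qlra.
have [b bE] : exists b, b = 64 * mu * c by eexists.
have b64 : 64 <= b by rewrite bE; nra.
have b0 : 0 < b by qlra.
have D1 : 64 * 64 * (mu * mu) = D by [].
have D64 : 64 <= D by rewrite -D1; nra.
rewrite cE -bE; split.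
- rewrite (_ : D * _ = 1 / (16 * b)); last by field; rewrite !gt_eqF.
  by rewrite ler_pdivrMr ?mulr_gt0//; qlra.
- by rewrite -[_^-1]mul1r ler_pdivrMr ?mulr_gt0//; nra.
- rewrite ler_pdivrMr ?mulr_gt0// mul1r bE.
  have h : 1 <= c * (16 * D) by nra.
  by rewrite -[_ * c * _]mulrA ler_peMr// mulr_ge0//; qlra.
rewrite (_ : 64 * 64 * 16 * (mu * mu) = 16 * D); last by rewrite /D; ring.
by rewrite divff// gt_eqF// !mulr_gt0.
Qed.

Lemma large_near m S e : (0 < m)%N -> 0 <= S -> 0 < e -> 64 * m%:R * e <= 1 ->
  exists N0, forall N, N0 <= N -> [/\ large m S e N, 0 < N & 2 * (e * N) + 3 <= N / (16 * m%:R)].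
Proof.
move=> m0 S0 e0; move: (ltac:(by rewrite ler1n) : 1 <= m%:R :> R); set mu : R := m%:R => mu1 e1.
pose N0 : R := 4 * mu * (S + 2) + 32 * mu + (S + 4) / e + 192 * mu.
have t0 : 0 <= 4 * mu * (S + 2) by rewrite !mulr_ge0//; qlra.
have t1 : 0 <= (S + 4) / e by rewrite divr_ge0 ?(ltW e0)//; qlra.
exists N0 => N NN; rewrite /N0 in NN.
have mu0 : 0 < mu by qlra.
have N0' : 0 < N by qlra.
have mn : 64 * mu != 0 by rewrite gt_eqF// mulr_gt0.
have h1 : N = 64 * mu * (N / (64 * mu)) by rewrite mulrC divfK.
set w := N / (64 * mu) in h1.
have w3 : 3 <= w by rewrite ler_pdivlMr ?mulr_gt0//; qlra.
have eN : e * N <= w.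
  rewrite h1 (_ : e * _ = 64 * mu * e * w); last by ring.
  by rewrite ler_piMl//; qlra.
have SN : S + 4 <= e * N.
  by rewrite mulrC -ler_pdivrMr//; qlra.
have E8 : N / (8 * mu) = 8 * w by rewrite /w; field; rewrite gt_eqF.
have E16 : N / (16 * mu) = 4 * w by rewrite /w; field; rewrite gt_eqF.
split; [split; rewrite -?/mu|exact: N0'|]; rewrite ?E8 ?E16; qlra.
Qed.

(** Assembles the three inputs of the counting argument: every eigenvalue below the threshold has a
    class, a class holds one eigenfunction up to scaling, and the class m gives the sine profile.
    The scaling by c makes the amplitude, or the value at the normalisation point, equal to 1. *)
Lemma large_facts m S : (0 < m)%N -> 0 <= S -> exists N0, forall N, N0 <= N -> forall phi,
    between0 phi S -> open (dom phi N) -> [/\ 0 < N,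
  forall lam u, efun phi N lam u -> lam <= threshold m N -> nonzero phi N u ->
    exists2 j, (0 < j <= m)%N & in_class N lam j,
  forall lam lam' u u' j, efun phi N lam u -> efun phi N lam' u' ->
    lam <= threshold m N -> lam' <= threshold m N -> nonzero phi N u -> nonzero phi N u' ->
    in_class N lam j -> in_class N lam' j ->
    lam = lam' /\ exists c, forall x y, dom phi N (x, y) -> u' 0%N 0%N x y = c * u 0%N 0%N x y
  & forall lam u, efun phi N lam u -> lam <= threshold m N -> nonzero phi N u ->
    in_class N lam m -> exists k c th, c != 0 /\
    near_sine phi S N k th (N / (16 * m%:R)) m (fun i j x y => c * u i j x y + 0 * u i j x y)].
Proof.
move=> m0 S0; have [e e0 [De e16 me Ke]] := constants m0.
have [C C0 HC] := @apriori_profile R m S e m0 S0 e0.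
have [C1 C10 HU] := @class_unique R m S m0 S0.
have [C2 C20 HB] := @strip_jets_bound R.
move: (ltac:(by rewrite ler1n) : 1 <= m%:R :> R) => mu1; have mu0 : 0 < m%:R :> R by qlra.
set mu : R := m%:R in De me Ke mu1 mu0.
set D := 64 * 64 * (mu * mu) in De Ke; have [K KE] : exists K, K = 512 * 1024 * (mu * mu * mu) by eexists.
rewrite -KE in Ke.
have D0 : 0 < D by rewrite /D !mulr_gt0.
have K0 : 0 < K.
  by rewrite KE; apply: mulr_gt0; [qlra|exact: mulr_gt0 (mulr_gt0 mu0 mu0) mu0].
have [t t0 tE] : exists2 t : R, 0 < t & t * (64 * 256) <= 1.
  by exists (1 / (64 * 256)); clear; qlra.
have KDC := mulr_ge0 (mulr_ge0 (ltW K0) (ltW D0)) (ltW C10).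
(* Powers of N to be beaten by exp(- e N): 6 in eta itself; 7 and 13 = 7 + 6 in [class_unique], for
   exp(- e N) and for eta; 8 = 6 + 2 in the remainder, which must be small relative to k^2 >=
   N^(-2). *)
have [n1 _ g1] := @exp_dominates R 6 C e (e / D) e0 ltac:(by rewrite divr_gt0) (ltW C0).
have [n2 _ g2] := @exp_dominates R 7 (K * D * C1) e (1 / 2) e0 ltac:(by []) KDC.
have [n3 _ g3] := @exp_dominates R 13 (K * D * C1 * C) e (1 / 2) e0 ltac:(by []) (mulr_ge0 KDC (ltW C0)).
have [n4 _ g4] := @exp_dominates R 8 (C2 * (64 * mu * C)) e t e0 t0 ltac:(by rewrite !mulr_ge0 ?ltW).
have [n0 gl] := large_near m0 S0 e0 me.
exists (Num.max (Num.max n0 n1) (Num.max (Num.max n2 n3) n4)) => N.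
rewrite !ge_max => /andP[/andP[/gl[lg N0 qN] /g1{}g1] /andP[/andP[/g2{}g2 /g3{}g3] /g4{}g4]] phi phiS dO.
set eta := C * N ^+ 6 * expR (- (e * N)) in g1.
have eta0 : 0 <= eta by rewrite /eta !mulr_ge0 ?exprn_ge0 ?expR_ge0 ?ltW.
have cls lam u : efun phi N lam u -> lam <= threshold m N -> nonzero phi N u ->
    exists k j, [/\ 0 < k, profile m S e eta N phi lam u k, (0 < j <= m)%N & `|k * N - j%:R * pi| <= D * e].
  move=> eu lt nz; have [k pr] := HC N phi lam u phiS dO lg eu lt nz g1 e16.
  have [|j [jm kj]] := profile_class m0 S0 e0 phiS lg pr eta0 g1.
    by rewrite -/mu -/D; apply: (le_trans De); clear; qlra.
  by have [k0 _ _ _] := profile_range m0 (lg_m lg) (pr_k pr); exists k, j.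
have clsj lam u j : efun phi N lam u -> lam <= threshold m N -> nonzero phi N u ->
    in_class N lam j -> exists k, [/\ 0 < k, profile m S e eta N phi lam u k & `|k * N - j%:R * pi| <= D * e].
  move=> eu lt nz [k' [k'0 E kj']]; have [k [j' [k0 pr jm kj]]] := cls _ _ eu lt nz.
  have kk : k = k'.
    apply/eqP; rewrite -(@eqrXn2 _ 2)// ?ltW//; apply/eqP.
    by apply: (addrI (pi ^+ 2)); rewrite -(pr_lam pr).
  have h (a b : nat) : (a < b)%N -> a%:R * pi + pi <= b%:R * pi :> R.
    by move=> ab; rewrite -{2}(mul1r pi) -mulrDl natr1 ler_pM2r ?pi_gt0// ler_nat.
  have pib := @pi_bounds R.
  have jj : j = j'.
    rewrite -kk in kj'; move: kj' kj De; rewrite !ler_norml; move: (k * N) (D * e) => w z.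
    have [/h ij|/h ij|//] := ltngtP j j' => h1 h2 h3; exfalso; move: ij h1 h2 h3 pib; clear; qlra.
  by exists k; rewrite jj.
have norm lam u k : efun phi N lam u -> profile m S e eta N phi lam u k -> 
    u 0%N 0%N (N - N / (4 * m%:R)) (1 / 2) != 0.
  move=> eu pr; apply/eqP => a0; have := pr_A pr; rewrite /amp a0 mul0r.
  by rewrite eqxx.
split => //.
- move=> lam u eu lt nz; have [k [j [k0 pr jm kj]]] := cls _ _ eu lt nz.
  by exists j => //; exists k; split => //; [exact: pr_lam pr|exact: le_trans De].
- move=> lam lam' u u' j eu eu' lt lt' nz nz' c c'.
  have [k [k0 pr kj]] := clsj _ _ _ eu lt nz c; have [k' [k0' pr' kj']] := clsj _ _ _ eu' lt' nz' c'.
  have a0 := norm _ _ _ eu pr; have a0' := norm _ _ _ eu' pr'; rewrite /= in a0 a0'.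
  set a := u _ _ _ _ in a0; set a' := u' _ _ _ _ in a0'.
  have i0 : a^-1 != 0 by rewrite invr_eq0.
  have i0' : a'^-1 != 0 by rewrite invr_eq0.
  have [||||E1 E2] := HU e eta N phi lam lam' _ _ k k' j e0 phiS dO lg
    (efun_lin a^-1 0 eu eu) (efun_lin a'^-1 0 eu' eu') (profile_scale i0 pr) (profile_scale i0' pr') _ _ kj kj' eta0.
  + by rewrite mul0r addr0 mulVf.
  + by rewrite mul0r addr0 mulVf.
  + by rewrite -/mu -KE.
  + rewrite -/mu -/D -KE (_ : K * D * _ = K * D * C1 * N ^+ 7 * expR (- (e * N)) +
      K * D * C1 * C * N ^+ 13 * expR (- (e * N))); first by move: g2 g3; clear; qlra.
    by rewrite /eta (exprD N 7 6); ring.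
  split => //; exists (a' / a) => x y Oxy; have := E2 x y Oxy; rewrite !mul0r !addr0 => E.
  by rewrite -mulrA E mulrA mulfV ?mul1r.
move=> lam u eu lt nz c; have [k [k0 pr kj]] := clsj _ _ _ eu lt nz c.
have A0 := pr_A pr; set A := amp m N k u in A0.
have i0 : A^-1 != 0 by rewrite invr_eq0.
have pb := @pi_bounds R.
exists k, A^-1, t; split => //; set v := fun i j x y => _.
have ev : efun phi N (pi ^+ 2 + k ^+ 2) v by rewrite -(pr_lam pr); exact: (efun_lin A^-1 0 eu eu).
have prv := profile_scale i0 pr; rewrite -/v in prv.
have Av : amp m N k v = 1 by rewrite amp_lin mulVf.
have [kp k8 _ _] := profile_range m0 (lg_m lg) (pr_k pr).
have k1N : 1 <= k * N.
  have : pi <= m%:R * pi :> R by rewrite ler_peMl// pi_ge0.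
  by move: kj De pb; rewrite ler_norml; clear; qlra.
have [a a0 aE] : exists2 a : R, 0 <= a & a = 2 * (e * N).
  by exists (2 * (e * N)) => //; rewrite !mulr_ge0 ?ltW.
have sub := rect_dom (N := N) phiS a0.
have [Jv Ev Vv] := ev.
have B0 x y : rect a N (x, y) -> `|remd N k 1 v 0 0 x y| <= 64 * mu * eta.
  move=> [/= xI yI]; have := pr_rem prv (x := x) (y := y); rewrite Av normr1 mulr1 -/mu.
  by apply => //; move: xI; rewrite -aE; clear; qlra.
have CB : C2 * (64 * mu * eta) <= t * k ^+ 2.
  have N2 : 0 < N ^+ 2 by rewrite exprn_gt0.
  rewrite -(ler_pM2r N2); apply: (@le_trans _ _ t).
    by apply: le_trans g4; rewrite le_eqVlt; apply/orP; left; apply/eqP; rewrite /eta (exprD N 6 2); ring.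
  by rewrite -mulrA -exprMn ler_peMr ?(ltW t0)// exprn_ege1.
have k1 : k <= 1 by move: k8; clear; qlra.
have tk : t * k ^+ 2 <= t * k by rewrite ler_pM2l// expr2 ler_piMl// ltW.
have tk' : t * k <= t by rewrite ler_piMr// ltW.
split => //.
- by have := lg_S lg.
- by have := lg_m lg.
- by move: kj (pr_k pr) De; rewrite ler_norml -/mu; clear; qlra.
- by split; [exact: ltW|exact: tE].
move=> x y xI yI.
have lam17 : 0 <= pi ^+ 2 + k ^+ 2 <= 17 by move: pb kp k8; clear; nra.
have sv : side0 a N (remd N k 1 v 0%N 0%N).
  apply: side0_rem; apply: vanishing_side0 Vv _ sub => p [] //.
have [|r0 r1 r2 r3] := HB _ a N (64 * mu * eta) (pi ^+ 2 + k ^+ 2)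
    (jets_rem N k 1 (jets_sub sub Jv)) lam17
    (rem_eq N 1 (erefl (pi ^+ 2 + k ^+ 2)) (fun x y h => Ev x y (sub _ h))) B0 sv x y _ yI.
  by move: xI qN; rewrite -/mu aE; have := mulr_gt0 e0 N0; clear; qlra.
have sy := ltW (sinpi_gt0 yI); have CB1 := le_trans CB tk; have CB2 := le_trans CB1 tk'.
split.
- by apply: (le_trans r0); rewrite ler_wpM2r.
- by apply: (le_trans r1); rewrite ler_wpM2r.
- exact: le_trans CB2.
move=> /r3[h1 h2 h3]; split; [exact: le_trans CB|exact: le_trans CB1|exact: le_trans CB2].
Qed.

End LargeN.

(** * Eigenfunctions as functions on the plane *)

Section Clairaut.
Context {R : realType}.
Implicit Types (x y : R) (O : set (R * R)).

(** The second difference over a square of side h, divided by h^2, is a value of either mixed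
    derivative at some point of the square; continuity at (x, y) identifies the two. *)
Lemma clairaut O (g gx gy gxy gyx : R -> R -> R) x y : open O -> O (x, y) ->
    (forall s t, O (s, t) -> [/\ is_derive s 1 (g^~ t) (gx s t), is_derive t 1 (g s) (gy s t),
      is_derive t 1 (gx s) (gxy s t) & is_derive s 1 (gy^~ t) (gyx s t)]) ->
    ctn gxy x y -> ctn gyx x y -> gxy x y = gyx x y.
Proof.
move=> oO Oxy H c1 c2; apply/eqP; rewrite -subr_eq0 -normr_le0; apply/ler_addgt0Pr => e e0.
have e2 : 0 < e / 2 by rewrite divr_gt0.
move/cvgrPdist_le : c1 => /(_ _ e2) c1; move/cvgrPdist_le : c2 => /(_ _ e2) c2.
have /nbhs_ballP[d /= d0 Hd] : nbhs (x, y) [set q : R * R | [/\ `|gxy x y - gxy q.1 q.2| <= e / 2,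
    `|gyx x y - gyx q.1 q.2| <= e / 2 & O q]].
  by apply: filterS3 c1 c2 (open_nbhs_nbhs (conj oO Oxy)) => q.
pose h := d / 2; have h0 : 0 < h by rewrite divr_gt0.
have near_h s t : x <= s <= x + h -> y <= t <= y + h ->
    [/\ `|gxy x y - gxy s t| <= e / 2, `|gyx x y - gyx s t| <= e / 2 & O (s, t)].
  move=> sI tI; apply: (Hd (s, t)).
  by split; rewrite /ball/= ltr_norml /h in sI tI *; qlra.
have xh : x < x + h by rewrite ltrDl.
have yh : y < y + h by rewrite ltrDl.
have yI : y <= y <= y + h by rewrite lexx ltW.
have yI' : y <= y + h <= y + h by rewrite lexx ltW.
have xI : x <= x <= x + h by rewrite lexx ltW.
have xI' : x <= x + h <= x + h by rewrite lexx ltW.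
have [|s1 s1I E1] := @mvt _ (fun s => g s (y + h) - g s y) (fun s => gx s (y + h) - gx s y) _ _ xh.
  move=> s sI; have [_ _ /H[d1 _ _ _]] := near_h _ _ sI yI; have [_ _ /H[d2 _ _ _]] := near_h _ _ sI yI'.
  exact: is_deriveB.
have s1I' : x <= s1 <= x + h by qlra.
have [|t1 t1I F1] := @mvt _ (gx s1) (gxy s1) _ _ yh.
  by move=> t tI; have [_ _ /H[_ _ d1 _]] := near_h _ _ s1I' tI.
have [|t2 t2I E2] := @mvt _ (fun t => g (x + h) t - g x t) (fun t => gy (x + h) t - gy x t) _ _ yh.
  move=> t tI; have [_ _ /H[_ d1 _ _]] := near_h _ _ xI tI; have [_ _ /H[_ d2 _ _]] := near_h _ _ xI' tI.
  exact: is_deriveB.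
have t2I' : y <= t2 <= y + h by qlra.
have [|s2 s2I F2] := @mvt _ (gy^~ t2) (gyx^~ t2) _ _ xh.
  by move=> s sI; have [_ _ /H[_ _ _ d1]] := near_h _ _ sI t2I'.
have E : gxy s1 t1 = gyx s2 t2.
  have hh : h * h != 0 by rewrite mulf_neq0// gt_eqF.
  have xE : x + h - x = h by ring.
  have yE : y + h - y = h by ring.
  rewrite ?xE ?yE in E1 F1 E2 F2; apply: (mulIf hh).
  have := congr1 (fun z => z * h) F1; have := congr1 (fun z => z * h) F2.
  by move: E1 E2; clear; qlra.
have [n1 _ _] := near_h s1 t1 s1I' ltac:(qlra); have [_ n2 _] := near_h s2 t2 ltac:(qlra) t2I'.
rewrite add0r (_ : gxy x y - gyx x y = (gxy x y - gxy s1 t1) - (gyx x y - gyx s2 t2)); last by rewrite E; ring.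
by apply: (le_trans (ler_normB _ _)); qlra.
Qed.

End Clairaut.

Section Plane.
Context {R : realType}.
Implicit Types (x y N : R) (phi : R -> R) (u g : 'rV[R]_2 -> R) (s : seq 'I_2).

Definition pt x y : 'rV[R]_2 := \row_i (if i == 0 then x else y).

Lemma pt0 x y : pt x y 0 0 = x. Proof. by rewrite mxE. Qed.
Lemma pt1 x y : pt x y 0 1 = y. Proof. by rewrite mxE. Qed.

Lemma ptE (p : 'rV[R]_2) : pt (p 0 0) (p 0 1) = p.
Proof. by apply/rowP => -[[|[|//]] i2]; rewrite mxE /=; congr (p _ _); exact: val_inj. Qed.

Lemma pt_dom phi N x y : strip phi N (pt x y) = dom phi N (x, y).
Proof. by rewrite /strip /dom /= !mxE. Qed.

Lemma strip_dom phi N (p : 'rV[R]_2) : strip phi N p = dom phi N (p 0 0, p 0 1).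
Proof. by rewrite -pt_dom ptE. Qed.

Lemma pt_cvg x y : pt p.1 p.2 @[p --> (x, y)] --> pt x y.
Proof.
apply/cvg_ballP => e e0.
suff : nbhs (x, y) [set p : R * R | ball (pt x y) e (pt p.1 p.2)] by [].
by apply/nbhs_ballP; exists e => //= -[s t] [/= b1 b2]; split => // i j; rewrite !mxE; case: ifP.
Qed.

Lemma coords_cvg (p : 'rV[R]_2) : (q 0 0, q 0 1) @[q --> p] --> (p 0 0, p 0 1).
Proof. by apply: (@cvg_pair _ _ _ (nbhs p) (nbhs (p 0 0)) (nbhs (p 0 1))); exact: coord_continuous. Qed.

Lemma pt_addx x y (h : R) : h *: 'e_0 + pt x y = pt (h *: 1 + x) y.
Proof.
by apply/rowP => -[[|[|//]] i2]; rewrite !mxE /= ?mulr1 ?mulr0 ?add0r// /GRing.scale/= mulr1.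
Qed.

Lemma pt_addy x y (h : R) : h *: 'e_1 + pt x y = pt x (h *: 1 + y).
Proof.
by apply/rowP => -[[|[|//]] i2]; rewrite !mxE /= ?mulr1 ?mulr0 ?add0r// /GRing.scale/= mulr1.
Qed.

Lemma is_derive_ptx g x y l : is_derive (pt x y) 'e_0 g l <-> is_derive x 1 (fun t => g (pt t y)) l.
Proof.
have E : (fun h : R => h^-1 *: ((g \o shift (pt x y)) (h *: 'e_0) - g (pt x y))) =
    (fun h => h^-1 *: (((fun t => g (pt t y)) \o shift x) (h *: 1) - g (pt x y))).
  by apply: funext => h /=; rewrite pt_addx.
split => -[h1 h2]; split.
- by move: h1; rewrite /derivable E.
- by move: h2; rewrite /derive E.
- by move: h1; rewrite /derivable -E.
- by move: h2; rewrite /derive -E.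
Qed.

Lemma is_derive_pty g x y l : is_derive (pt x y) 'e_1 g l <-> is_derive y 1 (fun t => g (pt x t)) l.
Proof.
have E : (fun h : R => h^-1 *: ((g \o shift (pt x y)) (h *: 'e_1) - g (pt x y))) =
    (fun h => h^-1 *: (((fun t => g (pt x t)) \o shift y) (h *: 1) - g (pt x y))).
  by apply: funext => h /=; rewrite pt_addy.
split => -[h1 h2]; split.
- by move: h1; rewrite /derivable E.
- by move: h2; rewrite /derive E.
- by move: h1; rewrite /derivable -E.
- by move: h2; rewrite /derive -E.
Qed.

Lemma rV_filter (p : 'rV[R]_2) : Filter (nbhs p).
Proof. exact: (@nbhs_filter 'rV[R]_2 p). Qed.

Lemma rV_continuous (f : 'rV[R]_2 -> R) (p : 'rV[R]_2) :
  (forall e, 0 < e -> nbhs p [set q | `|f p - f q| <= e]) -> {for p, continuous f}.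
Proof.
move=> H P /nbhs_ballP[e /= e0 He]; have e2 : 0 < e / 2 by rewrite divr_gt0.
apply: (@filterS _ _ (rV_filter p) _ _ _ (H _ e2)) => q /= h; apply: He.
by apply: (le_lt_trans h); rewrite ltr_pdivrMr// ltr_pMr// ltr1n.
Qed.

(** A fixed order of differentiation: the y-derivatives come first and the x-derivatives last. In
    [jets_smooth] a further y-derivative is moved past them by [clairaut]. *)
Definition ders u i j x y := foldr partial u (nseq i 0 ++ nseq j 1) (pt x y).

Lemma jets_smooth phi N u : open (dom phi N) -> smooth_on (strip phi N) u ->
  jets (dom phi N) (ders u).
Proof.
move=> dO su; set O := dom phi N; pose G s x y := foldr partial u s (pt x y).
have cG s x y : O (x, y) -> ctn (G s) x y.
  rewrite /O -pt_dom => /(su s)[c _].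
  have h := cvg_comp (fun p : R * R => pt p.1 p.2) (foldr partial u s) (@pt_cvg x y) c; exact: h.
have dx s x y : O (x, y) -> is_derive x 1 ((G s)^~ y) (G (0 :: s) x y).
  rewrite /O -pt_dom => /(su s)[_ /(_ 0) d]; apply/is_derive_ptx; exact: derivableP.
have dy s x y : O (x, y) -> is_derive y 1 (G s x) (G (1 :: s) x y).
  rewrite /O -pt_dom => /(su s)[_ /(_ 1) d]; apply/is_derive_pty; exact: derivableP.
have comm s x y : O (x, y) -> G [:: 1, 0 & s] x y = G [:: 0, 1 & s] x y.
  move=> Oxy; apply: (clairaut (g := G s) (gx := G (0 :: s)) (gy := G (1 :: s)) dO Oxy); try exact: cG.
  by move=> s' t Ost; split; [exact: dx|exact: dy|exact: dy|exact: dx].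
have shift i s x y : O (x, y) -> G (1 :: nseq i 0 ++ s) x y = G (nseq i 0 ++ 1 :: s) x y.
  elim: i x y => [//|i IH] x y Oxy; rewrite comm//=.
  apply: is_derive_unique (dx _ _ _ Oxy) _.
  have [Ox _] := open_lines dO Oxy; apply: near_is_derive (dx _ _ _ Oxy).
  by apply: filterS Ox => t Ot; rewrite IH.
move=> i j x y Oxy; split; [exact: cG|exact: dx|].
by have := dy (nseq i 0 ++ nseq j 1) x y Oxy; rewrite shift.
Qed.

Lemma smooth_jets phi N u U : open (dom phi N) -> jets (dom phi N) U ->
    (forall x y, dom phi N (x, y) -> u (pt x y) = U 0%N 0%N x y) ->
  smooth_on (strip phi N) u /\ forall i j x y, dom phi N (x, y) -> ders u i j x y = U i j x y.
Proof.
move=> dO JU uU; set O := dom phi N.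
(* An iterated partial derivative depends only on how often each of the two coordinates occurs in
   the list, since the jet has commuting derivatives built in. *)
have G s : exists i j, (forall x y, O (x, y) -> foldr partial u s (pt x y) = U i j x y) /\
    (i = count_mem 0 s /\ j = count_mem 1 s).
  elim: s => [|a s [i [j [IH [Ei Ej]]]]]; first by exists 0%N, 0%N.
  have aE : a = 0 \/ a = 1 by case: a => [[|[|//]] ia]; [left|right]; exact: val_inj.
  case: aE => ->; [exists i.+1, j|exists i, j.+1]; split; rewrite /= ?Ei ?Ej// => x y Oxy.
    have [_ d _] := JU i j x y Oxy; have [Ox _] := open_lines dO Oxy.
    suff /is_derive_ptx[_ h] : is_derive x 1 (fun t => foldr partial u s (pt t y)) (U i.+1 j x y).
      by rewrite -Ei -Ej; exact: h.
    by apply: near_is_derive d; apply: filterS Ox => t Ot; rewrite IH.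
  have [_ _ d] := JU i j x y Oxy; have [_ Oy] := open_lines dO Oxy.
  suff /is_derive_pty[_ h] : is_derive y 1 (fun t => foldr partial u s (pt x t)) (U i j.+1 x y).
    by rewrite -Ei -Ej; exact: h.
  by apply: near_is_derive d; apply: filterS Oy => t Ot; rewrite IH.
split => [s p|i j x y Oxy]; last first.
  have [i' [j' [E [Ei Ej]]]] := G (nseq i 0 ++ nseq j 1).
  by rewrite /ders E// Ei Ej !count_cat !count_nseq /= !mul1n !mul0n addn0 add0n.
rewrite strip_dom => Op; have [i [j [E _]]] := G s.
have [c d1 d2] := JU i j _ _ Op; split; last first.
  have [Ox Oy] := open_lines dO Op; move=> a.
  have aE : a = 0 \/ a = 1 by case: a => [[|[|//]] ia]; [left|right]; exact: val_inj.
  rewrite -(ptE p); case: aE => ->.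
    suff /is_derive_ptx[] : is_derive (p 0 0) 1 (fun t => foldr partial u s (pt t (p 0 1))) (U i.+1 j (p 0 0) (p 0 1)) by [].
    by apply: near_is_derive d1; apply: filterS Ox => t Ot; rewrite E.
  suff /is_derive_pty[] : is_derive (p 0 1) 1 (fun t => foldr partial u s (pt (p 0 0) t)) (U i j.+1 (p 0 0) (p 0 1)) by [].
  by apply: near_is_derive d2; apply: filterS Oy => t Ot; rewrite E.
have nO : nbhs p [set q : 'rV[R]_2 | O (q 0 0, q 0 1)].
  by apply: (@coords_cvg p O); exact: open_nbhs_nbhs.
apply: rV_continuous => e e0; move/cvgrPdist_le : c => /(_ e e0) h.
have h' : nbhs p [set q : 'rV[R]_2 | `|U i j (p 0 0) (p 0 1) - U i j (q 0 0) (q 0 1)| <= e] := coords_cvg h.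
by apply: (@filterS2 _ _ (rV_filter p) _ _ _ _ nO h') => q Oq /=; rewrite -(E _ _ Op) -(E _ _ Oq) !ptE.
Qed.

Lemma sum_ord2 (f : 'I_2 -> R) : \sum_i f i = f 0 + f 1.
Proof. by rewrite big_ord_recl big_ord1; congr (_ + f _); exact: val_inj. Qed.

Lemma lap_ders u x y : laplacian u (pt x y) = ders u 2 0 x y + ders u 0 2 x y.
Proof. by rewrite /laplacian sum_ord2. Qed.

Lemma open_dom phi S Lp N : cap_shape phi S Lp -> open (dom phi N).
Proof.
move=> sh; rewrite openE => -[x y] [/= yI xI].
have cph : ctn (fun s t : R => s + phi t) x y.
  apply: cvgD; first exact: cvg_fst.
  apply: (@cvg_comp _ _ _ (@snd R R) phi (nbhs (x, y)) (nbhs y)); first exact: cvg_snd.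
  exact: (phi_cont sh yI).
have n1 : nbhs (x, y) [set p : R * R | 0 < p.1 + phi p.2] by apply: (cvgr_gt _ cph) => /=; qlra.
have n2 : nbhs (x, y) [set p : R * R | - 1 - `|x| < p.1 < N /\ 0 < p.2 < 1].
  apply: open_nbhs_nbhs; split; first exact: open_rect.
  by split => //=; have := lerNnormlW; have := ler_norm (- x); rewrite normrN; qlra.
by apply: filterS2 n1 n2 => -[s t] /= h [h1 h2]; do !split => //=; qlra.
Qed.

(** An ultrafilter on the superlevel set converges in a bounding box, to a point of the closure.
    Continuity on the closure keeps |u| >= e at that point, so the boundary condition forces it into
    the interior. *)
Lemma dirichlet_vanishing phi S N u : between0 phi S -> 
    {within closure (strip phi N), continuous u} ->
    (forall p, boundary (strip phi N) p -> u p = 0) ->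
  vanishing (dom phi N) (fun x y => u (pt x y)).
Proof.
move=> phiS /subspace_continuousP cu u0 e e0; rewrite compact_ultra => F UF FK.
have := @compact_box R (- S) N 0 1; rewrite compact_ultra => /(_ F UF)[|[x y] [bx Fxy]].
  by apply: filterS FK => -[s t] [[/= tI sI] _]; have pS := phiS _ tI; do !split => //=; qlra.
have Fpt : pt p.1 p.2 @[p --> F] --> pt x y by exact: cvg_trans (cvg_app _ Fxy) (@pt_cvg x y).
have cl : closure (strip phi N) (pt x y).
  move=> B hB; have FB : F [set p | B (pt p.1 p.2)] := Fpt B hB; have [p [[Op _] Bp]] := filter_ex (filterI FK FB).
  by exists (pt p.1 p.2); split => //; rewrite pt_dom -surjective_pairing.
have Fu : u (pt p.1 p.2) @[p --> F] --> u (pt x y).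
  apply: cvg_trans (cu _ cl) => P /= PP.
  have FP : F [set p | closure (strip phi N) (pt p.1 p.2) -> P (u (pt p.1 p.2))] := Fpt _ PP.
  suff : F [set p | P (u (pt p.1 p.2))] by [].
  apply: filterS2 FK FP => p [Op _]; apply.
  by apply: subset_closure; rewrite pt_dom -surjective_pairing.
have ue : e <= `|u (pt x y)|.
  have Fn : (fun p : R * R => `|u (pt p.1 p.2)|) @ F --> `|u (pt x y)| by exact: cvg_norm Fu.
  apply: (cvgr_to_ge Fn).
  by apply: filterS FK => p [].
exists (x, y); split => //; split => //.
rewrite -pt_dom; apply: interior_subset; apply: contrapT => ni.
by move: ue; rewrite (u0 (pt x y) (conj cl ni)) normr0 leNgt e0.
Qed.

Lemma efun_dirichlet phi S N lam u : between0 phi S -> open (dom phi N) ->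
  dirichlet_solution (strip phi N) lam u -> efun phi N lam (ders u).
Proof.
move=> phiS dO [su cu lu bu]; split; first exact: jets_smooth.
- move=> x y Oxy; have := lu (pt x y); rewrite lap_ders pt_dom => /(_ Oxy).
  by move=> E; rewrite (_ : ders u 0 0 x y = u (pt x y))// -E addrN.
- exact: (dirichlet_vanishing phiS cu bu).
Qed.

Lemma dirichlet_efun phi N lam U : open (dom phi N) -> efun phi N lam U ->
  exists u, dirichlet_solution (strip phi N) lam u /\
    forall x y, dom phi N (x, y) -> u (pt x y) = U 0%N 0%N x y.
Proof.
move=> dO [JU EU VU]; set O := dom phi N.
pose u (p : 'rV[R]_2) := if `[< O (p 0 0, p 0 1) >] then U 0%N 0%N (p 0 0) (p 0 1) else 0.
have uE x y : O (x, y) -> u (pt x y) = U 0%N 0%N x y.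
  by move=> Oxy; rewrite /u pt0 pt1 asboolT.
have [su dE] := smooth_jets dO JU uE.
have u0 (p : 'rV[R]_2) : ~ O (p 0 0, p 0 1) -> u p = 0 by move=> nO; rewrite /u asboolF.
have cu : continuous u.
  move=> p; have [Op|nO] := pselect (O (p 0 0, p 0 1)).
    by have [] := su [::] p ltac:(by rewrite strip_dom).
  (* The extension by zero is continuous outside the domain: the set where |u| >= e is compact,
     hence closed, and misses a neighbourhood of such a point. *)
  apply: rV_continuous => e e0; have cK := VU e e0.
  have clK := compact_closed (@norm_hausdorff _ _) cK.
  have nK : nbhs (p 0 0, p 0 1) (~` [set q | O q /\ e <= `|U 0%N 0%N q.1 q.2|]).
    by apply: open_nbhs_nbhs; split; [exact: closed_openC|move=> []].
  have nq0 : nbhs p [set q : 'rV[R]_2 | ~ (O (q 0 0, q 0 1) /\ e <= `|U 0%N 0%N (q 0 0) (q 0 1)|)] := coords_cvg nK.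
  apply: (@filterS _ _ (rV_filter p) _ _ _ nq0) => q /= nq; rewrite u0// sub0r normrN.
  have [Oq|nq'] := pselect (O (q 0 0, q 0 1)); last by rewrite u0// normr0 ltW.
  rewrite -(ptE q) uE//; apply: ltW; rewrite ltNge; apply/negP => h; exact: nq.
exists u; split => //; split => //.
- exact: continuous_subspaceT.
- move=> p Op; rewrite -(ptE p) lap_ders; rewrite strip_dom in Op.
  by rewrite !dE// uE//; apply/eqP; rewrite eqr_oppLR -addr_eq0 EU.
- move=> p [_ ni]; apply: u0 => Op; apply: ni.
  have nO : nbhs p [set q : 'rV[R]_2 | O (q 0 0, q 0 1)].
    by apply: (@coords_cvg p O); exact: open_nbhs_nbhs.
  by apply: (@filterS _ _ (rV_filter p) _ _ _ nO) => q; rewrite /= strip_dom.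
Qed.

End Plane.

(** * Supporting lines of a concave profile *)

Section Shape.
Context {R : realType}.
Implicit Types (phi : R -> R) (x y z : R).

Lemma concave_chord phi x y z : concave_function `[0, 1]%classic phi ->
  0 <= x -> y <= 1 -> x < z < y -> phi x * (y - z) + phi y * (z - x) <= phi z * (y - x).
Proof.
move=> conc x0 y1 zI; have yx : 0 < y - x by qlra.
have t0 : 0 <= (y - z) / (y - x) by rewrite divr_ge0//; qlra.
have t1 : (y - z) / (y - x) <= 1 by rewrite ler_pdivrMr// mul1r; qlra.
have xD : x \in (`[0, 1]%classic : set R) by rewrite inE /= in_itv/=; qlra.
have yD : y \in (`[0, 1]%classic : set R) by rewrite inE /= in_itv/=; qlra.
have := conc (Itv01 t0 t1) x y xD yD; rewrite !convRE /unstable.onem /=.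
set t := (y - z) / (y - x); have tE : t * (y - x) = y - z by rewrite divfK// gt_eqF.
rewrite [X in phi X](_ : _ = z); last first.
  by change (t * x + (1 - t) * y = z); move: tE; clear; qlra.
move=> h; rewrite -tE (_ : z - x = (1 - t) * (y - x)); last by move: tE; clear; qlra.
have := ler_wpM2r (ltW yx) h; clear; qlra.
Qed.

(** The slope of the supporting line at y0 is the supremum of the difference quotients to the right
    of y0. By the chord inequality it is at most every quotient to the left, and the Lipschitz
    constant bounds it. *)
Lemma cap_shape_of phi : (forall y, 0 <= y <= 1 -> 0 <= phi y) ->
    [lipschitz phi y | y in `[0, 1]%classic] -> concave_function `[0, 1]%classic phi ->
  exists S Lp, cap_shape phi S Lp.
Proof.
move=> phi0 lip conc; have [L L0 HL] := pinfty_ex_gt0 lip.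
have lipE y z : 0 <= y <= 1 -> 0 <= z <= 1 -> `|phi y - phi z| <= L * `|y - z|.
  by move=> yI zI; have := HL (y, z); apply; split; rewrite /= in_itv.
exists (phi 0 + L), L; split.
- by rewrite addr_ge0 ?(ltW L0)// phi0// lexx ler01.
- exact: ltW.
- move=> y yI; rewrite phi0 ?andTb; last by qlra.
  have := lipE y 0 ltac:(qlra) ltac:(qlra); rewrite subr0 ler_norml ger0_norm; last by qlra.
  by move=> /andP[_ h]; have : L * y <= L by [rewrite ler_piMr ?ltW//; qlra]; qlra.
- by move=> y z yI zI; apply: lipE; qlra.
move=> y0 y0I; pose D y := (phi y - phi y0) / (y - y0).
have DL y : 0 <= y <= 1 -> y != y0 -> `|D y| <= L.
  move=> yI yy; rewrite /D normrM normfV ler_pdivrMr ?normr_gt0 ?subr_eq0//.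
  by apply: lipE => //; qlra.
pose A := [set s | exists2 y, y0 < y < 1 & s = D y].
have A0 : A !=set0 by exists (D ((y0 + 1) / 2)), ((y0 + 1) / 2) => //; qlra.
have Aub : has_sup A.
  by split => //; exists L => _ [y yI ->]; apply: le_trans (ler_norm _) (DL _ _ _); [qlra|rewrite gt_eqF//; qlra].
have DA y : y0 < y < 1 -> D y <= sup A by move=> yI; apply: sup_upper_bound => //; exists y.
have AD y : 0 < y < y0 -> sup A <= D y.
  move=> yI; apply: ge_sup => // _ [z zI ->].
  have p1 : 0 < z - y0 by qlra.
  have p2 : 0 < y0 - y by qlra.
  rewrite /D -[y - y0]opprB invrN mulrN -mulNr opprB ler_pdivrMr// mulrAC ler_pdivlMr//.
  have := concave_chord conc (x := y) (y := z) (z := y0) ltac:(qlra) ltac:(qlra) ltac:(qlra).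
  by clear; qlra.
exists (sup A).
  rewrite ler_norml; apply/andP; split.
    apply: le_trans (DA ((y0 + 1) / 2) ltac:(qlra)).
    have : `|D ((y0 + 1) / 2)| <= L by apply: DL; [qlra|rewrite gt_eqF//; qlra].
    by rewrite ler_norml => /andP[].
  apply: ge_sup => // _ [z zI ->]; apply: le_trans (ler_norm _) _.
  by apply: DL; [qlra|rewrite gt_eqF//; qlra].
move=> y yI; have [->|yy] := eqVneq y y0; first by rewrite subrr mulr0 addr0.
have E : phi y - phi y0 = D y * (y - y0) by rewrite divfK// subr_eq0.
have [yl|yg|yE] := ltgtP y y0; last by rewrite yE eqxx in yy.
  have := AD y ltac:(qlra) => h; have p2 : 0 <= y0 - y by qlra.
  by have := ler_wpM2r p2 h; move: E; clear; qlra.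
have := DA y ltac:(qlra) => h; have p2 : 0 <= y - y0 by qlra.
by have := ler_wpM2r p2 h; move: E; clear; qlra.
Qed.

End Shape.

(** * From the list of eigenvalues to the critical points *)

Section Counting.
Context {R : realType}.
Implicit Types (phi : R -> R) (N : R) (u : 'rV[R]_2 -> R) (m : nat) (Omega : set 'rV[R]_2).

Lemma basis_neq0 Omega (lam : R) (K : pred nat) e k : dirichlet_eigenbasis Omega lam K e ->
  K k -> exists2 p, Omega p & e k p != 0.
Proof.
move=> [_ ind _] Kk; apply: contrapT => H.
have e0 p : Omega p -> e k p = 0.
  by move=> Op; apply: contrapT => /eqP h; apply: H; exists p.
have := ind k.+1 (fun i => (i == k)%:R) _ k (ltnSn k) Kk; rewrite eqxx => h.
have /eqP : 1 = 0 :> R; last by rewrite oner_eq0.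
apply: h => p Op; rewrite big1// => i _; have [->|] := eqVneq (i : nat) k; first by rewrite e0// mulr0.
by rewrite mul0r.
Qed.

Lemma basis_free Omega (lam : R) (K : pred nat) e k k' c : dirichlet_eigenbasis Omega lam K e ->
  K k -> K k' -> (k < k')%N -> ~ forall p, Omega p -> e k' p = c * e k p.
Proof.
move=> [_ ind _] Kk Kk' kk H.
have := ind k'.+1 (fun i => if i == k then c else if i == k' then -1 else 0) _ k' (ltnSn _) Kk'.
rewrite (gtn_eqF kk) eqxx => h; have /eqP : -1 = 0 :> R; last by rewrite oppr_eq0 oner_eq0.
apply: h => p Op; have kl : (k < k'.+1)%N by exact: ltnW.
rewrite (bigD1 (Ordinal kl))//= eqxx (bigD1 (Ordinal (ltnSn k')))/=; last first.
  by rewrite Kk' -val_eqE /= gtn_eqF.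
rewrite (gtn_eqF kk) eqxx H// big1 ?addr0 ?mulN1r ?subrr// => i /andP[/andP[_ i1] i2].
by rewrite -val_eqE /= in i1; rewrite -val_eqE /= in i2; rewrite (negbTE i1) (negbTE i2) mul0r.
Qed.

Lemma spectrum_index Omega (lam : nat -> R) e mu u :
    (forall mu, dirichlet_eigenbasis Omega mu (fun k => lam k == mu) e) ->
  dirichlet_eigenfunction Omega mu u -> exists k, lam k = mu.
Proof.
move=> eb [du [p Op up]]; have [_ _ /(_ u du)[l [c uE]]] := eb mu.
apply: contrapT => H; move: up; rewrite uE// big1 ?eqxx// => i /eqP li.
by exfalso; apply: H; exists i.
Qed.

Lemma inj_large m (n : nat -> nat) : (0 < m)%N ->
    (forall l l', (l < m)%N -> (l' < m)%N -> n l = n l' -> l = l') ->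
  exists2 l, (l < m)%N & (m.-1 <= n l)%N.
Proof.
move=> m0 inj; apply: contrapT => H.
have nm (l : 'I_m) : (n l < m.-1)%N.
  by rewrite ltnNge; apply/negP => h; apply: H; exists l.
have := leq_card (fun l : 'I_m => Ordinal (nm l)); rewrite !card_ord => h.
have : (m <= m.-1)%N by apply: h => l l' /(congr1 val) /= /inj E; apply: val_inj; exact: E.
by rewrite -ltnS prednK// ltnn.
Qed.

Lemma mono_ge m (n : nat -> nat) : (forall l, (l < m)%N -> (0 < n l)%N) ->
    (forall l l', (l < l')%N -> (l' < m)%N -> (n l < n l')%N) ->
  forall l, (l < m)%N -> (l < n l)%N.
Proof.
move=> n0 inc; elim=> [|l IH] lm; first exact: n0.
exact: leq_ltn_trans (IH (ltnW lm)) (inc _ _ (ltnSn l) lm).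
Qed.

End Counting.

Section Conclusion.
Context {R : realType}.
Implicit Types (phi : R -> R) (S N lam k c x y : R) (u : 'rV[R]_2 -> R) (m : nat).

Lemma det2 (A : 'M[R]_2) : \det A = A 0 0 * A 1 1 - A 0 1 * A 1 0.
Proof.
rewrite (expand_det_row _ 0) sum_ord2 /cofactor !det_mx11 !mxE /= !addn0 !expr0 expr1 mul1r mulN1r mulrN.
have e1 : lift (0 : 'I_2) (0 : 'I_1) = 1 by exact: val_inj.
have e2 : lift (1 : 'I_2) (0 : 'I_1) = 0 by exact: val_inj.
by rewrite e1 e2.
Qed.

Lemma scaled_det (a b d c : R) : c != 0 -> (c * a) ^+ 2 < (c * b) * (c * d) -> a ^+ 2 < b * d.
Proof. by move=> c0; rewrite exprMn [ltRHS]mulrACA -expr2 ltr_pM2l// exprn_even_gt0. Qed.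

Lemma critical_ders u x y :
  critical_point u (pt x y) <-> ders u 1 0 x y = 0 /\ ders u 0 1 x y = 0.
Proof.
split => [H|[h0 h1] i]; first by split; [exact: (H 0)|exact: (H 1)].
have iE : i = 0 \/ i = 1 by case: i => [[|[|//]] ia]; [left|right]; exact: val_inj.
by case: iE => ->.
Qed.

Lemma hessian_ders phi N u x y : jets (dom phi N) (ders u) -> dom phi N (x, y) ->
  ders u 1 1 x y ^+ 2 < ders u 2 0 x y * ders u 0 2 x y -> nondegenerate_at u (pt x y).
Proof.
move=> Ju Oxy h; rewrite /nondegenerate_at unitmxE unitfE det2 !mxE.
have E : partial 1 (partial 0 u) (pt x y) = ders u 1 1 x y.
  have [_ _ d] := Ju 1%N 0%N x y Oxy.
  have [_ E] : is_derive (pt x y) 'e_1 (foldr partial u [:: 0]) (ders u 1 1 x y) by apply/is_derive_pty.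
  exact: E.
rewrite E; apply: lt0r_neq0; rewrite subr_gt0.
by move: h; rewrite expr2.
Qed.

Lemma near_pt (P : 'rV[R]_2 -> Prop) x y d : 0 < d ->
  (forall x' y', `|x' - x| < d -> `|y' - y| < d -> P (pt x' y')) -> nbhs (pt x y) P.
Proof.
move=> d0 H; have h : nbhs (x, y) [set q : R * R | P (pt q.1 q.2)].
  by apply/nbhs_ballP; exists d => //= -[s t] [/= b1 b2]; apply: H; rewrite distrC.
have h' : nbhs (pt x y) [set q : 'rV[R]_2 | P (pt (q 0 0) (q 0 1))].
  by have := @coords_cvg R (pt x y) [set q : R * R | P (pt q.1 q.2)]; rewrite pt0 pt1 => /(_ h).
by apply: (@filterS _ _ (rV_filter _) _ _ _ h') => q; rewrite /= ptE.
Qed.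

Lemma near_sine_conclusion phi S N k th q m u c : open (dom phi N) -> jets (dom phi N) (ders u) ->
    c != 0 -> near_sine phi S N k th q m (fun i j x y => c * ders u i j x y + 0 * ders u i j x y) ->
  [/\ ([set p | strip phi N p /\ critical_point u p] #= `I_m)%card,
      (forall p, strip phi N p -> critical_point u p -> nondegenerate_at u p) &
      (forall p, strip phi N p -> critical_point u p -> local_max u p \/ local_min u p)].
Proof.
move=> dO Ju c0 ns; pose v i j x y : R := c * ders u i j x y + 0 * ders u i j x y.
have [p [pP crit inj]] := near_sine_crit (v := v) ns.
have vE i j x y : v i j x y = c * ders u i j x y by rewrite /v mul0r addr0.
have v0 i j x y : v i j x y = 0 <-> ders u i j x y = 0.
  by rewrite vE; split => [/eqP|->]; rewrite ?mulr0// mulf_eq0 (negbTE c0) => /eqP.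
have critP x y : dom phi N (x, y) -> critical_point u (pt x y) -> exists2 i, (i < m)%N & p i = (x, y).
  by move=> Oxy /critical_ders[/v0 h1 /v0 h2]; exact: crit h1 h2.
have pdom i : (i < m)%N -> dom phi N ((p i).1, (p i).2).
  by move=> /pP[h _ _ _ _]; rewrite -surjective_pairing.
split.
- have -> : [set p | strip phi N p /\ critical_point u p] = (fun i => pt (p i).1 (p i).2) @` `I_m.
    apply/seteqP; split => [z [Oz cz]|_ [i /= im <-]].
      rewrite -(ptE z) pt_dom in Oz; rewrite -(ptE z) in cz.
      by have [i im pE] := critP _ _ Oz cz; exists i => //; rewrite pE ptE.
    have [_ h1 h2 _ _] := pP i im; split; first by rewrite pt_dom; exact: pdom.
    by apply/critical_ders; split; apply/v0.
  apply: inj_card_eq => i j; rewrite !inE /= => im jm E; apply: inj => //.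
  have := congr1 (fun z : 'rV[R]_2 => (z 0 0, z 0 1)) E.
  by rewrite !pt0 !pt1 -!surjective_pairing.
- move=> z Oz cz; rewrite -(ptE z) pt_dom in Oz; rewrite -(ptE z) in cz *.
  have [i im pE] := critP _ _ Oz cz; have [_ _ _ h _] := pP i im.
  by rewrite pE /= !vE in h; exact: hessian_ders Ju Oz (scaled_det c0 h).
move=> z Oz cz; rewrite -(ptE z) pt_dom in Oz; rewrite -(ptE z) in cz *.
have [i im pE] := critP _ _ Oz cz; have [_ _ _ _ [d d0]] := pP i im; rewrite pE /= => H.
(* The maximum is one of (-1)^i c u, so the sign of (-1)^i c decides between a local maximum and a
   local minimum of u. *)
pose a := (-1) ^+ i * c; have a0 : a != 0 by rewrite mulf_neq0// signr_eq0.
have {}H x' y' : `|x' - z 0 0| < d -> `|y' - z 0 1| < d -> a * u (pt x' y') <= a * u (pt (z 0 0) (z 0 1)).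
  by move=> h1 h2; have := H x' y' h1 h2; rewrite !vE /a -!mulrA.
have [an|ap] : a < 0 \/ 0 < a by apply/orP; rewrite -neq_lt.
  right; apply: (near_pt d0) => x' y' h1 h2.
  by have := H x' y' h1 h2; rewrite ler_nM2l.
left; apply: (near_pt d0) => x' y' h1 h2.
by have := H x' y' h1 h2; rewrite ler_pM2l.
Qed.

End Conclusion.

Section Spectrum.
Context {R : realType}.

(* The m functions of [efun_exists] are eigenfunctions for distinct eigenvalues below the threshold,
   so lam (m - 1) is below it too; then the classes of lam 0 < ... < lam (m - 1) increase strictly
   from 1 to m. *)
Lemma mth_in_class (phi : R -> R) (S Lp N : R) (m : nat) (lam : nat -> R) e :
    cap_shape phi S Lp -> 0 < N -> (0 < m)%N -> open (dom phi N) ->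
    (forall lam u, efun phi N lam u -> lam <= threshold m N -> nonzero phi N u ->
      exists2 j, (0 < j <= m)%N & in_class N lam j) ->
    (forall lam lam' u u' j, efun phi N lam u -> efun phi N lam' u' ->
      lam <= threshold m N -> lam' <= threshold m N -> nonzero phi N u -> nonzero phi N u' ->
      in_class N lam j -> in_class N lam' j ->
      lam = lam' /\ exists c, forall x y, dom phi N (x, y) -> u' 0%N 0%N x y = c * u 0%N 0%N x y) ->
    {homo lam : i j / (i <= j)%N >-> i <= j} ->
    (forall mu, dirichlet_eigenbasis (strip phi N) mu (fun k => lam k == mu) e) ->
  lam m.-1 <= threshold m N /\ in_class N (lam m.-1) m.
Proof.
move=> sh N0 m0 dO F1 F2 mono eb; have phiS := sh_S sh.
have thr : lam m.-1 <= threshold m N.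
  have [U [mu HU]] := efun_exists sh N0 m0.
  have /choice[n nE] l : exists k, (l < m)%N -> lam k = mu l.
    have [lm|_] := boolP (l < m)%N; last by exists 0%N.
    have [eU _ [x [y [Oxy U0]]] _] := HU l lm; have [w [dw wE]] := dirichlet_efun dO eU.
    have [|k kE] := spectrum_index eb (mu := mu l) (u := w); last by exists k.
    by split => //; exists (pt x y); rewrite ?pt_dom ?wE.
  have neq l l' : (l < m)%N -> (l' < l)%N -> mu l <> mu l'.
    move=> lm ll E; have lm' := ltn_trans ll lm.
    have [eU tU nU dU] := HU l lm; have [eU' tU' nU' _] := HU l' lm'.
    have [j _ cj] := F1 _ _ eU tU nU; have cj' := cj; rewrite E in cj'.
    have [_ [c cE]] := F2 _ _ _ _ _ eU eU' tU tU' nU nU' cj cj'.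
    by apply: (dU l' ll); exists c.
  (* The m positions are distinct, so one of them is at least m - 1; monotonicity of the list then
     puts its entry m - 1 below the threshold. *)
  have [l l' lm lm' E|l lm ln] := inj_large m0 (n := n).
    have E' : mu l = mu l' by rewrite -(nE l lm) -(nE l' lm') E.
    by have [h|h|//] := ltngtP l l'; [case: (neq _ _ lm' h)|case: (neq _ _ lm h)].
  apply: (le_trans (mono _ _ ln)); rewrite nE//.
  by have [_ tU _ _] := HU l lm.
split => //; have ek k : efun phi N (lam k) (ders (e k)) /\ nonzero phi N (ders (e k)).
  have [/(_ k (eqxx _)) dk _ _] := eb (lam k); split; first exact: efun_dirichlet phiS dO dk.
  have [p Op pk] := basis_neq0 (eb (lam k)) (eqxx (lam k)); exists (p 0 0), (p 0 1).
  by rewrite -pt_dom /ders /= ptE.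
have tk k : (k < m)%N -> lam k <= threshold m N.
  by move=> km; apply: le_trans thr; apply: mono; rewrite -ltnS prednK.
have /choice[n nE] k : exists j, (k < m)%N -> (0 < j <= m)%N /\ in_class N (lam k) j.
  have [km|_] := boolP (k < m)%N; last by exists 0%N.
  by have [j h1 h2] := F1 _ _ (ek k).1 (tk k km) (ek k).2; exists j.
have inc k k' : (k < k')%N -> (k' < m)%N -> (n k < n k')%N.
  move=> kk km'; have km := ltn_trans kk km'; have [_ c] := nE k km; have [_ c'] := nE k' km'.
  have [//|h|E] := ltngtP (n k) (n k').
    by have := in_class_lt N0 c' c h; rewrite ltNge mono// ltnW.
  rewrite -E in c'; have [E' [a aE]] := F2 _ _ _ _ _ (ek k).1 (ek k').1 (tk k km) (tk k' km') (ek k).2 (ek k').2 c c'.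
  exfalso; apply: (basis_free (c := a) (eb (lam k)) (eqxx _) _ kk); first by rewrite -E'.
  by move=> p; rewrite strip_dom => /aE; rewrite /ders /= ptE.
have pm : (m.-1 < m)%N by rewrite prednK.
have [/andP[_ nm] c] := nE _ pm.
have := mono_ge (fun l lm => (andP (nE l lm).1).1) inc pm; rewrite prednK// => mn.
have E : n m.-1 = m by apply/eqP; rewrite eqn_leq mn nm.
by rewrite E in c.
Qed.

End Spectrum.

Theorem theorem1p3 (R : realType) (phi : R -> R)
    (phi_ge0 : forall y : R, 0 <= y <= 1 -> 0 <= phi y)
    (phi_lipschitz : [lipschitz phi y | y in `[0, 1]%classic])
    (phi_concave : concave_function `[0, 1]%classic phi)
    (m : nat) (m_ge1 : (1 <= m)%N) :
  \forall N \near +oo, forall u : 'rV[R]_2 -> R,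
    mth_dirichlet_eigenfunction (strip phi N) m u ->
    [/\ ([set p | strip phi N p /\ critical_point u p] #= `I_m)%card,
        (forall p, strip phi N p -> critical_point u p -> nondegenerate_at u p) &
        (forall p, strip phi N p -> critical_point u p ->
           local_max u p \/ local_min u p)].
Proof.
have [S [Lp sh]] := cap_shape_of phi_ge0 phi_lipschitz phi_concave.
have phiS := sh_S sh; have [N0 H] := large_facts m_ge1 (sh_S0 sh).
near=> N; have NN : N0 <= N by near: N; apply: nbhs_pinfty_ge; exact: num_real.
move=> u [lam [mono [e eb]] [du [p Op up]]]; have dO := @open_dom R phi S Lp N sh.
have [Np F1 F2 F3] := H N NN phi phiS dO.
have [thr cm] := mth_in_class sh Np m_ge1 dO F1 F2 mono eb.
have eu := efun_dirichlet phiS dO du.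
have nu : nonzero phi N (ders u).
  by exists (p 0 0), (p 0 1); rewrite -pt_dom /ders /= ptE.
have [k [c [th [c0 ns]]]] := F3 _ _ eu thr nu cm.
exact: near_sine_conclusion dO (ef_jets eu) c0 ns.
Unshelve. all: by end_near.
Qed.
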